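(* In the setting of the context, assume: $f,m,\sigma\in\mathcal C^3(\mathbb R^d\times[0,1])$; $\Psi_{0,2}<\infty$; there is a constant $c_0<\infty$ such that almost surely $\sup_{t\in[0,1]}\sup_{u\in\mathbb R^d}\{f_1(u,t\mid\mathcal H_0)+|\partial^d f_1(u,t\mid\mathcal H_0)/\partial u|\}\le c_0$; and $\eta_i\in\mathcal L^p$ for some $p>2$. If $h_n\to0$ and $nh_n^d\to\infty$, then for $u\in\mathbb R^d$ $$(nh_n^d)^{1/2}\big[\tilde f_n(u)-E\{\tilde f_n(u)\}\big]\Rightarrow N\{0,\bar f(u)\lambda_{K_S}\},$$ where $\bar f(u)=\int_0^1f(u,t)\,dt$ and $\lambda_{K_S}=\int_{[-1,1]^d}K_S(s)^2\,ds$. If in addition $\bar f(u)>0$, then $$(nh_n^d)^{1/2}\Big[\hat\mu_n(u)-\frac{E\{\tilde T_n(u)\}}{E\{\tilde f_n(u)\}}\Big]\Rightarrow N\{0,\tilde V(u)\lambda_{K_S}\},$$ where, with $\bar m(u)=\int_0^1m(u,t)f(u,t)\,dt/\bar f(u)$, $$\tilde V(u)=\bar f(u)^{-2}\int_0^1\big[\{m(u,t)-\bar m(u)\}^2+\sigma(u,t)^2\big]f(u,t)\,dt.$$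
   Context: Data: for each $n$, $y_i=m(x_i,i/n)+e_i$, $i=1,\dots,n$, with $m:\mathbb R^d\times[0,1]\to\mathbb R$. The regressors are $x_i=G(i/n;\mathcal H_i)\in\mathbb R^d$, where $\mathcal H_i=(\dots,\xi_{i-1},\xi_i)$, $\xi_k$ ($k\in\mathbb Z$) are i.i.d. random vectors, and $G$ is measurable with $G(t;\mathcal H_i)$ well defined for every $t\in[0,1]$. The errors are $e_i=\sigma(x_i,i/n)\eta_i$, with $\sigma:\mathbb R^d\times[0,1]\to\mathbb R$ and $\eta_k$ ($k\in\mathbb Z$) i.i.d., independent of $(\xi_j)_{j\in\mathbb Z}$, $E\eta_k=0$, $E\eta_k^2=1$. Norms: $\|Z\|_q=\{E|Z|^q\}^{1/q}$; $Z\in\mathcal L^q$ means $\|Z\|_q<\infty$. Densities: $F_1(u,t\mid\mathcal H_k)=\mathrm{pr}\{G(t;\mathcal H_{k+1})\le u\mid\mathcal H_k\}$ and $f_1(u,t\mid\mathcal H_k)=\partial^dF_1(u,t\mid\mathcal H_k)/\partial u$ are the one-step-ahead conditional distribution function and density ($\partial^d/\partial u=\partial^d/\partial u_1\cdots\partial u_d$); $f(u,t)=E\{f_1(u,t\mid\mathcal H_0)\}$ is the marginal density of $G(t;\mathcal H_0)$. Dependence measure: $(\xi_i')$ is an i.i.d. copy of $(\xi_j)$, $\mathcal H_k'=(\dots,\xi_{-1},\xi_0',\xi_1,\dots,\xi_k)$, $\psi_{k,q}=\sup_{t\in[0,1]}\sup_{u\in\mathbb R^d}\|f_1(u,t\mid\mathcal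 H_k)-f_1(u,t\mid\mathcal H_k')\|_q$, $\Psi_{m,q}=\sum_{k=m}^\infty\psi_{k,q}$. Kernel: $K_S$ is symmetric and twice continuously differentiable on its support $[-1,1]^d$, with $\int_{[-1,1]^d}K_S=1$. $h_n>0$ is a bandwidth. Estimators: $\tilde T_n(u)=\frac1{nh_n^d}\sum_{i=1}^ny_iK_S\big(\frac{u-x_i}{h_n}\big)$, $\tilde f_n(u)=\frac1{nh_n^d}\sum_{i=1}^nK_S\big(\frac{u-x_i}{h_n}\big)$, $\hat\mu_n(u)=\tilde T_n(u)/\tilde f_n(u)$. $\Rightarrow$ denotes convergence in distribution as $n\to\infty$. *)

(* Defs.v *)
From HB Require Import structures.
From mathcomp Require Import all_boot all_order all_algebra.
From mathcomp Require Import all_classical all_reals all_analysis.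

Set Implicit Arguments.
Unset Strict Implicit.
Unset Printing Implicit Defensive.

Import Order.TTheory GRing.Theory Num.Theory.
Import numFieldNormedType.Exports.

Local Open Scope classical_set_scope.
Local Open Scope ring_scope.

(* Product (= Borel) sigma-algebra on row vectors, as the library does for
   tuples. *)
Definition rV_display : measure_display. Proof. exact: default_measure_display. Qed.

Section rV_measurable.
Context {R : realType} (d : nat).

Definition rV_measurable : set (set 'rV[R]_d) :=
  g_sigma_preimage (fun (i : 'I_d) (v : 'rV[R]_d) => v ord0 i).

Let rV_measurable0 : rV_measurable set0.
Proof. exact: sigma_algebra0. Qed.

Let rV_measurableC A : rV_measurable A -> rV_measurable (~` A).
Proof. exact: sigma_algebraC. Qed.

Let rV_measurable_bigcup (F : (set 'rV[R]_d)^nat) :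
  (forall i, rV_measurable (F i)) -> rV_measurable (\bigcup_i F i).
Proof. exact: sigma_algebra_bigcup. Qed.

HB.instance Definition _ := @isMeasurable.Build rV_display 'rV[R]_d
  rV_measurable rV_measurable0 rV_measurableC rV_measurable_bigcup.

End rV_measurable.

Section rV_measurable_fun.
Context {R : realType}.

Lemma measurable_rV_coord d (i : 'I_d) :
  measurable_fun [set: 'rV[R]_d] (fun v : 'rV[R]_d => v ord0 i).
Proof.
move=> _ Y mY; rewrite setTI; apply: sub_sigma_algebra => /=.
rewrite -bigcup_seq/=; exists i => /=; first by rewrite mem_index_enum.
by exists Y => //; rewrite setTI.
Qed.

Lemma measurable_fun_rVP disp (T : measurableType disp) d (f : T -> 'rV[R]_d) :
  measurable_fun [set: T] f <->
  forall i, measurable_fun [set: T] (fun x => f x ord0 i).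
Proof.
split=> [mf i|mf].
  by apply: (measurableT_comp (@measurable_rV_coord d i) mf).
move=> _ Y mY; rewrite setTI.
pose G : set (set 'rV[R]_d) := [set A | measurable (f @^-1` A)].
suff : @rV_measurable R d `<=` G by apply.
apply: smallest_sub.
  split; rewrite /G /=.
  - by rewrite preimage_set0.
  - by move=> A mA; rewrite setTD preimage_setC; exact: measurableC.
  - by move=> F mF; rewrite preimage_bigcup; exact: bigcupT_measurable.
move=> A; rewrite -bigcup_seq/= => -[i _ [B mB <-]].
rewrite /G /= setTI -comp_preimage -[X in measurable X]setTI.
exact: mf.
Qed.

Definition cons_rV d (p : R * 'rV[R]_d) : 'rV[R]_d.+1 :=
  row_mx (p.1%:M : 'rV[R]_1) p.2.

Lemma cons_rVE d (x : R) (v : 'rV[R]_d) :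
  (cons_rV (x, v) ord0 ord0 = x) /\
  (forall j, cons_rV (x, v) ord0 (lift ord0 j) = v ord0 j).
Proof.
split => [|j]; rewrite /cons_rV.
  have -> : ord0 = lshift d (ord0 : 'I_1) by exact/val_inj.
  by apply: etrans (@row_mxEl _ 1 1 d _ _ ord0 ord0) _; rewrite mxE.
have -> : lift ord0 j = rshift 1 j by exact/val_inj.
exact: (@row_mxEr _ 1 1 d).
Qed.

Lemma measurable_cons_rV d : measurable_fun [set: R * 'rV[R]_d] (@cons_rV d).
Proof.
apply/measurable_fun_rVP => i.
case: (unliftP ord0 i) => [j|] ->.
  rewrite (_ : (fun _ => _) = (fun v : 'rV[R]_d => v ord0 j) \o snd).
    exact: (measurableT_comp (@measurable_rV_coord d j) measurable_snd).
  by apply/funext => -[x v]; rewrite (cons_rVE x v).2.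
rewrite (_ : (fun _ => _) = fst)//.
by apply/funext => -[x v]; rewrite (cons_rVE x v).1.
Qed.

End rV_measurable_fun.

(* Lebesgue measure on R^d.  The library has it only for d = 1; here it is the
   iterated product measure, transported along R * R^d = R^(d+1). *)
Section lebesgue_rV.
Context {R : realType}.
Local Open Scope ereal_scope.

Lemma prod_sigma_finite disp1 disp2 (T1 : measurableType disp1)
    (T2 : measurableType disp2) (m1 : {sigma_finite_measure set T1 -> \bar R})
    (m2 : {sigma_finite_measure set T2 -> \bar R}) :
  sigma_finite setT (m1 \x m2).
Proof.
have /sigma_finiteP[F [TF ndF Foo]] := sigma_finiteT m1.
have /sigma_finiteP[G [TG ndG Goo]] := sigma_finiteT m2.
exists (fun n => F n `*` G n).
  rewrite -setXTT TF TG predeqE => -[x y]; split.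
    move=> [/= [n _ Fnx] [k _ Gky]]; exists (maxn n k) => //; split.
    - by move: x Fnx; exact/subsetPset/ndF/leq_maxl.
    - by move: y Gky; exact/subsetPset/ndG/leq_maxr.
  by move=> [n _ []/= ? ?]; split; exists n.
move=> k; have [? ?] := Foo k; have [? ?] := Goo k.
split; first exact: measurableX.
by rewrite product_measure1E// lte_mul_pinfty// ge0_fin_numE.
Qed.

Section step.
Context (d : nat) (mu : {sigma_finite_measure set 'rV[R]_d -> \bar R}).

Definition lebesgue_rV_step (A : set 'rV[R]_d.+1) : \bar R :=
  (@lebesgue_measure R \x mu) (@cons_rV R d @^-1` A).

Let step0 : lebesgue_rV_step set0 = 0.
Proof. by rewrite /lebesgue_rV_step preimage_set0 measure0. Qed.

Let step_ge0 A : 0 <= lebesgue_rV_step A.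
Proof. exact: measure_ge0. Qed.

Let mpre A : measurable A -> measurable (@cons_rV R d @^-1` A).
Proof.
by move=> mA; rewrite -[X in measurable X]setTI; exact: measurable_cons_rV.
Qed.

Let step_sigma_additive : semi_sigma_additive lebesgue_rV_step.
Proof.
move=> F mF tF mUF; rewrite /lebesgue_rV_step preimage_bigcup.
apply: measure_semi_sigma_additive.
- by move=> n; exact: mpre.
- apply/trivIsetP => /= i j _ _ ij; rewrite -preimage_setI.
  by move/trivIsetP : tF => /(_ _ _ _ _ ij) ->//; rewrite preimage_set0.
- by rewrite -preimage_bigcup; exact: mpre.
Qed.

HB.instance Definition _ := isMeasure.Build _ _ _ lebesgue_rV_step
  step0 step_ge0 step_sigma_additive.

Definition uncons_rV (v : 'rV[R]_d.+1) : R * 'rV[R]_d :=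
  (v ord0 ord0, \row_j v ord0 (lift ord0 j)).

Lemma cons_rVK : cancel (@cons_rV R d) uncons_rV.
Proof.
move=> [x v]; rewrite /uncons_rV; have [-> h] := cons_rVE x v.
by congr pair; apply/rowP => j; rewrite mxE h.
Qed.

Lemma measurable_uncons_rV : measurable_fun setT uncons_rV.
Proof.
apply: measurable_fun_pair; first exact: measurable_rV_coord.
apply/measurable_fun_rVP => j.
under eq_fun do rewrite mxE.
exact: measurable_rV_coord.
Qed.

Let step_sigma_finite : sigma_finite setT lebesgue_rV_step.
Proof.
have [F FT Foo] := prod_sigma_finite (@lebesgue_measure R) mu.
exists (fun n => uncons_rV @^-1` F n).
  by rewrite -preimage_bigcup -FT preimage_setT.
move=> n; have [mFn Fnoo] := Foo n; split.
  by rewrite -[X in measurable X]setTI; exact: measurable_uncons_rV.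
rewrite /lebesgue_rV_step -comp_preimage.
by rewrite (_ : uncons_rV \o _ = id)//; apply/funext => x /=; rewrite cons_rVK.
Qed.

HB.instance Definition _ := Measure_isSigmaFinite.Build _ _ _ lebesgue_rV_step
  step_sigma_finite.

End step.

Fixpoint lebesgue_rV (d : nat) :
    {sigma_finite_measure set 'rV[R]_d -> \bar R} :=
  if d is d'.+1 then lebesgue_rV_step (lebesgue_rV d')
  else dirac (0%R : 'rV[R]_0).

Lemma lebesgue_rV_box d (a b : 'rV[R]_d) :
  (forall i, a ord0 i <= b ord0 i)%R ->
  lebesgue_rV d [set v | forall i, a ord0 i <= v ord0 i <= b ord0 i]%R =
  (\prod_(i < d) (b ord0 i - a ord0 i))%:E%R.
Proof.
elim: d a b => [|d IH] a b ab.
  rewrite big_ord0 /= diracE mem_set//.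
  by move=> -[].
pose tl (v : 'rV[R]_d.+1) := (uncons_rV v).2.
have tlE v j : tl v ord0 j = v ord0 (lift ord0 j) by rewrite mxE.
pose B := [set v : 'rV[R]_d |
  forall i, tl a ord0 i <= v ord0 i <= tl b ord0 i]%R.
transitivity ((@lebesgue_measure R \x lebesgue_rV d)
    (`[a ord0 ord0, b ord0 ord0]%classic `*` B)).
  apply: (congr1 (@lebesgue_measure R \x lebesgue_rV d)).
  apply/seteqP; split => -[x v] /=; have [h0 hS] := cons_rVE x v.
    move=> h; split; first by have := h ord0; rewrite h0 in_itv.
    by move=> i; have := h (lift ord0 i); rewrite hS !tlE.
  move=> [hx hv] i; case: (unliftP ord0 i) => [j|] ->.
    by have := hv j; rewrite hS !tlE.
  by rewrite h0; move: hx; rewrite in_itv.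
rewrite product_measure1E//=; last first.
  rewrite (_ : B = \bigcap_(i in [set: 'I_d])
    ((fun v : 'rV[R]_d => v ord0 i) @^-1`
      `[tl a ord0 i, tl b ord0 i]%classic)); last first.
    apply/seteqP; split => v /= h i; first by move=> _ /=; rewrite in_itv/= h.
    by have := h i I; rewrite /= in_itv.
  apply: fin_bigcap_measurable => // i _.
  by rewrite -[X in measurable X]setTI; exact: measurable_rV_coord.
rewrite IH; last by move=> i; rewrite !tlE.
rewrite lebesgue_measure_itv/= lte_fin big_ord_recl EFinM.
under eq_bigr do rewrite !tlE.
case: ltP => // h; congr (_ * _).
by rewrite (@le_anti _ _ (a ord0 ord0) (b ord0 ord0)) ?subrr// ab h.
Qed.

End lebesgue_rV.

Section calculus.
Context {R : realType}.

(* f is of class C^k on D, through the partial derivatives along the family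
   [e].  The difference quotients are restricted to points of D, so at a
   boundary point of D the derivatives are the one-sided ones. *)
Fixpoint class_C (I : Type) (V : normedModType R) (e : I -> V) (D : set V)
    (k : nat) (f : V -> R) : Prop :=
  {within D, continuous f} /\
  if k is k'.+1 then
    forall i, exists g : V -> R,
      (forall x, D x ->
         h^-1 * (f (x + h *: e i) - f x) @[h --> within
           [set h | h != 0 /\ D (x + h *: e i)] (nbhs (0 : R))] --> g x) /\
      class_C e D k' g
  else True.

Definition unit_rV (d : nat) (i : 'I_d) : 'rV[R]_d := delta_mx ord0 i.

Definition unit_rVR (d : nat) (i : option 'I_d) : 'rV[R]_d * R^o :=
  if i is Some j then (unit_rV j, 0) else (0, 1).

(* C^k(R^d x [0,1]) *)
Definition class_C_space_time (d k : nat) (f : 'rV[R]_d -> R -> R) : Prop :=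
  class_C (@unit_rVR d) (setT `*` `[0, 1]) k
    (fun p : 'rV[R]_d * R^o => f p.1 p.2).

Definition cube (d : nat) : set 'rV[R]_d :=
  [set s | forall i, -1 <= s ord0 i <= 1].

Definition class_C_cube (d k : nat) (f : 'rV[R]_d -> R) : Prop :=
  class_C (@unit_rV d) (@cube d) k f.

(* partial_seq [:: i_1; ...; i_r] f = d/du_(i_1) ... d/du_(i_r) f *)
Fixpoint partial_seq (d : nat) (s : seq 'I_d) (f : 'rV[R]_d -> R^o) :
    'rV[R]_d -> R^o :=
  if s is i :: s' then fun u => 'D_(unit_rV i) (partial_seq s' f) u else f.

Fixpoint partial_seq_exists (d : nat) (s : seq 'I_d) (f : 'rV[R]_d -> R^o) :
    Prop :=
  if s is i :: s' then
    partial_seq_exists s' f /\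
    forall u, derivable (partial_seq s' f) u (unit_rV i)
  else True.

(* d^d f / du = d^d f / (du_1 ... du_d); meaningful only together with
   [mixed_partial_exists], as 'D is a total operator. *)
Definition mixed_partial (d : nat) (f : 'rV[R]_d -> R) : 'rV[R]_d -> R :=
  partial_seq (enum 'I_d) f.

Definition mixed_partial_exists (d : nat) (f : 'rV[R]_d -> R) : Prop :=
  partial_seq_exists (enum 'I_d) f.

Definition orthant (d : nat) (u : 'rV[R]_d) : set 'rV[R]_d :=
  [set v | forall i, v ord0 i <= u ord0 i].

End calculus.

Section probability.
Context {R : realType} (disp : measure_display) (Omega : measurableType disp).
Variable P : probability Omega R.

Definition expect (X : Omega -> R) : R := fine 'E_P[X].

(* sigma-algebra on Omega generated by the X_i with i in J *)
Definition sigma_of (I : Type) (disp' : measure_display)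
    (T : measurableType disp') (J : set I) (X : I -> Omega -> T) :
    set (set Omega) :=
  <<s \bigcup_(i in J) preimage_set_system setT (X i) measurable >>.

Definition independent_sigma (F G : set (set Omega)) : Prop :=
  forall A B, F A -> G B -> P (A `&` B) = (P A * P B)%E.

Definition mutually_independent (I : choiceType) (disp' : measure_display)
    (T : measurableType disp') (X : I -> Omega -> T) : Prop :=
  forall (s : seq I) (A : I -> set T), uniq s ->
    (forall i, measurable (A i)) ->
    P (\bigcap_(i in [set` s]) X i @^-1` A i) =
    (\big[*%E/1%E]_(i <- s) P (X i @^-1` A i))%E.

Definition iid (I : choiceType) (disp' : measure_display)
    (T : measurableType disp') (X : I -> Omega -> T) : Prop :=
  [/\ forall i, measurable_fun setT (X i),
      forall i j A, measurable A -> P (X i @^-1` A) = P (X j @^-1` A) &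
      mutually_independent X].

(* Convergence in distribution to the law [mu]: convergence of the distribution
   functions at every continuity point of the limiting one. *)
Definition cvg_in_distribution (Z : nat -> Omega -> R)
    (mu : probability (measurableTypeR R) R) : Prop :=
  (forall n, measurable_fun setT (Z n)) /\
  forall x : R, {for x, continuous (fun y : R => mu `]-oo, y]%classic)} ->
    P [set w | Z n w <= x] @[n --> \oo] --> mu `]-oo, x]%classic.

End probability.

(* N(0, v).  [normal_prob] is parametrized by the standard deviation and is the
   uniform law on [0,1] when that is 0, hence the case distinction. *)
Definition centered_normal {R : realType} (v : R) :
    probability (measurableTypeR R) R :=
  if v == 0 then
    dirac (0 : measurableTypeR R) : probability (measurableTypeR R) R
  else normal_prob 0 (Num.sqrt v) : probability (measurableTypeR R) R.

Section history.
Context (disp : measure_display) (E : measurableType disp).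

Definition history_cylinders : set (set (nat -> E)) :=
  \bigcup_j preimage_set_system setT (fun h : nat -> E => h j) measurable.

(* Histories (..., x_(k-1), x_k), listed from the most recent innovation:
   h j stands for x_(k-j).  Product sigma-algebra. *)
Definition history := g_sigma_algebraType history_cylinders.

Definition past (Omega : Type) (xi : int -> Omega -> E) (k : int) (w : Omega) :
  history := fun j : nat => xi (k - j%:Z) w.

(* xi with xi_0 replaced by xi'_0, so that [past (coupled xi xi') k] is H'_k *)
Definition coupled (Omega : Type) (xi xi' : int -> Omega -> E) :
  int -> Omega -> E := fun k => if k == 0 then xi' 0 else xi k.

(* The two-sided sequences xi and xi' as one family *)
Definition joint (Omega : Type) (xi xi' : int -> Omega -> E)
  (k : int + int) : Omega -> E :=
  match k with inl j => xi j | inr j => xi' j end.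

End history.

Section model.
Context {R : realType} (disp : measure_display) (Omega : measurableType disp).
Variable P : probability Omega R.
Context (d : nat) (dispE : measure_display) (E : measurableType dispE).
Variable G : R -> history E -> 'rV[R]_d.
Variables (xi xi' : int -> Omega -> E).

(* Phi(H_0) almost surely.  Phi need not be a measurable set of histories: the
   exceptional event is required to be contained in a null event of the form
   {H_0 \notin A}. *)
Definition as_past (Phi : history E -> Prop) : Prop :=
  exists A : set (history E),
    [/\ measurable A, P (past xi 0 @^-1` A) = 1%E & A `<=` [set h | Phi h]].

(* Q t is a regular version of the conditional law of G(t; H_(k+1)) given H_k,
   i.e. Q t (H_k) B = pr(G(t; H_(k+1)) \in B | H_k) for all B. *)
Definition is_one_step_law (Q : R -> R.-pker (history E) ~> 'rV[R]_d) : Prop :=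
  forall (t : R) (k : int) (A : set Omega) (B : set 'rV[R]_d),
    `[0, 1]%classic t -> sigma_of [set j : int | (j <= k)%R] xi A ->
    measurable B ->
    (\int[P]_(w in A) Q t (past xi k w) B)%E =
    P (A `&` [set w | B (G t (past xi (k + 1) w))]).

Variable Q : R -> R.-pker (history E) ~> 'rV[R]_d.

(* F_1(u,t|h), f_1(u,t|h), f(u,t) *)
Definition cond_cdf (u : 'rV[R]_d) (t : R) (h : history E) : R :=
  fine (Q t h (orthant u)).

Definition cond_pdf (u : 'rV[R]_d) (t : R) (h : history E) : R :=
  mixed_partial (fun v => cond_cdf v t h) u.

Definition marginal_pdf (u : 'rV[R]_d) (t : R) : R :=
  expect P (fun w => cond_pdf u t (past xi 0 w)).

(* For almost every history the derivative f_1 exists and is a density of F_1,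
   for all times t. *)
Definition has_cond_pdf : Prop :=
  as_past (fun h => forall t, `[0, 1]%classic t ->
    mixed_partial_exists (fun v => cond_cdf v t h) /\
    forall u, (\int[lebesgue_rV d]_(v in orthant u) (cond_pdf v t h)%:E =
               (cond_cdf u t h)%:E)%E).

(* sup_(t,u) (f_1 + |d^d f_1/du|) <= c almost surely *)
Definition cond_pdf_bound (c : R) : Prop :=
  as_past (fun h => forall t, `[0, 1]%classic t ->
    mixed_partial_exists (fun v => cond_pdf v t h) /\
    forall u, cond_pdf u t h +
      `|mixed_partial (fun v => cond_pdf v t h) u| <= c).

Definition psi (k : nat) (q : R) : \bar R :=
  ereal_sup [set ereal_sup (range (fun u : 'rV[R]_d =>
    Lnorm P q%:E (fun w =>
      (cond_pdf u t (past xi k%:Z w)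
       - cond_pdf u t (past (coupled xi xi') k%:Z w))%:E)))
    | t in `[0, 1]%classic].

Definition Psi (m : nat) (q : R) : \bar R := (\sum_(m <= k <oo) psi k q)%E.

Variables (m sigma : 'rV[R]_d -> R -> R) (eta : int -> Omega -> R).
Variables (K : 'rV[R]_d -> R) (h : nat -> R).

(* x_i and y_i in the sample of size n *)
Definition regressor (n i : nat) (w : Omega) : 'rV[R]_d :=
  G (i%:R / n%:R) (past xi i%:Z w).

Definition response (n i : nat) (w : Omega) : R :=
  m (regressor n i w) (i%:R / n%:R) +
  sigma (regressor n i w) (i%:R / n%:R) * eta i%:Z w.

Definition T_tilde (u : 'rV[R]_d) (n : nat) (w : Omega) : R :=
  (n%:R * h n ^+ d)^-1 *
  \sum_(1 <= i < n.+1)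
    response n i w * K ((h n)^-1 *: (u - regressor n i w)).

Definition f_tilde (u : 'rV[R]_d) (n : nat) (w : Omega) : R :=
  (n%:R * h n ^+ d)^-1 *
  \sum_(1 <= i < n.+1) K ((h n)^-1 *: (u - regressor n i w)).

Definition mu_hat (u : 'rV[R]_d) (n : nat) (w : Omega) : R :=
  T_tilde u n w / f_tilde u n w.

Definition f_bar (u : 'rV[R]_d) : R :=
  \int[lebesgue_measure]_(t in `[0, 1]) marginal_pdf u t.

Definition m_bar (u : 'rV[R]_d) : R :=
  (\int[lebesgue_measure]_(t in `[0, 1]) (m u t * marginal_pdf u t)) / f_bar u.

Definition V_tilde (u : 'rV[R]_d) : R :=
  (f_bar u) ^- 2 *
  \int[lebesgue_measure]_(t in `[0, 1])
    (((m u t - m_bar u) ^+ 2 + sigma u t ^+ 2) * marginal_pdf u t).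

Definition lambda_K : R :=
  \int[lebesgue_rV d]_(s in @cube R d) (K s ^+ 2).

(* K is symmetric and C^2 on its support [-1,1]^d, with unit integral. *)
Definition is_kernel : Prop :=
  [/\ closure [set s | K s != 0] = @cube R d,
      forall s, K (- s) = K s,
      class_C_cube 2 K &
      \int[lebesgue_rV d]_(s in @cube R d) K s = 1].

End model.

(* Main.v *)
(* Both claims follow from a central limit theorem for (n h^d)^(-1/2) sum (W_k - E W_k), where
   W_k = {alpha_n + B m(x_k, t_k) + B sigma(x_k, t_k) eta_k} K((u - x_k)/h): take (alpha, B) = (1, 0) for the density
   estimator f, and (alpha_n, B) = (- E T/E f, 1) for the ratio T/f, as T/f - E T/E f = (T - (E T/E f) f)/f.

   W_k - E W_k splits into a martingale difference and E(W_k | H_(k-1)) - E W_k.  The latter is the centred integral of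
   f_1(., t_k | H_(k-1)) against a weight of L^1 norm O(h^d); by an Efron-Stein inequality its sum has variance
   O(n h^(2d) Psi^2) = o(n h^d).  The same variance bound, with a Riemann sum, gives the limit of the conditional
   variances of the martingale, which is then handled by a Lindeberg argument: the test functions are Gaussian
   distribution functions Phi((a - x)/s), for which the heat equation is explicit, and testing against them for all a
   and s > 0 already characterizes the convergence to a normal law. *)
Require Import Defs.
From HB Require Import structures.
From mathcomp Require Import all_boot all_order all_algebra.
From mathcomp Require Import all_classical all_reals all_analysis.
From mathcomp Require Import measurable_realfun ring lra.
Set Implicit Arguments.
Unset Strict Implicit.
Unset Printing Implicit Defensive.
Import Order.TTheory GRing.Theory Num.Theory.
Import numFieldNormedType.Exports.
Local Open Scope classical_set_scope.
Local Open Scope ring_scope.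

(** * Gaussian distribution functions *)

Section gaussian.
Context {R : realType}.
Implicit Types (x y z a c M : R).

(** No conditional expectation operator is ever built. Given the pasts, the first two moments of a
    summand are explicit integrals against the one-step density, and their defining property is
    stated in weak form only: equality of expectations after multiplication by a bounded function of
    the two pasts. The replacement argument asks for no more, since it sees the past only through
    the partial sum and the accumulated conditional variance. The obstacle is the density itself. As
    an iterated derivative of a conditional distribution function it is total but uncontrolled off
    an almost sure event, and its definition gives neither joint measurability nor a sign. It is
    therefore exchanged for a version that is jointly measurable, nonnegative, bounded, and zero off
    that event; the link with the marginal density and with [psi] is recovered by ignoring null
    sets. The centring of the ratio depends on the sample size, which is why [alpha] is a sequence;
    only its limit, minus [m_bar], enters the variance. Large noise is absorbed by a Taylor
    remainder of the form min(D^2, |D|^3) and dominated convergence against 1 + eta^2. *)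

Lemma mvt_growth (g dg : R -> R) (y M : R) (k : nat) : 0 <= M ->
  (forall t, 0 <= t <= y \/ y <= t <= 0 ->
     is_derive t 1 g (dg t) /\ `|dg t| <= M * `|t| ^+ k) ->
  `|g y - g 0| <= M * `|y| ^+ k.+1.
Proof.
move=> M0 H.
have cont (a b : R) : (forall t, a <= t <= b -> is_derive t 1 g (dg t)) ->
    {within `[a, b], continuous g}.
  move=> D; apply/derivable_within_continuous => t; rewrite in_itv/= => /D dt.
  by case: dt.
have bound t : `|t| <= `|y| -> `|dg t| <= M * `|t| ^+ k ->
    `|dg t| * `|y| <= M * `|y| ^+ k.+1.
  move=> ty dt; rewrite exprSr mulrA ler_wpM2r// (le_trans dt)//.
  by rewrite ler_wpM2l// lerXn2r ?nnegrE.
have [y0|/ltW y0] := leP 0 y.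
  have [||c] := @MVT_segment _ g dg 0 y y0.
  - by move=> t; rewrite in_itv/= => /andP[? ?]; apply: (H t _).1; left; rewrite !ltW.
  - by apply: cont => t ty; apply: (H t _).1; left.
  rewrite in_itv/= => /andP[c0 cy] ->; rewrite subr0 normrM bound//.
    by rewrite !ger0_norm.
  by apply: (H c _).2; left; rewrite c0.
have [||c] := @MVT_segment _ g dg y 0 y0.
- by move=> t; rewrite in_itv/= => /andP[? ?]; apply: (H t _).1; right; rewrite !ltW.
- by apply: cont => t ty; apply: (H t _).1; right.
rewrite in_itv/= => /andP[c0 cy]; rewrite sub0r distrC => ->; rewrite normrM normrN bound//.
  by rewrite !ler0_norm// lerN2.
by apply: (H c _).2; right; rewrite c0.
Qed.

Lemma is_derive_translate (f : R -> R) x t (df : R) : is_derive (x + t) 1 f df ->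
  is_derive t 1 (fun t => f (x + t)) df.
Proof.
by move=> H; apply: is_derive_eq; rewrite /GRing.scale/= add0r mulr1.
Qed.

Lemma mvt_growth_at (F dF : R -> R) x y M k : 0 <= M ->
  (forall t, 0 <= t <= y \/ y <= t <= 0 ->
     is_derive (x + t) 1 F (dF t) /\ `|dF t| <= M * `|t| ^+ k) ->
  `|F (x + y) - F x| <= M * `|y| ^+ k.+1.
Proof.
move=> M0 H; have := @mvt_growth (fun t => F (x + t)) dF y M k M0.
rewrite addr0; apply => t ty; have [h1 h2] := H t ty; split=> //.
exact: is_derive_translate.
Qed.

Lemma taylor1_bound (F F1 : R -> R) x y M : 0 <= M ->
  (forall t, 0 <= t <= y \/ y <= t <= 0 -> is_derive (x + t) 1 F (F1 (x + t)) /\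
     `|F1 (x + t) - F1 x| <= M * `|t| ^+ 1) ->
  `|F (x + y) - F x - F1 x * y| <= M * `|y| ^+ 2.
Proof.
move=> M0 H; pose g t := F (x + t) - F x - F1 x * t.
have -> : F (x + y) - F x - F1 x * y = g y - g 0.
  by rewrite /g addr0 subrr mulr0 !subr0.
apply: (@mvt_growth g (fun t => F1 (x + t) - F1 x)) => // t ty.
have [h1 h2] := H t ty; split=> //.
have ? := is_derive_translate h1.
by rewrite /g; apply: is_derive_eq; rewrite /GRing.scale/=; ring.
Qed.

(** The cubic bound is the one for small increments, the quadratic one for large increments. Their
    minimum is integrable as soon as [y] has a second moment, and it is the quantity that the
    Lindeberg condition controls. *)
Lemma taylor2_bounds (F F1 F2 F3 : R -> R) M x y : 0 <= M ->
  (forall x, is_derive x 1 F (F1 x)) -> (forall x, is_derive x 1 F1 (F2 x)) ->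
  (forall x, is_derive x 1 F2 (F3 x)) ->
  (forall x, [/\ `|F1 x| <= M, `|F2 x| <= M & `|F3 x| <= M]) ->
  `|F (x + y) - F x| <= M * `|y| /\
  `|F (x + y) - F x - F1 x * y - F2 x * y ^+ 2 / 2| <= 2 * M * Num.min (y ^+ 2) (`|y| ^+ 3).
Proof.
move=> M0 d1 d2 d3 B.
have D1 t : `|F1 (x + t) - F1 x| <= M * `|t| ^+ 1.
  apply: (@mvt_growth_at F1 (fun t => F2 (x + t)) x t M 0 M0) => r _.
  by split; [exact: d2|rewrite mulr1; case: (B (x + r))].
have D2 t : `|F2 (x + t) - F2 x| <= M * `|t| ^+ 1.
  apply: (@mvt_growth_at F2 (fun t => F3 (x + t)) x t M 0 M0) => r _.
  by split; [exact: d3|rewrite mulr1; case: (B (x + r))].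
have T1 t : `|F1 (x + t) - F1 x - F2 x * t| <= M * `|t| ^+ 2.
  by apply: (@taylor1_bound F1 F2 x t M M0) => r _; split; [exact: d2|exact: D2].
have T0 t : `|F (x + t) - F x - F1 x * t| <= M * `|t| ^+ 2.
  by apply: (@taylor1_bound F F1 x t M M0) => r _; split; [exact: d1|exact: D1].
split.
  rewrite -[`|y|]expr1.
  apply: (@mvt_growth_at F (fun t => F1 (x + t)) x y M 0 M0) => r _.
  by split; [exact: d1|rewrite mulr1; case: (B (x + r))].
rewrite minr_pMr; last by rewrite mulr_ge0.
rewrite le_min; apply/andP; split.
  apply: (le_trans (ler_normB _ _)).
  have h := T0 y; rewrite -normrX (ger0_norm (sqr_ge0 y)) in h.
  have [_ h2 _] := B x.
  have : `|F2 x * y ^+ 2 / 2| <= M * y ^+ 2.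
    rewrite (normrM _ 2^-1) (normrM (F2 x)) (ger0_norm (sqr_ge0 y)) (ger0_norm (x := 2^-1))//.
    rewrite ler_pdivrMr// -mulrA ler_pM//; have := sqr_ge0 y; lra.
  lra.
pose g t := F (x + t) - F x - F1 x * t - F2 x / 2 * t ^+ 2.
have -> : F (x + y) - F x - F1 x * y - F2 x * y ^+ 2 / 2 = g y - g 0.
  by rewrite /g addr0 subrr mulr0 expr0n/= mulr0 !subr0 mulrAC.
apply: le_trans (_ : M * `|y| ^+ 3 <= _); last first.
  by rewrite ler_wpM2r ?exprn_ge0// ler_peMl// ler1n.
apply: (@mvt_growth g (fun t => F1 (x + t) - F1 x - F2 x * t)) => // t _.
split => //; have ? := is_derive_translate (d1 (x + t)).
by rewrite /g; apply: is_derive_eq; rewrite /GRing.scale/=; field.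
Qed.

(** A one-sided version, since it is applied in the variance variable, where derivatives are bounded
    only above a positive floor [c0]. *)
Lemma taylor1_bounds_ge (F F1 F2 : R -> R) M c0 c c' : 0 <= M -> c0 <= c -> c <= c' ->
  (forall c, c0 <= c -> is_derive c 1 F (F1 c)) ->
  (forall c, c0 <= c -> is_derive c 1 F1 (F2 c)) ->
  (forall c, c0 <= c -> `|F1 c| <= M /\ `|F2 c| <= M) ->
  `|F c' - F c| <= M * (c' - c) /\
  `|F c' - F c - F1 c * (c' - c)| <= M * (c' - c) ^+ 2.
Proof.
move=> M0 cc cc' d1 d2 B.
have ge t : 0 <= t <= c' - c \/ c' - c <= t <= 0 -> c0 <= c + t.
  by case=> /andP[? ?]; lra.
rewrite -{1 3}(subrK c c') (addrC _ c); split.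
  rewrite -[X in _ <= _ * X](ger0_norm (x := c' - c)) ?subr_ge0// -[`|_| in leRHS]expr1.
  apply: (@mvt_growth_at F (fun t => F1 (c + t)) c _ M 0 M0) => r /ge cr.
  by split; [exact: d1|rewrite mulr1; case: (B _ cr)].
have -> : (c' - c) ^+ 2 = `|c' - c| ^+ 2 by rewrite -normrX ger0_norm ?sqr_ge0.
apply: (@taylor1_bound F F1 c _ M M0) => t tc; split; first by apply: d1; exact: ge.
apply: (@mvt_growth_at F1 (fun t => F2 (c + t)) c t M 0 M0) => r rt.
have cr : c0 <= c + r.
  by case: tc => /andP[? ?]; case: rt => /andP[? ?]; lra.
by split; [exact: d2|rewrite mulr1; case: (B _ cr)].
Qed.

Definition phi x : R := normal_pdf 0 1 x.
Definition Phi x : R := fine (@normal_prob R 0 1 `]-oo, x]%classic).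

Lemma phiE x : phi x = normal_peak 1 * expR (- x ^+ 2 / 2).
Proof.
by rewrite /phi normal_pdfE ?oner_neq0// /normal_fun subr0 expr1n.
Qed.

Lemma phi_ge0 x : 0 <= phi x. Proof. exact: normal_pdf_ge0. Qed.

Lemma is_derive_Phi x : is_derive x 1 Phi (phi x).
Proof.
have intphi : lebesgue_measure.-integrable setT (EFin \o @normal_pdf R 0 1).
  exact: integrable_normal_pdf.
have [||||dP] := @continuous_FTC1 R (normal_pdf 0 1) -oo%O x (x + 1).
- by rewrite ltrDl.
- by apply: integrableS intphi.
- by rewrite ltNyr.
- by apply: continuous_normal_pdf; exact: oner_neq0.
move=> dE; have := derivableP dP; rewrite -derive1E dE; exact.
Qed.

Lemma is_derive_phi x : is_derive x 1 phi (- x * phi x).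
Proof.
have -> : phi = fun x => normal_peak 1 * expR (- x ^+ 2 / 2).
  by apply/funext => y; rewrite phiE.
apply: is_derive_eq.
by rewrite /GRing.scale/=; field.
Qed.

Definition zphi z := z * phi z.

Lemma is_derive_zphi x : is_derive x 1 zphi ((1 - x ^+ 2) * phi x).
Proof.
rewrite /zphi.
have := is_derive_phi x => ?.
apply: is_derive_eq; rewrite /GRing.scale/=; ring.
Qed.

Lemma phi_decay : exists2 B : R, 0 <= B & forall z, (1 + z ^+ 4) * phi z <= B.
Proof.
(* With [w = z^2 / 2], the exponential dominates [1 + w^2 / 2], while [1 + z^4 = 1 + 8 (w^2 / 2)];
   hence the factor 9. *)
exists (normal_peak 1 * 9); first by rewrite mulr_ge0// normal_peak_ge0.
move=> z; rewrite phiE mulrCA ler_wpM2l ?normal_peak_ge0//.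
have := @expR_ge1Dxn R (z ^+ 2 / 2) 1; rewrite divr_ge0 ?sqr_ge0// => /(_ isT).
rewrite (_ : - z ^+ 2 / 2 = - (z ^+ 2 / 2)) ?mulNr// expRN ler_pdivrMr ?expR_gt0//.
set e := expR _ => H.
have -> : z ^+ 4 = 8 * ((z ^+ 2 / 2) ^+ 2 / 2) by field.
set w := _ / 2 in H *; rewrite /= in H; have : 0 <= w by rewrite divr_ge0 ?sqr_ge0.
change (2 `!%:R : R) with (2%:R : R) in H.
lra.
Qed.

(** Up to powers of the variance, these four expressions build the first three derivatives of
    [smooth_cdf] in the space variable and the variance derivative of its second one. *)
Lemma phi_moments : exists2 B : R, 0 <= B & forall z,
  [/\ phi z <= B, `|z * phi z| <= B, `|(1 - z ^+ 2) * phi z| <= B &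
      `|z * ((1 - z ^+ 2) * phi z)| <= B].
Proof.
have [B B0 HB] := phi_decay; exists (3 * B); first by rewrite mulr_ge0.
move=> z; have := HB z; have := phi_ge0 z; set p := phi z => p0 zp.
have p1 : p <= B by apply: le_trans zp; rewrite ler_peMl// lerDl exprn_even_ge0.
have z1 : `|z| <= 1 + z ^+ 4.
  rewrite -(ger0_norm (@exprn_even_ge0 _ 4 z isT)) normrX; set t := `|z|.
  have := sqr_ge0 (t ^+ 2 - 1/2); have := sqr_ge0 (t - 1/2); nra.
have z2 : z ^+ 2 <= 1 + z ^+ 4 by have := sqr_ge0 (z ^+ 2 - 1/2); nra.
have z3 : `|z| * z ^+ 2 <= 1 + z ^+ 4.
  have -> : z ^+ 2 = `|z| ^+ 2 by rewrite -normrX ger0_norm ?sqr_ge0.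
  rewrite -(ger0_norm (@exprn_even_ge0 _ 4 z isT)) normrX; set t := `|z|.
  have t0 : 0 <= t by rewrite /t.
  have [h|h] := lerP t 1.
    have : t * t ^+ 2 <= 1 by rewrite -exprS exprn_ile1.
    have : 0 <= t ^+ 4 by rewrite exprn_ge0.
    lra.
  have : 0 <= (t - 1) * t ^+ 3 by rewrite mulr_ge0 ?exprn_ge0// subr_ge0 ltW.
  rewrite -[t * t ^+ 2]exprS mulrBl mul1r -[t * t ^+ 3]exprS; lra.
have zz : `|1 - z ^+ 2| <= 1 + z ^+ 2.
  by rewrite ler_norml; have := sqr_ge0 z; lra.
have mono u : u <= 1 + z ^+ 4 -> u * p <= B by move=> /(ler_wpM2r p0) /le_trans; exact.
have h1 := mono _ z1; have h2 := mono _ z2; have h3 := mono _ z3.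
split; first by lra.
- by rewrite normrM (ger0_norm p0); lra.
- rewrite normrM (ger0_norm p0); apply: le_trans (_ : (1 + z ^+ 2) * p <= _); last by lra.
  by rewrite ler_wpM2r.
- rewrite !normrM (ger0_norm p0).
  apply: le_trans (_ : `|z| * ((1 + z ^+ 2) * p) <= _).
    by rewrite ler_wpM2l// ler_wpM2r.
  have -> : `|z| * ((1 + z ^+ 2) * p) = `|z| * p + `|z| * z ^+ 2 * p by ring.
  lra.
Qed.

(** The probability that [x] plus a centred normal variable of variance [c] is at most [a]: the
    indicator of the half-line smoothed by the heat semigroup for time [c]. *)
Definition smooth_cdf a c x : R := Phi ((a - x) / Num.sqrt c).
Definition smooth_cdf' a c x : R := - (Num.sqrt c)^-1 * phi ((a - x) / Num.sqrt c).
Definition smooth_cdf'' a c x : R :=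
  - c^-1 * zphi ((a - x) / Num.sqrt c).

Lemma Phi_01 x : 0 <= Phi x <= 1.
Proof.
rewrite /Phi fine_ge0//= -[leRHS]/(fine 1%E) fine_le ?fin_num_measure//.
exact: probability_le1.
Qed.

Lemma is_derive_smooth_cdf a c x : 0 < c ->
  is_derive x 1 (smooth_cdf a c) (smooth_cdf' a c x).
Proof.
move=> c0; have := is_derive_Phi ((a - x) / Num.sqrt c) => ?.
apply: is_derive_eq; rewrite /GRing.scale/= /smooth_cdf'; ring.
Qed.

Lemma is_derive_smooth_cdf' a c x : 0 < c ->
  is_derive x 1 (smooth_cdf' a c) (smooth_cdf'' a c x).
Proof.
move=> c0; have := is_derive_phi ((a - x) / Num.sqrt c) => ?.
apply: is_derive_eq; rewrite /GRing.scale/= /smooth_cdf'' /zphi.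
rewrite -{5}(sqr_sqrtr (ltW c0)).
have : Num.sqrt c != 0 by rewrite gt_eqF// sqrtr_gt0.
by move: (Num.sqrt c) => s s0; field.
Qed.

Lemma is_derive_smooth_cdf'' a c x : 0 < c ->
  let z := (a - x) / Num.sqrt c in
  is_derive x 1 (smooth_cdf'' a c) (c^-1 / Num.sqrt c * ((1 - z ^+ 2) * phi z)).
Proof.
move=> c0 z; have := is_derive_zphi ((a - x) / Num.sqrt c) => ?.
apply: is_derive_eq; rewrite /GRing.scale/= -/z; ring.
Qed.

Lemma is_derive_zscore a x c : 0 < c ->
  is_derive c 1 (fun c => (a - x) / Num.sqrt c) (- ((a - x) / Num.sqrt c) / (2 * c)).
Proof.
move=> c0; have s0 : Num.sqrt c != 0 by rewrite gt_eqF// sqrtr_gt0.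
have := is_derive1_sqrt c0 => ?.
have := @is_deriveV _ (@Num.sqrt R) c _ 1 s0 _ => ?.
apply: is_derive_eq; rewrite /GRing.scale/=.
rewrite -{4}(sqr_sqrtr (ltW c0)).
by move: (Num.sqrt c) s0 => s s0; field.
Qed.

(** The heat equation. It lets a decrease of the variance [c] compensate the second-order Taylor
    term in [x]. *)
Lemma is_derive_smooth_cdf_var a x c : 0 < c ->
  is_derive c 1 (fun c => smooth_cdf a c x) (smooth_cdf'' a c x / 2).
Proof.
move=> c0; have := is_derive_zscore a x c0 => ?.
have := is_derive_Phi ((a - x) / Num.sqrt c) => ?.
apply: is_derive_eq; rewrite /GRing.scale/= /smooth_cdf'' /zphi.
by field; rewrite !gt_eqF// sqrtr_gt0.
Qed.

Lemma is_derive_smooth_cdf''_var a x c : 0 < c ->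
  let z := (a - x) / Num.sqrt c in
  is_derive c 1 (fun c => smooth_cdf'' a c x)
    (c ^- 2 * (z * phi z) + c ^- 2 / 2 * (z * ((1 - z ^+ 2) * phi z))).
Proof.
move=> c0 z; have := is_derive_zscore a x c0 => ?.
have := is_derive_zphi ((a - x) / Num.sqrt c) => ?.
have cn0 : id c != 0 by rewrite gt_eqF.
have := @is_deriveV _ id c _ 1 cn0 _ => ?.
apply: is_derive_eq; rewrite /GRing.scale/= -/z /zphi.
by field.
Qed.

(** * Derivative bounds uniform over variances bounded below *)

Section bounds.
Variable c0 : R.
Hypothesis c0_gt0 : 0 < c0.

Lemma smooth_cdf_bounds : exists2 M : R, 0 <= M & forall a c x, c0 <= c ->
  [/\ `|smooth_cdf' a c x| <= M, `|smooth_cdf'' a c x| <= M,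
    `|c^-1 / Num.sqrt c * ((1 - ((a - x) / Num.sqrt c) ^+ 2) * phi ((a - x) / Num.sqrt c))| <= M &
    let z := (a - x) / Num.sqrt c in
    `|c ^- 2 * (z * phi z) + c ^- 2 / 2 * (z * ((1 - z ^+ 2) * phi z))| <= M].
Proof.
have [B B0 HB] := phi_moments.
set i := c0^-1; set s := (Num.sqrt c0)^-1.
have i0 : 0 <= i by rewrite invr_ge0 ltW.
have s0 : 0 <= s by rewrite invr_ge0 sqrtr_ge0.
have B1 := mulr_ge0 s0 B0; have B2 := mulr_ge0 i0 B0.
have B3 := mulr_ge0 (mulr_ge0 i0 s0) B0; have B4 := mulr_ge0 (exprn_ge0 2 i0) B0.
exists (s * B + i * B + i * s * B + 2 * (i ^+ 2 * B)); first lra.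
move=> a c x cc; have c_gt0 : 0 < c by exact: lt_le_trans cc.
have ic : 0 <= c^-1 <= i by rewrite invr_ge0 ltW//= lef_pV2 ?posrE.
have sc : 0 <= (Num.sqrt c)^-1 <= s.
  by rewrite invr_ge0 sqrtr_ge0/= lef_pV2 ?posrE ?sqrtr_gt0// ler_wsqrtr.
have ic2 : 0 <= c^-2 <= i ^+ 2.
  by rewrite -exprVn; case/andP: ic => ? ?; rewrite exprn_ge0//= lerXn2r ?nnegrE.
have [b1 b2 b3 b4] := HB ((a - x) / Num.sqrt c).
have p0 := phi_ge0 ((a - x) / Num.sqrt c).
have mm (u v U V : R) : 0 <= u <= U -> `|v| <= V -> `|u * v| <= U * V.
  by case/andP=> ? ? ?; rewrite normrM (ger0_norm (x:=u))// ler_pM.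
split.
- rewrite /smooth_cdf' mulNr normrN; apply: (@le_trans _ _ (s * B)); last lra.
  by apply: mm => //; rewrite ger0_norm.
- rewrite /smooth_cdf'' mulNr normrN; apply: (@le_trans _ _ (i * B)); last lra.
  by apply: mm.
- apply: (@le_trans _ _ (i * s * B)); last lra.
  by apply: mm => //; case/andP: ic => ? ?; case/andP: sc => ? ?; rewrite mulr_ge0//= ler_pM.
- move=> z; apply: (@le_trans _ _ (2 * (i ^+ 2 * B))); last lra.
  apply: (le_trans (ler_normD _ _)).
  have := mm _ _ _ _ ic2 b2.
  have : 0 <= c^-2/2 <= i ^+ 2 by have /andP[? ?] := ic2; apply/andP; split; lra.
  move=> /mm /(_ b4); rewrite -/z; lra.
Qed.

Lemma smooth_cdf_taylor : exists2 M : R, 0 <= M & forall a c x, c0 <= c ->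
  (forall y, `|smooth_cdf a c (x + y) - smooth_cdf a c x| <= M * `|y| /\
   `|smooth_cdf a c (x + y) - smooth_cdf a c x - smooth_cdf' a c x * y
        - smooth_cdf'' a c x * y ^+ 2 / 2| <= M * Num.min (y ^+ 2) (`|y| ^+ 3)) /\
  [/\ `|smooth_cdf' a c x| <= M, `|smooth_cdf'' a c x| <= M &
      forall c', c <= c' ->
        `|smooth_cdf a c' x - smooth_cdf a c x| <= M * (c' - c) /\
        `|smooth_cdf a c' x - smooth_cdf a c x - smooth_cdf'' a c x / 2 * (c' - c)| <= M * (c' - c) ^+ 2].
Proof.
have [M M0 HM] := smooth_cdf_bounds; exists (2 * M); first by rewrite mulr_ge0.
move=> a c x cc; have c_gt0 : 0 < c by exact: lt_le_trans cc.
have wk u : 0 <= u -> M * u <= 2 * M * u by move=> u0; rewrite ler_wpM2r// ler_peMl// ler1n.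
have wk1 : M <= 2 * M by have := wk 1 ler01; rewrite !mulr1.
split.
  move=> y; have := @taylor2_bounds (smooth_cdf a c) (smooth_cdf' a c) (smooth_cdf'' a c)
    (fun x => c^-1 / Num.sqrt c * ((1 - ((a - x) / Num.sqrt c) ^+ 2) * phi ((a - x) / Num.sqrt c))) M x y M0.
  case.
  - by move=> z; exact: is_derive_smooth_cdf.
  - by move=> z; exact: is_derive_smooth_cdf'.
  - by move=> z; exact: is_derive_smooth_cdf''.
  - by move=> z; have [? ? ? _] := HM a c z cc; split.
  move=> h1 h2; split => //.
  by apply: le_trans h1 _; exact: wk.
have [h1 h2 _ _] := HM a c x cc.
split; [exact: le_trans wk1|exact: le_trans wk1|].
move=> c' cc'.
have := @taylor1_bounds_ge (fun c => smooth_cdf a c x) (fun c => smooth_cdf'' a c x / 2)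
  (fun c => (c ^- 2 * ((a - x) / Num.sqrt c * phi ((a - x) / Num.sqrt c)) + c ^- 2 / 2 * ((a - x) / Num.sqrt c * ((1 - ((a - x) / Num.sqrt c) ^+ 2) * phi ((a - x) / Num.sqrt c)))) / 2) M c0 c c' M0 cc cc'.
case.
- by move=> r rc; apply: is_derive_smooth_cdf_var; exact: lt_le_trans rc.
- move=> r rc; have r0 : 0 < r by exact: lt_le_trans rc.
  have ? := is_derive_smooth_cdf''_var a x r0.
  have -> : (fun c => smooth_cdf'' a c x / 2) = (fun c => 2^-1 * smooth_cdf'' a c x).
    by apply/funext => ?; rewrite mulrC.
  by apply: is_derive_eq; rewrite /GRing.scale/= mulrC.
- move=> r rc; have [_ b1 _ b2] := HM a r x rc.
  have half u : `|u| <= M -> `|u / 2| <= M.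
    by move=> uM; rewrite normrM (ger0_norm (x := 2^-1))// ler_pdivrMr// (le_trans uM)// ler_peMr// ler1n.
  by split; apply: half.
move=> g1 g2; split; [apply: le_trans g1 _|apply: le_trans g2 _]; apply: wk.
- by rewrite subr_ge0.
- exact: sqr_ge0.
Qed.

End bounds.


Lemma measurable_phi : measurable_fun setT phi.
Proof. exact: measurable_normal_pdf. Qed.

Lemma continuous_Phi : continuous Phi.
Proof.
move=> x; apply/differentiable_continuous/derivable1_diffP.
by have [] := is_derive_Phi x.
Qed.

Lemma measurable_Phi : measurable_fun setT Phi.
Proof. by apply: continuous_measurable_fun; exact: continuous_Phi. Qed.

Section measurability.
Context d (T : measurableType d) (f g : T -> R) (a : R).
Hypothesis (mf : measurable_fun setT f) (mg : measurable_fun setT g).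

Lemma measurable_invr : measurable_fun setT (fun x => x^-1 : R).
Proof.
(* Inversion is continuous off 0 only, so the point 0, where its value is 0 by convention, is
   treated apart. *)
have -> : [set: R] = [set 0] `|` [set~ 0] by rewrite setUv.
have o0 : open [set~ (0 : R)] by exact/closed_openC/closed_eq.
apply/measurable_funU => //; first exact: open_measurable.
split; first exact: measurable_fun_set1.
have : {within [set~ (0 : R)], continuous (fun x : R => x^-1)}.
  rewrite continuous_open_subspace// => x; rewrite inE/= => /eqP x0.
  exact: inv_continuous.
by apply: subspace_continuous_measurable_fun; exact: open_measurable.
Qed.

Lemma measurable_sqrt : measurable_fun setT (@Num.sqrt R).
Proof. by apply: continuous_measurable_fun => x; exact: sqrt_continuous. Qed.

Lemma measurable_fun_inv : measurable_fun setT (fun t => (f t)^-1).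
Proof. exact: measurableT_comp measurable_invr mf. Qed.

Lemma measurable_zscore : measurable_fun setT (fun t => (a - g t) / Num.sqrt (f t)).
Proof.
apply: measurable_funM; first exact: measurable_funB.
apply: measurableT_comp measurable_invr _; exact: measurableT_comp measurable_sqrt mf.
Qed.

Lemma measurable_smooth_cdf : measurable_fun setT (fun t => smooth_cdf a (f t) (g t)).
Proof. exact: measurableT_comp measurable_Phi measurable_zscore. Qed.

Lemma measurable_smooth_cdf' : measurable_fun setT (fun t => smooth_cdf' a (f t) (g t)).
Proof.
apply: measurable_funM; last exact: measurableT_comp measurable_phi measurable_zscore.
apply: measurableT_comp => //.
apply: measurableT_comp measurable_invr _; exact: measurableT_comp measurable_sqrt mf.
Qed.

Lemma measurable_smooth_cdf'' : measurable_fun setT (fun t => smooth_cdf'' a (f t) (g t)).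
Proof.
apply: measurable_funM; last first.
  apply: measurable_funM; first exact: measurable_zscore.
  exact: measurableT_comp measurable_phi measurable_zscore.
by apply: measurableT_comp => //; exact: measurable_fun_inv.
Qed.

End measurability.

Lemma normal_prob_cdf s x : 0 < s -> normal_prob 0 s `]-oo, x]%classic = (Phi (x / s))%:E.
Proof.
move=> s0; rewrite /Phi fineK; last exact: fin_num_measure.
rewrite /normal_prob.
have F' : (fun x : R => x / s)^`()%classic = cst s^-1.
  apply/funext => y; rewrite derive1E.
  have -> : (fun x : R => x / s) = s^-1 \*: id.
    by apply/funext => z; rewrite mulrC.
  by rewrite derive_val /GRing.scale/= mulr1.
rewrite (@increasing_ge0_integration_by_substitutionNy _ (fun x => x / s) (normal_pdf 0 1) x).
- apply: eq_integral => y _; rewrite F' /=; congr EFin.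
  rewrite !normal_pdfE ?gt_eqF// /normal_peak /normal_fun !subr0 expr1n mul1r.
  rewrite -mulrnAr sqrtrM ?sqr_ge0// sqrtr_sqr gtr0_norm// invfM.
  rewrite [RHS]mulrC [in RHS]mulrA; congr (_ * expR _); field; exact: lt0r_neq0.
- by move=> y z _ _ yz; rewrite ltr_pM2r ?invr_gt0.
- by rewrite F' => ? _; exact: cvg_cst.
- by rewrite F'; exact: is_cvg_cst.
- by rewrite F'; exact: cvg_cst.
- split; first by move=> y _; apply: derivableM.
  apply: cvg_at_left_filter; apply: cvgMr_tmp; exact: cvg_id.
- by apply: gt0_cvgMlNy; [rewrite invr_gt0|exact: cvg_id].
- by apply: continuous_subspaceT; apply: continuous_normal_pdf; exact: oner_neq0.
- by move=> y _; exact: normal_pdf_ge0.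
Qed.

(** The identity as a random variable under the standard normal law. Its distribution function is
    [Phi], so the limits of a distribution function at both infinities carry over. *)
Let idR : measurableTypeR R -> R := idfun.

#[local] HB.instance Definition _ :=
  @isMeasurableFun.Build _ _ _ _ idR (@measurable_id _ _ setT).

Lemma cvg_PhiNy : Phi x @[x --> -oo] --> (0 : R).
Proof.
have /fine_cvgP[_] := @cvg_cdfNy0 _ _ _ (@normal_prob R 0 1) (idR : {RV (@normal_prob R 0 1) >-> R}).
by apply.
Qed.

Lemma cvg_Phiy : Phi x @[x --> +oo] --> (1 : R).
Proof.
have /fine_cvgP[_] := @cvg_cdfy1 _ _ _ (@normal_prob R 0 1) (idR : {RV (@normal_prob R 0 1) >-> R}).
by apply.
Qed.

Lemma Phi_nondecreasing x y : x <= y -> Phi x <= Phi y.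
Proof.
move=> xy; rewrite fine_le ?fin_num_measure//; apply: le_measure; rewrite ?inE//.
exact: subset_itvl.
Qed.

Lemma phi_gt0 x : 0 < phi x.
Proof. by rewrite phiE mulr_gt0 ?expR_gt0// normal_peak_gt0// oner_neq0. Qed.

Lemma Phi_gt0 x : 0 < Phi x.
Proof.
have [|||z _] := @MVT_segment _ Phi phi (x - 1) x; first by rewrite gerBl.
- by move=> z _; exact: is_derive_Phi.
- exact/continuous_subspaceT/continuous_Phi.
have /andP[h0 _] := Phi_01 (x - 1).
by have := phi_gt0 z; lra.
Qed.

End gaussian.

(** * Expectations and convergence in distribution *)

Section expectation_calculus.
Context {R : realType} d (T : measurableType d) (P : probability T R).
Implicit Types (f g : T -> R).

Notation integ f := (P.-integrable setT (EFin \o f)).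

Lemma expectE f : expect P f = Rintegral P setT f.
Proof. by rewrite /expect unlock. Qed.

Lemma bounded_integrable f (M : R) : measurable_fun setT f ->
  (forall w, `|f w| <= M) -> integ f.
Proof.
move=> mf fM; apply: measurable_bounded_integrable => //.
  by rewrite (le_lt_trans (probability_le1 _ _))// ltry.
by exists M; split; [exact: num_real|move=> x Mx t _; exact: le_trans (fM t) (ltW Mx)].
Qed.

Lemma integrable_fun f : integ f -> measurable_fun setT f.
Proof. by move/measurable_int/measurable_EFinP. Qed.

Lemma integ_cst (c : R) : integ (fun=> c).
Proof. by apply: (@bounded_integrable _ `|c|). Qed.

Lemma integD f g : integ f -> integ g -> integ (fun w => f w + g w).
Proof. by move=> fi gi; have := integrableD measurableT fi gi. Qed.

Lemma integB f g : integ f -> integ g -> integ (fun w => f w - g w).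
Proof. by move=> fi gi; have := integrableB measurableT fi gi. Qed.

Lemma integZ (c : R) f : integ f -> integ (fun w => c * f w).
Proof. by move=> fi; have := integrableZl measurableT c fi. Qed.

Lemma integ_norm f : integ f -> integ (fun w => `|f w|).
Proof. exact: integrable_norm. Qed.

Lemma integ_dom f g : measurable_fun setT f -> (forall w, `|f w| <= g w) -> integ g -> integ f.
Proof.
move=> mf fg; apply: le_integrable => //; first exact/measurable_EFinP.
by move=> w _ /=; rewrite lee_fin (le_trans (fg w))// ler_norm.
Qed.

Lemma integM (M : R) f g : measurable_fun setT g -> (forall w, `|g w| <= M) -> integ f ->
  integ (fun w => g w * f w).
Proof.
move=> mg gM fi; apply: (@integ_dom _ (fun w => M * `|f w|)).
- by apply: measurable_funM => //; exact: integrable_fun.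
- by move=> w; rewrite normrM ler_wpM2r.
- exact/integZ/integ_norm.
Qed.

Lemma expect_cst (c : R) : expect P (fun=> c) = c.
Proof. by rewrite /expect expectation_cst. Qed.

Lemma expectB f g : integ f -> integ g ->
  expect P (fun w => f w - g w) = expect P f - expect P g.
Proof. by move=> fi gi; rewrite !expectE; exact: RintegralB. Qed.

Lemma expectD f g : integ f -> integ g ->
  expect P (fun w => f w + g w) = expect P f + expect P g.
Proof. by move=> fi gi; rewrite !expectE; exact: RintegralD. Qed.

Lemma expectZ c f : integ f -> expect P (fun w => c * f w) = c * expect P f.
Proof. by move=> fi; rewrite !expectE; exact: RintegralZl. Qed.

Lemma expect_le f g : integ f -> integ g ->
  (forall w, f w <= g w) -> expect P f <= expect P g.
Proof. by move=> fi gi fg; rewrite !expectE; apply: le_Rintegral. Qed.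

Lemma expect_ge0 f : (forall w, 0 <= f w) -> 0 <= expect P f.
Proof. by move=> f0; rewrite expectE; apply: Rintegral_ge0. Qed.

Lemma ler_norm_expect f : integ f -> `|expect P f| <= expect P (fun w => `|f w|).
Proof. by move=> fi; rewrite !expectE; exact: le_normr_Rintegral. Qed.

Lemma expect_norm_le f (M : R) : integ f -> (forall w, `|f w| <= M) -> `|expect P f| <= M.
Proof.
move=> fi fM; apply: (le_trans (ler_norm_expect fi)); rewrite -[leRHS]expect_cst.
by apply: expect_le => //; [exact: integ_norm|exact: integ_cst].
Qed.

Lemma integ_indic A : measurable A -> integ (\1_A : T -> R).
Proof. by move=> mA; apply: (@bounded_integrable _ 1) => // w; rewrite indicE; case: (_ \in _); rewrite ?normr1 ?normr0. Qed.

Lemma expect_indic A : measurable A -> expect P (\1_A) = fine (P A).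
Proof. by move=> mA; rewrite /expect expectation_indic. Qed.

Lemma integ_sum (I : Type) (s : seq I) (F : I -> T -> R) :
  (forall i, integ (F i)) -> integ (fun w => \sum_(i <- s) F i w).
Proof.
move=> Fi; elim: s => [|i s IH].
  by have := integ_cst 0; congr integrable; apply/funext => w /=; rewrite big_nil.
by have := integD (Fi i) IH; congr integrable; apply/funext => w /=; rewrite big_cons.
Qed.

Lemma expect_sum (I : Type) (s : seq I) (F : I -> T -> R) :
  (forall i, integ (F i)) ->
  expect P (fun w => \sum_(i <- s) F i w) = \sum_(i <- s) expect P (F i).
Proof.
move=> Fi; elim: s => [|i s IH].
  by rewrite big_nil -[RHS]expect_cst; congr expect; apply/funext => w; rewrite big_nil.
rewrite big_cons -IH -expectD//; last exact: integ_sum.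
by congr expect; apply/funext => w; rewrite big_cons.
Qed.

Lemma fine_prob_le (A B : set T) : measurable A -> measurable B -> A `<=` B ->
  fine (P A) <= fine (P B).
Proof. by move=> mA mB AB; rewrite fine_le ?fin_num_measure//; apply: le_measure; rewrite ?inE. Qed.

Lemma fine_prob_leU (A B C : set T) : measurable A -> measurable B -> measurable C ->
  A `<=` B `|` C -> fine (P A) <= fine (P B) + fine (P C).
Proof.
move=> mA mB mC ABC; rewrite -!expect_indic// -expectD; [|exact: integ_indic..].
apply: expect_le; [exact: integ_indic|by apply: integD; exact: integ_indic|].
move=> w; rewrite !indicE; have [/set_mem wA|_] := boolP (w \in A); last first.
  by do 2 case: (_ \in _) => //=; rewrite ?addr0 ?ler01// ?add0r ?ler01// addr_ge0.
case: (ABC _ wA) => wB; rewrite (mem_set wB); case: (_ \in _) => //=; rewrite ?addr0 ?add0r// ?lerDl ?lerDr//.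
Qed.

Lemma fine_prob_ge0 A : 0 <= fine (P A).
Proof. by rewrite fine_ge0. Qed.

Lemma measurable_norm_ge (f : T -> R) e : measurable_fun setT f ->
  measurable [set w | e <= `|f w|].
Proof.
move=> mf; rewrite -[X in measurable X]setTI.
have : measurable_fun setT (fun w => e <= `|f w|).
  by apply: measurable_fun_ler => //; exact: measurableT_comp.
by move/(_ measurableT [set true]); rewrite setTI; apply.
Qed.

Lemma markov_norm (f : T -> R) e : 0 < e -> integ f ->
  fine (P [set w | e <= `|f w|]) <= e^-1 * expect P (fun w => `|f w|).
Proof.
move=> e0 fi; rewrite -expect_indic; last by apply: measurable_norm_ge; exact: integrable_fun.
rewrite -expectZ; last exact: integ_norm.
apply: expect_le; [|exact/integZ/integ_norm|].
  by apply/integ_indic/measurable_norm_ge/integrable_fun.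
move=> w; rewrite indicE; case: (boolP (_ \in _)) => [/set_mem/=h|_].
  by rewrite ler_pdivlMl// mulr1.
by rewrite mulr_ge0// invr_ge0 ltW.
Qed.

End expectation_calculus.

(** * Convergence in law tested on Gaussian distribution functions *)

Section smooth_convergence.
Context {R : realType} d (T : measurableType d) (P : probability T R).
Implicit Types (X Y : nat -> T -> R).

(* Tested against the Gaussian distribution functions, whose heat flow is
   explicit: [E Phi ((a - N(0, v)) / s) = Phi (a / sqrt (v + s^2))]. *)
Definition smooth_cvg X (v : R) := forall a s : R, 0 < s ->
  expect P (fun w => Phi ((a - X n w) / s)) @[n --> \oo] --> Phi (a / Num.sqrt (v + s ^+ 2)).

Definition cvg0_in_probability X := forall e : R, 0 < e ->
  fine (P [set w | e <= `|X n w|]) @[n --> \oo] --> (0 : R).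

Lemma measurable_Phi_test X n a s : measurable_fun setT (X n) ->
  measurable_fun setT (fun w => Phi ((a - X n w) / s)).
Proof.
move=> mX; apply: measurableT_comp measurable_Phi _.
by apply: measurable_funM => //; exact: measurable_funB.
Qed.

Lemma integ_Phi_test X n a s : measurable_fun setT (X n) ->
  P.-integrable setT (EFin \o (fun w => Phi ((a - X n w) / s))).
Proof.
move=> mX; apply: (@bounded_integrable _ _ _ _ _ 1); first exact: measurable_Phi_test.
by move=> w; have /andP[? ?] := Phi_01 ((a - X n w) / s); rewrite ger0_norm.
Qed.

(** The test function decreases in [X n], so its value at [x] separates [X n <= x] from the
    complement. The lower error is small when [b] lies many multiples of [s] to the left of [x], the
    upper one when it lies far to the right. *)
Lemma cdf_sandwich X n x b s : measurable_fun setT (X n) -> 0 < s ->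
  expect P (fun w => Phi ((b - X n w) / s)) - Phi ((b - x) / s) <= fine (P [set w | X n w <= x]) /\
  fine (P [set w | X n w <= x]) <= expect P (fun w => Phi ((b - X n w) / s)) + (1 - Phi ((b - x) / s)).
Proof.
move=> mX s0; have mA : measurable [set w | X n w <= x].
  rewrite -[X in measurable X]setTI.
  have : measurable_fun setT (fun w => X n w <= x) by exact: measurable_fun_ler.
  by move/(_ measurableT [set true]); rewrite setTI; apply.
have Pi := integ_Phi_test b s mX.
rewrite -expect_indic// -[Phi ((b - x) / s)](expect_cst P) -[X in _ + (X - _)](expect_cst P).
rewrite -!expectB; [|exact: integ_cst|exact: integ_cst|exact: Pi|exact: integ_cst].
rewrite -expectD; [|exact: Pi|by apply: integB; exact: integ_cst].
have mono w : (X n w <= x -> Phi ((b - x) / s) <= Phi ((b - X n w) / s)) /\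
    (x < X n w -> Phi ((b - X n w) / s) <= Phi ((b - x) / s)).
  by split=> h; apply: Phi_nondecreasing; rewrite ler_pM2r ?invr_gt0//; lra.
split; apply: expect_le.
- by apply: integB => //; exact: integ_cst.
- exact: integ_indic.
- move=> w; rewrite indicE; have /andP[h1 h2] := Phi_01 ((b - X n w) / s).
  have /andP[h3 h4] := Phi_01 ((b - x) / s); have [m1 m2] := mono w.
  case: (boolP (_ \in _)) => [/set_mem/=h|/negP h]; first lra.
  have : x < X n w by rewrite ltNge; apply/negP => h'; apply/h/mem_set.
  by move/m2; rewrite /=; lra.
- exact: integ_indic.
- by apply: integD => //; apply: integB; exact: integ_cst.
- move=> w; rewrite indicE; have /andP[h1 h2] := Phi_01 ((b - X n w) / s).
  have /andP[h3 h4] := Phi_01 ((b - x) / s); have [m1 m2] := mono w.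
  case: (boolP (_ \in _)) => [/set_mem/=/m1 h|/negP h] /=; lra.
Qed.

Lemma Phi_tail (e : R) : 0 < e ->
  exists2 A : R, 0 < A & forall y, A <= y -> 1 - e <= Phi y /\ Phi (- y) <= e.
Proof.
move=> e0.
have /cvgrPdist_le/(_ _ e0)[A [_ HA]] := @cvg_Phiy R.
have /cvgrPdist_le/(_ _ e0)[B [_ HB]] := @cvg_PhiNy R.
exists (`|A| + `|B| + 1) => [|y Ay]; first by rewrite ltr_wpDl// addr_ge0.
have A0 := normr_ge0 A; have B0 := normr_ge0 B.
have hA : A < y by apply: le_lt_trans (ler_norm A) _; lra.
have hB : - y < B by have := ler_norm (- B); rewrite normrN; lra.
by split; [have := HA _ hA|have := HB _ hB]; rewrite ler_norml; lra.
Qed.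

(** The shift is [t] and the smoothing scale is [t^2]. The shift vanishes, so the Gaussian limit
    stays close to the limiting distribution function [L], while their ratio [1 / t] diverges, which
    makes the errors of [cdf_sandwich] small. For [v = 0] the function [L] is a step, hence the
    exclusion of [x = 0]. *)
Lemma Phi_test_limit (v x : R) : 0 <= v -> v != 0 \/ x != 0 -> forall e : R, 0 < e ->
  let L := if v == 0 then (0 <= x)%R%:R else Phi (x / Num.sqrt v) in
  \forall t \near 0^'+, L - e <= Phi ((x - t) / Num.sqrt (v + (t ^+ 2) ^+ 2)) /\
    Phi ((x + t) / Num.sqrt (v + (t ^+ 2) ^+ 2)) <= L + e.
Proof.
move=> v0 vx e e0; have [v_eq0|v_neq0] /= := eqVneq v 0; last first.
  have cont (f : R -> R) : continuous f -> f 0 = x ->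
      Phi (f t / Num.sqrt (v + (t ^+ 2) ^+ 2)) @[t --> 0^'+] --> Phi (x / Num.sqrt v).
    move=> cf f0; apply: cvg_at_right_filter.
    have <- : f 0 / Num.sqrt (v + ((0 : R) ^+ 2) ^+ 2) = x / Num.sqrt v.
      by rewrite f0 !expr0n addr0.
    apply: (@cvg_comp _ _ _ (fun t => f t / Num.sqrt (v + (t ^+ 2) ^+ 2)) Phi); last exact: continuous_Phi.
    apply: cvgM; first exact: cf.
    apply: cvgV; first by rewrite !expr0n addr0 sqrtr_eq0 -ltNge lt_def v_neq0.
    apply: (@cvg_comp _ _ _ (fun t => v + (t ^+ 2) ^+ 2) Num.sqrt); last exact: sqrt_continuous.
    apply: cvgD; first exact: cvg_cst.
    by apply: (cvg_comp (fun t : R => t ^+ 2) (fun t => t ^+ 2)); exact: sqr_continuous.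
  have c1 : Phi ((x - t) / Num.sqrt (v + (t ^+ 2) ^+ 2)) @[t --> 0^'+] --> Phi (x / Num.sqrt v).
    apply: (cont (fun t => x - t)); last by rewrite subr0.
    by move=> t; apply: cvgB; [exact: cvg_cst|exact: cvg_id].
  have c2 : Phi ((x + t) / Num.sqrt (v + (t ^+ 2) ^+ 2)) @[t --> 0^'+] --> Phi (x / Num.sqrt v).
    apply: (cont (fun t => x + t)); last by rewrite addr0.
    by move=> t; apply: cvgD; [exact: cvg_cst|exact: cvg_id].
  move/cvgrPdist_le/(_ _ e0) : c1 => h1; move/cvgrPdist_le/(_ _ e0) : c2 => h2.
  near=> t.
  have : `|Phi (x / Num.sqrt v) - Phi ((x - t) / Num.sqrt (v + (t ^+ 2) ^+ 2))| <= e by near: t.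
  have : `|Phi (x / Num.sqrt v) - Phi ((x + t) / Num.sqrt (v + (t ^+ 2) ^+ 2))| <= e by near: t.
  by rewrite !ler_norml; lra.
have x0 : x != 0 by case: vx => //; rewrite v_eq0 eqxx.
have sq (t : R) : Num.sqrt (v + (t ^+ 2) ^+ 2) = t ^+ 2.
  by rewrite v_eq0 add0r sqrtr_sqr ger0_norm// sqr_ge0.
have P01 y := Phi_01 (y : R).
have [xpos|xneg|xz] := ltgtP 0 x; last by rewrite -xz eqxx in x0.
  have [A A0 HA] := Phi_tail e0.
  near=> t; have t0 : 0 < t by near: t; exact: nbhs_right_gt.
  rewrite sq; split => /=; last by have /andP[] := P01 ((x + t) / t ^+ 2); lra.
  apply: (HA _ _).1; rewrite ler_pdivlMr ?exprn_gt0//.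
  (* The three constraints on [t] give [A t^2 <= A t <= x / 2 <= x - t], so that the argument of
     [Phi] is at least [A]. *)
  have t1 : t <= 1 by near: t; exact: nbhs_right_le.
  have t2 : t <= x / 2 by near: t; apply: nbhs_right_le; rewrite divr_gt0.
  have : t <= (x / 2) / A by near: t; apply: nbhs_right_le; rewrite !divr_gt0.
  rewrite ler_pdivlMr// => t3.
  have : A * t ^+ 2 <= A * t by rewrite ler_pM2l// expr2 ler_piMl// ltW.
  lra.
have [A A0 HA] := Phi_tail e0.
near=> t; have t0 : 0 < t by near: t; exact: nbhs_right_gt.
rewrite sq; split => /=; first by have /andP[] := P01 ((x - t) / t ^+ 2); lra.
rewrite add0r -[X in Phi X]opprK; apply: (HA _ _).2.
rewrite lerNr ler_pdivrMr ?exprn_gt0//.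
have t1 : t <= 1 by near: t; exact: nbhs_right_le.
have t2 : t <= - x / 2 by near: t; apply: nbhs_right_le; rewrite divr_gt0// oppr_gt0.
have : t <= (- x / 2) / A by near: t; apply: nbhs_right_le; rewrite !divr_gt0// oppr_gt0.
rewrite ler_pdivlMr// => t3.
have : A * t ^+ 2 <= A * t by rewrite ler_pM2l// expr2 ler_piMl// ltW.
lra.
Unshelve. all: by end_near. Qed.

Lemma measurable_le_set (f : T -> R) x : measurable_fun setT f ->
  measurable [set w | f w <= x].
Proof.
move=> mf; rewrite -[X in measurable X]setTI.
have : measurable_fun setT (fun w => f w <= x) by exact: measurable_fun_ler.
by move/(_ measurableT [set true]); rewrite setTI; apply.
Qed.

Lemma cvg_distribution_of_smooth X v : 0 <= v -> (forall n, measurable_fun setT (X n)) ->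
  smooth_cvg X v -> cvg_in_distribution P X (centered_normal v).
Proof.
move=> v0 mX Xv; split=> // x cx.
(* For [v = 0] the limit is the point mass at 0. Its distribution function has left limit 0 and
   value 1 at 0, so a continuity point cannot be 0. *)
have vx : v != 0 \/ x != 0.
  have [v_eq0|?] := eqVneq v 0; last by left.
  right; apply/eqP => x0; move: cx; rewrite x0 /centered_normal v_eq0 eqxx => c0.
  set D := (fun y : R => _) in c0.
  have h1 : D y @[y --> (0:R)^'-] --> D 0 by exact: cvg_at_left_filter c0.
  have h2 : D y @[y --> (0:R)^'-] --> (0%E : \bar R).
    apply: cvg_near_cst; near=> y.
    rewrite /D /= diracE memNset//= in_itv/= => h.
    have : y < 0 by near: y; exact: nbhs_left_lt.
    by rewrite ltNge h.
  have D0 : D 0 = 0%E := cvg_unique (@ereal_hausdorff R) h1 h2.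
  have : D 0 = 1%E by rewrite /D /= diracE mem_set//= in_itv/=.
  by rewrite D0 => /esym/eqP; rewrite onee_eq0.
pose L := if v == 0 then (0 <= x)%R%:R else Phi (x / Num.sqrt v).
have -> : centered_normal v `]-oo, x]%classic = L%:E.
  rewrite /centered_normal /L; case: eqP => [_|/eqP v_neq0] /=.
    rewrite diracE; case: leP => h.
      by rewrite mem_set//= in_itv.
    by rewrite memNset//= in_itv/= leNgt h.
  by rewrite normal_prob_cdf// sqrtr_gt0 lt_def v_neq0.
suff : fine (P [set w | X n w <= x]) @[n --> \oo] --> L.
  move=> h; apply: cvg_EFin => //; near=> n.
  by rewrite fin_num_measure//; exact: measurable_le_set.
apply/cvgrPdist_le => e e0; have e30 : 0 < e / 3 by rewrite divr_gt0.
have Lt := Phi_test_limit v0 vx e30.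
have [t [t0 [t1 t2] [t3 t4]]] : exists t : R, [/\ 0 < t,
   L - e / 3 <= Phi ((x - t) / Num.sqrt (v + (t ^+ 2) ^+ 2)) /\
   Phi ((x + t) / Num.sqrt (v + (t ^+ 2) ^+ 2)) <= L + e / 3 &
   Phi (- t / t ^+ 2) <= e / 3 /\ 1 - Phi (t / t ^+ 2) <= e / 3].
  have [A A0 HA] := Phi_tail e30.
  near (0 : R)^'+ => t; have t0 : 0 < t by near: t; exact: nbhs_right_gt.
  exists t; split => //; first by near: t.
  rewrite expr2 invfM mulNr mulrA mulfV ?gt_eqF// mul1r.
  have tA : A <= t^-1.
    rewrite -[A]invrK lef_pV2 ?posrE ?invr_gt0//.
    by near: t; apply: nbhs_right_le; rewrite invr_gt0.
  by have [] := HA _ tA; lra.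
have s0 : 0 < t ^+ 2 by rewrite exprn_gt0.
have /cvgrPdist_le/(_ _ e30) n1 := Xv (x - t) _ s0.
have /cvgrPdist_le/(_ _ e30) n2 := Xv (x + t) _ s0.
near=> n.
have [h1 _] := cdf_sandwich x (x - t) (mX n) s0.
have [_ h2] := cdf_sandwich x (x + t) (mX n) s0.
rewrite (_ : x - t - x = - t) in h1; last by ring.
rewrite (_ : x + t - x = t) in h2; last by ring.
have : `|Phi ((x - t) / Num.sqrt (v + (t ^+ 2) ^+ 2)) - expect P (fun w => Phi ((x - t - X n w) / t ^+ 2))| <= e / 3 by near: n.
have : `|Phi ((x + t) / Num.sqrt (v + (t ^+ 2) ^+ 2)) - expect P (fun w => Phi ((x + t - X n w) / t ^+ 2))| <= e / 3 by near: n.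
by rewrite !ler_norml; lra.
Unshelve. all: by end_near. Qed.

Lemma Phi_strict x y : x < y -> Phi x < Phi y :> R.
Proof.
move=> xy; have [|||z _] := @MVT_segment _ Phi phi x y; first exact: ltW.
- by move=> z _; exact: is_derive_Phi.
- exact/continuous_subspaceT/continuous_Phi.
have := phi_gt0 z; move=> p0 h; rewrite -subr_gt0 h mulr_gt0// subr_gt0//.
Qed.

Lemma Phi_lipschitz : exists2 M : R, 0 <= M & forall x y : R, `|Phi x - Phi y| <= M * `|x - y|.
Proof.
have [B B0 HB] := @phi_moments R; exists B => // x y.
have := @mvt_growth_at _ Phi (fun t => phi (y + t)) y (x - y) B 0 B0.
rewrite expr1 (addrC y) subrK; apply => t _; split; first exact: is_derive_Phi.
by rewrite mulr1 ger0_norm ?phi_ge0//; case: (HB (y + t)).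
Qed.

Lemma cvg0_in_probability_L1 X : (forall n, P.-integrable setT (EFin \o X n)) ->
  expect P (fun w => `|X n w|) @[n --> \oo] --> (0 : R) -> cvg0_in_probability X.
Proof.
move=> Xi X0 e e0; apply/cvgr0Pnorm_le => k k0.
have /cvgr0Pnorm_le/(_ (e * k)) := X0; rewrite mulr_gt0// => /(_ isT).
apply: filterS => n; rewrite ger0_norm; last exact: expect_ge0.
move=> h; rewrite ger0_norm ?fine_prob_ge0//.
by apply: (le_trans (markov_norm e0 (Xi n))); rewrite ler_pdivrMl.
Qed.

Lemma smooth_cvg_perturb X Y v : (forall n, measurable_fun setT (X n)) ->
  (forall n, measurable_fun setT (Y n)) ->
  cvg0_in_probability (fun n w => Y n w - X n w) -> smooth_cvg X v -> smooth_cvg Y v.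
Proof.
move=> mX mY XY Xv a s s0.
have [M M0 lipM] := Phi_lipschitz.
have diff0 : expect P (fun w => Phi ((a - Y n w) / s)) - expect P (fun w => Phi ((a - X n w) / s)) @[n --> \oo] --> (0 : R).
  apply/cvgr0Pnorm_le => e e0.
  (* Where the two sequences differ by less than [k], the Lipschitz bound costs at most [e / 2];
     elsewhere the test functions differ by at most 1. Dividing by [M + 1] covers the case
     [M = 0]. *)
  have [k k0 ke] : exists2 k : R, 0 < k & M * (k / s) <= e / 2.
    exists (e * s / (2 * (M + 1))).
      by rewrite divr_gt0// ?mulr_gt0// ltr_wpDl.
    have M1 : 0 < M + 1 by rewrite ltr_wpDl.
    rewrite (_ : M * _ = (M / (M + 1)) * (e / 2)); last by field; rewrite !gt_eqF.
    by rewrite ler_piMl ?divr_ge0 ?(ltW e0)// ler_pdivrMr// mul1r; lra.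
  have /cvgr0Pnorm_le/(_ (e / 2)) := XY k k0; rewrite divr_gt0// => /(_ isT).
  apply: filterS => n; rewrite ger0_norm ?fine_prob_ge0// => Pn.
  have mA : measurable [set w | k <= `|Y n w - X n w|].
    by apply: measurable_norm_ge; exact: measurable_funB.
  have iX := @integ_Phi_test X n a s (mX n); have iY := @integ_Phi_test Y n a s (mY n).
  rewrite -expectB//.
  apply: (le_trans (ler_norm_expect _)); first exact: integB.
  apply: (@le_trans _ _ (e / 2 + fine (P [set w | k <= `|Y n w - X n w|]))); last by lra.
  rewrite -[e / 2](expect_cst P) -expect_indic// -expectD; [|exact: integ_cst|exact: integ_indic].
  apply: expect_le.
  - exact/integ_norm/integB.
  - by apply: integD; [exact: integ_cst|exact: integ_indic].
  move=> w; rewrite indicE; case: (boolP (_ \in _)) => [/set_mem/=h|/negP h] /=.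
    have /andP[? ?] := Phi_01 ((a - X n w) / s); have /andP[? ?] := Phi_01 ((a - Y n w) / s).
    rewrite ler_norml; lra.
  have {}h : `|Y n w - X n w| < k by rewrite ltNge; apply/negP => h'; apply/h/mem_set.
  rewrite addr0; apply: (le_trans (lipM _ _)); apply: le_trans ke; rewrite ler_wpM2l//.
  rewrite -mulrBl normrM (gtr0_norm (x := s^-1)) ?invr_gt0// ler_pM2r ?invr_gt0//.
  by rewrite opprB addrC addrA subrK distrC ltW.
exact: (cvg_sub0 diff0 (Xv a s s0)).
Qed.

Lemma smooth_cvg_scale X v b : 0 < b -> smooth_cvg X v ->
  smooth_cvg (fun n w => X n w / b) (v / b ^+ 2).
Proof.
move=> b0 Xv a s s0.
(* Testing [X / b] at level [a] and scale [s] is the same as testing [X] at [a b] and [s b]. *)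
have := Xv (a * b) (s * b) (mulr_gt0 s0 b0).
rewrite (_ : a * b / _ = a / Num.sqrt (v / b ^+ 2 + s ^+ 2)).
  apply: cvg_trans; apply: near_eq_cvg; near=> n; congr expect; apply/funext => w.
  by congr Phi; field; rewrite !gt_eqF.
rewrite (_ : v + _ = (v / b ^+ 2 + s ^+ 2) * b ^+ 2); last by field; rewrite gt_eqF.
rewrite (mulrC _ (b ^+ 2)) sqrtrM ?sqr_ge0// sqrtr_sqr gtr0_norm// invfM.
by rewrite mulrA mulfK ?gt_eqF.
Unshelve. all: by end_near. Qed.

(** When [|X n|] reaches [L], either the test function at level [-L] is at least [Phi 0], or the one
    at level [L] is at most [Phi 0]. Hence [min (Phi 0) (1 - Phi 0)] times the tail probability is
    bounded by two expectations whose limits are Gaussian tails. Each is at most [2 k]: one [k] for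
    the tail and one for the convergence, which explains the factor [e / 4] in [k]. *)
Lemma smooth_cvg_tight X v : 0 <= v -> (forall n, measurable_fun setT (X n)) -> smooth_cvg X v ->
  forall e : R, 0 < e -> exists2 L : R, 0 < L &
   \forall n \near \oo, fine (P [set w | L <= `|X n w|]) <= e.
Proof.
move=> v0 mX Xv e e0.
set r := Num.sqrt (v + 1 ^+ 2); have r0 : 0 < r by rewrite sqrtr_gt0 expr1n ltr_wpDl.
have p0 : 0 < Phi (0 : R) by exact: Phi_gt0.
have q0 : 0 < 1 - Phi (0 : R).
  by rewrite subr_gt0; apply: (lt_le_trans (Phi_strict ltr01)); case/andP: (Phi_01 (1 : R)).
pose k := Num.min (Phi 0) (1 - Phi 0) * (e / 4).
have k0 : 0 < k by rewrite mulr_gt0// ?lt_min ?p0// divr_gt0.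
have [A A0 HA] := Phi_tail k0.
pose L := A * r; have L0 : 0 < L by rewrite mulr_gt0.
have [HL1 HL2] := HA _ (lexx A).
have Lr : L / r = A by rewrite mulfK ?gt_eqF.
exists L => //.
have := Xv (- L) 1 ltr01; have := Xv L 1 ltr01; rewrite -/r.
move=> /cvgrPdist_le/(_ _ k0) n1 /cvgrPdist_le/(_ _ k0) n2.
near=> n.
have h1 : expect P (fun w => Phi ((- L - X n w) / 1)) <= 2 * k.
  rewrite -Lr -mulNr in HL2; have : `|Phi (- L / r) - expect P (fun w => Phi ((- L - X n w) / 1))| <= k by near: n.
  by rewrite ler_norml; lra.
have h2 : 1 - expect P (fun w => Phi ((L - X n w) / 1)) <= 2 * k.
  rewrite -Lr in HL1; have : `|Phi (L / r) - expect P (fun w => Phi ((L - X n w) / 1))| <= k by near: n.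
  by rewrite ler_norml; lra.
have i1 := @integ_Phi_test X n (- L) 1 (mX n); have i2 := @integ_Phi_test X n L 1 (mX n).
have mm := measurable_norm_ge L (mX n).
pose mn := Num.min (Phi (0 : R)) (1 - Phi (0 : R)).
have mn0 : 0 < mn by rewrite lt_min p0.
have : mn * fine (P [set w | L <= `|X n w|]) <= 4 * k.
  rewrite -expect_indic// -expectZ; last exact: integ_indic.
  apply: (@le_trans _ _ (expect P (fun w => Phi ((- L - X n w) / 1) + (1 - Phi ((L - X n w) / 1))))).
    apply: expect_le.
    - exact/integZ/integ_indic.
    - by apply: integD => //; apply: integB => //; exact: integ_cst.
    move=> w; rewrite indicE !divr1.
    have /andP[? ?] := Phi_01 (- L - X n w); have /andP[? ?] := Phi_01 (L - X n w).
    have mn1 : mn <= Phi 0 by rewrite /mn ge_min lexx.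
    have mn2 : mn <= 1 - Phi 0 by rewrite /mn ge_min lexx orbT.
    case: (boolP (_ \in _)) => [/set_mem/=|_] /=; last by rewrite mulr0; lra.
    rewrite leNgt ltr_norml negb_and -!leNgt mulr1 => /orP[] h.
      have : Phi 0 <= Phi (- L - X n w) by apply: Phi_nondecreasing; rewrite subr_ge0.
      move=> h3; apply: (le_trans mn1); apply: (le_trans h3).
      by rewrite lerDl subr_ge0.
    have : Phi (L - X n w) <= Phi 0 by apply: Phi_nondecreasing; rewrite subr_le0.
    move=> h3; apply: (le_trans mn2); apply: (@le_trans _ _ (1 - Phi (L - X n w))).
      by rewrite lerD2l lerN2.
    by rewrite lerDr.
  rewrite expectD//; last by apply: integB => //; exact: integ_cst.
  by rewrite expectB// ?expect_cst; [lra|exact: integ_cst].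
rewrite /k -/mn (_ : 4 * _ = mn * e); last by field.
by rewrite ler_pM2l.
Unshelve. all: by end_near. Qed.

Lemma cvg0_in_probability_tightM X (r : nat -> R) v : 0 <= v ->
  (forall n, measurable_fun setT (X n)) -> smooth_cvg X v ->
  r n @[n --> \oo] --> (0 : R) -> cvg0_in_probability (fun n w => r n * X n w).
Proof.
move=> v0 mX Xv r0 e e0; apply/cvgr0Pnorm_le => k k0.
have [L L0 HL] := smooth_cvg_tight v0 mX Xv k0.
have /cvgr0Pnorm_le/(_ (e / L)) := r0; rewrite divr_gt0// => /(_ isT) nr.
near=> n; rewrite ger0_norm ?fine_prob_ge0//.
apply: (@le_trans _ _ (fine (P [set w | L <= `|X n w|]))); last by near: n.
apply: fine_prob_le; [|exact: measurable_norm_ge|].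
  by apply: measurable_norm_ge; exact: measurable_funM.
move=> w /=; rewrite normrM => h.
have rn : `|r n| <= e / L by near: n.
have : e <= e / L * `|X n w| by apply: le_trans h _; rewrite ler_wpM2r.
by rewrite mulrAC ler_pdivlMr// ler_pM2l.
Unshelve. all: by end_near. Qed.

Lemma smooth_cvg_ratio X (F : nat -> T -> R) v b : 0 <= v -> 0 < b ->
  (forall n, measurable_fun setT (X n)) -> (forall n, measurable_fun setT (F n)) ->
  smooth_cvg X v -> cvg0_in_probability (fun n w => F n w - b) ->
  smooth_cvg (fun n w => X n w / F n w) (v / b ^+ 2).
Proof.
move=> v0 b0 mX mF Xv Fb.
have mXF n : measurable_fun setT (fun w => X n w / F n w).
  by apply: measurable_funM => //; exact: measurable_fun_inv.
have mXb n : measurable_fun setT (fun w => X n w / b) by apply: measurable_funM.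
apply: (smooth_cvg_perturb mXb mXF _ (smooth_cvg_scale b0 Xv)).
move=> e e0; apply/cvgr0Pnorm_le => k k0; have k20 : 0 < k / 2 by rewrite divr_gt0.
have [L L0 HL] := smooth_cvg_tight v0 mX Xv k20.
(* The first bound keeps [F n w] above [b / 2]. With [|X n w| < L] the second one makes
   [|X n w| |F n w - b|] smaller than [e b^2 / 2], hence smaller than [e] times the denominator
   [F n w * b]. *)
pose t := Num.min (b / 2) (e * b ^+ 2 / (2 * L)).
have t0 : 0 < t by rewrite lt_min !divr_gt0// ?mulr_gt0// exprn_gt0.
have /cvgr0Pnorm_le/(_ _ k20) nF := Fb t t0.
near=> n; rewrite ger0_norm ?fine_prob_ge0//.
apply: (@le_trans _ _ (fine (P [set w | L <= `|X n w|]) + fine (P [set w | t <= `|F n w - b|]))); last first.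
  have h1 : fine (P [set w | L <= `|X n w|]) <= k / 2 by near: n.
  have h2 : `|fine (P [set w | t <= `|F n w - b|])| <= k / 2 by near: n.
  by rewrite ger0_norm ?fine_prob_ge0// in h2; lra.
apply: fine_prob_leU.
- by apply: measurable_norm_ge; exact: measurable_funB.
- exact: measurable_norm_ge.
- by apply: measurable_norm_ge; exact: measurable_funB.
move=> w /= h; apply: contrapT => /not_orP[/negP]; rewrite -ltNge => hX /negP; rewrite -ltNge => hF.
have hF1 : `|F n w - b| < b / 2 by apply: lt_le_trans hF _; rewrite ge_min lexx.
have hF2 : `|F n w - b| < e * b ^+ 2 / (2 * L) by apply: lt_le_trans hF _; rewrite ge_min lexx orbT.
have F0 : b / 2 < F n w by move: hF1; rewrite ltr_norml; lra.
have F00 : 0 < F n w by apply: lt_trans F0; rewrite divr_gt0.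
have E : X n w / F n w - X n w / b = X n w * (b - F n w) / (F n w * b).
  by field; rewrite !gt_eqF.
move: h; rewrite E normrM normfV normrM (gtr0_norm (x := F n w * b)) ?mulr_gt0//.
rewrite ler_pdivlMr ?mulr_gt0// leNgt => /negP; apply.
apply: (@lt_le_trans _ _ (L * (e * b ^+ 2 / (2 * L)))).
  by rewrite distrC ltr_pM.
rewrite (_ : L * _ = e * (b / 2 * b)); last by field; rewrite gt_eqF.
by rewrite ler_pM2l// ler_pM2r// ltW.
Unshelve. all: by end_near. Qed.

End smooth_convergence.

(** * Central limit theorem for martingale arrays *)

Section array_clt.
Context {R : realType} d (T : measurableType d) (P : probability T R).
Variables (D q : nat -> nat -> T -> R) (V C : R).

Notation integ f := (P.-integrable setT (EFin \o f)).

Definition psum (X : nat -> nat -> T -> R) n k w := \sum_(j < k) X n j w.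

Hypotheses (V0 : 0 <= V) (C0 : 0 <= C).
Hypothesis mD : forall n k, measurable_fun setT (D n k).
Hypothesis mq : forall n k, measurable_fun setT (q n k).
Hypothesis q_bound : forall n k w, 0 <= q n k w <= C / n%:R.
Hypothesis D_L2 : forall n k, integ (fun w => D n k w ^+ 2).
(** The martingale property and the conditional variance in weak form. The tests involve the clock
    through index [k], since [q n k] is known before [D n k], but the partial sum only over indices
    below [k]. No filtration has to be named. *)
Hypothesis D_mart : forall n k (g : R * R -> R) (M : R), (k < n)%N -> measurable_fun setT g ->
  (forall z, `|g z| <= M) ->
  expect P (fun w => g (psum q n k.+1 w, psum D n k w) * D n k w) = 0 /\
  expect P (fun w => g (psum q n k.+1 w, psum D n k w) * D n k w ^+ 2) =
  expect P (fun w => g (psum q n k.+1 w, psum D n k w) * q n k w).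
Hypothesis q_cvg : expect P (fun w => `|psum q n n w - V|) @[n --> \oo] --> (0 : R).
Hypothesis D_lindeberg :
  \sum_(k < n) expect P (fun w => Num.min (D n k w ^+ 2) (`|D n k w| ^+ 3)) @[n --> \oo] --> (0 : R).

Lemma measurable_psum (X : nat -> nat -> T -> R) n k : (forall n k, measurable_fun setT (X n k)) ->
  measurable_fun setT (psum X n k).
Proof. by move=> mX; apply: measurable_sum => j; exact: mX. Qed.

Variables (a s : R).
Hypothesis s0 : 0 < s.

Let S n k w := psum D n k w.
Let v n k w := psum q n k w.
(** The variance still to come. The floor [s^2] makes the Taylor constants uniform in [n] and [k];
    the truncation at 0 is there because the random clock may overshoot [V]. *)
Let c n k w := s ^+ 2 + Num.max (V - v n k w) 0.
Let U n k w := smooth_cdf a (c n k w) (S n k w).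

Let s20 : 0 < s ^+ 2. Proof. by rewrite exprn_gt0. Qed.

Let mv n k : measurable_fun setT (v n k). Proof. exact: measurable_psum. Qed.
Let mS n k : measurable_fun setT (S n k). Proof. exact: measurable_psum. Qed.

Let mc n k : measurable_fun setT (c n k).
Proof.
apply: measurable_funD => //; apply: measurable_maxr => //.
exact: measurable_funB.
Qed.

Let c_ge n k w : s ^+ 2 <= c n k w.
Proof. by rewrite /c lerDl le_max lexx orbT. Qed.

Let vS n k w : v n k.+1 w = v n k w + q n k w.
Proof. by rewrite /v /psum big_ord_recr. Qed.

Let SS n k w : S n k.+1 w = S n k w + D n k w.
Proof. by rewrite /S /psum big_ord_recr. Qed.

Let c_step n k w : 0 <= c n k w - c n k.+1 w <= q n k w.
Proof.
rewrite /c vS; have /andP[q0 _] := q_bound n k w.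
by case: (lerP (V - v n k w) 0) => h1; case: (lerP (V - (v n k w + q n k w)) 0) => h2; apply/andP; split; lra.
Qed.

Let D_L1 n k : integ (D n k).
Proof.
apply: (@integ_dom _ _ _ _ _ (fun w => 1 + D n k w ^+ 2)) => //.
  move=> w; rewrite -[D n k w ^+ 2]ger0_norm ?sqr_ge0// normrX.
  by have := sqr_ge0 (`|D n k w| - 1/2); have := normr_ge0 (D n k w); nra.
by apply: integD; [exact: integ_cst|exact: D_L2].
Qed.

Let U01 n k w : `|U n k w| <= 1.
Proof. by have /andP[? ?] := Phi_01 ((a - S n k w) / Num.sqrt (c n k w)); rewrite /U /smooth_cdf ger0_norm. Qed.

Let mU n k : measurable_fun setT (U n k).
Proof. exact: measurable_smooth_cdf. Qed.

Let iU n k : integ (U n k).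
Proof. exact: (bounded_integrable P (mU n k) (U01 n k)). Qed.

Let qi n k : integ (q n k).
Proof.
apply: (@bounded_integrable _ _ _ _ _ (C / n%:R)) => // w.
by have /andP[h1 h2] := q_bound n k w; rewrite ger0_norm.
Qed.

Let ci n k : integ (c n k).
Proof.
apply: (@bounded_integrable _ _ _ _ _ (s ^+ 2 + V)) => // w.
rewrite ger0_norm; last by apply: le_trans (c_ge n k w); rewrite sqr_ge0.
rewrite /c lerD2l ge_max V0 andbT lerBlDr lerDl /v /psum sumr_ge0// => j _.
by case/andP: (q_bound n j w).
Qed.

Let mini n k : integ (fun w => Num.min (D n k w ^+ 2) (`|D n k w| ^+ 3)).
Proof.
apply: (@integ_dom _ _ _ _ _ (fun w => D n k w ^+ 2)) => //.
  apply: measurable_minr; first exact: measurable_funX.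
  by apply: measurable_funX; exact: measurableT_comp.
move=> w; rewrite ger0_norm ?ge_min ?lexx// le_min sqr_ge0 exprn_ge0//.
Qed.

(** Both functions are expanded about [S n k] and the variance [c n k.+1]. As that variance is known
    before [D n k], [D_mart] removes the linear term and turns [D^2] into [q]. By the heat equation,
    the passage from [c n k] to [c n k.+1] contributes half the second derivative times the decrease
    of [c]. What remains is the Taylor remainder, a term of order [(C / n)^2], and [q] minus the
    decrease of [c], which is nonzero only once the clock has passed [V]. *)
Let step (M : R) : 0 <= M ->
  (forall a c x, s ^+ 2 <= c ->
  (forall y, `|smooth_cdf a c (x + y) - smooth_cdf a c x| <= M * `|y| /\
   `|smooth_cdf a c (x + y) - smooth_cdf a c x - smooth_cdf' a c x * y
        - smooth_cdf'' a c x * y ^+ 2 / 2| <= M * Num.min (y ^+ 2) (`|y| ^+ 3)) /\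
  [/\ `|smooth_cdf' a c x| <= M, `|smooth_cdf'' a c x| <= M &
      forall c', c <= c' ->
        `|smooth_cdf a c' x - smooth_cdf a c x| <= M * (c' - c) /\
        `|smooth_cdf a c' x - smooth_cdf a c x - smooth_cdf'' a c x / 2 * (c' - c)| <= M * (c' - c) ^+ 2]) ->
  forall n k, (k < n)%N ->
  `|expect P (U n k.+1) - expect P (U n k)| <=
    M * expect P (fun w => Num.min (D n k w ^+ 2) (`|D n k w| ^+ 3)) + M * (C / n%:R) ^+ 2 +
    M * expect P (fun w => q n k w - (c n k w - c n k.+1 w)).
Proof.
move=> M0 HM n k kn.
pose g1 (z : R * R) := smooth_cdf' a (s ^+ 2 + Num.max (V - z.1) 0) z.2.
pose g2 (z : R * R) := smooth_cdf'' a (s ^+ 2 + Num.max (V - z.1) 0) z.2.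
have mc' : measurable_fun setT (fun z : R * R => s ^+ 2 + Num.max (V - z.1) 0).
  apply: measurable_funD => //; apply: measurable_maxr => //.
  by apply: measurable_funB => //; exact: measurable_fst.
have mg1 : measurable_fun setT g1 by apply: measurable_smooth_cdf' => //; exact: measurable_snd.
have mg2 : measurable_fun setT g2 by apply: measurable_smooth_cdf'' => //; exact: measurable_snd.
have ge' (z : R * R) : s ^+ 2 <= s ^+ 2 + Num.max (V - z.1) 0 by rewrite lerDl le_max lexx orbT.
have bg1 z : `|g1 z| <= M by have [_ []] := HM a _ z.2 (ge' z).
have bg2 z : `|g2 z| <= M by have [_ []] := HM a _ z.2 (ge' z).
have [m1 _] := D_mart kn mg1 bg1; have [_ m2] := D_mart kn mg2 bg2.
pose G1 w := g1 (v n k.+1 w, S n k w); pose G2 w := g2 (v n k.+1 w, S n k w).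
have mz : measurable_fun setT (fun w => (v n k.+1 w, S n k w)) by apply: measurable_fun_pair.
have mG1 : measurable_fun setT G1 by exact: measurableT_comp mg1 mz.
have mG2 : measurable_fun setT G2 by exact: measurableT_comp mg2 mz.
pose dc w := c n k w - c n k.+1 w.
have idc : integ dc by exact: integB.
have i1 : integ (fun w => G1 w * D n k w) by exact: (integM mG1 (fun w => bg1 _) (D_L1 n k)).
have i2 : integ (fun w => G2 w * D n k w ^+ 2) by exact: (integM mG2 (fun w => bg2 _) (D_L2 n k)).
have i3 : integ (fun w => G2 w * dc w) by exact: (integM mG2 (fun w => bg2 _) idc).
have i4 : integ (fun w => G2 w * q n k w) by exact: (integM mG2 (fun w => bg2 _) (qi n k)).
pose L w := G1 w * D n k w + 2^-1 * (G2 w * D n k w ^+ 2) - 2^-1 * (G2 w * dc w).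
have iL1 : integ (fun w => G1 w * D n k w + 2^-1 * (G2 w * D n k w ^+ 2)).
  by apply: integD => //; exact: integZ.
have iL : integ L by apply: integB => //; exact: integZ.
have EL : expect P L = 2^-1 * expect P (fun w => G2 w * (q n k w - dc w)).
  rewrite /L expectB//; last exact: integZ.
  rewrite expectD//; last exact: integZ.
  rewrite m1 add0r !expectZ// m2 -mulrBr; congr (_ * _).
  rewrite -expectB//; by congr expect; apply/funext => w; rewrite [RHS]mulrBr.
have iqdc : integ (fun w => q n k w - dc w) by exact: integB.
have rem w : `|U n k.+1 w - U n k w - L w| <=
    M * Num.min (D n k w ^+ 2) (`|D n k w| ^+ 3) + M * (C / n%:R) ^+ 2.
  have [H1 [_ _ H2]] := HM a (c n k.+1 w) (S n k w) (c_ge n k.+1 w).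
  have [_ h1] := H1 (D n k w).
  have /andP[d0 dq] := c_step n k w.
  have cc : c n k.+1 w <= c n k w by rewrite -subr_ge0.
  have [_ h2] := H2 (c n k w) cc.
  have -> : U n k.+1 w - U n k w - L w =
    (smooth_cdf a (c n k.+1 w) (S n k w + D n k w) - smooth_cdf a (c n k.+1 w) (S n k w) - G1 w * D n k w
     - G2 w * D n k w ^+ 2 / 2) -
    (smooth_cdf a (c n k w) (S n k w) - smooth_cdf a (c n k.+1 w) (S n k w) - G2 w / 2 * dc w).
    by rewrite /L /U SS; field.
  apply: (le_trans (ler_normB _ _)); apply: lerD; first exact: h1.
  apply: (le_trans h2); rewrite ler_wpM2l// lerXn2r ?nnegrE//.
    by rewrite divr_ge0.
  by apply: (le_trans dq); have /andP[] := q_bound n k w.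
have iUU : integ (fun w => U n k.+1 w - U n k w) by exact: integB.
have -> : expect P (U n k.+1) - expect P (U n k) = expect P L + expect P (fun w => U n k.+1 w - U n k w - L w).
  have e1 : expect P (fun w => U n k.+1 w - U n k w) = expect P (U n k.+1) - expect P (U n k).
    exact: expectB.
  have e2 : expect P (fun w => U n k.+1 w - U n k w - L w) = expect P (fun w => U n k.+1 w - U n k w) - expect P L.
    exact: expectB.
  by rewrite e2 e1 [RHS]addrC subrK.
rewrite addrC; apply: (le_trans (ler_normD _ _)); apply: lerD.
  apply: (le_trans (ler_norm_expect _)); first exact: integB.
  rewrite -[X in _ <= _ + X](expect_cst P) -expectZ// -expectD; [|exact: integZ|exact: integ_cst].
  apply: expect_le => //; first exact/integ_norm/integB.
  by apply: integD; [exact: integZ|exact: integ_cst].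
rewrite EL -[leLHS]mul1r; apply: (@le_trans _ _ (expect P (fun w => `|G2 w * (q n k w - dc w)|))).
  have h := ler_norm_expect (integM mG2 (fun w => bg2 _) iqdc).
  rewrite mul1r normrM (gtr0_norm (x := 2^-1))//.
  have := normr_ge0 (expect P (fun w => G2 w * (q n k w - dc w))); move: h.
  lra.
rewrite -expectZ//; apply: expect_le.
- exact/integ_norm/(integM mG2 (fun w => bg2 _) iqdc).
- exact: integZ.
move=> w; rewrite normrM (ger0_norm (x := q n k w - dc w)).
  by rewrite ler_wpM2r ?bg2// subr_ge0; case/andP: (c_step n k w).
by rewrite subr_ge0; case/andP: (c_step n k w).
Qed.

(* Lindeberg's replacement with the predictable clock [v]: along [k], the test function is
   [Phi ((a - S) / sqrt (s^2 + max (V - v) 0))], and by the heat equation the second-order term in [D] is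
   cancelled by the decrease of the variance. *)
Lemma array_clt_test : expect P (fun w => Phi ((a - psum D n n w) / s)) @[n --> \oo] -->
  Phi (a / Num.sqrt (V + s ^+ 2)).
Proof.
have [M M0 HM] := smooth_cdf_taylor s20.
have E0 n : expect P (U n 0) = Phi (a / Num.sqrt (V + s ^+ 2)).
  rewrite (_ : U n 0 = fun=> Phi (a / Num.sqrt (V + s ^+ 2))) ?expect_cst//.
  apply/funext => w; rewrite /U /c /S /v /psum !big_ord0 /smooth_cdf !subr0.
  by rewrite max_l// addrC.
have iend n : integ (fun w => Phi ((a - psum D n n w) / s)) by exact: (@integ_Phi_test _ _ _ P (fun n => psum D n n)).
have ivV n : integ (fun w => psum q n n w - V).
  by apply: integB; [exact: integ_sum|exact: integ_cst].
have Eend n : `|expect P (fun w => Phi ((a - psum D n n w) / s)) - expect P (U n n)| <=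
    M * expect P (fun w => `|psum q n n w - V|).
  rewrite -expectB// -expectZ; last exact: integ_norm.
  apply: (le_trans (ler_norm_expect _)); first exact: integB.
  apply: expect_le; first exact/integ_norm/integB.
    exact/integZ/integ_norm.
  move=> w; have [_ [_ _ /(_ (c n n w) (c_ge n n w))[h _]]] := HM a (s ^+ 2) (S n n w) (lexx _).
  have <- : smooth_cdf a (s ^+ 2) (S n n w) = Phi ((a - psum D n n w) / s).
    by rewrite /smooth_cdf sqrtr_sqr gtr0_norm.
  rewrite distrC; apply: (le_trans h).
  rewrite ler_wpM2l// /c addrC addKr ge_max normr_ge0 andbT distrC; exact: ler_norm.
have Esum n : expect P (U n n) - expect P (U n 0) = \sum_(k < n) (expect P (U n k.+1) - expect P (U n k)).
  by rewrite -(big_mkord xpredT (fun k => expect P (U n k.+1) - expect P (U n k))) telescope_sumr.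
have bnd n : `|expect P (fun w => Phi ((a - psum D n n w) / s)) - Phi (a / Num.sqrt (V + s ^+ 2))| <=
   2 * M * expect P (fun w => `|psum q n n w - V|) +
   M * \sum_(k < n) expect P (fun w => Num.min (D n k w ^+ 2) (`|D n k w| ^+ 3)) + M * C ^+ 2 * n%:R^-1.
  rewrite -(E0 n) -(subrK (expect P (U n n)) (expect P _)) -addrA.
  apply: (le_trans (ler_normD _ _)).
  have h2 : `|expect P (U n n) - expect P (U n 0)| <= M * expect P (fun w => `|psum q n n w - V|) +
     M * \sum_(k < n) expect P (fun w => Num.min (D n k w ^+ 2) (`|D n k w| ^+ 3)) + M * C ^+ 2 * n%:R^-1.
    rewrite Esum; apply: (le_trans (ler_norm_sum _ _ _)).
    apply: (@le_trans _ _ (\sum_(k < n) (M * expect P (fun w => Num.min (D n k w ^+ 2) (`|D n k w| ^+ 3)) + M * (C / n%:R) ^+ 2 +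
    M * expect P (fun w => q n k w - (c n k w - c n k.+1 w))))).
      by apply: ler_sum => k _; exact: step.
    rewrite !big_split/= -!mulr_sumr sumr_const card_ord.
    rewrite -(@expect_sum _ _ _ P _ _ (fun (k : 'I_n) w => q n k w - (c n k w - c n k.+1 w))); last first.
      by move=> k; apply: integB => //; apply: integB.
    rewrite [leLHS]addrC addrA; apply: lerD; last first.
      case: n => [|n]; first by rewrite mulr0n !mulr0 invr0 mulr0.
      by rewrite -mulr_natr le_eqVlt; apply/orP; left; apply/eqP; field.
    rewrite lerD2r ler_wpM2l//; apply: expect_le.
    - by apply: integ_sum => k; apply: integB => //; apply: integB.
    - exact: integ_norm.
    (* The decreases of [c] telescope, and the whole sum equals the overshoot [max (v - V) 0] of the
       final clock value [v]. *)
    move=> w; rewrite big_split/= sumrN.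
    rewrite -(big_mkord xpredT (fun k => c n k w - c n k.+1 w)).
    have -> : \sum_(0 <= k < n) (c n k w - c n k.+1 w) = c n 0 w - c n n w.
      rewrite -[RHS]opprB -(telescope_sumr (fun k => c n k w))// -sumrN.
      by apply: eq_bigr => k _; rewrite opprB.
    have c0E : c n 0 w = s ^+ 2 + V by rewrite /c /v /psum big_ord0 subr0 max_l.
    rewrite c0E /c -/(v n n w) -/(psum q n n w) -/(v n n w).
    have := ler_norm (v n n w - V); have := normr_ge0 (v n n w - V).
    by case: (lerP (V - v n n w) 0); lra.
  apply: (le_trans (lerD (Eend n) h2)).
  by rewrite !addrA !lerD2r -mulrDl -mulr2n mulr_natl.
apply/cvgrPdist_le => e e0; near=> n; rewrite distrC; apply: (le_trans (bnd n)).
near: n.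
have lim0 : 2 * M * expect P (fun w => `|psum q n n w - V|) +
   M * \sum_(k < n) expect P (fun w => Num.min (D n k w ^+ 2) (`|D n k w| ^+ 3)) + M * C ^+ 2 * n%:R^-1
   @[n --> \oo] --> (2 * M * 0 + M * 0 + M * C ^+ 2 * 0 : R).
  apply: cvgD; first apply: cvgD.
  - by apply: cvgM => //; exact: cvg_cst.
  - by apply: cvgM => //; exact: cvg_cst.
  - apply: cvgM; first exact: cvg_cst.
    by rewrite -cvg_shiftS; exact: cvg_harmonic.
move: lim0; rewrite !mulr0 !addr0 => lim0.
move/cvgr0Pnorm_le/(_ _ e0) : lim0; apply: filterS => k.
exact: le_trans (ler_norm _).
Unshelve. all: by end_near. Qed.

End array_clt.

(** * Independent families and the Efron-Stein inequality *)

Section sequence_space.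
Context dE (E : measurableType dE).

Definition coordinate_sets (J : Type) : set (set (J -> E)) :=
  \bigcup_j preimage_set_system setT (fun h : J -> E => h j) measurable.

(** For [J = nat] this is convertible with [history E], so that results on product spaces apply to
    histories. *)
Definition prodspace (J : Type) := g_sigma_algebraType (@coordinate_sets J).

(** Sets depending on one coordinate are not stable under intersection; finite rectangles are, as
    uniqueness of measures requires. *)
Definition cylinders (J : choiceType) : set (set (J -> E)) :=
  [set B | exists s : seq J, exists A : J -> set E,
     [/\ uniq s, forall j, measurable (A j) & B = \bigcap_(j in [set` s]) [set h | A j (h j)]]].

Lemma measurable_coord (J : Type) (j : J) : measurable_fun setT (fun h : prodspace J => h j).
Proof.
move=> _ A mA; rewrite setTI; apply: sub_sigma_algebra; exists j => //.
by exists A => //; rewrite setTI.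
Qed.

Lemma measurable_prodspaceP d (T : measurableType d) (J : Type) (f : T -> prodspace J) :
  (forall j, measurable_fun setT (fun w => f w j)) -> measurable_fun setT f.
Proof.
move=> mf _ Y mY; rewrite setTI.
pose G : set (set (J -> E)) := [set A | measurable (f @^-1` A)].
suff : <<s @coordinate_sets J >> `<=` G by apply.
apply: smallest_sub.
  split; rewrite /G /=.
  - by rewrite preimage_set0.
  - by move=> A mA; rewrite setTD preimage_setC; exact: measurableC.
  - by move=> F mF; rewrite preimage_bigcup; exact: bigcupT_measurable.
move=> _ [j _ [B mB <-]]; rewrite /G /= setTI -comp_preimage -[X in measurable X]setTI.
exact: mf.
Qed.

Lemma measurable_cylinder (J : choiceType) (B : set (J -> E)) : cylinders B ->
  measurable (B : set (prodspace J)).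
Proof.
move=> [s [A [_ mA ->]]].
elim: s => [|i s IH].
  by rewrite (_ : \bigcap_(_ in _) _ = setT)// -subTset => h _ j /=; rewrite in_nil.
rewrite (_ : \bigcap_(_ in _) _ = [set h | A i (h i)] `&` \bigcap_(j in [set` s]) [set h | A j (h j)]).
  apply: measurableI => //.
  by have := measurable_coord i measurableT (mA i); rewrite setTI.
apply/seteqP; split => [h H|h [h1 h2] j /=].
  by split=> [|j /= js]; apply: H => /=; rewrite in_cons ?eqxx ?js ?orbT.
by rewrite in_cons => /orP[/eqP ->//|js]; exact: h2.
Qed.

Lemma prodspace_measurableE (J : choiceType) :
  @measurable _ (prodspace J) = <<s @cylinders J >>.
Proof.
apply/seteqP; split.
  apply: smallest_sub; first exact: smallest_sigma_algebra.
  move=> _ [j _ [B mB <-]]; apply: sub_sigma_algebra.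
  exists [:: j], (fun=> B); split=> //; rewrite setTI.
  by apply/seteqP; split => [h Bh i /=|h /(_ j)]; [rewrite in_cons in_nil orbF => /eqP ->|apply; rewrite /= in_cons eqxx].
apply: smallest_sub; first exact: sigma_algebra_measurable.
move=> B cB; exact: measurable_cylinder.
Qed.

Lemma cylinders_setI (J : choiceType) : setI_closed (@cylinders J).
Proof.
move=> _ _ [s [A [us mA ->]]] [t [B [ut mB ->]]].
exists (undup (s ++ t)), (fun j => (if j \in s then A j else setT) `&` (if j \in t then B j else setT)).
split.
- exact: undup_uniq.
- by move=> j; apply: measurableI; case: ifP.
apply/seteqP; split => [h [h1 h2] j /=|h H].
  by rewrite mem_undup mem_cat => /orP[] js; split; case: ifPn => // j'; (try exact: h1); exact: h2.
split=> j /= js.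
  by have := H j; rewrite /= mem_undup mem_cat js => /(_ isT)[].
by have := H j; rewrite /= mem_undup mem_cat js orbT => /(_ isT)[].
Qed.

Lemma cylinders_setT (J : choiceType) : @cylinders J setT.
Proof.
exists [::], (fun=> setT); split=> //.
by apply/seteqP; split=> // h _ j /=; rewrite in_nil.
Qed.

End sequence_space.

Section image_measure.
Context d1 d2 (T1 : measurableType d1) (T2 : measurableType d2) {R : realType}.
Variables (m : {measure set T1 -> \bar R}) (f : T1 -> T2) (mf : measurable_fun setT f).
Local Open Scope ereal_scope.

(** The measurability proof is an argument of the term so that the canonical measure structure can
    depend on it. *)
Definition image_measure of measurable_fun setT f := fun A => m (f @^-1` A).

Let image0 : image_measure mf set0 = 0.
Proof. by rewrite /image_measure preimage_set0 measure0. Qed.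

Let image_ge0 A : 0 <= image_measure mf A. Proof. exact: measure_ge0. Qed.

Let image_sigma_additive : semi_sigma_additive (image_measure mf).
Proof.
have mpre A : measurable A -> measurable (f @^-1` A).
  by move=> mA; rewrite -[X in measurable X]setTI; exact: mf.
move=> F mF tF mUF; rewrite /image_measure preimage_bigcup.
apply: measure_semi_sigma_additive.
- by move=> n; exact: mpre.
- apply/trivIsetP => /= i j _ _ ij; rewrite -preimage_setI.
  by move/trivIsetP : tF => /(_ _ _ _ _ ij) ->//; rewrite preimage_set0.
- by rewrite -preimage_bigcup; exact: mpre.
Qed.

HB.instance Definition _ := isMeasure.Build _ _ _ (image_measure mf)
  image0 image_ge0 image_sigma_additive.

End image_measure.

(** * Independence, i.i.d. families and their relabellings *)

Section independence.
Context {R : realType} d (Omega : measurableType d) (P : probability Omega R).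

Lemma finite_measure_unique d' (T : measurableType d') (G : set (set T))
    (m1 m2 : {measure set T -> \bar R}) :
  measurable = <<s G >> -> setI_closed G -> G setT -> (m1 setT < +oo)%E ->
  (forall A, G A -> m1 A = m2 A) -> forall A, measurable A -> m1 A = m2 A.
Proof.
move=> mG GI GT m1T m12 A mA.
apply: (measure_unique G (fun=> setT)) => //.
by rewrite bigcup_const//; exists 0%N.
Qed.

Definition independent_rv d1 (T1 : measurableType d1) d2 (T2 : measurableType d2)
  (X : Omega -> T1) (Y : Omega -> T2) := forall A B, measurable A -> measurable B ->
  P ((X @^-1` A) `&` (Y @^-1` B)) = (P (X @^-1` A) * P (Y @^-1` B))%E.

Lemma preimage_measurable d' (T : measurableType d') (Z : Omega -> T) A :
  measurable_fun setT Z -> measurable A -> measurable (Z @^-1` A).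
Proof. by move=> mZ mA; rewrite -[X in measurable X]setTI; exact: mZ. Qed.

(* The measures [B |-> P (C, Y in B)] and [B |-> P C * P (Y in B)] agree on a pi-system. *)
Lemma independent_pi_system_r d2 (T2 : measurableType d2) (Y : Omega -> T2)
    (G : set (set T2)) (C : set Omega) : measurable_fun setT Y -> measurable C ->
  measurable = <<s G >> -> setI_closed G -> G setT ->
  (forall B, G B -> P (C `&` Y @^-1` B) = (P C * P (Y @^-1` B))%E) ->
  forall B, measurable B -> P (C `&` Y @^-1` B) = (P C * P (Y @^-1` B))%E.
Proof.
move=> mY mC mG GI GT H B mB.
have PC0 : (0 <= fine (P C))%R by rewrite fine_ge0.
pose m1 : {measure set T2 -> \bar R} := image_measure (mrestr P mC) mY.
pose m2 : {measure set T2 -> \bar R} := image_measure (mscale (NngNum PC0) P) mY.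
have E1 A : m1 A = P (C `&` Y @^-1` A).
  by rewrite /m1 /= /image_measure /mrestr setIC.
have E2 A : m2 A = (P C * P (Y @^-1` A))%E.
  by rewrite /m2 /= /image_measure /mscale /= fineK// fin_num_measure.
rewrite -E1 -E2; apply: (finite_measure_unique mG GI GT _ _ mB).
  by rewrite E1 (le_lt_trans (probability_le1 _ _))// ?ltry//; apply: measurableI => //; exact: preimage_measurable.
by move=> A GA; rewrite E1 E2; exact: H.
Qed.

Lemma independent_pi_system d1 (T1 : measurableType d1) d2 (T2 : measurableType d2)
    (X : Omega -> T1) (Y : Omega -> T2) (G1 : set (set T1)) (G2 : set (set T2)) :
  measurable_fun setT X -> measurable_fun setT Y ->
  measurable = <<s G1 >> -> setI_closed G1 -> G1 setT ->
  measurable = <<s G2 >> -> setI_closed G2 -> G2 setT ->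
  (forall A B, G1 A -> G2 B -> P ((X @^-1` A) `&` (Y @^-1` B)) = (P (X @^-1` A) * P (Y @^-1` B))%E) ->
  independent_rv X Y.
Proof.
move=> mX mY mG1 G1I G1T mG2 G2I G2T H A B mA mB.
have mXA := preimage_measurable mX mA.
apply: (independent_pi_system_r mY mXA mG2 G2I G2T _ mB) => {mB}B GB.
have mB : measurable B by rewrite mG2; exact: sub_sigma_algebra.
rewrite setIC muleC.
apply: (independent_pi_system_r mX (preimage_measurable mY mB) mG1 G1I G1T _ mA) => {mA mXA}A GA.
by rewrite setIC muleC; exact: H.
Qed.

(** Independence identifies the law of the pair with the product of the two laws; Tonelli's theorem
    then applies. *)
Lemma independent_fubini d1 (T1 : measurableType d1) d2 (T2 : measurableType d2)
    (X : Omega -> T1) (Y : Omega -> T2) (f : T1 * T2 -> \bar R) :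
  measurable_fun setT X -> measurable_fun setT Y -> independent_rv X Y ->
  measurable_fun setT f -> (forall z, 0 <= f z)%E ->
  (\int[P]_w f (X w, Y w) = \int[P]_w \int[P]_w' f (X w, Y w'))%E.
Proof.
move=> mX mY XY mf f0.
pose Xm : {mfun Omega >-> T1} := mfun_Sub (mem_set mX).
pose Ym : {mfun Omega >-> T2} := mfun_Sub (mem_set mY).
have mXY : measurable_fun setT (fun w => (X w, Y w)) by exact: measurable_fun_pair.
pose XYm : {mfun Omega >-> (T1 * T2)%type} := mfun_Sub (mem_set mXY).
pose m1 : probability T1 R := distribution P Xm.
pose m2 : probability T2 R := distribution P Ym.
pose m : probability (T1 * T2)%type R := distribution P XYm.
have E A : measurable A -> m A = (m1 \x m2)%E A.
  by move=> mA; apply/esym; apply: product_measure_unique.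
transitivity (\int[m]_z f z)%E.
  by rewrite [RHS]ge0_integral_distribution.
rewrite (eq_measure_integral (m1 \x m2)%E) => [|A mA _]; last exact: E.
rewrite fubini_tonelli1//.
rewrite (_ : (\int[m1]_x _)%E = \int[P]_w (fubini_F m2 f (X w)))%E; last first.
  by rewrite ge0_integral_distribution//; [exact: measurable_fun_fubini_tonelli_F|move=> x; apply: integral_ge0].
apply: eq_integral => w _; rewrite /fubini_F.
rewrite ge0_integral_distribution//.
exact: measurable_fun_pair2.
Qed.

Section iid.
Context dE (E : measurableType dE).

Lemma iid_reindex (I J : choiceType) (a : J -> I) (X : I -> Omega -> E) :
  injective a -> iid P X -> iid P (X \o a).
Proof.
move=> inj_a [mX idX indX]; split => [j|i j A mA|s A us mA]; [exact: mX|exact: idX|].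
(* The test sets are transported along [a]; an index outside its range receives the whole space,
   which constrains nothing. *)
pose A' i := if pselect (exists j, a j == i) is left e then A (xchoose e) else setT.
have A'E j : A' (a j) = A j.
  rewrite /A'; case: pselect => [e|]; last by case; exists j.
  by have /eqP/inj_a -> := xchooseP e.
have mA' i : measurable (A' i) by rewrite /A'; case: pselect.
have := indX (map a s) A' _ mA'; rewrite map_inj_uniq// => /(_ us).
rewrite big_map; under [in RHS]eq_bigr do rewrite A'E; move=> <-; congr (P _).
apply/seteqP; split => [w H _ /= /mapP[j js ->]|w H j /= js].
  by rewrite A'E; exact: H.
by have := H (a j); rewrite /= A'E; apply; exact: map_f.
Qed.

Lemma iid_cylinder (J : choiceType) (X : J -> Omega -> E) (s : seq J) (A : J -> set E) :
  iid P X -> uniq s -> (forall j, measurable (A j)) ->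
  P ((fun w j => X j w) @^-1` (\bigcap_(j in [set` s]) [set h | A j (h j)])) =
  (\big[*%E/1%E]_(j <- s) P (X j @^-1` A j))%E.
Proof. by move=> [_ _ indX] us mA; rewrite -indX// preimage_bigcap. Qed.

Lemma iid_measurable (J : choiceType) (X : J -> Omega -> E) : iid P X ->
  measurable_fun setT ((fun w j => X j w) : Omega -> prodspace E J).
Proof. by case=> mX _ _; apply: measurable_prodspaceP. Qed.

Lemma iid_same_law (J : choiceType) (X Y : J -> Omega -> E) : iid P X -> iid P Y ->
  (forall j A, measurable A -> P (X j @^-1` A) = P (Y j @^-1` A)) ->
  forall B, measurable (B : set (prodspace E J)) ->
  P ((fun w j => X j w) @^-1` B) = P ((fun w j => Y j w) @^-1` B).
Proof.
move=> iX iY XY B mB.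
pose m1 : {measure set (prodspace E J) -> \bar R} := image_measure P (iid_measurable iX).
pose m2 : {measure set (prodspace E J) -> \bar R} := image_measure P (iid_measurable iY).
have := @finite_measure_unique _ (prodspace E J) (@cylinders _ E J) m1 m2 (prodspace_measurableE E J)
  (@cylinders_setI _ E J) (@cylinders_setT _ E J).
apply => //.
  by rewrite /m1 /= /image_measure preimage_setT probability_setT ltry.
move=> _ [s [A [us mA ->]]]; rewrite /m1 /m2 /= /image_measure.
rewrite (iid_cylinder iX us mA) (iid_cylinder iY us mA).
by apply: eq_bigr => j _; exact: XY.
Qed.

(** Stationarity of the histories, the exchange of two copies and the reduction of the dependence
    measure to lag 0 are all instances of this invariance under injective relabelling. *)
Lemma iid_law_reindex (I J : choiceType) (X : I -> Omega -> E) (a b : J -> I) :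
  iid P X -> injective a -> injective b ->
  forall f : prodspace E J -> \bar R, measurable_fun setT f -> (forall h, 0 <= f h)%E ->
  (\int[P]_w f (fun j => X (a j) w) = \int[P]_w f (fun j => X (b j) w))%E.
Proof.
move=> iX ia ib f mf f0.
have iXa := iid_reindex ia iX; have iXb := iid_reindex ib iX.
pose Xm : {mfun Omega >-> prodspace E J} := mfun_Sub (mem_set (iid_measurable iXa)).
pose Ym : {mfun Omega >-> prodspace E J} := mfun_Sub (mem_set (iid_measurable iXb)).
transitivity (\int[distribution P Xm]_h f h)%E; first by rewrite ge0_integral_distribution.
rewrite (eq_measure_integral (distribution P Ym)) => [|A mA _].
  by rewrite ge0_integral_distribution.
rewrite /distribution /pushforward /=; apply: (iid_same_law iXa iXb) => // j B mB.
by case: iX => _ idX _; exact: idX.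
Qed.

Lemma iid_disjoint_independent (I J1 J2 : choiceType) (X : I -> Omega -> E) (a : J1 -> I) (b : J2 -> I) :
  iid P X -> injective a -> injective b -> (forall j1 j2, a j1 != b j2) ->
  independent_rv ((fun w j => X (a j) w) : Omega -> prodspace E J1)
    ((fun w j => X (b j) w) : Omega -> prodspace E J2).
Proof.
move=> iX ia ib ab.
have iXa := iid_reindex ia iX; have iXb := iid_reindex ib iX.
apply: (@independent_pi_system _ (prodspace E J1) _ (prodspace E J2)
  (fun w j => X (a j) w) (fun w j => X (b j) w) (@cylinders _ E J1) (@cylinders _ E J2)
  (iid_measurable iXa) (iid_measurable iXb) (prodspace_measurableE _ _) (@cylinders_setI _ _ _)
  (@cylinders_setT _ _ _) (prodspace_measurableE _ _) (@cylinders_setI _ _ _) (@cylinders_setT _ _ _)).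
move=> _ _ [s [A [us mA ->]]] [t [B [ut mB ->]]].
rewrite (iid_cylinder iXa us mA) (iid_cylinder iXb ut mB).
(* The two injections have disjoint ranges, so they glue to one injection of the disjoint union, and
   a pair of cylinders becomes a single cylinder. *)
have iab : injective (fun j => match j with inl j => a j | inr j => b j end).
  move=> [j|j] [k|k] //; [by move=> /ia ->| | |by move=> /ib ->].
    by move=> /eqP; rewrite (negbTE (ab j k)).
  by move=> /esym/eqP; rewrite (negbTE (ab k j)).
have iXab := iid_reindex iab iX.
have := @iid_cylinder _ _ (map inl s ++ map inr t) (fun j => match j with inl j => A j | inr j => B j end) iXab.
rewrite big_cat/= !big_map/= => <-; last 2 first.
- rewrite cat_uniq !map_inj_uniq ?us ?ut//; [|by move=> ? ? []|by move=> ? ? []].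
  by rewrite andbT; apply/hasPn => _ /mapP[j _ ->]; apply/mapP => -[].
- by case.
congr (P _); apply/seteqP; split => [w [h1 h2] j|w H].
  by rewrite /= mem_cat => /orP[] /mapP[k ks ->] /=; [exact: h1|exact: h2].
split=> j /= js.
  by apply: (H (inl j)); rewrite /= mem_cat map_f.
by apply: (H (inr j)); rewrite /= mem_cat map_f ?orbT.
Qed.

End iid.


Lemma independent_expectM d1 (T1 : measurableType d1) d2 (T2 : measurableType d2)
    (X : Omega -> T1) (Y : Omega -> T2) (f : T1 -> R) (g : T2 -> R) (M : R) :
  measurable_fun setT X -> measurable_fun setT Y -> independent_rv X Y ->
  measurable_fun setT f -> measurable_fun setT g ->
  (forall x, 0 <= f x <= M) -> (forall y, 0 <= g y <= M) ->
  expect P (fun w => f (X w) * g (Y w)) = expect P (f \o X) * expect P (g \o Y).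
Proof.
move=> mX mY XY mf mg f0 g0; rewrite !expectE /Rintegral.
have ig : P.-integrable setT (EFin \o (g \o Y)).
  apply: (@bounded_integrable _ _ _ _ _ M); first exact: measurableT_comp.
  by move=> w /=; case/andP: (g0 (Y w)) => ? ?; rewrite ger0_norm.
have if_ : P.-integrable setT (EFin \o (f \o X)).
  apply: (@bounded_integrable _ _ _ _ _ M); first exact: measurableT_comp.
  by move=> w /=; case/andP: (f0 (X w)) => ? ?; rewrite ger0_norm.
rewrite -fineM; [|exact: integrable_fin_num..]; congr fine.
rewrite (@independent_fubini _ _ _ _ X Y (fun z => (f z.1 * g z.2)%:E))//=.
- under eq_integral => w _.
    rewrite (eq_integral (fun w' => (f (X w))%:E * (g (Y w'))%:E)%E); last by move=> ? _; rewrite EFinM.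
    rewrite integralZl//; over.
  by rewrite -(fineK (integrable_fin_num measurableT ig)) integralZr.
- apply/measurable_EFinP; apply: measurable_funM.
    exact: measurableT_comp mf measurable_fst.
  exact: measurableT_comp mg measurable_snd.
- move=> z; case/andP: (f0 z.1) => ? _; case/andP: (g0 z.2) => ? _.
  by rewrite lee_fin mulr_ge0.
Qed.

End independence.

Lemma cvg0_sum {R : realType} (L : nat) (u : nat -> nat -> R) :
  (forall l, u l n @[n --> \oo] --> (0 : R)) ->
  \sum_(l < L) u l n @[n --> \oo] --> (0 : R).
Proof.
move=> u0; elim: L => [|L IH]; first by under eq_fun do rewrite big_ord0; exact: cvg_cst.
rewrite (_ : (fun n => _) = (fun n => \sum_(l < L) u l n + u L n)); last first.
  by apply/funext => n; rewrite big_ord_recr.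
by have := cvgD IH (u0 L); rewrite addr0; exact.
Qed.

(** * Exchange of coordinates between two independent copies *)

Section efron_stein.
Context {R : realType} d (Omega : measurableType d) (P : probability Omega R).
Context dE (E : measurableType dE).
Variable X : bool * nat -> Omega -> E.
Hypothesis iX : iid P X.

(** [X (false, _)] is the original sequence and [X (true, _)] an independent copy; [p] selects the
    copy used at each coordinate. Thus [leq N] replaces everything from coordinate [N] on, and
    [leq 0] gives a full independent copy. *)
Definition mixed (p : nat -> bool) (w : Omega) : history E := fun j => X (p j, j) w.

Let mixed_inj (p : nat -> bool) : injective (fun j : nat => (p j, j)).
Proof. by move=> i j []. Qed.

Lemma measurable_mixed p : measurable_fun setT (mixed p).
Proof. exact: (iid_measurable (iid_reindex (@mixed_inj p) iX)). Qed.

(** Exchanging the two copies at the coordinates marked by [t] is an injective relabelling of the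
    i.i.d. family, hence preserves its law. *)
Lemma mixed_swap (t p1 p2 : nat -> bool) (f : history E * history E -> R) :
  measurable_fun setT f -> (forall z, 0 <= f z) ->
  expect P (fun w => f (mixed p1 w, mixed p2 w)) =
  expect P (fun w => f (mixed (fun j => t j (+) p1 j) w, mixed (fun j => t j (+) p2 j) w)).
Proof.
move=> mf f0; rewrite !expectE /Rintegral; congr fine.
pose sw (i : bool * nat) : bool * nat := (t i.2 (+) i.1, i.2).
have sw_inj : injective sw.
  by move=> [b i] [c j] [/[swap] ->]; case: (t j) b c => [] [] [].
pose F (h : prodspace E (bool * nat)%type) : \bar R :=
  (f (fun j => h (p1 j, j), fun j => h (p2 j, j)))%:E.
have mcoord (p : nat -> bool) : measurable_fun setT (fun h : prodspace E (bool * nat)%type => (fun j => h (p j, j)) : history E).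
  apply: (@measurable_prodspaceP _ E) => j; exact: measurable_coord.
have mF : measurable_fun setT F.
  apply/measurable_EFinP; apply: measurableT_comp mf _.
  exact: measurable_fun_pair.
have F0 h : (0 <= F h)%E by rewrite lee_fin.
exact: (iid_law_reindex iX (@inj_id _) sw_inj mF F0).
Qed.

Definition none : nat -> bool := fun=> false.

Lemma mixed_law (p : nat -> bool) (f : history E -> R) : measurable_fun setT f -> (forall z, 0 <= f z) ->
  expect P (fun w => f (mixed p w)) = expect P (fun w => f (mixed none w)).
Proof.
move=> mf f0; have := @mixed_swap p p p (fun z => f z.1).
rewrite /= => -> //; last exact: measurableT_comp mf measurable_fst.
by congr expect; apply/funext => w; congr (f (mixed _ w)); apply/funext => j; rewrite addbb.
Qed.

Let gap (B : set (history E)) N :=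
  expect P (fun w => `|\1_B (mixed none w) - \1_B (mixed (leq N) w)|).

Let integ_ind (B : set (history E)) p : measurable B ->
  P.-integrable setT (EFin \o (fun w => \1_B (mixed p w) : R)).
Proof.
move=> mB; apply: (@bounded_integrable _ _ _ _ _ 1).
  by apply: measurableT_comp (measurable_mixed p); exact: measurable_indic.
by move=> w; rewrite indicE; case: (_ \in _); rewrite ?normr1 ?normr0.
Qed.

Let integ_gap (B : set (history E)) N : measurable B ->
  P.-integrable setT (EFin \o (fun w => `|\1_B (mixed none w) - \1_B (mixed (leq N) w)| : R)).
Proof. by move=> mB; apply/integ_norm/integB; exact: integ_ind. Qed.

(** The sets with vanishing gap contain those depending on one coordinate, for which the gap is
    eventually 0, and they form a sigma-algebra. This replaces an approximation of measurable sets
    by cylinders. *)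
Lemma mixed_tail_set (B : set (history E)) : measurable B -> gap B N @[N --> \oo] --> (0 : R).
Proof.
pose C : set (set (history E)) := [set B | measurable B /\ gap B N @[N --> \oo] --> (0 : R)].
suff : <<s @history_cylinders _ E >> `<=` C by move=> H mB; case: (H B mB).
apply: smallest_sub; last first.
  move=> _ [j _ [A mA <-]]; rewrite setTI; split.
    by have := @measurable_coord _ E _ j measurableT A mA; rewrite setTI.
  apply: cvg_near_cst; exists j.+1 => // N /= jN.
  rewrite /gap -[RHS](expect_cst P); congr expect; apply/funext => w.
  have E0 : mixed none w j = mixed (leq N) w j by rewrite /mixed /none leqNgt jN.
  rewrite !indicE (_ : (mixed none w \in _) = (mixed (leq N) w \in @^~ j @^-1` A)) ?subrr ?normr0//.
  by apply/idP/idP => /set_mem h; apply/mem_set; move: h => /=; rewrite E0.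
split.
- split=> //; apply: cvg_near_cst; near=> N.
  rewrite /gap -[RHS](expect_cst P); congr expect; apply/funext => w.
  by rewrite !indicE !in_set0 subrr normr0.
- move=> A [mA gA]; rewrite setTD; split; first exact: measurableC.
  rewrite (_ : gap (~` A) = gap A)//; apply/funext => N; congr expect; apply/funext => w.
  rewrite !indicE !in_setC; do 2 case: (_ \in _) => /=; rewrite ?subrr// ?subr0 ?sub0r ?normrN//.
- move=> F' FC'; pose F : nat -> set (history E) := F'.
  have FC : forall i, C (F i) := FC'.
  have mF i : measurable (F i) by case: (FC i).
  pose U : set (history E) := \bigcup_i F i; have mU : measurable U by exact: bigcupT_measurable.
  split=> //; apply/cvgr0Pnorm_le => e e0.
  (* The part of the union missed by its first [N] members. Its probability tends to 0, equally for
     both histories since they have the same law, and only finitely many gaps are left to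
     control. *)
  pose V N := U `\` \bigcup_(i < N) F i.
  have mV N : measurable (V N) by apply: measurableD => //; exact: bigcup_measurable.
  have V0 : fine (P (mixed none @^-1` V N)) @[N --> \oo] --> (0 : R).
    have mN : measurable_fun setT (mixed none) by exact: measurable_mixed.
    have := @nonincreasing_cvg_mu _ _ _ P (fun N => mixed none @^-1` V N).
    rewrite (_ : \bigcap_n _ = set0) ?measure0; last first.
      rewrite -subset0 => w /= H; have [[i _ Fi] _] := H 0%N I.
      by have [_] := H i.+1 I; apply; exists i => /=.
    move=> /(_ _ _ _ _)/fine_cvgP[]//.
    - by rewrite (le_lt_trans (probability_le1 _ _))// ?ltry//; exact: preimage_measurable.
    - by move=> N; exact: preimage_measurable.
    - move=> n m nm; apply/subsetPset => w [Uw nU]; split=> // -[i /= im Fi].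
      by apply: nU; exists i => //=; exact: leq_trans nm.
  have e30 : 0 < e / 3 by rewrite divr_gt0.
  have /cvgr0Pnorm_le/(_ _ e30)[N0 _ HN0] := V0.
  have {HN0} := HN0 N0 (leqnn _); rewrite ger0_norm ?fine_prob_ge0// => HN0.
  have sum0 : \sum_(i < N0) gap (F i) N @[N --> \oo] --> (0 : R).
    by apply: (@cvg0_sum _ N0 (fun i => gap (F i))) => i; case: (FC i).
  have /cvgr0Pnorm_le/(_ _ e30) := sum0; apply: filterS => N HN.
  rewrite ger0_norm; last exact: expect_ge0.
  have h1 : expect P (fun w => \1_(V N0) (mixed none w) : R) <= e / 3.
    by apply: le_trans HN0; rewrite -expect_indic//; exact: preimage_measurable (measurable_mixed _) _.
  have h2 : expect P (fun w => \1_(V N0) (mixed (leq N) w) : R) <= e / 3.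
    by rewrite (@mixed_law (leq N) (\1_(V N0)))//; exact: measurable_indic.
  have {}HN : \sum_(i < N0) gap (F i) N <= e / 3 by apply: le_trans (ler_norm _) HN.
  apply: (@le_trans _ _ (e / 3 + e / 3 + e / 3)); last lra.
  apply: le_trans (lerD (lerD h1 h2) HN).
  rewrite /gap -expect_sum; last by move=> i; exact: integ_gap.
  rewrite -expectD; [|exact: integ_ind..]; rewrite -expectD; last 2 first.
  - by apply: integD; exact: integ_ind.
  - by apply: integ_sum => i; exact: integ_gap.
  apply: expect_le; first exact: integ_gap.
    by apply: integD; [apply: integD; exact: integ_ind|apply: integ_sum => i; exact: integ_gap].
  move=> w; move: (mixed none w) (mixed (leq N) w) => x y.
  have sum_ge0 : 0 <= \sum_(i < N0) `|\1_(F i) x - \1_(F i) y| :> R by apply: sumr_ge0.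
  have ind_ge0 (B' : set (history E)) z : 0 <= \1_B' z :> R by rewrite indicE.
  (* If only one of two points lies in the union, then either that point lies in the remainder
     [V N0], or one of the first [N0] sets separates them. *)
  have key (x' y' : history E) : U x' -> ~ U y' ->
      1 <= \1_(V N0) x' + \sum_(i < N0) `|\1_(F i) x' - \1_(F i) y'| :> R.
    move=> Ux Uy; have [[i /= iN Fi]|nU] := pselect ((\bigcup_(i < N0) F i) x').
      rewrite (bigD1 (Ordinal iN))//= !indicE (mem_set Fi) (memNset (A := F i)); last first.
        by move=> Fy; apply: Uy; exists i.
      by rewrite subr0 normr1 addrCA lerDl addr_ge0// sumr_ge0.
    rewrite {1}indicE mem_set; last by split.
    by rewrite lerDl sumr_ge0.
  rewrite [\1_U x]indicE [\1_U y]indicE.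
  case: (boolP (x \in U)) => [/set_mem Ux|/negP Ux]; case: (boolP (y \in U)) => [/set_mem Uy|/negP Uy].
  + by rewrite subrr normr0 !addr_ge0.
  + rewrite subr0 normr1; have := key x y Ux (fun h => Uy (mem_set h)).
    by have := ind_ge0 (V N0) y; lra.
  + rewrite sub0r normrN normr1; have := key y x Uy (fun h => Ux (mem_set h)).
    under eq_bigr do rewrite distrC.
    by have := ind_ge0 (V N0) x; lra.
  + by rewrite subrr normr0 !addr_ge0.
Unshelve. all: by end_near. Qed.

Section bounded_functional.
Variables (f : history E -> R) (M : R).
Hypothesis mf : measurable_fun setT f.
Hypothesis f0M : forall z, 0 <= f z <= M.

Let S p w := f (mixed p w).

Let mS p : measurable_fun setT (S p).
Proof. exact: measurableT_comp mf (measurable_mixed p). Qed.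

Let iS p : P.-integrable setT (EFin \o S p).
Proof.
apply: (@bounded_integrable _ _ _ _ _ M) => // w.
by have /andP[h1 h2] := f0M (mixed p w); rewrite /S ger0_norm.
Qed.

Let iSS p q : P.-integrable setT (EFin \o (fun w => S p w * S q w)).
Proof.
apply: (@integM _ _ _ _ M) => // w.
by have /andP[h1 h2] := f0M (mixed p w); rewrite /S ger0_norm.
Qed.

(** The level sets of [f] at mesh [e / 2] reduce this to sets: values further apart than [e / 2] are
    separated by a level, at a cost of at most [M]. [L] levels exhaust the range of [f]. *)
Lemma mixed_tail : expect P (fun w => `|S none w - S (leq N) w|) @[N --> \oo] --> (0 : R).
Proof.
have M0 : 0 <= M by have /andP[h1 h2] := f0M (mixed none point); exact: le_trans h2.
apply/cvgr0Pnorm_le => e e0; have e20 : 0 < e / 2 by rewrite divr_gt0.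
pose L := (Num.truncn (M / (e / 2))).+1.
pose B l : set (history E) := [set x | l%:R * (e / 2) <= f x].
have mB l : measurable (B l).
  rewrite -[X in measurable X]setTI.
  have : measurable_fun setT (fun x => l%:R * (e / 2) <= f x) by exact: measurable_fun_ler.
  by move/(_ measurableT [set true]); rewrite setTI; apply.
have sum0 : \sum_(l < L) M * gap (B l) N @[N --> \oo] --> (0 : R).
  apply: (@cvg0_sum _ L (fun l N => M * gap (B l) N)) => l.
  rewrite -[X in _ --> X](mulr0 M); apply: cvgM; first exact: cvg_cst.
  exact: mixed_tail_set.
have /cvgr0Pnorm_le/(_ _ e20) := sum0; apply: filterS => N HN.
rewrite ger0_norm; last exact: expect_ge0.
have {}HN : \sum_(l < L) M * gap (B l) N <= e / 2 by apply: le_trans (ler_norm _) HN.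
apply: (@le_trans _ _ (e / 2 + e / 2)); last lra.
apply: le_trans (lerD (lexx (e / 2)) HN).
rewrite /gap -mulr_sumr -expect_sum; last by move=> l; exact: integ_gap.
rewrite -expectZ; last by apply: integ_sum => l; exact: integ_gap.
rewrite -[e / 2](expect_cst P) -expectD; [|exact: integ_cst|]; last first.
  by apply/integZ/integ_sum => l; exact: integ_gap.
apply: expect_le; first exact/integ_norm/integB.
  apply: integD; first exact: integ_cst.
  by apply/integZ/integ_sum => l; exact: integ_gap.
move=> w; rewrite /S; move: (mixed none w) (mixed (leq N) w) => x y.
have key (x' y' : history E) : f y' + e / 2 < f x' ->
    f x' - f y' <= M * \sum_(l < L) `|\1_(B l) x' - \1_(B l) y'| :> R.
  move=> xy; have /andP[fx0 fxM] := f0M x'; have /andP[fy0 fyM] := f0M y'.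
  have fxe0 : 0 <= f x' / (e / 2) by rewrite divr_ge0// ltW.
  have /andP[t1 t2] := truncn_itv fxe0.
  have tL : (Num.truncn (f x' / (e / 2)) < L)%N.
    by rewrite ltnS; apply: le_truncn; rewrite ler_pM2r// invr_gt0.
  rewrite (bigD1 (Ordinal tL))//= !indicE mem_set/=; last by rewrite /B /= -ler_pdivlMr.
  rewrite memNset/=; last first.
    rewrite /B /= => h; move: t2; rewrite ltr_pdivrMr// -natr1 mulrDl mul1r.
    by move=> t2; lra.
  rewrite subr0 normr1 mulrDr mulr1; have : 0 <= M * \sum_(l < L | l != Ordinal tL) `|\1_(B l) x' - \1_(B l) y'|.
    by rewrite mulr_ge0// sumr_ge0.
  by move=> h; lra.
have s0 : 0 <= M * \sum_(l < L) `|\1_(B l) x - \1_(B l) y| by rewrite mulr_ge0// sumr_ge0.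
have [h|h] := lerP `|f x - f y| (e / 2); first by lra.
have [fxy|fyx] := lerP (f y) (f x).
  have h' : f y + e / 2 < f x by move: h; rewrite ger0_norm ?subr_ge0//; lra.
  by have := key _ _ h'; lra.
have h' : f x + e / 2 < f y by move: h; rewrite distrC ger0_norm ?subr_ge0 ?ltW//; lra.
have := key _ _ h'; rewrite (_ : \sum_(l < L) `|\1_(B l) y - \1_(B l) x| = \sum_(l < L) `|\1_(B l) x - \1_(B l) y|).
  by lra.
by apply: eq_bigr => l _; rewrite distrC.
Qed.

Let c p q := expect P (fun w => S p w * S q w).

Let c_swap t p q : c p q = c (fun j => t j (+) p j) (fun j => t j (+) q j).
Proof.
apply: (@mixed_swap t p q (fun z => f z.1 * f z.2)).
  apply: measurable_funM.
    exact: measurableT_comp mf measurable_fst.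
  exact: measurableT_comp mf measurable_snd.
by move=> z; have /andP[? _] := f0M z.1; have /andP[? _] := f0M z.2; rewrite mulr_ge0.
Qed.

Let sq_swap t p q : expect P (fun w => (S p w - S q w) ^+ 2) =
  expect P (fun w => (S (fun j => t j (+) p j) w - S (fun j => t j (+) q j) w) ^+ 2).
Proof.
apply: (@mixed_swap t p q (fun z => (f z.1 - f z.2) ^+ 2)).
  apply: measurable_funX; apply: measurable_funB.
    exact: measurableT_comp mf measurable_fst.
  exact: measurableT_comp mf measurable_snd.
by move=> z; exact: sqr_ge0.
Qed.

Let e_ (j : nat) : nat -> bool := fun i => i == j.

Let isq p q : P.-integrable setT (EFin \o (fun w => (S p w - S q w) ^+ 2)).
Proof.
have M0 : 0 <= M by have /andP[h1 h2] := f0M (mixed none point); exact: le_trans h2.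
apply: (@bounded_integrable _ _ _ _ _ (M ^+ 2)).
  by apply: measurable_funX; exact: measurable_funB.
move=> w; rewrite normrX lerXn2r ?nnegrE//.
have /andP[h1 h2] := f0M (mixed p w); have /andP[h3 h4] := f0M (mixed q w).
by rewrite /S ler_norml; lra.
Qed.

(** The exchange at coordinate [j] swaps [none] with [e_ j] and [leq j] with [leq j.+1]. So twice
    the increment is the expectation of [S none - S (e_ j)] times [S (leq j.+1) - S (leq j)].
    Exchanging all coordinates beyond [j] shows that the two factors have the same second moment,
    and the product is at most half the sum of the squares. *)
Let c_step j : c none (leq j.+1) - c none (leq j) <=
  2^-1 * expect P (fun w => (S none w - S (e_ j) w) ^+ 2).
Proof.
have E1 : (fun i => e_ j i (+) none i) = e_ j by apply/funext => i; rewrite /e_ /none addbF.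
have E2 : (fun i => e_ j i (+) (j < i)%N) = leq j.
  by apply/funext => i; rewrite /e_; case: ltngtP.
have E3 : (fun i => e_ j i (+) (j <= i)%N) = leq j.+1.
  by apply/funext => i; rewrite /e_; case: ltngtP.
have := c_swap (e_ j) none (leq j.+1); rewrite E1 E2 => h1.
have := c_swap (e_ j) none (leq j); rewrite E1 E3 => h2.
have E4 : (fun i => (j < i)%N (+) (j < i)%N) = none by apply/funext => i; rewrite addbb.
have E5 : (fun i => (j < i)%N (+) (j <= i)%N) = e_ j.
  by apply/funext => i; rewrite /e_; case: ltngtP.
have := sq_swap (leq j.+1) (leq j.+1) (leq j); rewrite E4 E5 => h3.
have : expect P (fun w => (S none w - S (e_ j) w) * (S (leq j.+1) w - S (leq j) w)) <=
   2^-1 * (expect P (fun w => (S none w - S (e_ j) w) ^+ 2) +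
           expect P (fun w => (S (leq j.+1) w - S (leq j) w) ^+ 2)).
  rewrite -expectD// -expectZ; last exact: integD.
  apply: expect_le.
  - have := integB (integB (iSS none (leq j.+1)) (iSS none (leq j)))
      (integB (iSS (e_ j) (leq j.+1)) (iSS (e_ j) (leq j))).
    by congr integrable; apply/funext => w /=; congr EFin; ring.
  - exact/integZ/integD.
  move=> w; move: (S none w - _) (S (leq j.+1) w - _) => x y.
  by have := sqr_ge0 (x - y); rewrite sqrrB mulr2n; lra.
rewrite -h3.
have -> : expect P (fun w => (S none w - S (e_ j) w) * (S (leq j.+1) w - S (leq j) w)) =
   (c none (leq j.+1) - c none (leq j)) - (c (e_ j) (leq j.+1) - c (e_ j) (leq j)).
  rewrite -!expectB//; try exact: integB.
  by congr expect; apply/funext => w; ring.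
by rewrite -h1 -h2; lra.
Qed.

(* Chatterjee's exchange argument: [E (S S')], with [S'] an independent copy, is deformed into [E (S^2)] one
   coordinate at a time, and each increment is symmetrized by exchanging the two copies at that coordinate;
   no conditional expectation is needed. *)
Lemma efron_stein (B : R) :
  (forall N, \sum_(j < N) expect P (fun w => (S none w - S (eq_op^~ j) w) ^+ 2) <= B) ->
  expect P (fun w => S none w ^+ 2) - expect P (S none) ^+ 2 <= 2^-1 * B.
Proof.
move=> HB.
have M0 : 0 <= M by have /andP[h1 h2] := f0M (mixed none point); exact: le_trans h2.
have c00 : c none none = expect P (fun w => S none w ^+ 2).
  by congr expect; apply/funext => w; rewrite expr2.
(* [leq 0] is constantly true: the second history is an independent copy, and the product of the two
   functionals has expectation [E(S)^2]. *)
have c0q : c none (leq 0) = expect P (S none) ^+ 2.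
  have ind : independent_rv P (mixed none) (mixed (leq 0)).
    apply: (@iid_disjoint_independent _ _ _ P _ E _ _ _ X (fun j => (false, j)) (fun j => (true, j)) iX); try by move=> ? ? [].
    by [].
  rewrite /c (independent_expectM (measurable_mixed none) (measurable_mixed (leq 0)) ind mf mf f0M f0M).
  rewrite expr2; congr (_ * _).
  by apply: mixed_law => // z; case/andP: (f0M z).
have tel N : c none (leq N) - c none (leq 0) <= 2^-1 * B.
  apply: (@le_trans _ _ (2^-1 * \sum_(j < N) expect P (fun w => (S none w - S (eq_op^~ j) w) ^+ 2))); last first.
    by rewrite ler_wpM2l.
  rewrite -(telescope_sumr (fun N => c none (leq N)))// big_mkord mulr_sumr.
  by apply: ler_sum => j _; exact: c_step.
rewrite -c00 -c0q; apply/ler_addgt0Pr => e e0.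
have := mixed_tail => /cvgr0Pnorm_le/(_ (e / (M + 1))).
have M1 : 0 < M + 1 by rewrite ltr_wpDl.
rewrite divr_gt0// => /(_ isT)[N _ /(_ N (leqnn N))] HN.
have : c none none - c none (leq N) <= e.
  rewrite -expectB//.
  apply: (@le_trans _ _ (expect P (fun w => M * `|S none w - S (leq N) w|))).
    apply: expect_le; [exact: integB|exact/integZ/integ_norm/integB|].
    move=> w; rewrite -mulrBr; have /andP[h1 h2] := f0M (mixed none w).
    apply: (@le_trans _ _ (S none w * `|S none w - S (leq N) w|)).
      by rewrite ler_wpM2l// ler_norm.
    by rewrite ler_wpM2r.
  rewrite expectZ; last exact/integ_norm/integB.
  move: HN; rewrite ger0_norm; last exact: expect_ge0.
  move=> HN; apply: (le_trans (ler_wpM2l M0 HN)).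
  by rewrite mulrCA ler_piMr ?(ltW e0)// ler_pdivrMr// mul1r lerDl.
by have := tel N; lra.
Qed.

End bounded_functional.

End efron_stein.

(** * A measurable version of the conditional density *)

Section density_measure.
Context d (T : measurableType d) {R : realType} (mu : {measure set T -> \bar R}).
Variable f : T -> R.
Hypotheses (mf : measurable_fun setT f) (f0 : forall x, 0 <= f x).
Local Open Scope ereal_scope.

Definition density_measure of measurable_fun setT f & (forall x, 0 <= f x)%R :=
  fun A => \int[mu]_(x in A) (f x)%:E.

Let density0 : density_measure mf f0 set0 = 0.
Proof. by rewrite /density_measure integral_set0. Qed.

Let density_ge0 A : 0 <= density_measure mf f0 A.
Proof. by apply: integral_ge0 => x _; rewrite lee_fin. Qed.

Let density_sigma_additive : semi_sigma_additive (density_measure mf f0).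
Proof.
apply: semi_sigma_additive_nng_induced; first exact/measurable_EFinP.
by move=> x; rewrite lee_fin.
Qed.

HB.instance Definition _ := isMeasure.Build _ _ _ (density_measure mf f0)
  density0 density_ge0 density_sigma_additive.

Import HBNNSimple.

Lemma ge0_integral_density (g : T -> \bar R) : measurable_fun setT g -> (forall x, 0 <= g x) ->
  \int[density_measure mf f0]_x g x = \int[mu]_x (g x * (f x)%:E).
Proof.
move=> mg g0; pose h := nnsfun_approx measurableT mg.
have mfE : measurable_fun setT (EFin \o f) by exact/measurable_EFinP.
have mh n : measurable_fun setT (EFin \o h n) by exact/measurable_EFinP.
have gE x : g x = lim ((EFin \o h n) x @[n --> \oo]).
  by apply/esym/cvg_lim => //; exact: cvg_nnsfun_approx.
transitivity (lim (\int[density_measure mf f0]_x (EFin \o h n) x @[n --> \oo])).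
  rewrite (eq_integral _ _ (fun x _ => gE x)); apply: monotone_convergence => //.
  - by move=> n x _ /=; rewrite lee_fin.
  - by move=> x _ a b ab; rewrite lee_fin; exact/lefP/nd_nnsfun_approx.
transitivity (lim (\int[mu]_x ((EFin \o h n) \* (EFin \o f)) x @[n --> \oo])); last first.
  have gfE x : g x * (f x)%:E = lim (((EFin \o h n) \* (EFin \o f)) x @[n --> \oo]).
    by apply/esym/cvg_lim => //; apply: cvgeZr => //; exact: cvg_nnsfun_approx.
  rewrite (eq_integral _ _ (fun x _ => gfE x)); apply/esym/monotone_convergence => //.
  - by move=> n; exact: emeasurable_funM.
  - by move=> n x _ /=; rewrite -EFinM lee_fin mulr_ge0.
  - by move=> x _ a b ab; rewrite /= -!EFinM lee_fin ler_wpM2r//; exact/lefP/nd_nnsfun_approx.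
congr (limn _); apply/funext => n.
transitivity (\int[density_measure mf f0]_x
   (\sum_(y \in range (h n)) (y * \1_(h n @^-1` [set y]) x)%:E)).
  by apply: eq_integral => t tE; rewrite /= fimfunE -fsumEFin.
have indich r : measurable_fun setT (fun x => (r * \1_(h n @^-1` [set r]) x)%:E).
  by apply: (measurable_comp measurableT) => //; exact: measurable_funM.
rewrite ge0_integral_fsum//; last by move=> m y Ey; exact: nnfun_muleindic_ge0.
transitivity (\int[mu]_x (\sum_(y \in range (h n))
    (y * \1_(h n @^-1` [set y]) x)%:E * (f x)%:E)); last first.
  apply: eq_integral => x xE.
  rewrite -ge0_mule_fsuml => [|y]; last exact: nnfun_muleindic_ge0.
  by rewrite fsumEFin // -(fimfunE _ x).
rewrite ge0_integral_fsum//; last 2 first.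
  - by move=> y; apply: emeasurable_funM.
  - move=> m y Ey; apply: mule_ge0; first exact: nnfun_muleindic_ge0.
    by rewrite lee_fin.
apply: eq_fsbigr => r rhn.
under eq_integral do rewrite EFinM.
rewrite integralZl_indic_nnsfun => //.
under [RHS]eq_integral do rewrite EFinM -muleA.
rewrite [RHS]ge0_integralZl//.
- under [in RHS]eq_integral do rewrite muleC.
  rewrite [X in _ = _ * X](eq_integral ((EFin \o f) \_ (h n @^-1` [set r]))); last first.
    by move=> x xE; rewrite epatch_indic.
  by rewrite -integral_mkcond integral_indic// setIT.
- apply: emeasurable_funM => //; exact/measurable_EFinP.
- by move=> t Et; rewrite mule_ge0 ?lee_fin.
- by move: rhn; rewrite inE => -[t _ <-]; rewrite lee_fin.
Qed.

End density_measure.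

Lemma ge0_integral_image d1 d2 (T1 : measurableType d1) (T2 : measurableType d2) {R : realType}
    (m : {measure set T1 -> \bar R}) (f : T1 -> T2) (mf : measurable_fun setT f) (g : T2 -> \bar R) :
  measurable_fun setT g -> (forall x, 0 <= g x)%E ->
  (\int[image_measure m mf]_y g y = \int[m]_x g (f x))%E.
Proof.
move=> mg g0.
pose fm : {mfun T1 >-> T2} := mfun_Sub (mem_set mf).
rewrite (eq_measure_integral (pushforward m fm))//.
by rewrite ge0_integral_pushforward// ?preimage_setT.
Qed.

(** * Integrals of possibly nonmeasurable functions off a null set *)

Section negligible_change.
Context d (T : measurableType d) {R : realType} (mu : {measure set T -> \bar R}).
Variable N : set T.
Hypotheses (mN : measurable N) (N0 : mu N = 0%E).

Import HBNNSimple.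

(** The integral of a nonnegative function is a supremum over simple functions below it. Setting
    such a simple function to 0 on [N] keeps its integral and puts it below the other function,
    whatever the values on [N]. *)
Let ge0_le (f g : T -> \bar R) : (forall x, 0 <= f x)%E -> (forall x, 0 <= g x)%E ->
  (forall x, ~ N x -> f x = g x) -> (\int[mu]_x f x <= \int[mu]_x g x)%E.
Proof.
move=> f0 g0 fg; rewrite [leLHS]ge0_integralTE//.
apply: ge_ereal_sup => _ [h hf <-].
have mNC : measurable (~` N) by exact: measurableC.
pose h' : {nnsfun T >-> R} := proj_nnsfun h mNC.
have h'E x : h' x = (h \_ (~` N)) x by rewrite mrestrict.
have h'g x : ((h' x)%:E <= g x)%E.
  rewrite h'E /patch; case: ifPn => // xN.
  by rewrite -fg//; exact: set_mem.
have -> : sintegral mu h = (\int[mu]_x (h x)%:E)%E by rewrite integral_nnsfun// patch_setT.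
have -> : (\int[mu]_x (h x)%:E = \int[mu]_x (h' x)%:E)%E.
  apply: ge0_ae_eq_integral => //.
  - exact/measurable_EFinP.
  - exact/measurable_EFinP.
  - by move=> x _; rewrite lee_fin.
  - by move=> x _; rewrite lee_fin.
  exists N; split=> // x /= H; apply: contrapT => xN; apply: H => _.
  by rewrite /= mindicE mem_set//= mulr1.
rewrite (ge0_integralTE _ g0).
have -> : (\int[mu]_x (h' x)%:E = sintegral mu h')%E by rewrite integral_nnsfun// patch_setT.
by apply: ereal_sup_ubound; exists h'.
Qed.

(* Unlike [ae_eq_integral], without any measurability assumption on [f] and [g]. *)
Lemma integral_eq_off_null (f g : T -> \bar R) :
  (forall x, ~ N x -> f x = g x) -> (\int[mu]_x f x = \int[mu]_x g x)%E.
Proof.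
have H (f' g' : T -> \bar R) : (forall x, 0 <= f' x)%E -> (forall x, 0 <= g' x)%E ->
  (forall x, ~ N x -> f' x = g' x) -> (\int[mu]_x f' x = \int[mu]_x g' x)%E.
  move=> f0 g0 fg; apply/eqP; rewrite eq_le; apply/andP; split; apply: ge0_le => // x xN.
  by rewrite fg.
move=> fg; rewrite integralE [RHS]integralE; congr (_ - _)%E; apply: H => // x xN.
  by rewrite !funeposE fg.
by rewrite !funenegE fg.
Qed.

End negligible_change.

(** * Orthants as an intersection-stable generator *)

Section orthants.
Context {R : realType} (d : nat).
Implicit Types (u v w : 'rV[R]_d).

Definition orthants : set (set 'rV[R]_d) := range (@orthant R d).

Lemma measurable_orthant u : measurable (orthant u).
Proof.
rewrite (_ : orthant u = \bigcap_(i in [set: 'I_d])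
    ((fun v : 'rV[R]_d => v ord0 i) @^-1` `]-oo, u ord0 i]%classic)); last first.
  apply/seteqP; split => v /= h i; first by move=> _ /=; rewrite in_itv/= h.
  by have := h i I; rewrite /= in_itv.
apply: fin_bigcap_measurable => // i _.
by rewrite -[X in measurable X]setTI; exact: measurable_rV_coord.
Qed.

Lemma orthants_setI : setI_closed orthants.
Proof.
move=> _ _ [u _ <-] [v _ <-]; exists (\row_i Num.min (u ord0 i) (v ord0 i)) => //.
apply/seteqP; split => w; rewrite /orthant /=.
  by move=> h; split=> i; have := h i; rewrite mxE le_min => /andP[].
by move=> [h1 h2] i; rewrite mxE le_min h1 h2.
Qed.

Lemma bigcup_orthants : \bigcup_n (orthant (const_mx n%:R : 'rV[R]_d)) = setT.
Proof.
apply/seteqP; split=> // v _.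
exists (Num.truncn (\sum_i `|v ord0 i|)).+1 => // i; rewrite mxE.
have /andP[_ /ltW] := truncn_itv (sumr_ge0 _ (fun i _ => normr_ge0 (v ord0 i)) : 0 <= \sum_i `|v ord0 i|).
apply: le_trans; rewrite (bigD1 i)//=.
by rewrite ler_wpDr ?ler_norm// sumr_ge0.
Qed.

Lemma rV_measurableE : @measurable _ 'rV[R]_d = <<s orthants >>.
Proof.
apply/seteqP; split; last first.
  apply: smallest_sub; first exact: sigma_algebra_measurable.
  by move=> _ [u _ <-]; exact: measurable_orthant.
pose S : set (set R) := [set B | forall i : 'I_d, <<s orthants >> ((fun v => v ord0 i) @^-1` B)].
have SB : @measurable _ (measurableTypeR R) `<=` S.
  rewrite [X in X `<=` _](_ : _ = (@RGenOInfty.G R).-sigma.-measurable); last first.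
    by rewrite -RGenOInfty.measurableE.
  apply: smallest_sub.
    split; rewrite /S /=.
    - by move=> i; rewrite preimage_set0; exact: sigma_algebra0.
    - by move=> A mA i; rewrite setTD preimage_setC; apply: sigma_algebraC; exact: mA.
    - by move=> F mF i; rewrite preimage_bigcup; apply: sigma_algebra_bigcup => n; exact: mF.
  move=> _ [x ->] i.
  (* The complementary half-space is the increasing union of the orthants with bound [x] in
     direction [i] and bound [n] in the others. *)
  rewrite (_ : _ @^-1` _ = ~` (\bigcup_n orthant (\row_j (if j == i then x else n%:R)))).
    apply: sigma_algebraC; apply: sigma_algebra_bigcup => n.
    by apply: sub_sigma_algebra; exists (\row_j (if j == i then x else n%:R)).
  apply/seteqP; split => v /=; rewrite in_itv/= andbT.
    by move=> xv [n _ /(_ i)]; rewrite mxE eqxx leNgt xv.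
  move=> H; rewrite ltNge; apply/negP => vx; apply: H.
  have : setT v by []; rewrite -bigcup_orthants => -[n _ vn]; exists n => // j.
  by rewrite mxE; case: eqP => [->//|_]; have := vn j; rewrite mxE.
apply: smallest_sub; first exact: smallest_sigma_algebra.
move=> A; rewrite -bigcup_seq/= => -[i _ [B mB <-]]; rewrite setTI.
exact: SB.
Qed.

Lemma orthant_measure_unique (m1 m2 : {measure set 'rV[R]_d -> \bar R}) :
  (forall u, m1 (orthant u) < +oo)%E -> (forall u, m1 (orthant u) = m2 (orthant u)) ->
  forall A, measurable A -> m1 A = m2 A.
Proof.
move=> fin E A mA.
apply: (measure_unique orthants (fun n => orthant (const_mx n%:R))) => //.
- exact: rV_measurableE.
- exact: orthants_setI.
- by move=> n; exists (const_mx n%:R).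
- exact: bigcup_orthants.
- by move=> _ [u _ <-].
Qed.

End orthants.

Section joint_cdf.
Context {R : realType} (d : nat) dH (H : measurableType dH) (Q : R.-pker H ~> 'rV[R]_d).

(** The orthant varies with the point, so measurability of the kernel on a fixed set is not enough.
    The value is the kernel mass of a section of the measurable set of pairs with all coordinates
    ordered. *)
Lemma measurable_orthant_kernel : measurable_fun setT
  (fun p : 'rV[R]_d * H => fine (Q p.2 (orthant p.1))).
Proof.
apply: measurableT_comp; first exact: fine_measurable.
pose A : set (('rV[R]_d * H) * 'rV[R]_d) := [set p : ('rV[R]_d * H) * 'rV[R]_d | forall i, p.2 ord0 i <= p.1.1 ord0 i].
have mA : measurable A.
  rewrite (_ : A = \bigcap_(i in [set: 'I_d])
    [set p : ('rV[R]_d * H) * 'rV[R]_d | p.2 ord0 i <= p.1.1 ord0 i]); last first.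
    by apply/seteqP; split => v /= h i; [move=> _ /=; exact: h|exact: h].
  apply: fin_bigcap_measurable => // i _.
  have h : measurable_fun setT (fun p : ('rV[R]_d * H) * 'rV[R]_d => p.2 ord0 i <= p.1.1 ord0 i).
    apply: measurable_fun_ler.
      exact: (measurableT_comp (measurable_rV_coord i) measurable_snd).
    apply: (measurableT_comp (measurable_rV_coord i)).
    exact: (measurableT_comp measurable_fst measurable_fst).
  by have := h measurableT [set true] I; rewrite setTI; apply.
have := @measurable_fun_xsection_finite_kernel _ _ ('rV[R]_d * H)%type 'rV[R]_d R (kernel.kernel_snd Q : R.-fker _ ~> _) A.
rewrite inE => /(_ mA); congr measurable_fun; apply/funext => -[v h] /=.
by congr (Q h _); apply/seteqP; split => w; rewrite /xsection /A /= inE.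
Qed.

End joint_cdf.

(** * Mixed partial derivatives as limits of box masses *)

Section iterated_partial.
Context {R : realType} (d : nat).
Implicit Types (F : 'rV[R]_d -> R) (s : seq 'I_d) (L : seq ('I_d * R)).

Lemma cvg_difference_quotient F (v : 'rV[R]_d) (e : 'rV[R]_d) :
  derivable (F : 'rV[R]_d -> R^o) v e ->
  n.+1%:R * (F (v + n.+1%:R^-1 *: e) - F v) @[n --> \oo] --> ('D_e (F : 'rV[R]_d -> R^o) v : R).
Proof.
move=> dF.
pose t (n : nat) : R := n.+1%:R^-1.
have t0 : t n @[n --> \oo] --> (0 : R)^'.
  move=> A /=; rewrite /dnbhs withinE => -[B B0 BA].
  have t0 : t n @[n --> \oo] --> (0 : R) by exact: cvg_harmonic.
  have : \forall n \near \oo, B (t n) by exact: t0.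
  change ((\forall n \near \oo, B (t n)) -> \forall n \near \oo, A (t n)).
  apply: filterS => n Bn; have : (B `&` (fun x : R => x != 0)) (t n).
    by split=> //; rewrite invr_neq0.
  by rewrite -BA => -[].
have H := cvg_comp _ _ t0 dF.
rewrite (_ : (fun n => _) = (fun h : R => h^-1 *: ((F \o shift v) (h *: e) - F v)) \o t); first exact: H.
apply/funext => n /=; rewrite /t invrK /GRing.scale /=.
by rewrite (addrC _ v).
Qed.

(** Iterated forward differences. Applied to a distribution function in distinct directions with
    positive steps, they give the mass of a box. *)
Fixpoint difference L F : 'rV[R]_d -> R :=
  if L is (i, t) :: L' then fun v => difference L' F (v + t *: unit_rV i) - difference L' F v else F.

Lemma difference_rcons L i t F v :
  difference (rcons L (i, t)) F v = difference L (fun v => F (v + t *: unit_rV i) - F v) v.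
Proof. by elim: L v => [|[j r] L IH] v //=; rewrite !IH. Qed.

Lemma differenceZ L c F v : difference L (fun v => c * F v) v = c * difference L F v.
Proof. by elim: L v => [|[j r] L IH] v //=; rewrite !IH mulrBr. Qed.

Lemma cvg_difference L (F_ : nat -> 'rV[R]_d -> R) F v : (forall v, F_ n v @[n --> \oo] --> F v) ->
  difference L (F_ n) v @[n --> \oo] --> difference L F v.
Proof.
by move=> FF; elim: L v => [|[i t] L IH] v /=; [exact: FF|apply: cvgB; exact: IH].
Qed.

(** A derivative is a limit of difference quotients, so peeling one derivative off [s] adds one
    difference to [L]. When [s] is exhausted, only differences of [F] itself remain, and these are
    nonnegative by assumption. *)
Lemma partial_seq_ge0 s L F : partial_seq_exists s F ->
  (forall L', map fst L' = map fst L ++ s -> all (fun p => 0 < p.2) L' -> forall v, 0 <= difference L' F v) ->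
  all (fun p => 0 < p.2) L -> forall v, 0 <= difference L (partial_seq s F) v.
Proof.
elim: s L => [|i s IH] L /=.
  by move=> _ H L0 v; apply: H => //; rewrite cats0.
move=> [sF dF] H L0 v.
have := @cvg_difference L (fun n v => n.+1%:R * (partial_seq s F (v + n.+1%:R^-1 *: unit_rV i) - partial_seq s F v))
  ('D_(unit_rV i) (partial_seq s F)) v.
move=> /(_ (fun v => cvg_difference_quotient (dF v))) cv.
apply: (@ler_cvg_to _ _ _ R (fun=> 0) _ _ _ (cvg_cst 0) cv); apply: nearW => n /=.
rewrite differenceZ -difference_rcons mulr_ge0//; apply: IH => //.
  by move=> L' L'E; apply: H; rewrite L'E map_rcons cat_rcons.
by rewrite all_rcons /= invr_gt0 ltr0Sn.
Qed.

Section box.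
Variable m : {measure set 'rV[R]_d -> \bar R}.
Hypothesis fin_m : forall A, measurable A -> m A \is a fin_num.

Let box L (v : 'rV[R]_d) : set 'rV[R]_d := [set w | (forall p, p \in L -> v ord0 p.1 < w ord0 p.1 <= v ord0 p.1 + p.2) /\
  forall j, j \notin map fst L -> w ord0 j <= v ord0 j].

Let unit_rVE (t : R) (i j : 'I_d) (v : 'rV[R]_d) : (v + t *: unit_rV i) ord0 j = v ord0 j + (if j == i then t else 0).
Proof. by rewrite !mxE eqxx /=; case: eqP => _ /=; rewrite ?mulr1 ?mulr0. Qed.

(** Differencing in a new direction subtracts the masses of two nested boxes; it turns an unbounded
    side into a bounded half-open one. Distinctness of the directions keeps the other sides
    unchanged. *)
Let difference_box L v : uniq (map fst L) -> all (fun p => 0 < p.2) L ->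
  measurable (box L v) /\ difference L (fun v => fine (m (orthant v))) v = fine (m (box L v)).
Proof.
elim: L v => [|[i t] L IH] v /=.
  move=> _ _; rewrite (_ : box [::] v = orthant v); first by split=> //; exact: measurable_orthant.
  by apply/seteqP; split => w /=; [move=> [_ +] j; exact|split].
move=> /andP[iL uL] /andP[t0 L0].
have [m1 E1] := IH (v + t *: unit_rV i) uL L0; have [m2 E2] := IH v uL L0.
have sub : box L v `<=` box L (v + t *: unit_rV i).
  move=> w [h1 h2]; split => [p pL|j jL]; rewrite !unit_rVE; last first.
    by apply: le_trans (h2 j jL) _; case: eqP => _; rewrite ?addr0// lerDl ltW.
  case: eqP => [pi|_]; last by rewrite addr0; exact: h1.
  by move: iL; rewrite -pi map_f.
have -> : box ((i, t) :: L) v = box L (v + t *: unit_rV i) `\` box L v.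
  apply/seteqP; split => w.
    move=> [h1 h2]; split.
      split => [p pL|j jL]; rewrite !unit_rVE.
        case: eqP => [pi|_]; first by move: iL; rewrite -pi map_f.
        by rewrite addr0; apply: h1; rewrite in_cons pL orbT.
      case: eqP => [->|/eqP ji]; first by have /andP[] := h1 (i, t) (mem_head _ _).
      by rewrite addr0; apply: h2; rewrite /= in_cons (negbTE ji).
    move=> [_ h3]; have /andP[] := h1 (i, t) (mem_head _ _).
    by rewrite /= ltNge h3.
  move=> [[h1 h2] h3]; split => [p|j].
    rewrite in_cons => /orP[/eqP -> /=|pL].
      apply/andP; split; last by have := h2 i iL; rewrite unit_rVE eqxx.
      rewrite ltNge; apply/negP => h; apply: h3; split => [p' pL|j jL].
        have := h1 p' pL; rewrite !unit_rVE; case: eqP => [pi|_]; last by rewrite addr0.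
        by move: iL; rewrite -pi map_f.
      have := h2 j jL; rewrite unit_rVE; case: eqP => [->//|_]; by rewrite addr0.
    have := h1 p pL; rewrite !unit_rVE; case: eqP => [pi|_]; last by rewrite addr0.
    by move: iL; rewrite -pi map_f.
  rewrite /= in_cons negb_or => /andP[ji jL].
  by have := h2 j jL; rewrite unit_rVE (negbTE ji) addr0.
split; first exact: measurableD.
rewrite E1 E2 measureD//; last by rewrite ltey_eq fin_m.
by rewrite setIidr// fineB// fin_m.
Qed.

(** Gives the sign of [cond_pdf], which is defined as a derivative. In the box argument all sides
    are bounded in the end, as [enum 'I_d] lists each direction once. *)
Lemma mixed_partial_cdf_ge0 : mixed_partial_exists (fun v => fine (m (orthant v))) ->
  forall v, 0 <= mixed_partial (fun v => fine (m (orthant v))) v.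
Proof.
move=> H v; apply: (@partial_seq_ge0 (enum 'I_d) [::]) => // L /= LE L0 {}v.
have uL : uniq (map fst L) by rewrite LE enum_uniq.
by rewrite (difference_box v uL L0).2 fine_ge0.
Qed.

End box.

Context dH (H : measurableType dH).

(** A limit superior of difference quotients along [1 / (n + 1)]: always jointly measurable in the
    point and the parameter, and equal to the partial derivative wherever the latter exists. *)
Fixpoint partial_lim s (F : 'rV[R]_d * H -> R) : 'rV[R]_d * H -> R :=
  if s is i :: s' then fun p => fine (limn_esup (fun n =>
    (n.+1%:R * (partial_lim s' F (p.1 + n.+1%:R^-1 *: unit_rV i, p.2) - partial_lim s' F p))%:E))
  else F.

Lemma measurable_partial_lim s (F : 'rV[R]_d * H -> R) : measurable_fun setT F -> measurable_fun setT (partial_lim s F).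
Proof.
move=> mF; elim: s => [//|i s IH] /=.
apply: measurableT_comp; first exact: fine_measurable.
apply: (@measurable_fun_limn_esup _ ('rV[R]_d * H)%type R setT (fun n p => (n.+1%:R * (partial_lim s F (p.1 + n.+1%:R^-1 *: unit_rV i, p.2) - partial_lim s F p))%:E)) => n.
apply/measurable_EFinP; apply: measurable_funM => //; apply: measurable_funB => //.
apply: (measurableT_comp IH); apply: measurable_fun_pair => //.
apply/measurable_fun_rVP => j.
under eq_fun do rewrite mxE.
apply: measurable_funD => //.
exact: (measurableT_comp (measurable_rV_coord j) measurable_fst).
Qed.

Lemma partial_limE s (F : 'rV[R]_d * H -> R) h : partial_seq_exists s (fun v => F (v, h)) ->
  forall v, partial_lim s F (v, h) = partial_seq s (fun v => F (v, h)) v.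
Proof.
elim: s => [//|i s IH] /= [sF dF] v.
set l : R := 'D_(unit_rV i) _ v.
rewrite (@cvg_limn_einf_sup _ _ l%:E _).2//.
apply: cvg_EFin; first exact: nearW.
rewrite /l.
rewrite (_ : fine \o _ = (fun n => n.+1%:R * (partial_seq s (fun v => F (v, h)) (v + n.+1%:R^-1 *: unit_rV i) -
  partial_seq s (fun v => F (v, h)) v))); first exact: cvg_difference_quotient.
by apply/funext => n; rewrite /= !IH.
Qed.

End iterated_partial.

Lemma probability1_setI {R : realType} d (Omega : measurableType d) (P : probability Omega R)
    (A B : set Omega) : measurable A -> measurable B -> P A = 1%E -> P B = 1%E -> P (A `&` B) = 1%E.
Proof.
move=> mA mB PA PB; rewrite -PA (@measureDI _ _ _ P A B)//.
rewrite [X in _ = (X + _)%E](_ : _ = 0%E) ?add0e//.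
apply: (@subset_measure0 _ _ _ P _ (~` B)); [exact: measurableD|exact: measurableC|by move=> w []|].
by apply: etrans (probability_setC P mB) _; rewrite PB subee.
Qed.

Section one_step_density.
Context {R : realType} (disp : measure_display) (Omega : measurableType disp).
Variable P : probability Omega R.
Context (d : nat) (dE : measure_display) (E : measurableType dE).
Variable xi : int -> Omega -> E.
Variable Q : R -> R.-pker (history E) ~> 'rV[R]_d.

(* [cond_pdf] is a derivative, hence in general neither measurable nor nonnegative off the good set [A]. *)
Lemma cond_pdf_version c0 : measurable_fun setT (past xi 0) ->
  has_cond_pdf P xi Q -> cond_pdf_bound P xi Q c0 ->
  exists (A : set (history E)) (fh : R -> 'rV[R]_d * history E -> R),
    [/\ measurable A, P (past xi 0 @^-1` A) = 1%E, forall t h v, ~ A h -> fh t (v, h) = 0 &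
    forall t, `[0, 1]%classic t ->
    [/\ measurable_fun setT (fh t), forall p, 0 <= fh t p <= `|c0|,
      forall h v, A h -> fh t (v, h) = cond_pdf Q v t h &
      forall h B, A h -> measurable B ->
        (Q t h B = \int[lebesgue_rV d]_(v in B) (fh t (v, h))%:E)%E]].
Proof.
move=> mxi [A1 [mA1 PA1 A1H]] [A2 [mA2 PA2 A2H]].
pose A : set (history E) := A1 `&` A2.
have mA : measurable A by exact: measurableI.
pose fl t : 'rV[R]_d * history E -> R := partial_lim (enum 'I_d) (fun p => cond_cdf Q p.1 t p.2).
(* The clipping between 0 and [|c0|] enforces the bounds at every history; on [A] it changes
   nothing, since the derivative there exists, is nonnegative and is at most [c0]. *)
pose fh t p := \1_A p.2 * Num.max 0 (Num.min `|c0| (fl t p)).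
have mfh t : measurable_fun setT (fh t).
  apply: measurable_funM.
    have mI : measurable_fun setT (\1_A : history E -> R) by exact: measurable_indic.
    exact: (measurableT_comp mI measurable_snd).
  apply: measurable_maxr => //; apply: measurable_minr => //.
  by apply: measurable_partial_lim; exact: measurable_orthant_kernel.
have fh0 t p : 0 <= fh t p.
  by rewrite mulr_ge0 ?indicE// le_max lexx.
have fhE t h v : `[0, 1]%classic t -> A h -> fh t (v, h) = cond_pdf Q v t h.
  move=> t01 [A1h A2h]; have [ex int] := A1H _ A1h t t01; have [_ bd] := A2H _ A2h t t01.
  have flE : fl t (v, h) = cond_pdf Q v t h by rewrite /fl partial_limE.
  have ge0 : 0 <= cond_pdf Q v t h.
    apply: (@mixed_partial_cdf_ge0 _ _ (Q t h)) => // B mB.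
    rewrite ge0_fin_numE// (le_lt_trans _ (ltry 1))//.
    by rewrite -(@prob_kernel _ _ _ _ _ (Q t) h) le_measure// ?inE.
  rewrite /fh /= indicE mem_set// mul1r flE min_r ?max_r//.
  apply: le_trans (ler_norm c0); apply: le_trans (bd v).
  by rewrite lerDl.
exists A, fh; split=> // [|t h v Ah|t t01]; last 1 first; last first.
- by rewrite /fh indicE memNset// mul0r.
- rewrite /A preimage_setI.
  have m1 : measurable (past xi 0 @^-1` A1) by exact: preimage_measurable.
  have m2 : measurable (past xi 0 @^-1` A2) by exact: preimage_measurable.
  by rewrite probability1_setI.
split=> //.
- move=> p; rewrite fh0/= /fh indicE; case: (_ \in _); rewrite ?mul0r// mul1r ge_max normr_ge0 /=.
  by rewrite ge_min lexx.
- by move=> h v; exact: fhE.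
move=> h B Ah mB.
have mfhh : measurable_fun setT (fun v => fh t (v, h)) by exact: measurable_fun_pair1.
have fh0h v : 0 <= fh t (v, h) by [].
(* The density property is assumed on orthants only; uniqueness of measures extends it to all Borel
   sets. *)
have := @orthant_measure_unique _ _ (Q t h) (density_measure (lebesgue_rV d) mfhh fh0h).
apply => // u.
  rewrite (le_lt_trans _ (ltry 1))//.
  rewrite -(@prob_kernel _ _ _ _ _ (Q t) h) le_measure// ?inE//; exact: measurable_orthant.
have [ex int] := A1H _ Ah.1 t t01.
rewrite /= /density_measure (eq_integral (fun v => (cond_pdf Q v t h)%:E)) ?int.
  rewrite fineK// ge0_fin_numE// (le_lt_trans _ (ltry 1))//.
  rewrite -(@prob_kernel _ _ _ _ _ (Q t) h) le_measure// ?inE//; exact: measurable_orthant.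
by move=> v _; rewrite fhE.
Qed.

End one_step_density.

(** * Lebesgue measure and continuity on R^d *)

Section continuous_measurable.
Context {R : realType} (d : nat).

Lemma measurable_rV_itv (a b : 'rV[R]_d) :
  measurable [set v : 'rV[R]_d | forall i, a ord0 i <= v ord0 i <= b ord0 i].
Proof.
rewrite (_ : [set _ | _] = \bigcap_(i in [set: 'I_d])
    ((fun v : 'rV[R]_d => v ord0 i) @^-1` `[a ord0 i, b ord0 i]%classic)); last first.
  apply/seteqP; split => v /= h i; first by move=> _ /=; rewrite in_itv/= h.
  by have := h i I; rewrite /= in_itv.
apply: fin_bigcap_measurable => // i _.
by rewrite -[X in measurable X]setTI; exact: measurable_rV_coord.
Qed.

Lemma open_measurable_rV (O : set 'rV[R]_d) : open O -> measurable O.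
Proof.
move=> oO.
(* Countably many closed grid cells, with integer corners and mesh [1 / (n + 1)]. A point of an open
   set lies in a cell contained in it as soon as the mesh is below the radius of a ball inside the
   set. *)
pose box (p : 'rV[int]_d * nat) : set 'rV[R]_d := [set v | forall i,
  (\row_j ((p.1 ord0 j)%:~R / p.2.+1%:R : R)) ord0 i <= v ord0 i <=
  (\row_j (((p.1 ord0 j)%:~R + 1) / p.2.+1%:R : R)) ord0 i].
have -> : O = \bigcup_p (if pselect (box p `<=` O) then box p else set0).
  apply/seteqP; split; last by move=> v [p _]; case: pselect => // sub /sub.
  move=> v Ov; have : nbhs v O by exact: open_nbhs_nbhs.
  move=> /nbhs_ballP[e /= e0 eO].
  pose n := Num.truncn e^-1.
  pose p : 'rV[int]_d * nat := (\row_i Num.floor (v ord0 i * n.+1%:R), n).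
  have ne : n.+1%:R^-1 < e.
    by rewrite invf_plt ?posrE//; have /andP[] := truncn_itv (ltW (divr_gt0 ltr01 e0)); rewrite mul1r.
  exists p => //; case: pselect => /= [_ i|].
    rewrite !mxE; apply/andP; split.
      by rewrite ler_pdivrMr// ge_floor.
    by rewrite ler_pdivlMr// ltW//; have := lt_succ_floor (v ord0 i * n.+1%:R); rewrite intrD.
  case=> w H; apply: eO; rewrite /ball/=; split=> // i j; rewrite !ord1.
  have := H j; rewrite !mxE => /andP[h1 h2].
  have h3 : (Num.floor (v ord0 j * n.+1%:R))%:~R / n.+1%:R <= v ord0 j.
    by rewrite ler_pdivrMr// ge_floor.
  have h4 : v ord0 j < ((Num.floor (v ord0 j * n.+1%:R))%:~R + 1) / n.+1%:R.
    by rewrite ltr_pdivlMr//; have := lt_succ_floor (v ord0 j * n.+1%:R); rewrite intrD.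
  move: h2 h4; rewrite mulrDl mul1r => h2 h4.
  rewrite /ball/= (_ : 0 = ord0)//; move: h1 h2 h3 h4; rewrite /p /=.
  move: (_%:~R / _) ne => z; move: (n.+1%:R^-1) => y ne h1 h2 h3 h4.
  by rewrite ltr_norml; apply/andP; split; lra.
apply: countable_bigcupT_measurable; first exact: countableP.
by move=> p; case: ifP => // _; exact: measurable_rV_itv.
Qed.

Lemma within_continuous_measurable_rV (D : set 'rV[R]_d) (f : 'rV[R]_d -> R) :
  measurable D -> {within D, continuous f} -> measurable_fun D f.
Proof.
move=> mD cf; apply: (measurability _ (RGenOpens.measurableE R)) => //.
move=> _ [_ [a [b ->] <-]].
move/continuousP : cf => /(_ _ (@interval_open R (BRight a) (BLeft b) isT isT)).
move=> /open_subspaceP[V oV VD].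
by rewrite setIC -VD; apply: measurableI => //; exact: open_measurable_rV.
Qed.

Lemma continuous_measurable_rV (f : 'rV[R]_d -> R) : continuous f -> measurable_fun setT f.
Proof. by move=> cf; apply: within_continuous_measurable_rV => //; exact: continuous_subspaceT. Qed.

End continuous_measurable.

(** * Affine change of variables for Lebesgue measure *)

Section rescaling.
Context {R : realType} (d : nat).
Implicit Types (u v a b : 'rV[R]_d).

Let box a b : set 'rV[R]_d := [set v | forall i, a ord0 i <= v ord0 i <= b ord0 i].

Let boxes : set (set 'rV[R]_d) := [set B | exists a b, B = box a b].

Let boxesI : setI_closed boxes.
Proof.
move=> _ _ [a [b ->]] [a' [b' ->]].
exists (\row_i Num.max (a ord0 i) (a' ord0 i)), (\row_i Num.min (b ord0 i) (b' ord0 i)).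
apply/seteqP; split => v.
  by move=> [h1 h2] i; have := h1 i; have := h2 i; rewrite !mxE ge_max le_min => /andP[-> ->] /andP[-> ->].
by move=> h; split=> i; have := h i; rewrite !mxE ge_max le_min => /andP[/andP[? ?] /andP[? ?]]; apply/andP.
Qed.

Let cover_boxes : \bigcup_n (box (const_mx (- n%:R)) (const_mx n%:R)) = setT.
Proof.
apply/seteqP; split=> // v _.
exists (Num.truncn (\sum_i `|v ord0 i|)).+1 => // i; rewrite !mxE -ler_norml.
have /andP[_ /ltW] := truncn_itv (sumr_ge0 _ (fun i _ => normr_ge0 (v ord0 i)) : 0 <= \sum_i `|v ord0 i|).
apply: le_trans; rewrite (bigD1 i)//=.
by rewrite ler_wpDr// sumr_ge0.
Qed.

Let boxesE : @measurable _ 'rV[R]_d = <<s boxes >>.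
Proof.
apply/seteqP; split; last first.
  apply: smallest_sub; first exact: sigma_algebra_measurable.
  by move=> _ [a [b ->]]; exact: measurable_rV_itv.
rewrite rV_measurableE; apply: smallest_sub; first exact: smallest_sigma_algebra.
move=> _ [u _ <-].
rewrite (_ : orthant u = \bigcup_n box (const_mx (- n%:R)) u).
  by apply: sigma_algebra_bigcup => n; apply: sub_sigma_algebra; exists (const_mx (- n%:R)), u.
apply/seteqP; split => [v vu|v [n _ h] i]; last by have /andP[] := h i.
have : setT v by []; rewrite -cover_boxes => -[n _ h].
by exists n => // i; rewrite vu andbT; have /andP[] := h i.
Qed.

Lemma measurable_rescaling (c : R) u : measurable_fun setT (fun s : 'rV[R]_d => u - c *: s).
Proof.
apply/measurable_fun_rVP => i; under eq_fun do rewrite !mxE.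
apply: measurable_funB => //; apply: measurable_funM => //.
exact: measurable_rV_coord.
Qed.

Lemma lebesgue_rV_box0 a b i : b ord0 i < a ord0 i -> lebesgue_rV d (box a b) = 0%E.
Proof.
move=> ba; rewrite (_ : box a b = set0) ?measure0//.
by rewrite -subset0 => v /(_ i)/andP[h1 h2]; have := le_trans h1 h2; rewrite leNgt ba.
Qed.

(** Both sides define measures, compared on boxes. The map reverses the order of each coordinate, so
    the preimage of the box from [a] to [b] runs from [(u - b) / c] to [(u - a) / c]. *)
Lemma lebesgue_rV_rescale (c : R) u (g : 'rV[R]_d -> \bar R) : 0 < c ->
  measurable_fun setT g -> (forall v, 0 <= g v)%E ->
  (\int[lebesgue_rV d]_v g v = (c ^+ d)%:E * \int[lebesgue_rV d]_s g (u - c *: s)%R)%E.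
Proof.
move=> c0 mg g0.
have cd0 : 0 <= c ^+ d by rewrite exprn_ge0// ltW.
pose im : {measure set 'rV[R]_d -> \bar R} := image_measure (lebesgue_rV d) (measurable_rescaling c u).
pose m2 : {measure set 'rV[R]_d -> \bar R} := mscale (NngNum cd0) im.
transitivity (\int[m2]_v g v)%E; last first.
  rewrite /m2 ge0_integral_mscale//=; congr (_ * _)%E.
  by rewrite /im ge0_integral_image.
apply: eq_measure_integral => A mA _; apply: (measure_unique boxes (fun n => box (const_mx (- n%:R)) (const_mx n%:R))) => //.
- by move=> n; exists (const_mx (- n%:R)), (const_mx n%:R).
- move=> _ [a [b ->]]; rewrite /m2 /= /mscale /= /im /= /image_measure.
  rewrite (_ : _ @^-1` _ = box (c^-1 *: (u - b)) (c^-1 *: (u - a))); last first.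
    apply/seteqP; split => s h i; have := h i; rewrite !mxE !ler_pdivrMl// !ler_pdivlMl//.
      by move=> /andP[h1 h2]; apply/andP; split; lra.
    by move=> /andP[h1 h2]; apply/andP; split; lra.
  (* The product formula for the volume needs ordered corners; a box with some reversed side is
     empty, and so is its preimage. *)
  have [ab|/existsNP[i /negP]] := pselect (forall i, a ord0 i <= b ord0 i); last first.
    rewrite -ltNge => ba; rewrite (lebesgue_rV_box0 ba) (@lebesgue_rV_box0 _ _ i) ?mule0//.
    by rewrite !mxE ltr_pM2l ?invr_gt0// ltrD2l ltrN2.
  rewrite !lebesgue_rV_box//; last first.
    by move=> i; rewrite !mxE ler_pM2l ?invr_gt0// lerB.
  rewrite -EFinM; congr EFin.
  transitivity (\prod_(i < d) (c * (c^-1 * (b ord0 i - a ord0 i)))).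
    by apply: eq_bigr => i _; rewrite mulrA divff ?mul1r// gt_eqF.
  rewrite big_split/= prodr_const card_ord; congr (_ * _).
  by apply: eq_bigr => i _; rewrite !mxE; ring.
- move=> n; have h : lebesgue_rV d (box (const_mx (- n%:R)) (const_mx n%:R)) = (\prod_(i < d) ((const_mx n%:R : 'rV[R]_d) ord0 i - (const_mx (- n%:R) : 'rV[R]_d) ord0 i))%:E.
    apply: (@lebesgue_rV_box _ _ (const_mx (- n%:R)) (const_mx n%:R : 'rV[R]_d)) => i; rewrite !mxE.
    by rewrite -subr_ge0 opprK addr_ge0.
  exact: (eq_ind_r (fun x => (x < +oo)%E) (ltry _) h).
Qed.

End rescaling.

(** * Functions continuous on space-time: uniformity in time *)

Section space_time.
Context {R : realType} (d : nat) (G : 'rV[R]_d -> R -> R).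
Hypothesis cG : {within setT `*` `[0, 1], continuous (fun p : 'rV[R]_d * R^o => G p.1 p.2)}.

Let cG_at (u : 'rV[R]_d) (t : R) (A : set R) : `[0, 1]%classic t -> nbhs (G u t) A ->
  exists U V, [/\ nbhs u U, nbhs t V & forall v r, U v -> V r -> `[0, 1]%classic r -> A (G v r)].
Proof.
move=> t01 nA; have D : (setT `*` `[0, 1]%classic : set ('rV[R]_d * R^o)) (u, t) by [].
have : nbhs_subspace (A := setT `*` `[0, 1]%classic : set ('rV[R]_d * R^o)) (u, t)
  ((fun p : 'rV[R]_d * R^o => G p.1 p.2) @^-1` A) by apply: (@cG (u, t)).
rewrite -(nbhs_subspace_in D) => -[[U V] /= [nU nV] UV].
by exists U, V; split=> // v r Uv Vr r01; apply: (UV (v, r)).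
Qed.

Lemma space_time_continuous_l (t : R) : `[0, 1]%classic t -> continuous (fun v => G v t).
Proof.
move=> t01 v A nA; have [U [V [nU nV UV]]] := cG_at t01 nA.
have : U `<=` (G ^~ t) @^-1` A by move=> w Uw; apply: UV => //; exact: nbhs_singleton nV.
by move/filterS; apply.
Qed.

Lemma space_time_continuous_r (u : 'rV[R]_d) : {within `[0, 1], continuous (G u)}.
Proof.
move=> t; rewrite /continuous_at; case: (nbhs_subspaceP (`[0, 1]%classic : set R) t) => t01.
  move=> A nA; have [U [V [nU nV UV]]] := cG_at t01 nA.
  apply: filterS nV => r Vr r01; apply: UV => //; exact: nbhs_singleton nU.
by move=> A nA x /= ->; exact: nbhs_singleton nA.
Qed.

(** Compactness of the time interval turns continuity at every [(u, t)] into one radius around [u]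
    valid for all times. *)
Lemma space_time_equicontinuous (u : 'rV[R]_d) (e : R) : 0 < e ->
  exists2 r, 0 < r & forall (v : 'rV[R]_d) (t : R), `[0, 1]%classic t -> (forall i, `|u ord0 i - v ord0 i| < r) ->
    `|G u t - G v t| <= e.
Proof.
move=> e0; have e20 : 0 < e / 2 by rewrite divr_gt0.
have cI : compact (`[0, 1]%classic : set R) by exact: segment_compact.
have : nbhs u (fun v => forall t : R, `[0, 1]%classic t -> `[0, 1]%classic t -> `|G u t - G v t| <= e).
  apply: ((compact_near_coveringP _).1 cI _ (nbhs u) (fun v t => `[0, 1]%classic t -> `|G u t - G v t| <= e) _) => t t01.
  have [U [V [nU nV UV]]] := cG_at t01 (nbhsx_ballx (G u t) _ e20).
  exists (V, U) => //= -[r v] /= [Vr Uv] r01.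
  have h1 := UV v r Uv Vr r01; have h2 := UV u r (nbhs_singleton nU) Vr r01.
  move: h1 h2; rewrite /ball/= => h1 h2; rewrite (splitr e) -(subrKA (G u t)).
  by apply: le_trans (ler_normD _ _) _; rewrite [`|_ - G u t|]distrC lerD// ltW.
move=> /nbhs_ballP[r /= r0 H]; exists r => // v t t01 uv; apply: H => //=.
by rewrite /ball/=; split=> // i j; rewrite /ball/= !ord1.
Qed.

Lemma space_time_bounded (u : 'rV[R]_d) (r : R) : exists M, forall (v : 'rV[R]_d) (t : R), `[0, 1]%classic t ->
  (forall i, `|u ord0 i - v ord0 i| <= r) -> `|G v t| <= M.
Proof.
have cB : compact [set v : 'rV[R]_d | forall i, `[u ord0 i - r, u ord0 i + r]%classic (v ord0 i)].
  by apply: (@rV_compact R _ (fun i => `[u ord0 i - r, u ord0 i + r]%classic)) => i; exact: segment_compact.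
have cI : compact (`[0, 1]%classic : set R^o) by exact: segment_compact.
have /compact_bounded[M [_ HM]] : compact ((fun p : 'rV[R]_d * R^o => G p.1 p.2) @`
    ([set v : 'rV[R]_d | forall i, `[u ord0 i - r, u ord0 i + r]%classic (v ord0 i)] `*` `[0, 1]%classic) : set R^o).
  apply: continuous_compact; last exact: compact_setX.
  by apply: continuous_subspaceW cG => p [].
exists (M + 1) => v t t01 uv; apply: (HM (M + 1)); first by rewrite ltrDl.
exists (v, t) => //; split=> // i; have := uv i; rewrite ler_norml /= in_itv/= => /andP[h1 h2].
by apply/andP; split; lra.
Qed.

End space_time.

Section kernel.
Context {R : realType} (d : nat) (K : 'rV[R]_d -> R).
Hypothesis HK : is_kernel K.

Lemma kernel_out s : ~ cube s -> K s = 0.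
Proof.
case: HK => <- _ _ _ H; apply/eqP; apply: contrapT => Ks; apply: H.
by apply: subset_closure => /=; exact/negP.
Qed.

Lemma kernel_continuous : {within @cube R d, continuous K}.
Proof. by case: HK => _ _ []. Qed.

Lemma measurable_cube : measurable (@cube R d).
Proof.
have := measurable_rV_itv (const_mx (-1)) (const_mx 1 : 'rV[R]_d); congr measurable.
by apply/seteqP; split => v h i; have := h i; rewrite !mxE.
Qed.

Lemma measurable_kernel_fun : measurable_fun setT K.
Proof.
have := within_continuous_measurable_rV measurable_cube kernel_continuous.
rewrite (measurable_restrictT K measurable_cube); congr measurable_fun.
apply/funext => s; rewrite /patch; case: ifPn => // /negP Ks.
by rewrite kernel_out// => ?; apply: Ks; rewrite inE.
Qed.

Lemma kernel_bounded : exists2 M, 0 < M & forall s, `|K s| <= M.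
Proof.
have cC : compact (@cube R d).
  rewrite (_ : @cube R d = [set v | forall i, `[-1, 1]%classic (v ord0 i)]).
    by apply: (@rV_compact R _ (fun=> `[-1, 1]%classic)) => i; exact: segment_compact.
  by apply/seteqP; split => v h i; have := h i; rewrite /= in_itv.
have /compact_bounded[M [_ HM]] := continuous_compact kernel_continuous cC.
exists (`|M| + 1) => [|s]; first by rewrite ltr_wpDl.
have [Ks|Ks] := pselect (cube s); last by rewrite kernel_out// normr0 addr_ge0.
apply: (HM (`|M| + 1)); last by exists s.
by rewrite (le_lt_trans (ler_norm M))// ltrDl.
Qed.

Lemma lebesgue_cube : lebesgue_rV d (@cube R d) = (2 ^+ d)%:E.
Proof.
transitivity (lebesgue_rV d [set v | forall i, (const_mx (-1) : 'rV[R]_d) ord0 i <= v ord0 i <= (const_mx 1 : 'rV[R]_d) ord0 i]).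
  by congr (lebesgue_rV d _); apply/seteqP; split => v h i; have := h i; rewrite !mxE.
rewrite lebesgue_rV_box => [|i]; last by rewrite !mxE; lra.
congr EFin; transitivity (\prod_(i < d) (2 : R)); last by rewrite prodr_const card_ord.
by apply: eq_bigr => i _; rewrite !mxE; lra.
Qed.

End kernel.

(** * Variance of sums of predictable integrals *)

Lemma cauchy_schwarz {R : realType} d (T : measurableType d) (P : probability T R) (X Y : T -> R) (a b : R) :
  measurable_fun setT X -> measurable_fun setT Y ->
  P.-integrable setT (EFin \o (fun w => X w ^+ 2)) -> P.-integrable setT (EFin \o (fun w => Y w ^+ 2)) ->
  0 <= a -> 0 <= b -> expect P (fun w => X w ^+ 2) <= a ^+ 2 -> expect P (fun w => Y w ^+ 2) <= b ^+ 2 ->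
  (\int[P]_w (`|X w * Y w|)%:E <= (a * b)%:E)%E.
Proof.
move=> mX mY iX iY a0 b0 Xa Yb.
have iXY : P.-integrable setT (EFin \o (fun w => `|X w * Y w|)).
  apply: (@integ_dom _ _ _ P _ (fun w => X w ^+ 2 + Y w ^+ 2)); last exact: integD.
    by apply: measurableT_comp => //; exact: measurable_funM.
  move=> w; rewrite normr_id normrM -(real_normK (num_real (X w))) -(real_normK (num_real (Y w))).
  have := sqr_ge0 (`|X w| - `|Y w|); have := mulr_ge0 (normr_ge0 (X w)) (normr_ge0 (Y w)).
  by rewrite sqrrB mulr2n; lra.
have key r : 0 < r -> expect P (fun w => `|X w * Y w|) <= (a + r) * (b + r).
  move=> r0; have ar : 0 < a + r by rewrite ltr_wpDl.
  have br : 0 < b + r by rewrite ltr_wpDl.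
  (* The weight that balances the two squares. The positive [r] is added because [a] and [b] are
     mere bounds and may vanish. *)
  pose s := (b + r) / (a + r); have s0 : 0 < s by rewrite divr_gt0.
  have h w : `|X w * Y w| <= 2^-1 * (s * X w ^+ 2 + s^-1 * Y w ^+ 2).
    rewrite normrM -(real_normK (num_real (X w))) -(real_normK (num_real (Y w))).
    set x := `|X w|; set y := `|Y w|.
    have : 0 <= s^-1 * (s * x - y) ^+ 2 by rewrite mulr_ge0 ?sqr_ge0// invr_ge0 ltW.
    rewrite (_ : s^-1 * _ = s * x ^+ 2 + s^-1 * y ^+ 2 - 2 * (x * y)); last by field; rewrite gt_eqF.
    by lra.
  apply: (le_trans (expect_le iXY _ h)); first exact/integZ/integD/integZ/iY/integZ.
  rewrite expectZ; last exact/integD/integZ/iY/integZ.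
  rewrite expectD; [|exact/integZ..]; rewrite !expectZ//.
  apply: (@le_trans _ _ (2^-1 * (s * (a + r) ^+ 2 + s^-1 * (b + r) ^+ 2))).
    rewrite ler_wpM2l ?invr_ge0// lerD// ler_wpM2l ?invr_ge0 ?(ltW s0)//.
      by apply: (le_trans Xa); rewrite lerXn2r ?nnegrE ?(ltW ar)// lerDl ltW.
    by apply: (le_trans Yb); rewrite lerXn2r ?nnegrE ?(ltW br)// lerDl ltW.
  by rewrite /s le_eqVlt; apply/orP; left; apply/eqP; field; rewrite !gt_eqF.
have E : expect P (fun w => `|X w * Y w|) <= a * b.
  apply/ler_addgt0Pr => e e0.
  (* For [r <= 1], [(a + r) (b + r) <= a b + r (a + b + 1)]. *)
  pose r := Num.min 1 (e / (a + b + 1)).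
  have ab : 0 < a + b + 1 by rewrite ltr_wpDl// addr_ge0.
  have r0 : 0 < r by rewrite lt_min ltr01 divr_gt0.
  have r1 : r <= 1 by rewrite ge_min lexx.
  have re : r * (a + b + 1) <= e by rewrite -ler_pdivlMr// ge_min lexx orbT.
  apply: (le_trans (key r r0)).
  have : r * r <= r by rewrite ler_piMr// ltW.
  by nra.
move: E; rewrite expectE /Rintegral -lee_fin fineK//.
exact: integrable_fin_num iXY.
Qed.

Section weighted_integral.
Context {R : realType} dV (V : measurableType dV) (mu : {sigma_finite_measure set V -> \bar R}).
Context dH (H : measurableType dH).

Definition weighted_integral (w : V -> R) (phi : V * H -> R) (h : H) : R :=
  Rintegral mu setT (fun v => w v * phi (v, h)).

Lemma measurable_param_integral (g : V * H -> R) : measurable_fun setT g ->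
  measurable_fun setT (fun h => Rintegral mu setT (fun v => g (v, h))).
Proof.
move=> mg; apply: measurableT_comp; first exact: fine_measurable.
under eq_fun do rewrite integralE.
have mgE : measurable_fun setT (fun p : H * V => (g (p.2, p.1))%:E).
  by apply/measurable_EFinP; apply: (measurableT_comp mg); apply: measurable_fun_pair => //.
apply: emeasurable_funB.
  apply: (@measurable_fun_fubini_tonelli_F _ _ _ _ _ mu (fun p : H * V => ((fun v => (g (v, p.1))%:E)^\+ p.2)%E)).
    rewrite (_ : (fun _ => _) = (fun p : H * V => (g (p.2, p.1))%:E)^\+%E); first exact: measurable_funepos.
    by apply/funext => -[h v]; rewrite !funeposE.
  by [].
apply: (@measurable_fun_fubini_tonelli_F _ _ _ _ _ mu (fun p : H * V => ((fun v => (g (v, p.1))%:E)^\- p.2)%E)).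
  rewrite (_ : (fun _ => _) = (fun p : H * V => (g (p.2, p.1))%:E)^\-%E); first exact: measurable_funeneg.
  by apply/funext => -[h v]; rewrite !funenegE.
by [].
Qed.

Variables (w : V -> R) (phi : V * H -> R) (B c : R).
Hypotheses (mw : measurable_fun setT w) (mphi : measurable_fun setT phi).
Hypothesis wB : (\int[mu]_v (`|w v|)%:E <= B%:E)%E.
Hypothesis phic : forall p, 0 <= phi p <= c.

Lemma measurable_section h : measurable_fun setT (fun v => phi (v, h)).
Proof. exact: measurable_fun_pair1. Qed.

Lemma weighted_integrable h : mu.-integrable setT (EFin \o (fun v => w v * phi (v, h))).
Proof.
have mwp : measurable_fun setT (fun v => w v * phi (v, h)).
  by apply: measurable_funM => //; exact: measurable_section.
apply/integrableP; split; first exact/measurable_EFinP.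
have c0 : 0 <= c by case/andP: (phic (point, h)); exact: le_trans.
apply: (@le_lt_trans _ _ (\int[mu]_v (c%:E * (`|w v|)%:E))%E).
  apply: ge0_le_integral => //.
  - by apply: measurableT_comp => //; exact/measurable_EFinP.
  - apply: emeasurable_funM => //; apply/measurable_EFinP; exact: measurableT_comp.
  move=> v _; have /andP[p0 pc] := phic (v, h).
  by rewrite -EFinM lee_fin normrM mulrC ler_wpM2r// ger0_norm.
rewrite ge0_integralZl//; last by apply/measurable_EFinP; exact: measurableT_comp.
by apply: lte_mul_pinfty => //; exact: le_lt_trans wB (ltry _).
Qed.

Lemma measurable_weighted_integral : measurable_fun setT (weighted_integral w phi).
Proof.
apply: (@measurable_param_integral (fun p => w p.1 * phi p)).
by apply: measurable_funM => //; exact: (measurableT_comp mw measurable_fst).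
Qed.

Lemma weighted_integral_le h : `|weighted_integral w phi h| <= c * B.
Proof.
have c0 : 0 <= c by case/andP: (phic (point, h)); exact: le_trans.
have iw := weighted_integrable h.
apply: (le_trans (le_normr_Rintegral measurableT iw)).
rewrite -lee_fin /Rintegral fineK; last first.
  by have := integrable_fin_num measurableT (integrable_norm iw).
apply: (@le_trans _ _ (\int[mu]_v (c%:E * (`|w v|)%:E))%E).
  apply: ge0_le_integral => //.
  - apply/measurable_EFinP; apply: measurableT_comp => //; apply: measurable_funM => //; exact: measurable_section.
  - apply: emeasurable_funM => //; apply/measurable_EFinP; exact: measurableT_comp.
  move=> v _; have /andP[p0 pc] := phic (v, h).
  by rewrite -EFinM lee_fin normrM mulrC ler_wpM2r// ger0_norm.
rewrite ge0_integralZl//; last by apply/measurable_EFinP; exact: measurableT_comp.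
by rewrite EFinM lee_wpmul2l.
Qed.

End weighted_integral.

Section predictable_variance.
Context {R : realType} d (Omega : measurableType d) (P : probability Omega R).
Context dE (E : measurableType dE) dV (V : measurableType dV).
Variable mu : {sigma_finite_measure set V -> \bar R}.
Variables (xi xi' : int -> Omega -> E).
Hypothesis iid_xi : iid P (joint xi xi').
Variables (phi : nat -> V * history E -> R) (c : R) (ps : nat -> R) (Psi0 : R).
Variables (w : nat -> V -> R) (B : R).
Hypothesis mphi : forall k, measurable_fun setT (phi k).
Hypothesis phic : forall k p, 0 <= phi k p <= c.
Hypothesis ps0 : forall l, 0 <= ps l.
Hypothesis ps_sum : forall N, \sum_(l < N) ps l <= Psi0.
Hypothesis ps_bound : forall k l v, expect P (fun x =>
  (phi k (v, past xi l%:Z x) - phi k (v, past (coupled xi xi') l%:Z x)) ^+ 2) <= ps l ^+ 2.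
Hypothesis mw : forall k, measurable_fun setT (w k).
Hypothesis wB : forall k, (\int[mu]_v (`|w k v|)%:E <= B%:E)%E.

Let cm k (h : history E) := weighted_integral mu (w k) (phi k) h.

Let mcm k : measurable_fun setT (cm k).
Proof. exact: (@measurable_weighted_integral _ _ _ _ _ _ _ _ (mw k) (mphi k)). Qed.

Let cmB k h : `|cm k h| <= c * B.
Proof. exact: (@weighted_integral_le _ _ _ _ _ _ _ _ _ _ (mw k) (mphi k) (wB k) (phic k)). Qed.

Let B0 : 0 <= B.
Proof. by rewrite -lee_fin; apply: le_trans (wB 0); apply: integral_ge0. Qed.

(** Forgets the [l] newest entries. All pasts up to time [n] are shifts of the past at [n], so the
    whole sum is one functional of one history. *)
Let shift (l : nat) (z : history E) : history E := fun j => z (j + l)%N.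

Let mshift l : measurable_fun setT (shift l).
Proof. by apply: (@measurable_prodspaceP _ E _ _ nat) => j; exact: (@measurable_coord _ E nat). Qed.

Variable n : nat.

(** Time runs backwards from [n]: coordinate [j] is the innovation at [n - j], and the second copy
    is read off [xi']. *)
Let X (i : bool * nat) : Omega -> E := if i.1 then xi' (n%:Z - i.2%:Z) else xi (n%:Z - i.2%:Z).

Let iX : iid P X.
Proof.
pose a (i : bool * nat) : int + int := if i.1 then inr (n%:Z - i.2%:Z) else inl (n%:Z - i.2%:Z).
have ia : injective a.
  by move=> [[] i] [[] j] //; rewrite /a /= => -[] /addrI /oppr_inj [] ->.
have := iid_reindex ia iid_xi; congr iid.
by apply/funext => -[[] j]; rewrite /a /X.
Qed.

Let pastE k x : (k <= n)%N -> past xi k%:Z x = shift (n - k) (mixed X none x).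
Proof.
move=> kn; apply/funext => j; rewrite /shift /past /mixed /X /none /=; congr (xi _ x).
by rewrite PoszD -subzn//; ring.
Qed.

(** Coordinate [j] of the past at [n] is invisible to the past at [n - l] when [j < l]. Otherwise it
    is the innovation [j - l] steps back, and relabelling moves it to time 0, which is the coupling
    in the dependence measure. *)
Let law_diff k l j v : expect P (fun x =>
  (phi k (v, shift l (mixed X none x)) - phi k (v, shift l (mixed X (eq_op^~ j) x))) ^+ 2)
  <= (if (j < l)%N then 0 else ps (j - l)) ^+ 2.
Proof.
case: ltnP => jl.
  rewrite (_ : (fun _ => _) = fun=> 0) ?expect_cst ?expr0n//.
  apply/funext => x; rewrite (_ : shift l (mixed X (eq_op^~ j) x) = shift l (mixed X none x)) ?subrr ?expr0n//.
  apply/funext => i; rewrite /shift /mixed /none.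
  by rewrite (_ : (i + l)%N == j = false)//; apply/eqP => h; move: jl; rewrite -h ltnNge leq_addl.
apply: le_trans (ps_bound k (j - l) v); rewrite le_eqVlt; apply/orP; left; apply/eqP.
pose F (h : prodspace E (bool * nat)%type) : R :=
  (phi k (v, (fun i => h (false, i)) : history E) - phi k (v, (fun i => h (i == (j - l)%N, i)) : history E)) ^+ 2.
have mphi2 : measurable_fun setT (fun h : history E => phi k (v, h)) by exact: measurable_fun_pair2.
have mre (g : nat -> bool * nat) : measurable_fun setT
    ((fun h i => h (g i)) : prodspace E (bool * nat)%type -> history E).
  by apply: (@measurable_prodspaceP _ E _ _ nat) => i; exact: measurable_coord.
have mF : measurable_fun setT F.
  apply: measurable_funX; apply: measurable_funB.
    exact: (measurableT_comp mphi2 (mre (fun i => (false, i)))).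
  exact: (measurableT_comp mphi2 (mre (fun i => (i == (j - l)%N, i)))).
pose a (i : bool * nat) : int + int :=
  if i.1 then inr (n%:Z - l%:Z - i.2%:Z) else inl (n%:Z - l%:Z - i.2%:Z).
pose b (i : bool * nat) : int + int :=
  if i.1 then inr ((j - l)%N%:Z - i.2%:Z) else inl ((j - l)%N%:Z - i.2%:Z).
have ia : injective a by move=> [[] i] [[] i'] //; rewrite /a /= => -[] /addrI /oppr_inj [] ->.
have ib : injective b by move=> [[] i] [[] i'] //; rewrite /b /= => -[] /addrI /oppr_inj [] ->.
have := @iid_law_reindex _ _ _ P _ E _ _ (joint xi xi') a b iid_xi ia ib (EFin \o F) _ _.
move=> H; rewrite !expectE /Rintegral; congr fine; apply: etrans (etrans (H _ _) _).
- apply: eq_integral => x _ /=; congr (((_ - _) ^+ 2)%:E); congr (phi k (v, _)); apply/funext => i.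
    by rewrite /shift /mixed /X /none /a /=; congr (xi _ x); rewrite PoszD; ring.
  rewrite /shift /mixed /X /a /= (_ : (i == (j - l)%N) = ((i + l)%N == j)); last first.
    by rewrite -(eqn_add2r l) subnK.
  by case: ifP => _ /=; [congr (xi' _ x)|congr (xi _ x)]; rewrite PoszD; ring.
- exact/measurable_EFinP.
- by move=> h; rewrite lee_fin sqr_ge0.
apply: eq_integral => x _ /=; congr (((_ - _) ^+ 2)%:E); congr (phi k (v, _)); apply/funext => i.
rewrite /past /coupled /b /= subr_eq0 eqz_nat eq_sym.
case: eqP => [->|_] //=; by rewrite subrr.
Qed.

Let T k j x := cm k (shift (n - k) (mixed X none x)) - cm k (shift (n - k) (mixed X (eq_op^~ j) x)).

Let mZ l p : measurable_fun setT (fun x => shift l (mixed X p x)).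
Proof. exact: (measurableT_comp (mshift l) (measurable_mixed iX p)). Qed.

Let mT k j : measurable_fun setT (T k j).
Proof.
by apply: measurable_funB; apply: (measurableT_comp (mcm k)); exact: mZ.
Qed.

Let rate l j := if (j < l)%N then 0 else ps (j - l).

(** Minkowski's inequality for integrals, in dual form: after testing with [Y] and exchanging the
    integrals, Cauchy-Schwarz is applied at each fixed [v], and the weight is integrated last. *)
Let expect_TY k j (Y : Omega -> R) (M y : R) : measurable_fun setT Y -> (forall x, `|Y x| <= M) ->
  0 <= y -> expect P (fun x => Y x ^+ 2) <= y ^+ 2 ->
  expect P (fun x => T k j x * Y x) <= B * (rate (n - k) j * y).
Proof.
move=> mY YM y0 Yy.
pose z1 x := shift (n - k) (mixed X none x); pose z2 x := shift (n - k) (mixed X (eq_op^~ j) x).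
have iY : P.-integrable setT (EFin \o Y) by exact: bounded_integrable YM.
have iT : P.-integrable setT (EFin \o (T k j)).
  by apply: integB; apply: (@bounded_integrable _ _ _ P _ (c * B)) => [|x]; (try exact: cmB);
    apply: (measurableT_comp (mcm k)); exact: mZ.
have iTY : P.-integrable setT (EFin \o (fun x => T k j x * Y x)).
  by under eq_fun do rewrite mulrC; apply: integM iT => //; exact: YM.
pose g (p : Omega * V) : R := `|w k p.2| * `|(phi k (p.2, z1 p.1) - phi k (p.2, z2 p.1)) * Y p.1|.
have mdl : measurable_fun setT (fun p : Omega * V => phi k (p.2, z1 p.1) - phi k (p.2, z2 p.1)).
  by apply: measurable_funB; apply: (measurableT_comp (mphi k)); apply: measurable_fun_pair => //;
    exact: (measurableT_comp (mZ _ _) measurable_fst).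
have mg : measurable_fun setT g.
  apply: measurable_funM; first by apply: measurableT_comp => //; exact: (measurableT_comp (mw k) measurable_snd).
  by apply: measurableT_comp => //; apply: measurable_funM => //; exact: (measurableT_comp mY measurable_fst).
have r0 : 0 <= rate (n - k) j by rewrite /rate; case: ifP.
rewrite -lee_fin; apply: (@le_trans _ _ (\int[P]_x (`|T k j x * Y x|)%:E)%E).
  rewrite expectE /Rintegral fineK; last exact: integrable_fin_num iTY.
  apply: le_integral => //; first exact: integrable_norm iTY.
  by move=> x _; rewrite lee_fin ler_norm.
apply: (@le_trans _ _ (\int[P]_x \int[mu]_v (g (x, v))%:E)%E).
  apply: ge0_le_integral => //.
  - by apply/measurable_EFinP; apply: measurableT_comp => //; exact: measurable_funM.
  - apply: (@measurable_fun_fubini_tonelli_F _ _ _ _ _ mu (EFin \o g)) => //.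
    + exact/measurable_EFinP.
    + by move=> p; rewrite lee_fin mulr_ge0.
  move=> x _; have i1 := weighted_integrable (mw k) (mphi k) (wB k) (phic k) (z1 x).
  have i2 := weighted_integrable (mw k) (mphi k) (wB k) (phic k) (z2 x).
  have TE : T k j x = Rintegral mu setT (fun v => w k v * (phi k (v, z1 x) - phi k (v, z2 x))).
    rewrite /T /cm /weighted_integral -RintegralB//.
    by apply: eq_Rintegral => v _; rewrite mulrBr.
  have i12 : mu.-integrable setT (EFin \o (fun v => w k v * (phi k (v, z1 x) - phi k (v, z2 x)))).
    have := integrableB measurableT i1 i2; congr integrable.
    by apply/funext => v /=; rewrite mulrBr.
  have i12n := integrable_norm i12.
  rewrite normrM; apply: (@le_trans _ _ (Rintegral mu setT (fun v => `|w k v * (phi k (v, z1 x) - phi k (v, z2 x))|) * `|Y x|)%:E).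
    by rewrite lee_fin ler_wpM2r// TE; exact: le_normr_Rintegral.
  rewrite /Rintegral EFinM fineK; last exact: (integrable_fin_num measurableT i12n).
  rewrite -ge0_integralZr//; last first.
    exact: (measurable_int _ i12n).
  rewrite le_eqVlt; apply/orP; left; apply/eqP; apply: eq_integral => v _.
  by rewrite /g /= -EFinM !normrM mulrA.
rewrite [leLHS](@fubini_tonelli _ _ Omega V R P mu (EFin \o g)); last 2 first.
- exact/measurable_EFinP.
- by move=> p; rewrite lee_fin mulr_ge0.
apply: (@le_trans _ _ (\int[mu]_v ((`|w k v|)%:E * (rate (n - k) j * y)%:E))%E).
  apply: ge0_le_integral => //.
  - by move=> v _; apply: integral_ge0 => x _; rewrite lee_fin mulr_ge0.
  - apply: (@measurable_fun_fubini_tonelli_G _ _ _ _ _ P (EFin \o g)) => //.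
    + exact/measurable_EFinP.
    + by move=> p; rewrite lee_fin mulr_ge0.
  - by apply: emeasurable_funM => //; apply/measurable_EFinP; exact: measurableT_comp.
  move=> v _; rewrite /g /=; under eq_integral do rewrite EFinM.
  have mphi2 : measurable_fun setT (fun h : history E => phi k (v, h)) by exact: measurable_fun_pair2.
  have m1 : measurable_fun setT (fun x => phi k (v, z1 x) - phi k (v, z2 x)).
    by apply: measurable_funB; apply: (measurableT_comp mphi2); exact: mZ.
  rewrite ge0_integralZl//; last first.
    by apply/measurable_EFinP; apply: measurableT_comp => //; exact: measurable_funM.
  apply: lee_wpmul2l; first by rewrite lee_fin.
  apply: cauchy_schwarz => //; last exact: law_diff.
    apply: (@bounded_integrable _ _ _ P _ (c ^+ 2)); first exact: measurable_funX.
    move=> x; rewrite normrX; have /andP[p1 p2] := phic k (v, z1 x); have /andP[p3 p4] := phic k (v, z2 x).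
    have c0 : 0 <= c by exact: le_trans p2.
    by rewrite lerXn2r ?nnegrE// ler_norml; apply/andP; split; lra.
  apply: (@bounded_integrable _ _ _ P _ (M ^+ 2)); first exact: measurable_funX.
  by move=> x; rewrite normrX; have := YM x; have := normr_ge0 (Y x); move=> h1 h2; rewrite lerXn2r ?nnegrE// (le_trans h1).
rewrite ge0_integralZr//; last 2 first.
- by apply/measurable_EFinP; apply: measurableT_comp.
- by rewrite lee_fin mulr_ge0.
by rewrite [leRHS]EFinM lee_wpmul2r// lee_fin mulr_ge0.
Qed.

(** Together with [rate_sum_j] this bounds the row and the column sums of the influence matrix by
    the same constant, as in a Schur test. *)
Let rate_sum_k j : \sum_(k < n) rate (n - k) j <= Psi0.
Proof.
have -> : \sum_(k < n) rate (n - k) j = \sum_(l < n) rate l.+1 j.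
  rewrite (reindex_inj rev_ord_inj)/=; apply: eq_bigr => l _; congr (rate _ j).
  by rewrite subKn.
have H N : \sum_(l < N) rate l.+1 j + \sum_(i < j - N) ps i = \sum_(i < j) ps i.
  elim: N => [|N IH]; first by rewrite big_ord0 add0r subn0.
  rewrite big_ord_recr/= -IH -addrA; congr (_ + _); rewrite /rate subnS ltnS.
  case: leqP => jN; first by rewrite (_ : j - N = 0)%N ?big_ord0 ?add0r//; apply/eqP; rewrite subn_eq0.
  have : (0 < j - N)%N by rewrite subn_gt0.
  by case: (j - N)%N => // i _; rewrite big_ord_recr addrC.
apply: le_trans (ps_sum j); rewrite -(H n) lerDl.
by apply: sumr_ge0 => i _.
Qed.

Let rate_sum_j l N : \sum_(j < N) rate l j <= Psi0.
Proof.
have -> : \sum_(j < N) rate l j = \sum_(i < N - l) ps i; last exact: ps_sum.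
elim: N => [|N IH]; first by rewrite sub0n !big_ord0.
rewrite big_ord_recr/= IH /rate; case: ltnP => Nl.
  have -> : (N.+1 - l = 0)%N by apply/eqP; rewrite subn_eq0.
  have -> : (N - l = 0)%N by apply/eqP; rewrite subn_eq0 ltnW.
  by rewrite big_ord0 addr0.
by rewrite subSn// big_ord_recr.
Qed.

Let Psi0_ge0 : 0 <= Psi0.
Proof. by have := ps_sum 0; rewrite big_ord0. Qed.

Let f (z : history E) : R := \sum_(k < n) cm k (shift (n - k) z).

Let mf : measurable_fun setT f.
Proof.
apply: measurable_sum => k; exact: (measurableT_comp (mcm k) (mshift _)).
Qed.

Let fB z : `|f z| <= n%:R * (c * B).
Proof.
apply: (le_trans (ler_norm_sum _ _ _)); apply: (@le_trans _ _ (\sum_(k < n) (c * B))).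
  by apply: ler_sum => k _; exact: cmB.
by rewrite sumr_const card_ord mulr_natl.
Qed.

Let diff_bound j : expect P (fun x => (f (mixed X none x) - f (mixed X (eq_op^~ j) x)) ^+ 2) <=
  (B * \sum_(k < n) rate (n - k) j) ^+ 2.
Proof.
pose Y x := f (mixed X none x) - f (mixed X (eq_op^~ j) x).
have YE x : Y x = \sum_(k < n) T k j x by rewrite /Y /f -sumrB.
have mY : measurable_fun setT Y.
  by apply: measurable_funB; apply: (measurableT_comp mf); exact: (measurable_mixed iX).
pose M := n%:R * (c * B) + n%:R * (c * B).
have YM x : `|Y x| <= M.
  by apply: le_trans (ler_normB _ _) _; apply: lerD; exact: fB.
have iY2 : P.-integrable setT (EFin \o (fun x => Y x ^+ 2)).
  apply: (@bounded_integrable _ _ _ P _ (M ^+ 2)); first exact: measurable_funX.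
  by move=> x; rewrite normrX lerXn2r ?nnegrE// (le_trans _ (YM x)).
set e := expect P _; have e0 : 0 <= e by apply: expect_ge0 => x; exact: sqr_ge0.
pose y := Num.sqrt e; have y0 : 0 <= y by exact: sqrtr_ge0.
have y2 : y ^+ 2 = e by rewrite sqr_sqrtr.
set S := B * _; have S0 : 0 <= S by rewrite mulr_ge0// sumr_ge0// => k _; rewrite /rate; case: ifP.
(* Duality: [e] is the expectation of [Y^2]. One factor is expanded as the sum of the [T k j], each
   is tested against the other factor, and [y^2 <= S y] is divided by [y]. *)
have : e <= S * y.
  have -> : e = \sum_(k < n) expect P (fun x => T k j x * Y x).
    rewrite -expect_sum; last first.
      move=> k; under eq_fun do rewrite mulrC; apply: (@integM _ _ _ P M) => //.
      apply: (@bounded_integrable _ _ _ P _ (c * B + c * B)); first exact: mT.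
      by move=> x; apply: le_trans (ler_normB _ _) _; rewrite lerD// cmB.
    by congr expect; apply/funext => x; rewrite -mulr_suml -YE expr2.
  rewrite /S mulr_sumr mulr_suml; apply: ler_sum => k _; rewrite -mulrA.
  by apply: (@expect_TY k j Y M y) => //; rewrite y2.
rewrite -y2 => h; have [y00|yn0] := eqVneq y 0; first by rewrite y00 expr0n sqr_ge0.
have yp : 0 < y by rewrite lt_def yn0.
by rewrite lerXn2r ?nnegrE//; move: h; rewrite expr2 ler_pM2r.
Qed.

(* Efron-Stein: replacing one innovation changes the integral at lag [l] by a weighted integral of a density
   increment, of [L^2] norm at most [B * ps l]. *)
Lemma predictable_variance :
  expect P (fun x => (\sum_(k < n) weighted_integral mu (w k) (phi k) (past xi k%:Z x)) ^+ 2) -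
  expect P (fun x => \sum_(k < n) weighted_integral mu (w k) (phi k) (past xi k%:Z x)) ^+ 2 <=
  n%:R * (B * Psi0) ^+ 2.
Proof.
pose S x := \sum_(k < n) cm k (past xi k%:Z x).
rewrite -/(cm _) -/S.
pose M := n%:R * (c * B).
have SE x : S x = f (mixed X none x).
  by apply: eq_bigr => k _; rewrite pastE// ltnW.
have mS : measurable_fun setT S.
  have : measurable_fun setT (f \o mixed X none) by exact: (measurableT_comp mf (measurable_mixed iX _)).
  by congr measurable_fun; apply/funext => x; rewrite SE.
have iS : P.-integrable setT (EFin \o S) by apply: (@bounded_integrable _ _ _ P _ M) => // x; rewrite SE; exact: fB.
have M0 : 0 <= M by apply: le_trans (fB point).
have iS2 : P.-integrable setT (EFin \o (fun x => S x ^+ 2)).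
  apply: (@bounded_integrable _ _ _ P _ (M ^+ 2)); first exact: measurable_funX.
  by move=> x; rewrite normrX lerXn2r ?nnegrE// SE.
(* [efron_stein] is stated for nonnegative functionals; adding the constant [M] makes [f]
   nonnegative without changing its variance. *)
have mf' : measurable_fun setT (fun z => f z + M) by exact: measurable_funD.
have f'b z : 0 <= f z + M <= M + M.
  by have := fB z; rewrite ler_norml => /andP[h1 h2]; apply/andP; split; [rewrite -lerBlDr sub0r|rewrite lerD2r].
have := @efron_stein _ _ _ P _ E X iX (fun z => f z + M) (M + M) mf' f'b (n%:R * (B * Psi0) ^+ 2) _.
have -> : (fun x => f (mixed X none x) + M) = (fun x => S x + M) by apply/funext => x; rewrite SE.
have -> : expect P (fun x => (f (mixed X none x) + M) ^+ 2) = expect P (fun x => S x ^+ 2) + 2 * M * expect P S + M ^+ 2.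
  rewrite -expectZ// -expectD//; last exact: integZ.
  rewrite -[X in _ + X](expect_cst P) -expectD; last 2 first.
  - by apply: integD => //; exact: integZ.
  - exact: integ_cst.
  by congr expect; apply/funext => x; rewrite SE; ring.
rewrite expectD//; last exact: integ_cst.
rewrite expect_cst => H.
have {}H : expect P (fun x => S x ^+ 2) - expect P S ^+ 2 <= 2^-1 * (n%:R * (B * Psi0) ^+ 2).
  apply: le_trans (H _); first by rewrite le_eqVlt; apply/orP; left; apply/eqP; ring.
  move=> N.
  (* In each square one factor is bounded by a sum over [k], at most [Psi0]. The other is kept and
     summed over [j] first, so that only [n] terms of size [Psi0] remain. *)
  apply: (@le_trans _ _ (\sum_(j < N) (B * Psi0) * (B * \sum_(k < n) rate (n - k) j))).
    apply: ler_sum => j _.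
    rewrite (_ : (fun x => _) = (fun x => (f (mixed X none x) - f (mixed X (eq_op^~ (j : nat)) x)) ^+ 2)); last first.
      by apply/funext => x; rewrite opprD addrACA subrr addr0.
    apply: (le_trans (diff_bound j)); rewrite expr2 ler_wpM2r//.
      by rewrite mulr_ge0// sumr_ge0// => k _; rewrite /rate; case: ifP.
    by rewrite ler_wpM2l.
  rewrite -mulr_sumr -mulr_sumr exchange_big/=.
  have h : \sum_(k < n) \sum_(j < N) rate (n - k) j <= n%:R * Psi0.
    apply: (@le_trans _ _ (\sum_(k < n) Psi0)); first by apply: ler_sum => k _; exact: rate_sum_j.
    by rewrite sumr_const card_ord mulr_natl.
  rewrite (_ : n%:R * _ = (B * Psi0) * (B * (n%:R * Psi0))); last by ring.
  by rewrite !ler_wpM2l// mulr_ge0.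
apply: (le_trans H); apply: ler_piMl; first by rewrite mulr_ge0// sqr_ge0.
by rewrite invf_le1 ?ler1n.
Qed.

End predictable_variance.

(** * One-step-ahead conditional moments *)

Section independent_product.
Context {R : realType} d (Omega : measurableType d) (P : probability Omega R).
Context d1 (T1 : measurableType d1) d2 (T2 : measurableType d2) (X : Omega -> T1) (Y : Omega -> T2).
Hypotheses (mX : measurable_fun setT X) (mY : measurable_fun setT Y) (XY : independent_rv P X Y).

Let ge0_case (f : T1 -> R) (g : T2 -> R) : measurable_fun setT f -> measurable_fun setT g ->
  (forall x, 0 <= f x) -> (forall y, 0 <= g y) -> P.-integrable setT (EFin \o (f \o X)) ->
  P.-integrable setT (EFin \o (g \o Y)) ->
  expect P (fun w => f (X w) * g (Y w)) = expect P (f \o X) * expect P (g \o Y).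
Proof.
move=> mf mg f0 g0 If Ig; rewrite !expectE /Rintegral.
have mh : measurable_fun setT (fun z : T1 * T2 => (f z.1 * g z.2)%:E).
  apply/measurable_EFinP; apply: measurable_funM.
    exact: (measurableT_comp mf measurable_fst).
  exact: (measurableT_comp mg measurable_snd).
have h0 (z : T1 * T2) : (0 <= (f z.1 * g z.2)%:E)%E by rewrite lee_fin mulr_ge0.
rewrite (independent_fubini mX mY XY mh h0) /=.
rewrite -fineM; [|exact: integrable_fin_num..]; congr fine.
rewrite -ge0_integralZr//; last 3 first.
- exact: (measurable_int _ If).
- by move=> w _; rewrite lee_fin.
- by apply: integral_ge0 => w _; rewrite lee_fin.
apply: eq_integral => w _; under eq_integral do rewrite EFinM.
rewrite ge0_integralZl//; first exact: (measurable_int _ Ig).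
  by move=> w' _; rewrite lee_fin.
by rewrite lee_fin.
Qed.

Lemma independent_expectM_bounded (f : T1 -> R) (g : T2 -> R) (M : R) :
  measurable_fun setT f -> measurable_fun setT g -> (forall x, `|f x| <= M) ->
  P.-integrable setT (EFin \o (g \o Y)) ->
  expect P (fun w => f (X w) * g (Y w)) = expect P (f \o X) * expect P (g \o Y).
Proof.
move=> mf mg fM Ig.
have If : P.-integrable setT (EFin \o (f \o X)).
  by apply: (@bounded_integrable _ _ _ P _ M) => [|w]; [exact: measurableT_comp|exact: fM].
pose g1 y := Num.max (g y) 0; pose g2 y := Num.max (- g y) 0.
have mg1 : measurable_fun setT g1 by exact: measurable_maxr.
have mg2 : measurable_fun setT g2 by apply: measurable_maxr => //; exact: measurableT_comp.
have g10 y : 0 <= g1 y by rewrite le_max lexx orbT.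
have g20 y : 0 <= g2 y by rewrite le_max lexx orbT.
have gE y : g y = g1 y - g2 y.
  rewrite /g1 /g2; case: (lerP 0 (g y)) => h.
    by rewrite max_r ?subr0// oppr_le0.
  by rewrite max_l ?sub0r ?opprK// oppr_ge0 ltW.
have g1le y : `|g1 y| <= `|g y|.
  by rewrite ger0_norm// /g1 ge_max ler_norm normr_ge0.
have g2le y : `|g2 y| <= `|g y|.
  by rewrite ger0_norm// /g2 ge_max normr_ge0 -normrN ler_norm.
have Ig1 : P.-integrable setT (EFin \o (g1 \o Y)).
  apply: (@integ_dom _ _ _ P _ (fun w => `|g (Y w)|)) => [|w|]; [exact: measurableT_comp| |exact: integ_norm Ig].
  exact: g1le.
have Ig2 : P.-integrable setT (EFin \o (g2 \o Y)).
  apply: (@integ_dom _ _ _ P _ (fun w => `|g (Y w)|)) => [|w|]; [exact: measurableT_comp| |exact: integ_norm Ig].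
  exact: g2le.
(* A bounded factor becomes nonnegative by adding a constant, the other by splitting into positive
   and negative parts; Tonelli's theorem then applies to each product. *)
pose f1 x := f x + M.
have mf1 : measurable_fun setT f1 by exact: measurable_funD.
have f10 x : 0 <= f1 x by have := fM x; rewrite ler_norml /f1 => /andP[h _]; rewrite -lerBlDr sub0r.
have f1M x : `|f1 x| <= M + M by rewrite ger0_norm// /f1 lerD2r (le_trans (ler_norm _)).
have If1 : P.-integrable setT (EFin \o (f1 \o X)).
  by apply: (@bounded_integrable _ _ _ P _ (M + M)) => // [|w]; [exact: measurableT_comp|exact: f1M].
have Ifg (g' : T2 -> R) : P.-integrable setT (EFin \o (g' \o Y)) -> P.-integrable setT (EFin \o (fun w => f1 (X w) * g' (Y w))).
  move=> Ig'; apply: (@integM _ _ _ P (M + M) (g' \o Y) (f1 \o X)) => //; first exact: measurableT_comp.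
  by move=> w; exact: f1M.
have h1 := ge0_case mf1 mg1 f10 g10 If1 Ig1.
have h2 := ge0_case mf1 mg2 f10 g20 If1 Ig2.
have E1 : expect P (fun w => f1 (X w) * g (Y w)) = expect P (f1 \o X) * expect P (g \o Y).
  rewrite (_ : (fun w => f1 (X w) * g (Y w)) = (fun w => f1 (X w) * g1 (Y w) - f1 (X w) * g2 (Y w))); last first.
    by apply/funext => w; rewrite gE mulrBr.
  rewrite expectB; [|exact: Ifg..]; rewrite h1 h2 -mulrBr; congr (_ * _).
  by rewrite -expectB//; congr expect; apply/funext => w /=; rewrite -gE.
rewrite (_ : (fun w => f (X w) * g (Y w)) = (fun w => f1 (X w) * g (Y w) - M * g (Y w))); last first.
  by apply/funext => w; rewrite /f1; ring.
rewrite expectB; [|exact: Ifg|exact: integZ].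
rewrite E1 (expectZ M Ig) -mulrBl; congr (_ * _).
rewrite (_ : f1 \o X = fun w => (f \o X) w + M)//.
by rewrite expectD//; [rewrite expect_cst addrK|exact: integ_cst].
Qed.

End independent_product.

Lemma measurable_set_integral {R : realType} dV (V : measurableType dV) (mu : {sigma_finite_measure set V -> \bar R})
    dH (H : measurableType dH) (f : V * H -> R) (B : set V) :
  measurable_fun setT f -> (forall p, 0 <= f p) -> measurable B ->
  measurable_fun setT (fun h => \int[mu]_(v in B) (f (v, h))%:E)%E.
Proof.
move=> mf f0 mB; under eq_fun do rewrite integral_mkcond.
apply: (@measurable_fun_fubini_tonelli_F _ _ H V R mu (fun p => ((fun v => (f (v, p.1))%:E) \_ B) p.2)).
  rewrite (_ : (fun _ => _) = ((fun p : H * V => (f (p.2, p.1))%:E) \_ (setT `*` B))); last first.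
    by apply/funext => -[h v]; rewrite /patch /= in_setX in_setT.
  apply/(measurable_restrictT _ (measurableX measurableT mB)).
  by apply/measurable_funTS/measurable_EFinP; apply: (measurableT_comp mf); exact: measurable_fun_pair.
by move=> p; rewrite /patch; case: ifP => _ //; rewrite lee_fin.
Qed.

Lemma measurable_past d (Omega : measurableType d) dE (E : measurableType dE) (X : int -> Omega -> E) k :
  (forall j, measurable_fun setT (X j)) -> measurable_fun setT (past X k).
Proof. by move=> mX; apply: (@measurable_prodspaceP _ E _ Omega nat) => j; exact: mX. Qed.

Lemma past_sigma_of d (Omega : measurableType d) dE (E : measurableType dE)
    (X : int -> Omega -> E) (J : set int) (k : int) (B : set (history E)) :
  (forall j : nat, J (k - j%:Z)) -> measurable B -> sigma_of J X (past X k @^-1` B).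
Proof.
move=> Jk; move: B; pose S : set (set (history E)) := [set B | sigma_of J X (past X k @^-1` B)].
suff : <<s history_cylinders (E:=E) >> `<=` S by apply.
apply: smallest_sub.
  split; rewrite /S /=.
  - by rewrite preimage_set0; exact: sigma_algebra0.
  - by move=> B mB; rewrite setTD preimage_setC; apply: sigma_algebraC.
  - by move=> F mF; rewrite preimage_bigcup; exact: sigma_algebra_bigcup.
move=> _ [j _ [B mB <-]]; rewrite /S /= setTI; apply: sub_sigma_algebra.
exists (k - j%:Z); first exact: Jk.
by exists B => //; rewrite setTI.
Qed.

(** * The next regressor given the pasts of innovations and errors *)

Section one_step.
Context {R : realType} (disp : measure_display) (Omega : measurableType disp).
Variable P : probability Omega R.
Context (d : nat) (dE : measure_display) (E : measurableType dE).
Variable G : R -> history E -> 'rV[R]_d.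
Variables (xi : int -> Omega -> E) (Q : R -> R.-pker (history E) ~> 'rV[R]_d).
Hypothesis mxi : forall k, measurable_fun setT (xi k).
Hypothesis law_Q : is_one_step_law P G xi Q.
Variables (t : R) (k : int).
Hypothesis t01 : `[0, 1]%classic t.
Hypothesis mG : measurable_fun setT (G t).
Variables (A : set (history E)) (f : 'rV[R]_d * history E -> R).
Hypotheses (mA : measurable A) (PA : P (past xi k @^-1` A) = 1%E).
Hypotheses (mf : measurable_fun setT f) (f0 : forall p, 0 <= f p).
Hypothesis Qf : forall h B, A h -> measurable B ->
  (Q t h B = \int[lebesgue_rV d]_(v in B) (f (v, h))%:E)%E.

Let x w := G t (past xi (k + 1) w).

Let mx : measurable_fun setT x.
Proof. exact: (measurableT_comp mG (measurable_past _ mxi)). Qed.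

Let mH := measurable_past k mxi.

(** The joint law of the past and of the next regressor is compared with the measure of density [f]
    over the law of the past times Lebesgue measure. On rectangles their equality is [law_Q]
    combined with [Qf]; exceptional histories form a null set. *)
Lemma one_step_integral (psi : history E * 'rV[R]_d -> \bar R) : measurable_fun setT psi ->
  (forall z, 0 <= psi z)%E ->
  (\int[P]_w psi (past xi k w, G t (past xi (k + 1) w)) =
   \int[P]_w \int[lebesgue_rV d]_v (psi (past xi k w, v) * (f (v, past xi k w))%:E))%E.
Proof.
move=> mpsi psi0.
have mHx : measurable_fun setT (fun w => (past xi k w, x w)) by exact: measurable_fun_pair.
pose fl (p : Omega * 'rV[R]_d) := f (p.2, past xi k p.1).
have mH1 : measurable_fun setT (fun p : Omega * 'rV[R]_d => past xi k p.1).
  exact: (measurableT_comp mH measurable_fst).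
have mfl : measurable_fun setT fl by apply: (measurableT_comp mf); exact: measurable_fun_pair.
have fl0 p : 0 <= fl p by exact: f0.
have mHv : measurable_fun setT (fun p : Omega * 'rV[R]_d => (past xi k p.1, p.2)) by exact: measurable_fun_pair.
pose m1 : {measure set (history E * 'rV[R]_d) -> \bar R} := image_measure P mHx.
pose m2 : {measure set (history E * 'rV[R]_d) -> \bar R} :=
  image_measure (density_measure (P \x lebesgue_rV d)%E mfl fl0) mHv.
have m12 B : measurable B -> m1 B = m2 B.
  apply: (@finite_measure_unique _ _ _ [set A' `*` B' | A' in measurable & B' in measurable] m1 m2).
  - exact: measurable_prod_measurableType.
  - move=> _ _ [A1 mA1 [B1 mB1 <-]] [A2 mA2 [B2 mB2 <-]].
    by rewrite -setXI; exists (A1 `&` A2); [exact: measurableI|exists (B1 `&` B2) => //; exact: measurableI].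
  - by exists setT => //; exists setT => //; rewrite setXTT.
  - by rewrite /m1 /= /image_measure preimage_setT probability_setT ltry.
  move=> _ [A1 mA1 [B1 mB1 <-]].
  have mHA : measurable (past xi k @^-1` A1) by exact: preimage_measurable.
  transitivity (\int[P]_(w in past xi k @^-1` A1) Q t (past xi k w) B1)%E.
    rewrite (law_Q t01 _ mB1)//; apply: past_sigma_of => // j; exact: gerBl.
  have mfB : measurable_fun setT (fun h => \int[lebesgue_rV d]_(v in B1) (f (v, h))%:E)%E.
    exact: measurable_set_integral.
  transitivity (\int[P]_(w in past xi k @^-1` A1) \int[lebesgue_rV d]_(v in B1) (f (v, past xi k w))%:E)%E.
    apply: ge0_ae_eq_integral => //.
    - by apply: measurable_funTS; exact: (measurableT_comp (measurable_kernel (Q t) _ mB1) mH).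
    - by apply: measurable_funTS; exact: (measurableT_comp mfB mH).
    - by move=> w _; apply: integral_ge0 => v _; rewrite lee_fin.
    exists (~` (past xi k @^-1` A)); split.
    - exact/measurableC/preimage_measurable.
    - by apply: etrans (probability_setC P (preimage_measurable mH mA)) _; rewrite PA subee.
    by move=> w /= H AH; apply: H => _; exact: Qf.
  pose D : set (Omega * 'rV[R]_d) := (past xi k @^-1` A1) `*` B1.
  have mD : measurable D by exact: measurableX.
  transitivity (\int[P \x lebesgue_rV d]_(p in D) (fl p)%:E)%E; last by [].
  have mflD : measurable_fun setT ((EFin \o fl) \_ D).
    by apply/(measurable_restrictT _ mD)/measurable_funTS/measurable_EFinP.
  have fl0D p : (0 <= ((EFin \o fl) \_ D) p)%E by rewrite /patch; case: ifP => _ //; rewrite lee_fin.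
  rewrite [RHS]integral_mkcond (@fubini_tonelli1 _ _ Omega 'rV[R]_d R P (lebesgue_rV d) _ mflD fl0D).
  rewrite integral_mkcond; apply: eq_integral => w _; rewrite /fubini_F /patch.
  case: ifPn => [/set_mem Aw|Aw].
    rewrite [LHS]integral_mkcond; apply: eq_integral => v _; rewrite /patch.
    rewrite (_ : ((w, v) \in _) = (v \in B1))//; apply/idP/idP => /set_mem h; apply/mem_set.
      by case: h.
    by split.
  rewrite integral0_eq// => v _; case: ifPn => // /set_mem [h _].
  by move/negP: Aw; case; exact/mem_set.
transitivity (\int[m1]_z psi z)%E; first by rewrite ge0_integral_image.
rewrite (eq_measure_integral m2) => [|B mB _]; last exact: m12.
rewrite ge0_integral_image//.
rewrite ge0_integral_density//; last first.
  exact: (measurableT_comp mpsi mHv).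
rewrite fubini_tonelli1//.
  apply: emeasurable_funM; first exact: (measurableT_comp mpsi mHv).
  exact/measurable_EFinP.
by move=> p; rewrite mule_ge0// lee_fin.
Qed.

Variables (eta : int -> Omega -> R) (c : R).
Hypothesis iid_eta : iid P eta.
Hypothesis ind : independent_sigma P (sigma_of [set: int] eta) (sigma_of [set: int] xi).
Hypothesis fc : forall p, f p <= c.

Let meta j : measurable_fun setT (eta j). Proof. by case: iid_eta. Qed.

Lemma past_independent l l' : independent_rv P (past eta l) (past xi l').
Proof. by move=> B C mB mC; apply: ind; apply: past_sigma_of. Qed.

Definition both_pasts (w : Omega) : history E * history R := (past xi k w, past eta k w).

Lemma measurable_both_pasts : measurable_fun setT both_pasts.
Proof. by apply: measurable_fun_pair => //; exact: measurable_past. Qed.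

(** Drops the newest innovation: the past at [k] is a function of the past at [k + 1], so that the
    pair of past and regressor depends on one history only. *)
Let tl (h : history E) : history E := fun j => h j.+1.

Let mtl : measurable_fun setT tl.
Proof. by apply: (@measurable_prodspaceP _ E _ (history E) nat) => j; exact: (@measurable_coord _ E nat). Qed.

Let tl_past w : tl (past xi (k + 1) w) = past xi k w.
Proof. by apply/funext => j; rewrite /tl /past; congr (xi _ w); rewrite -addn1 PoszD; ring. Qed.

(** The errors do not change the conditional law of the regressor: by independence their past can be
    frozen, the one-step formula used for the innovations, and the two reassembled. *)
Lemma both_pasts_integral (psi : (history E * history R) * 'rV[R]_d -> \bar R) : measurable_fun setT psi ->
  (forall z, 0 <= psi z)%E ->
  (\int[P]_w psi (both_pasts w, G t (past xi (k + 1) w)) =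
   \int[P]_w \int[lebesgue_rV d]_v (psi (both_pasts w, v) * (f (v, past xi k w))%:E))%E.
Proof.
move=> mpsi psi0.
pose F1 (p : history R * history E) := psi ((tl p.2, p.1), G t p.2).
have mF1 : measurable_fun setT F1.
  apply: (measurableT_comp mpsi); apply: measurable_fun_pair; last exact: (measurableT_comp mG measurable_snd).
  by apply: measurable_fun_pair => //; exact: (measurableT_comp mtl measurable_snd).
have F10 p : (0 <= F1 p)%E by exact: psi0.
have m1 := measurable_past k meta; have m2 := measurable_past (k + 1) mxi.
transitivity (\int[P]_w F1 (past eta k w, past xi (k + 1) w))%E.
  by apply: eq_integral => w _; rewrite /F1 /= tl_past.
rewrite (independent_fubini m1 m2 (@past_independent _ _) mF1 F10).
pose F2 (p : history R * history E) := (\int[lebesgue_rV d]_v (psi ((p.2, p.1), v) * (f (v, p.2))%:E))%E.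
have mF2 : measurable_fun setT F2.
  apply: (@measurable_fun_fubini_tonelli_F _ _ (history R * history E)%type 'rV[R]_d R (lebesgue_rV d)
    (fun p => psi ((p.1.2, p.1.1), p.2) * (f (p.2, p.1.2))%:E)%E).
    have m11 : measurable_fun setT (fun p : (history R * history E) * 'rV[R]_d => p.1.1).
      exact: (measurableT_comp measurable_fst measurable_fst).
    have m12 : measurable_fun setT (fun p : (history R * history E) * 'rV[R]_d => p.1.2).
      exact: (measurableT_comp measurable_snd measurable_fst).
    apply: emeasurable_funM.
      apply: (measurableT_comp mpsi); apply: measurable_fun_pair => //; exact: measurable_fun_pair.
    apply/measurable_EFinP; apply: (measurableT_comp mf); exact: measurable_fun_pair.
  by move=> p; rewrite mule_ge0// lee_fin.
have F20 p : (0 <= F2 p)%E by apply: integral_ge0 => v _; rewrite mule_ge0// lee_fin.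
rewrite [RHS](_ : _ = \int[P]_w F2 (past eta k w, past xi k w))%E//.
rewrite (independent_fubini m1 mH (@past_independent _ _) mF2 F20).
apply: eq_integral => w _.
have mpsiw : measurable_fun setT (fun z : history E * 'rV[R]_d => psi ((z.1, past eta k w), z.2)).
  by apply: (measurableT_comp mpsi); apply: measurable_fun_pair => //; exact: measurable_fun_pair.
have := one_step_integral mpsiw (fun z => psi0 _) => /= <-.
by apply: eq_integral => w' _; rewrite /F1 /= tl_past.
Qed.

Section real_valued.
Variables (psi : (history E * history R) * 'rV[R]_d -> R) (a : 'rV[R]_d -> R) (M : R).
Hypotheses (mpsi : measurable_fun setT psi) (ma : measurable_fun setT a).
Hypotheses (a0M : forall v, 0 <= a v <= M) (Ia : (\int[lebesgue_rV d]_v (a v)%:E < +oo)%E).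

Let f_integrable (g : 'rV[R]_d -> R) h : measurable_fun setT g -> (forall v, `|g v| <= a v) ->
  (lebesgue_rV d).-integrable setT (EFin \o (fun v => g v * f (v, h))).
Proof.
move=> mg ga; have c0 : 0 <= c := le_trans (f0 (point, h)) (fc (point, h)).
have := @weighted_integrable _ _ _ (lebesgue_rV d) _ (history E) g f (fine (\int[lebesgue_rV d]_v (a v)%:E)%E) c mg mf.
apply.
- have fa : (\int[lebesgue_rV d]_v (a v)%:E)%E \is a fin_num.
    by rewrite ge0_fin_numE//; apply: integral_ge0 => v _; rewrite lee_fin; case/andP: (a0M v).
  rewrite fineK//; apply: ge0_le_integral => //; [|exact/measurable_EFinP|].
    by apply/measurable_EFinP; exact: measurableT_comp.
  by move=> v _; rewrite lee_fin.
by move=> p; rewrite f0 fc.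
Qed.

Let ge0_case (p : (history E * history R) * 'rV[R]_d -> R) : measurable_fun setT p ->
  (forall z v, 0 <= p (z, v)) -> (forall z v, p (z, v) <= 2 * a v) ->
  expect P (fun w => p (both_pasts w, G t (past xi (k + 1) w))) =
  expect P (fun w => Rintegral (lebesgue_rV d) setT (fun v => p (both_pasts w, v) * f (v, past xi k w))).
Proof.
move=> mp p0 pa; rewrite !expectE /Rintegral; congr fine.
have mpE : measurable_fun setT (EFin \o p) by exact/measurable_EFinP.
have p0E z : (0 <= (EFin \o p) z)%E by case: z => z v; rewrite /= lee_fin.
rewrite (both_pasts_integral mpE p0E); apply: eq_integral => w _ /=.
rewrite fineK//.
have mpw : measurable_fun setT (fun v => 2^-1 * p (both_pasts w, v)).
  by apply: measurable_funM => //; exact: measurable_fun_pair2.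
have paw v : `|2^-1 * p (both_pasts w, v)| <= a v.
  by rewrite ger0_norm ?mulr_ge0//; rewrite ler_pdivrMl.
have := f_integrable (past xi k w) mpw paw => /(integrableZl measurableT 2).
move/(integrable_fin_num measurableT); congr (_ \is a fin_num); apply: eq_integral => v _ /=.
by rewrite -EFinM; congr EFin; field.
Qed.

(** A signed [psi] dominated by [a] is the difference of [psi + a] and [a], both nonnegative and at
    most [2 a]. *)
Lemma both_pasts_expect : (forall z v, `|psi (z, v)| <= a v) ->
  expect P (fun w => psi (both_pasts w, G t (past xi (k + 1) w))) =
  expect P (fun w => Rintegral (lebesgue_rV d) setT (fun v => psi (both_pasts w, v) * f (v, past xi k w))).
Proof.
move=> psia.
have a0 v : 0 <= a v by case/andP: (a0M v).
have a1 v : `|a v| <= a v by rewrite ger0_norm.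
have map : measurable_fun setT (fun z : (history E * history R) * 'rV[R]_d => a z.2).
  exact: (measurableT_comp ma measurable_snd).
have mpa : measurable_fun setT (fun z => psi z + a z.2) by exact: measurable_funD.
have h1 := @ge0_case (fun z => psi z + a z.2) mpa.
have h2 := @ge0_case (fun z => a z.2) map.
have mZx : measurable_fun setT (fun w => (both_pasts w, x w)).
  by apply: measurable_fun_pair => //; exact: measurable_both_pasts.
have c0 : 0 <= c := le_trans (f0 (point, point)) (fc (point, point)).
have msec w : measurable_fun setT (fun v => psi (both_pasts w, v)) by exact: measurable_fun_pair2.
pose I1 w := Rintegral (lebesgue_rV d) setT (fun v => psi (both_pasts w, v) * f (v, past xi k w)).
pose I2 w := Rintegral (lebesgue_rV d) setT (fun v => a v * f (v, past xi k w)).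
pose B := fine (\int[lebesgue_rV d]_v (a v)%:E)%E.
have faE : (\int[lebesgue_rV d]_v (a v)%:E = B%:E)%E.
  by rewrite fineK// ge0_fin_numE//; apply: integral_ge0 => v _; rewrite lee_fin.
have aB : (\int[lebesgue_rV d]_v (`|a v|)%:E <= B%:E)%E.
  by rewrite -faE le_eqVlt; apply/orP; left; apply/eqP; apply: eq_integral => v _; rewrite ger0_norm.
have psiB w : (\int[lebesgue_rV d]_v (`|psi (both_pasts w, v)|)%:E <= B%:E)%E.
  rewrite -faE; apply: ge0_le_integral => //; [|exact/measurable_EFinP|].
    by apply/measurable_EFinP; exact: measurableT_comp.
  by move=> v _; rewrite lee_fin.
have f0c p : 0 <= f p <= c by rewrite f0 fc.
have II1 : P.-integrable setT (EFin \o I1).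
  apply: (@bounded_integrable _ _ _ P _ (c * B)).
    have mg : measurable_fun setT (fun p : 'rV[R]_d * Omega => psi (both_pasts p.2, p.1) * f (p.1, past xi k p.2)).
      apply: measurable_funM.
        by apply: (measurableT_comp mpsi); apply: measurable_fun_pair => //; exact: (measurableT_comp measurable_both_pasts measurable_snd).
      by apply: (measurableT_comp mf); apply: measurable_fun_pair => //; exact: (measurableT_comp mH measurable_snd).
    exact: (@measurable_param_integral _ _ _ (lebesgue_rV d) _ Omega _ mg).
  by move=> w; apply: (@weighted_integral_le _ _ _ (lebesgue_rV d) _ (history E) (fun v => psi (both_pasts w, v)) f B c).
have II2 : P.-integrable setT (EFin \o I2).
  apply: (@bounded_integrable _ _ _ P _ (c * B)).
    exact: (measurableT_comp (measurable_weighted_integral (lebesgue_rV d) ma mf) mH).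
  by move=> w; apply: (@weighted_integral_le _ _ _ (lebesgue_rV d) _ (history E) a f B c).
have Ip : P.-integrable setT (EFin \o (fun w => psi (both_pasts w, x w))).
  apply: (@bounded_integrable _ _ _ P _ M); first exact: (measurableT_comp mpsi mZx).
  by move=> w; apply: le_trans (psia _ _) _; case/andP: (a0M (x w)).
have Ia' : P.-integrable setT (EFin \o (fun w => a (x w))).
  apply: (@bounded_integrable _ _ _ P _ M); first exact: (measurableT_comp ma mx).
  by move=> w; rewrite ger0_norm//; case/andP: (a0M (x w)).
have E1 : expect P (fun w => psi (both_pasts w, x w) + a (x w)) = expect P (fun w => I1 w + I2 w).
  rewrite [LHS]h1.
  - congr expect; apply/funext => w; rewrite /I1 /I2 -RintegralD//; last 2 first.
    + exact: f_integrable.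
    + exact: f_integrable.
    by apply: eq_Rintegral => v _; rewrite mulrDl.
  - by move=> z v /=; have := psia z v; rewrite ler_norml -lerBlDr sub0r => /andP[].
  - by move=> z v /=; rewrite mulr2n mulrDl mul1r lerD2r; exact: le_trans (ler_norm _) (psia z v).
have E2 : expect P (fun w => a (x w)) = expect P I2.
  by apply: h2 => // z v /=; rewrite mulr2n mulrDl mul1r lerDl.
by move: E1; rewrite !expectD// E2 => /addIr.
Qed.

End real_valued.

(** The pair is a function of the error past at [k] and the innovation past at [k + 1]. On a
    rectangle, the event on the errors up to [k] and on the next error is an event on the error past
    at [k + 1], hence independent of the innovations; independence among the errors splits it
    further. *)
Let next_noise_independent : independent_rv P (fun w => (both_pasts w, x w)) (eta (k + 1)).
Proof.
pose U w : history R * history E := (past eta k w, past xi (k + 1) w).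
have m1 := measurable_past k meta; have m2 := measurable_past (k + 1) mxi.
have mU : measurable_fun setT U by exact: measurable_fun_pair.
have ind1 : independent_rv P U (eta (k + 1)).
  apply: (@independent_pi_system _ _ _ P _ _ _ _ U (eta (k + 1))
    [set A' `*` B' | A' in measurable & B' in measurable] measurable mU (meta _)).
  - exact: measurable_prod_measurableType.
  - move=> _ _ [A1 mA1 [B1 mB1 <-]] [A2 mA2 [B2 mB2 <-]].
    by rewrite -setXI; exists (A1 `&` A2); [exact: measurableI|exists (B1 `&` B2) => //; exact: measurableI].
  - by exists setT => //; exists setT => //; rewrite setXTT.
  - by rewrite sigma_algebra_id//; exact: sigma_algebra_measurable.
  - by move=> ? ? ? ?; exact: measurableI.
  - exact: measurableT.
  move=> _ C [A1 mA1 [B1 mB1 <-]] mC.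
  have ind2 : P (past eta k @^-1` A1 `&` eta (k + 1) @^-1` C) = (P (past eta k @^-1` A1) * P (eta (k + 1) @^-1` C))%E.
    have ia : injective (fun j : nat => k - j%:Z) by move=> i j /addrI /oppr_inj [].
    have ib : injective (fun _ : unit => k + 1) by move=> [] [].
    have ab (j1 : nat) (j2 : unit) : k - j1%:Z != k + 1.
      by rewrite (inj_eq (addrI k)); case: j1.
    have := @iid_disjoint_independent _ _ _ P _ _ _ _ _ eta _ _ iid_eta ia ib ab A1 [set h | C (h tt)] mA1.
    by apply; have := @measurable_coord _ _ unit tt measurableT C mC; rewrite setTI.
  have ind3 : P ((past eta k @^-1` A1 `&` eta (k + 1) @^-1` C) `&` past xi (k + 1) @^-1` B1) =
      (P (past eta k @^-1` A1 `&` eta (k + 1) @^-1` C) * P (past xi (k + 1) @^-1` B1))%E.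
    have -> : past eta k @^-1` A1 `&` eta (k + 1) @^-1` C =
        past eta (k + 1) @^-1` [set h | A1 ((fun j => h j.+1) : history R) /\ C (h 0%N)].
      have E0 w : (fun j : nat => past eta (k + 1) w j.+1) = past eta k w.
        by apply/funext => j; rewrite /past; congr (eta _ w); rewrite -addn1 PoszD; ring.
      have E1 w : past eta (k + 1) w 0%N = eta (k + 1) w by rewrite /past subr0.
      by apply/seteqP; split => w /=; rewrite E0 E1.
    apply: past_independent => //.
    have mtlR : measurable_fun setT ((fun h j => h j.+1) : history R -> history R).
      by apply: (@measurable_prodspaceP _ _ _ (history R) nat) => j; exact: (@measurable_coord _ _ nat).
    apply: measurableI; first exact: (preimage_measurable mtlR).
    by have := @measurable_coord _ _ nat 0%N measurableT C mC; rewrite setTI.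
  have E1 : U @^-1` (A1 `*` B1) `&` eta (k + 1) @^-1` C =
      (past eta k @^-1` A1 `&` eta (k + 1) @^-1` C) `&` past xi (k + 1) @^-1` B1.
    by apply/seteqP; split => w; rewrite /U /=; [move=> [[? ?] ?]|move=> [[? ?] ?]].
  have E2 : P (U @^-1` (A1 `*` B1)) = (P (past eta k @^-1` A1) * P (past xi (k + 1) @^-1` B1))%E.
    exact: past_independent.
  by rewrite E1 ind3 ind2 E2 muleAC.
pose g (u : history R * history E) := ((tl u.2, u.1), G t u.2).
have mg : measurable_fun setT g.
  apply: measurable_fun_pair; last exact: (measurableT_comp mG measurable_snd).
  by apply: measurable_fun_pair => //; exact: (measurableT_comp mtl measurable_snd).
have gU w : (both_pasts w, x w) = g (U w) by rewrite /g /= tl_past.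
move=> B1 C mB1 mC.
have -> : (fun w => (both_pasts w, x w)) @^-1` B1 = U @^-1` (g @^-1` B1).
  by apply/seteqP; split => w; rewrite /preimage /= gU.
by apply: ind1 => //; exact: (preimage_measurable mg).
Qed.

Hypothesis eta2 : P.-integrable setT (EFin \o (fun w => eta (k + 1) w ^+ 2)).
Hypotheses (mean_eta : expect P (eta (k + 1)) = 0) (var_eta : expect P (fun w => eta (k + 1) w ^+ 2) = 1).

Let eta1 : P.-integrable setT (EFin \o eta (k + 1)).
Proof.
apply: (@integ_dom _ _ _ P _ (fun w => 1 + eta (k + 1) w ^+ 2)) => // [w|]; last first.
  by apply: integD => //; exact: integ_cst.
rewrite -(real_normK (num_real (eta _ w))).
have := sqr_ge0 (`|eta (k + 1) w| - 1); have := normr_ge0 (eta (k + 1) w).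
by rewrite sqrrB1 mulr2n; lra.
Qed.

Section moments.
Variables (F : history E * history R -> R) (al be : 'rV[R]_d -> R) (M : R).
Hypotheses (mF : measurable_fun setT F) (FM : forall z, `|F z| <= M).
Hypotheses (mal : measurable_fun setT al) (mbe : measurable_fun setT be).
Variables (D : set 'rV[R]_d).
Hypotheses (mD : measurable D) (Dfin : (lebesgue_rV d D < +oo)%E).
Hypotheses (alM : forall v, `|al v| <= M * \1_D v) (beM : forall v, `|be v| <= M * \1_D v).

Let M0 : 0 <= M. Proof. exact: le_trans (FM point). Qed.

Let D1 (v : 'rV[R]_d) : 0 <= (\1_D v : R) <= 1.
Proof. by rewrite indicE; case: (_ \in _); rewrite /= ?lexx ?ler01. Qed.

Let supported_expect (g : 'rV[R]_d -> R) (N : R) : 0 <= N -> measurable_fun setT g -> (forall v, `|g v| <= N * \1_D v) ->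
  expect P (fun w => F (both_pasts w) * g (x w)) =
  expect P (fun w => F (both_pasts w) * weighted_integral (lebesgue_rV d) g f (past xi k w)).
Proof.
move=> N0 mg gN.
have mp : measurable_fun setT (fun z : (history E * history R) * 'rV[R]_d => F z.1 * g z.2).
  by apply: measurable_funM; [exact: (measurableT_comp mF measurable_fst)|exact: (measurableT_comp mg measurable_snd)].
have ma : measurable_fun setT (fun v : 'rV[R]_d => M * N * \1_D v : R).
  by apply: measurable_funM => //; exact: measurable_indic.
have a0 v : 0 <= M * N * \1_D v <= M * N.
  have /andP[h1 h2] := D1 v; rewrite mulr_ge0 ?mulr_ge0//= ler_piMr// mulr_ge0//.
rewrite [LHS](@both_pasts_expect (fun z => F z.1 * g z.2) (fun v => M * N * \1_D v) (M * N) mp ma a0).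
- congr expect; apply/funext => w /=.
  have Ig : (lebesgue_rV d).-integrable setT (EFin \o (fun v => g v * f (v, past xi k w))).
    apply: (@weighted_integrable _ _ _ (lebesgue_rV d) _ (history E) g f (N * fine (lebesgue_rV d D)) c mg mf).
    + apply: (@le_trans _ _ (\int[lebesgue_rV d]_v (N%:E * (\1_D v)%:E))%E).
        apply: ge0_le_integral => //.
        * by apply/measurable_EFinP; exact: measurableT_comp.
        * by apply: emeasurable_funM => //; apply/measurable_EFinP; exact: measurable_indic.
        by move=> v _; rewrite -EFinM lee_fin.
      rewrite ge0_integralZl//; last by apply/measurable_EFinP; exact: measurable_indic.
      by rewrite integral_indic// setIT EFinM fineK// ge0_fin_numE.
    + by move=> p; rewrite f0 fc.
  by rewrite /weighted_integral -RintegralZl//; apply: eq_Rintegral => v _; rewrite mulrA.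
- under eq_integral do rewrite EFinM.
  rewrite ge0_integralZl//; last 2 first.
  + by apply/measurable_EFinP; exact: measurable_indic.
  + by rewrite lee_fin mulr_ge0.
  by rewrite integral_indic// setIT lte_mul_pinfty// lee_fin mulr_ge0.
by move=> z v /=; rewrite normrM -mulrA ler_pM.
Qed.

Let mZx : measurable_fun setT (fun w => (both_pasts w, x w)).
Proof. by apply: measurable_fun_pair => //; exact: measurable_both_pasts. Qed.

Let bounded_noise (h : 'rV[R]_d -> R) (g : R -> R) (N : R) : measurable_fun setT h -> measurable_fun setT g ->
  (forall v, `|h v| <= N) -> P.-integrable setT (EFin \o (g \o eta (k + 1))) ->
  P.-integrable setT (EFin \o (fun w => (F (both_pasts w) * h (x w)) * g (eta (k + 1) w))) /\
  expect P (fun w => (F (both_pasts w) * h (x w)) * g (eta (k + 1) w)) =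
  expect P (fun w => F (both_pasts w) * h (x w)) * expect P (g \o eta (k + 1)).
Proof.
move=> mh mg hN Ig.
have mFh : measurable_fun setT (fun z : (history E * history R) * 'rV[R]_d => F z.1 * h z.2).
  by apply: measurable_funM; [exact: (measurableT_comp mF measurable_fst)|exact: (measurableT_comp mh measurable_snd)].
have FhN (z : (history E * history R) * 'rV[R]_d) : `|F z.1 * h z.2| <= M * N by rewrite normrM ler_pM.
split; last exact: (@independent_expectM_bounded _ _ _ P _ _ _ _ _ _ mZx (meta _) next_noise_independent _ _ (M * N) mFh mg FhN Ig).
apply: (@integM _ _ _ P (M * N) (g \o eta (k + 1)) (fun w => F (both_pasts w) * h (x w))) => //.
  exact: (measurableT_comp mFh mZx).
by move=> w; exact: (FhN (both_pasts w, x w)).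
Qed.

Let DM (h : 'rV[R]_d -> R) N : 0 <= N -> (forall v, `|h v| <= N * \1_D v) -> forall v, `|h v| <= N.
Proof.
by move=> N0 hN v; apply: le_trans (hN v) _; have /andP[h1 h2] := D1 v; rewrite ler_piMr.
Qed.

Let alM' := DM M0 alM.
Let beM' := DM M0 beM.

Let IFh (h : 'rV[R]_d -> R) (N : R) : measurable_fun setT h -> (forall v, `|h v| <= N) ->
  P.-integrable setT (EFin \o (fun w => F (both_pasts w) * h (x w))).
Proof.
move=> mh hN; apply: (@bounded_integrable _ _ _ P _ (M * N)).
  apply: measurable_funM; first exact: (measurableT_comp mF measurable_both_pasts).
  exact: (measurableT_comp mh mx).
by move=> w; rewrite normrM ler_pM.
Qed.

(** Letting [F] range over bounded functions of both pasts is conditioning on them in weak form. The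
    next error is centred and independent of the pasts and the regressor jointly, so its term drops
    out. *)
Lemma conditional_mean :
  expect P (fun w => F (both_pasts w) * (al (x w) + be (x w) * eta (k + 1) w)) =
  expect P (fun w => F (both_pasts w) * weighted_integral (lebesgue_rV d) al f (past xi k w)).
Proof.
rewrite -(supported_expect M0 mal alM).
have [I1 E1] := bounded_noise (g := idfun) mbe (@measurable_id _ _ setT) beM' eta1.
under eq_fun do rewrite mulrDr mulrA.
by rewrite expectD; [rewrite E1 [X in _ * X]mean_eta mulr0 addr0|exact: IFh mal alM'|exact: I1].
Qed.

Lemma conditional_second_moment :
  expect P (fun w => F (both_pasts w) * (al (x w) + be (x w) * eta (k + 1) w) ^+ 2) =
  expect P (fun w => F (both_pasts w) *
    weighted_integral (lebesgue_rV d) (fun v => al v ^+ 2 + be v ^+ 2) f (past xi k w)).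
Proof.
have sqM (h : 'rV[R]_d -> R) : (forall v, `|h v| <= M * \1_D v) -> forall v, `|h v ^+ 2| <= M ^+ 2 * \1_D v.
  move=> hM v; rewrite normrX; have := hM v; rewrite indicE; case: (_ \in _) => /=.
    by rewrite !mulr1 => h1; rewrite lerXn2r ?nnegrE.
  by rewrite !mulr0 => h1; rewrite (le_anti (_ : `|h v| <= 0 <= `|h v|)) ?h1 ?normr_ge0// expr0n.
have mal2 : measurable_fun setT (fun v => al v ^+ 2) by exact: measurable_funX.
have mbe2 : measurable_fun setT (fun v => be v ^+ 2) by exact: measurable_funX.
have M20 : 0 <= M ^+ 2 by rewrite sqr_ge0.
have al2M v := DM M20 (sqM _ alM) v.
have be2M v := DM M20 (sqM _ beM) v.
rewrite -(@supported_expect _ (2 * M ^+ 2)); last 3 first.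
- by rewrite mulr_ge0.
- exact: measurable_funD.
- move=> v; apply: le_trans (ler_normD _ _) _.
  by have := lerD (sqM _ alM v) (sqM _ beM v); rewrite -mulr2n -[_ *+ 2]mulr_natl mulrA.
have mab : measurable_fun setT (fun v => 2 * (al v * be v)) by apply: measurable_funM => //; exact: measurable_funM.
have abM v : `|2 * (al v * be v)| <= 2 * (M * M).
  by rewrite normrM ger0_norm// ler_wpM2l// normrM ler_pM.
have [I1 E1] := bounded_noise (g := idfun) mab (@measurable_id _ _ setT) abM eta1.
have [I2 E2] := bounded_noise (g := fun y => y ^+ 2) mbe2 (measurable_funX 2 (@measurable_id _ _ setT)) be2M eta2.
have I0 := IFh mal2 al2M.
rewrite (_ : (fun w => F (both_pasts w) * (al (x w) + be (x w) * eta (k + 1) w) ^+ 2) =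
  (fun w => (F (both_pasts w) * al (x w) ^+ 2 + F (both_pasts w) * (2 * (al (x w) * be (x w))) * eta (k + 1) w) +
    F (both_pasts w) * be (x w) ^+ 2 * eta (k + 1) w ^+ 2)); last by apply/funext => w; ring.
rewrite expectD; [|exact: (integD I0 I1)|exact: I2].
rewrite expectD; [|exact: I0|exact: I1].
rewrite E1 E2 [X in _ + _ * X + _]mean_eta [X in _ + _ * X]var_eta mulr0 addr0 mulr1 -expectD//.
  by congr expect; apply/funext => w; rewrite mulrDr.
exact: IFh mbe2 be2M.
Qed.

End moments.

End one_step.

(** * Local averages *)

Section riemann_sums.
Context {R : realType}.
Local Notation mu := (@lebesgue_measure R).

Lemma segment_uniform_continuity (g : R -> R) (e : R) : {within `[0, 1], continuous g} -> 0 < e ->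
  exists2 r, 0 < r & forall s t, `[0, 1]%classic s -> `[0, 1]%classic t -> `|s - t| < r -> `|g s - g t| <= e.
Proof.
move=> cg e0; have e20 : 0 < e / 2 by rewrite divr_gt0.
have cI : compact (`[0, 1]%classic : set R) by exact: segment_compact.
have local (t : R) : `[0, 1]%classic t -> exists2 r, 0 < r & forall s, `[0, 1]%classic s -> `|t - s| < r -> `|g t - g s| < e / 2.
  move=> t01; have : nbhs_subspace (A := `[0, 1]%classic : set R) t (g @^-1` ball (g t) (e / 2)).
    by apply: (@cg t); exact: nbhsx_ballx.
  rewrite -(nbhs_subspace_in t01) => /nbhs_ballP[r /= r0 H].
  by exists r => // s s01 ts; apply: H.
have : \forall r \near (0 : R)^'+, forall t, `[0, 1]%classic t ->
    (forall s, `[0, 1]%classic s -> `[0, 1]%classic t -> `|s - t| < r -> `|g s - g t| <= e).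
  apply: ((compact_near_coveringP _).1 cI _ _ (fun r t => forall s, `[0, 1]%classic s -> `[0, 1]%classic t -> `|s - t| < r -> `|g s - g t| <= e) _) => t t01.
  have [r r0 Hr] := local t t01; have r20 : 0 < r / 2 by rewrite divr_gt0.
  exists (ball t (r / 2), [set r' | 0 < r' < r / 2]) => /=.
    split; first exact: nbhsx_ballx.
    near=> z; apply/andP; split; near: z; [exact: nbhs_right_gt|exact: nbhs_right_lt].
  move=> [t' r'] /= [tt' /andP[r'0 r'r]] s s01 t'01 st'.
  have h1 : `|g t - g s| < e / 2.
    apply: Hr => //; rewrite (splitr r) -(subrKA t'); apply: le_lt_trans (ler_normD _ _) _.
    by apply: ltrD => //; rewrite distrC; exact: lt_trans r'r.
  have h2 : `|g t - g t'| < e / 2.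
    by apply: Hr => //; apply: lt_trans tt' _; rewrite ltr_pdivrMr// ltr_pMr// ltr1n.
  rewrite (splitr e) -(subrKA (g t)); apply: le_trans (ler_normD _ _) _.
  by rewrite lerD// ?(ltW h2)// distrC ltW.
move=> H; have [r [r0 {}H]] := filter_ex (filterI (nbhs_right_gt 0) H).
by exists r => // s t s01 t01 st; exact: H.
Unshelve. all: by end_near. Qed.

Lemma continuous_segment_integrable (g : R -> R) (a b : R) : 0 <= a -> b <= 1 -> {within `[0, 1], continuous g} ->
  mu.-integrable `[a, b] (EFin \o g).
Proof.
move=> a0 b1 cg; apply: continuous_compact_integrable; first exact: segment_compact.
apply: continuous_subspaceW cg => x /=; rewrite !in_itv/= => /andP[h1 h2].
by rewrite (le_trans a0)// (le_trans h2).
Qed.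

Lemma riemann_sum_cvg (g : R -> R) : {within `[0, 1], continuous g} ->
  n%:R^-1 * \sum_(k < n) g (k.+1%:R / n%:R) @[n --> \oo] --> Rintegral mu `[0, 1] g.
Proof.
move=> cg; apply/cvgrPdist_le => e e0.
have [r r0 Hr] := segment_uniform_continuity cg e0.
near=> n.
have n0 : (0 < n)%N by near: n; exact: nbhs_infty_gt.
have n0' : 0 < n%:R :> R by rewrite ltr0n.
have nr : n%:R^-1 < r.
  rewrite invf_plt ?posrE//; near: n; exact: nbhs_infty_gtr.
pose I j := Rintegral mu `[0, j%:R / n%:R] g.
have I0 : I 0%N = 0.
  by rewrite /I mul0r set_itv1 /Rintegral integral_set1.
have In : I n = Rintegral mu `[0, 1] g by rewrite /I divff// gt_eqF.
have jn j : (j <= n)%N -> j%:R / n%:R <= 1 :> R.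
  by move=> h; rewrite ler_pdivrMr// mul1r ler_nat.
have j0 j : 0 <= j%:R / n%:R :> R by rewrite divr_ge0.
have step j : (j < n)%N -> `|I j.+1 - I j - n%:R^-1 * g (j.+1%:R / n%:R)| <= e * n%:R^-1.
  move=> jlt; have jj : j%:R / n%:R <= j.+1%:R / n%:R :> R by rewrite ler_pM2r ?invr_gt0// ler_nat.
  have iJ : mu.-integrable `[0, j.+1%:R / n%:R] (EFin \o g).
    by apply: continuous_segment_integrable => //; exact: jn.
  rewrite /I Rintegral_itvB ?bnd_simp//.
  set J := [set` _]; have mJ : measurable J by exact: measurable_itv.
  have muJ : mu J = (n%:R^-1)%:E.
    rewrite /J lebesgue_measure_itv/= lte_fin ltr_pM2r ?invr_gt0// ltr_nat ltnSn.
    by rewrite -EFinB -mulrBl -natrB// subSnn mul1r.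
  have JE t : J t -> j%:R / n%:R < t <= j.+1%:R / n%:R by rewrite /J /= in_itv.
  have iJ' : mu.-integrable J (EFin \o g).
    apply: integrableS iJ => // t /JE /andP[h1 h2] /=; rewrite in_itv/= h2 andbT.
    by rewrite (le_trans _ (ltW h1)).
  have ic (r' : R) : mu.-integrable J (EFin \o (cst r')).
    have ic0 : mu.-integrable `[0, 1] (EFin \o (fun=> r')).
      by apply: continuous_segment_integrable => //; apply: continuous_subspaceT; exact: cst_continuous.
    apply: integrableS ic0 => // t' /JE /andP[h1 h2] /=.
    by rewrite in_itv/= (le_trans (j0 j) (ltW h1)) (le_trans h2 (jn _ jlt)).
  have cJ r' : Rintegral mu J (cst r') = r' * n%:R^-1.
    by rewrite Rintegral_cst//; congr (_ * _); rewrite [X in fine X]muJ.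
  have -> : n%:R^-1 * g (j.+1%:R / n%:R) = Rintegral mu J (cst (g (j.+1%:R / n%:R))).
    by rewrite cJ mulrC.
  have iB : mu.-integrable J (EFin \o (fun t => g t - g (j.+1%:R / n%:R))).
    by have H := fun mD => integrableB mD iJ' (ic (g (j.+1%:R / n%:R))); apply: H.
  rewrite -RintegralB//; last exact: ic.
  apply: le_trans (le_normr_Rintegral _ _) _ => //.
  rewrite -[leRHS](cJ e).
  apply: le_Rintegral => //.
  - exact: (integrable_norm iB).
  - exact: ic.
  move=> t /JE /andP[h1 h2] /=; apply: Hr => /=; rewrite ?in_itv/=.
  - by rewrite (le_trans (j0 j) (ltW h1))/= (le_trans h2)// jn.
  - by rewrite j0 jn.
  rewrite distrC ger0_norm ?subr_ge0//; apply: le_lt_trans nr.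
  rewrite lerBlDr (le_trans _ (lerD (lexx n%:R^-1) (ltW h1)))// -[X in X + _]mul1r -mulrDl.
  by rewrite -natr1 addrC.
have tel : I n = \sum_(k < n) (I k.+1 - I k).
  by rewrite -(big_mkord xpredT (fun k => I k.+1 - I k)) telescope_sumr// I0 subr0.
rewrite -In tel mulr_sumr -sumrB.
apply: (le_trans (ler_norm_sum _ _ _)); apply: (@le_trans _ _ (\sum_(k < n) e * n%:R^-1)).
  by apply: ler_sum => k _; exact: step.
by rewrite sumr_const card_ord -[X in X <= _]mulr_natr mulfVK// gt_eqF.
Unshelve. all: by end_near. Qed.

End riemann_sums.

(** * Kernel averages over shrinking windows *)

Section local_averages.
Context {R : realType} (d : nat).
Local Notation lam := (@lebesgue_rV R d).

Lemma Rintegral_rescale (b : R) (u : 'rV[R]_d) (g : 'rV[R]_d -> R) : 0 < b ->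
  lam.-integrable setT (EFin \o g) ->
  Rintegral lam setT g = b ^+ d * Rintegral lam setT (fun s => g (u - b *: s)).
Proof.
move=> b0 Ig; have mg : measurable_fun setT (EFin \o g) := measurable_int _ Ig.
have bd0 : 0 < b ^+ d by rewrite exprn_gt0.
have Hp := lebesgue_rV_rescale u b0 (measurable_funepos mg) (funepos_ge0 _).
have Hn := lebesgue_rV_rescale u b0 (measurable_funeneg mg) (funeneg_ge0 _).
have fp := integrable_pos_fin_num measurableT Ig.
have fn := integrable_neg_fin_num measurableT Ig.
have inv (x y : \bar R) : (x = (b ^+ d)%:E * y -> y = ((b ^+ d)^-1)%:E * x)%E.
  by move=> ->; rewrite muleA -EFinM mulVf ?mul1e// gt_eqF.
rewrite /Rintegral integralE [in RHS]integralE.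
rewrite (_ : (\int[lam]_s ((fun s => (g (u - b *: s))%:E)^\+ s))%E = ((b ^+ d)^-1)%:E * \int[lam]_v ((EFin \o g)^\+ v))%E; last first.
  by apply: inv; rewrite Hp; congr (_ * _)%E; apply: eq_integral => s _; rewrite !funeposE.
rewrite (_ : (\int[lam]_s ((fun s => (g (u - b *: s))%:E)^\- s))%E = ((b ^+ d)^-1)%:E * \int[lam]_v ((EFin \o g)^\- v))%E; last first.
  by apply: inv; rewrite Hn; congr (_ * _)%E; apply: eq_integral => s _; rewrite !funenegE.
rewrite -(fineK fp) -(fineK fn) -!EFinM -!EFinB /= -mulrBr mulrA divff ?mul1r// gt_eqF//.
Qed.

Section cube_supported.
Variables (phi : 'rV[R]_d -> R) (M : R).
Hypotheses (mphi : measurable_fun setT phi) (phiM : forall s, `|phi s| <= M).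
Hypothesis phi_out : forall s, ~ cube s -> phi s = 0.

Lemma cube_supported_integrable (g : 'rV[R]_d -> R) (N : R) : measurable_fun setT g ->
  (forall s, cube s -> `|g s| <= N) -> lam.-integrable setT (EFin \o (fun s => phi s * g s)).
Proof.
move=> mg gN; have M0 : 0 <= M := le_trans (normr_ge0 _) (phiM 0).
have mpg : measurable_fun setT (fun s => phi s * g s) by exact: measurable_funM.
apply/integrableP; split; first exact/measurable_EFinP.
apply: (@le_lt_trans _ _ (\int[lam]_s ((M * N)%:E * (\1_(@cube R d) s)%:E))%E).
  apply: ge0_le_integral => //.
  - by apply: measurableT_comp => //; exact/measurable_EFinP.
  - by apply: emeasurable_funM => //; apply/measurable_EFinP/measurable_indic; exact: measurable_cube.
  move=> s _ /=; rewrite -EFinM lee_fin indicE.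
  have [cs|cs] := pselect (cube s); last by rewrite phi_out// mul0r normr0 memNset// mulr0.
  by rewrite mem_set// mulr1 normrM ler_pM// gN.
have N0 : 0 <= N.
  have c0 : cube (0 : 'rV[R]_d) by move=> i; rewrite mxE; lra.
  exact: le_trans (normr_ge0 _) (gN _ c0).
rewrite ge0_integralZl//; last 2 first.
- by apply/measurable_EFinP/measurable_indic; exact: measurable_cube.
- by rewrite lee_fin mulr_ge0.
rewrite integral_indic ?setIT//; last exact: measurable_cube.
apply: (eq_ind_r (fun x => ((M * N)%:E * x < +oo)%E) _ (@lebesgue_cube R d)).
by rewrite -EFinM ltry.
Qed.

Lemma cube_supported_Rintegral : Rintegral lam (@cube R d) phi = Rintegral lam setT phi.
Proof.
rewrite /Rintegral integral_mkcond; congr fine; apply: eq_integral => s _; rewrite /patch.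
by case: ifPn => // /negP cs; rewrite phi_out// => h; apply: cs; exact: mem_set.
Qed.

(** On the support of [phi] the argument stays within [b n] of [u], so [G] may be replaced by its
    value at [u], uniformly in time; what is left is a Riemann sum. *)
Lemma local_average_cvg (G : 'rV[R]_d -> R -> R) (b : nat -> R) (u : 'rV[R]_d) :
  {within setT `*` `[0, 1], continuous (fun p : 'rV[R]_d * R^o => G p.1 p.2)} ->
  (forall n, 0 < b n) -> b n @[n --> \oo] --> (0 : R) ->
  n%:R^-1 * \sum_(k < n) Rintegral lam setT (fun s => phi s * G (u - b n *: s) (k.+1%:R / n%:R)) @[n --> \oo] -->
  Rintegral lam setT phi * Rintegral lebesgue_measure `[0, 1] (G u).
Proof.
move=> cG b0 bcvg.
pose t n k : R := k.+1%:R / n%:R.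
have t01 n k : (k < n)%N -> `[0, 1]%classic (t n k).
  move=> kn; rewrite /= in_itv/= /t divr_ge0//= ler_pdivrMr ?mul1r ?ler_nat// ltr0n.
  exact: leq_ltn_trans kn.
have Iphi : lam.-integrable setT (EFin \o phi).
  have := @cube_supported_integrable (fun=> 1) 1 (measurable_cst _); under eq_fun do rewrite mulr1.
  by apply => s _; rewrite normr1.
have mGt n k : (k < n)%N -> measurable_fun setT (fun s : 'rV[R]_d => G (u - b n *: s) (t n k)).
  move=> kn; have mGtk : measurable_fun setT (fun v => G v (t n k)).
    by apply: continuous_measurable_rV; apply: (space_time_continuous_l cG); exact: t01.
  exact: (measurableT_comp mGtk (measurable_rescaling (b n) u)).
have scube n (s : 'rV[R]_d) i : cube s -> `|u ord0 i - (u - b n *: s) ord0 i| <= b n.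
  move=> /(_ i); rewrite -ler_norml => si.
  rewrite !mxE opprB addrC subrK normrM gtr0_norm//.
  by rewrite ler_piMr// ltW.
have IG n k : (k < n)%N -> lam.-integrable setT (EFin \o (fun s => phi s * G (u - b n *: s) (t n k))).
  move=> kn; have [N HN] := space_time_bounded cG u (b n).
  apply: (cube_supported_integrable (mGt n k kn) (N := N)) => s cs.
  by apply: HN; [exact: t01|move=> i; exact: scube].
pose L := Rintegral lam setT phi.
pose A n := n%:R^-1 * \sum_(k < n) Rintegral lam setT (fun s => phi s * G (u - b n *: s) (t n k)).
pose C n := n%:R^-1 * \sum_(k < n) G u (t n k).
have Ccvg : L * C n @[n --> \oo] --> L * Rintegral lebesgue_measure `[0, 1] (G u).
  by apply: cvgM; [exact: cvg_cst|apply: riemann_sum_cvg; exact: space_time_continuous_r].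
suff D0 : A n - L * C n @[n --> \oo] --> (0 : R).
  rewrite -/L -[X in _ --> X]add0r (_ : (fun n => _) = (fun n => (A n - L * C n) + L * C n)); first exact: cvgD D0 Ccvg.
  by apply/funext => n; rewrite subrK.
pose W := Rintegral lam setT (fun s => `|phi s|).
have W0 : 0 <= W by apply: Rintegral_ge0.
apply/cvgr0Pnorm_le => e e0.
(* [W] is the integral of [|phi|]; the 1 guards against division by 0. *)
have e10 : 0 < e / (W + 1) by rewrite divr_gt0// ltr_wpDl.
have [r r0 Hr] := space_time_equicontinuous cG u e10.
have br : \forall n \near \oo, b n < r.
  have := bcvg => /cvgr0Pnorm_lt/(_ _ r0); apply: filterS => n; exact: le_lt_trans (ler_norm _).
apply: filterS br => n bnr.
case: n bnr => [|n] bnr; first by rewrite /A /C !big_ord0 !mulr0 subrr normr0 ltW.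
rewrite /A /C mulrCA -mulrBr mulr_sumr -sumrB normrM ger0_norm ?invr_ge0//.
rewrite ler_pdivrMl ?ltr0n//; apply: le_trans (ler_norm_sum _ _ _) _.
rewrite mulr_natl -[X in _ *+ X]card_ord -sumr_const; apply: ler_sum => k _.
have IGu : lam.-integrable setT (EFin \o (fun s => phi s * G u (t n.+1 k))).
  by have := integrableZl measurableT (G u (t n.+1 k)) Iphi; congr integrable; apply/funext => s /=; rewrite mulrC.
have IGk := IG n.+1 k (ltn_ord k).
rewrite /L mulrC -RintegralZl//.
under [X in _ - X]eq_Rintegral do rewrite mulrC.
rewrite -RintegralB//; apply: le_trans (le_normr_Rintegral _ _) _ => //.
  by have := integrableB measurableT IGk IGu.
apply: (@le_trans _ _ (Rintegral lam setT (fun s => e / (W + 1) * `|phi s|))).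
  apply: le_Rintegral => //.
  - by have := integrable_norm (integrableB measurableT IGk IGu).
  - by have := integrableZl measurableT (e / (W + 1)) (integrable_norm Iphi).
  move=> s _; rewrite -mulrBr normrM mulrC.
  have [cs|cs] := pselect (cube s); last by rewrite phi_out// normr0 !mulr0.
  rewrite ler_wpM2r// distrC; apply: Hr; first exact: t01.
  by move=> i; apply: le_lt_trans bnr; exact: scube.
rewrite RintegralZl//; last exact: (integrable_norm Iphi).
rewrite -/W mulrAC ler_pdivrMr ?ltr_wpDl// ler_wpM2l ?(ltW e0)//.
by rewrite lerDl.
Qed.

End cube_supported.

End local_averages.

Section local_weight.
Context {R : realType} (d : nat) (u : 'rV[R]_d) (b : R).
Hypothesis b0 : 0 < b.
Local Notation lam := (@lebesgue_rV R d).

Definition rescaled (v : 'rV[R]_d) : 'rV[R]_d := b^-1 *: (u - v).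

Definition window : set 'rV[R]_d := rescaled @^-1` @cube R d.

Lemma measurable_rescaled : measurable_fun setT rescaled.
Proof.
have := measurable_rescaling (b^-1) (b^-1 *: u); congr measurable_fun.
by apply/funext => v; rewrite /rescaled scalerBr.
Qed.

Lemma measurable_window : measurable window.
Proof. by rewrite -[X in measurable X]setTI; apply: measurable_rescaled => //; exact: measurable_cube. Qed.

Lemma rescaledK s : rescaled (u - b *: s) = s.
Proof. by rewrite /rescaled opprB addrC subrK scalerA mulVf ?scale1r// gt_eqF. Qed.

Lemma windowP v : window v -> forall i, `|u ord0 i - v ord0 i| <= b.
Proof.
move=> + i => /(_ i); rewrite !mxE -ler_norml normrM ger0_norm ?invr_ge0 ?(ltW b0)//.
by rewrite ler_pdivrMl// mulr1.
Qed.

Lemma lebesgue_window : lam window = (b ^+ d * 2 ^+ d)%:E.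
Proof.
have mW := measurable_window.
have EW : (\int[lam]_v (\1_window v)%:E)%E = lam window by rewrite integral_indic// setIT.
have EC : (\int[lam]_v (\1_(@cube R d) v)%:E)%E = lam (@cube R d).
  by rewrite integral_indic ?setIT//; exact: measurable_cube.
have mI : measurable_fun setT (fun v => (\1_window v : R)%:E) by apply/measurable_EFinP; exact: measurable_indic.
rewrite -EW (lebesgue_rV_rescale u b0 mI); last by move=> v; rewrite lee_fin.
rewrite [RHS]EFinM; congr (_ * _)%E; apply: etrans (etrans EC (@lebesgue_cube R d)).
apply: eq_integral => s _; rewrite !indicE; congr ((_ : bool)%:R)%:E.
have E : window (u - b *: s) = cube s := congr1 (@cube R d) (rescaledK s).
by apply/idP/idP => /set_mem h; apply/mem_set; [rewrite -E|rewrite E].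
Qed.

Variables (phi : 'rV[R]_d -> R) (M : R).
Hypotheses (mphi : measurable_fun setT phi) (phiM : forall s, `|phi s| <= M).
Hypothesis phi_out : forall s, ~ cube s -> phi s = 0.
Variables (g : 'rV[R]_d -> R) (N : R).
Hypothesis mg : measurable_fun setT g.
Hypothesis gN : forall v : 'rV[R]_d, (forall i, `|u ord0 i - v ord0 i| <= b) -> `|g v| <= N.

(** The common shape of all weights below. Its [L^1] norm is of order [b^d], the volume of the
    window, and this is the source of every power of the bandwidth. *)
Definition local_weight (v : 'rV[R]_d) := g v * phi (rescaled v).

Lemma measurable_local_weight : measurable_fun setT local_weight.
Proof. by apply: measurable_funM => //; exact: (measurableT_comp mphi measurable_rescaled). Qed.

Lemma local_weight_le v : `|local_weight v| <= N * M * \1_window v.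
Proof.
rewrite indicE /local_weight; case: (boolP (v \in window)) => [/set_mem wv|/negP wv].
  by rewrite mulr1 normrM ler_pM//; apply: gN; exact: windowP.
by rewrite phi_out ?mulr0 ?normr0// => h; apply: wv; exact: mem_set.
Qed.

Let NM0 : 0 <= N * M.
Proof.
rewrite mulr_ge0//; last exact: le_trans (normr_ge0 _) (phiM 0).
by apply: le_trans (normr_ge0 _) (gN (v := u) _) => i; rewrite subrr normr0 ltW.
Qed.

Lemma local_weight_integral : (\int[lam]_v (`|local_weight v|)%:E <= (N * M * (b ^+ d * 2 ^+ d))%:E)%E.
Proof.
have mW := measurable_window.
apply: (@le_trans _ _ (\int[lam]_v ((N * M)%:E * (\1_window v)%:E))%E).
  apply: ge0_le_integral => //.
  - by apply/measurable_EFinP; apply: measurableT_comp => //; exact: measurable_local_weight.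
  - by apply: emeasurable_funM => //; apply/measurable_EFinP; exact: measurable_indic.
  by move=> v _; rewrite -EFinM lee_fin local_weight_le.
rewrite ge0_integralZl//; last by apply/measurable_EFinP; exact: measurable_indic.
rewrite integral_indic// setIT [in leRHS]EFinM.
by apply: lee_wpmul2l; [rewrite lee_fin|rewrite -lebesgue_window].
Qed.

Lemma local_weight_rescale (F : 'rV[R]_d -> R) (L : R) : measurable_fun setT F -> (forall v, `|F v| <= L) ->
  Rintegral lam setT (fun v => local_weight v * F v) =
  b ^+ d * Rintegral lam setT (fun s => phi s * (g (u - b *: s) * F (u - b *: s))).
Proof.
move=> mF FL; rewrite (Rintegral_rescale u b0); last first.
  have mw := measurable_local_weight.
  apply/integrableP; split; first by apply/measurable_EFinP; exact: measurable_funM.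
  apply: (@le_lt_trans _ _ (\int[lam]_v (L%:E * (`|local_weight v|)%:E))%E).
    apply: ge0_le_integral => //.
    - by apply: measurableT_comp => //; apply/measurable_EFinP; exact: measurable_funM.
    - by apply: emeasurable_funM => //; apply/measurable_EFinP; exact: measurableT_comp.
    by move=> v _; rewrite /= -EFinM lee_fin normrM mulrC ler_wpM2r.
  have L0 : 0 <= L := le_trans (normr_ge0 _) (FL 0).
  rewrite ge0_integralZl//; last by apply/measurable_EFinP; exact: measurableT_comp.
  by apply: lte_mul_pinfty => //; apply: le_lt_trans local_weight_integral (ltry _).
congr (_ * _); apply: eq_Rintegral => s _.
by rewrite /local_weight rescaledK; ring.
Qed.

End local_weight.

Section expectation_bounds.
Context {R : realType} d (T : measurableType d) (P : probability T R).

Lemma expect_dominated_cvg0 (X : nat -> T -> R) (g : T -> R) : (forall n, measurable_fun setT (X n)) ->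
  P.-integrable setT (EFin \o g) -> (forall n w, `|X n w| <= g w) ->
  (forall w, X n w @[n --> \oo] --> (0 : R)) -> expect P (X n) @[n --> \oo] --> (0 : R).
Proof.
move=> mX Ig Xg X0.
have mXE n : measurable_fun setT (EFin \o X n) by exact/measurable_EFinP.
have [] := @dominated_convergence _ T R P setT measurableT (fun n => EFin \o X n) (cst 0%E) (EFin \o g) mXE.
- exact: measurable_cst.
- by apply: aeW => w _; apply/fine_cvgP; split; [exact: nearW|exact: X0].
- exact: Ig.
- by apply: aeW => w n _ /=; rewrite lee_fin.
move=> _ _; rewrite integral0 => H.
have -> : (fun n => expect P (X n)) = fine \o (fun n => (\int[P]_(x in setT) (EFin \o X n) x)%E).
  by apply/funext => n; rewrite expectE.
exact: fine_cvg H.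
Qed.

Lemma expect_norm_deviation (Y : T -> R) (M y : R) : measurable_fun setT Y -> (forall w, `|Y w| <= M) ->
  0 <= y -> expect P (fun w => Y w ^+ 2) - expect P Y ^+ 2 <= y ^+ 2 ->
  expect P (fun w => `|Y w - expect P Y|) <= y.
Proof.
move=> mY YM y0 H; set a := expect P Y; set b := expect P _.
have M0 : 0 <= M := le_trans (normr_ge0 _) (YM point).
have IY : P.-integrable setT (EFin \o Y) by exact: bounded_integrable YM.
have IY2 : P.-integrable setT (EFin \o (fun w => Y w ^+ 2)).
  apply: (@bounded_integrable _ _ _ P _ (M ^+ 2)); first exact: measurable_funX.
  by move=> w; rewrite normrX lerXn2r ?nnegrE.
have IYa : P.-integrable setT (EFin \o (fun w => Y w - a)) by apply: integB => //; exact: integ_cst.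
have b0 : 0 <= b by apply: expect_ge0.
(* The variance of [|Y - a|] is nonnegative, which bounds the square of the mean absolute deviation
   by the variance of [Y]. *)
have : 0 <= expect P (fun w => (`|Y w - a| - b) ^+ 2) by apply: expect_ge0 => w; exact: sqr_ge0.
have -> : (fun w => (`|Y w - a| - b) ^+ 2) = (fun w => (Y w ^+ 2 - 2 * a * Y w) - 2 * b * `|Y w - a| + (a ^+ 2 + b ^+ 2)).
  apply/funext => w; rewrite sqrrB real_normK ?num_real// sqrrB; move: (`|_|) => z; ring.
have I1 := integB IY2 (integZ (2 * a) IY).
have I2 := integZ (2 * b) (integ_norm IYa).
rewrite expectD; [|exact: integB|exact: integ_cst].
rewrite expectB// expectB//; last exact: integZ.
rewrite (expectZ (2 * b) (integ_norm IYa)) (expectZ (2 * a) IY) expect_cst -/a -/b => H2.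
have b2 : b ^+ 2 <= y ^+ 2.
  apply: le_trans H.
  by move: H2; rewrite !expr2 -!mulrA; move: (a * a) (b * b) (expect _ _) => *; lra.
by rewrite -(ler_pXn2r (n := 2)) ?nnegrE.
Qed.

End expectation_bounds.

(** * Stationarity and the dependence measure *)

Section stationarity.
Context {R : realType} d (Omega : measurableType d) (P : probability Omega R).
Context dE (E : measurableType dE) (xi xi' : int -> Omega -> E).
Hypothesis iid_xi : iid P (joint xi xi').

Lemma joint_measurable k : measurable_fun setT (xi k).
Proof. by case: iid_xi => m _ _; exact: (m (inl k)). Qed.

Let past_inj k : injective (fun j : nat => inl (k - j%:Z) : int + int).
Proof. by move=> i j [] /addrI /oppr_inj []. Qed.

Let coupled_index k (j : nat) : int + int := if k - j%:Z == 0 then inr 0 else inl (k - j%:Z).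

Let coupled_inj k : injective (coupled_index k).
Proof.
move=> i j; rewrite /coupled_index; case: eqP => hi; case: eqP => hj //.
  by move=> _; have : k - i%:Z = k - j%:Z by [rewrite hi hj]; move=> /addrI /oppr_inj [].
by move=> [] /addrI /oppr_inj [].
Qed.

Let coupledE k w : past (coupled xi xi') k w = fun j => joint xi xi' (coupled_index k j) w.
Proof. by apply/funext => j; rewrite /past /coupled /coupled_index; case: ifP. Qed.

Lemma measurable_past_coupled k : measurable_fun setT (past (coupled xi xi') k).
Proof.
have := iid_measurable (iid_reindex (@coupled_inj k) iid_xi); congr measurable_fun.
by apply/funext => w; rewrite coupledE.
Qed.

Lemma past_law k (B : set (history E)) : measurable B -> P (past xi k @^-1` B) = P (past xi 0 @^-1` B).
Proof.
move=> mB.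
have := @iid_same_law _ _ _ P _ E _ _ _ (iid_reindex (@past_inj k) iid_xi) (iid_reindex (@past_inj 0) iid_xi) _ B mB.
apply => j C mC.
by case: iid_xi => _ idX _; exact: (idX (inl _) (inl _)).
Qed.

Lemma past_coupled_law k (B : set (history E)) : measurable B ->
  P (past (coupled xi xi') k @^-1` B) = P (past xi 0 @^-1` B).
Proof.
move=> mB.
have := @iid_same_law _ _ _ P _ E _ _ _ (iid_reindex (@coupled_inj k) iid_xi) (iid_reindex (@past_inj 0) iid_xi) _ B mB.
rewrite (_ : past (coupled xi xi') k = (fun w j => (joint xi xi' \o coupled_index k) j w)); last first.
  by apply/funext => w; rewrite coupledE.
apply => j C mC.
by case: iid_xi => _ idX _; exact: idX.
Qed.

Lemma past_expect k (f : history E -> R) : measurable_fun setT f -> (forall z, 0 <= f z) ->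
  expect P (fun w => f (past xi k w)) = expect P (fun w => f (past xi 0 w)).
Proof.
move=> mf f0; rewrite !expectE /Rintegral; congr fine.
have mfE : measurable_fun setT (EFin \o f : prodspace E nat -> \bar R) by exact/measurable_EFinP.
have f0E (z : prodspace E nat) : (0 <= (EFin \o f) z)%E by rewrite lee_fin.
exact: (iid_law_reindex iid_xi (@past_inj k) (@past_inj 0) mfE f0E).
Qed.

End stationarity.

(** * The version of the density against the original one *)

Section conditional_density.
Context {R : realType} d (Omega : measurableType d) (P : probability Omega R).
Context dE (E : measurableType dE) (xi xi' : int -> Omega -> E) (r : nat).
Hypothesis iid_xi : iid P (joint xi xi').
Variable Q : R -> R.-pker (history E) ~> 'rV[R]_r.
Variables (A : set (history E)) (f : 'rV[R]_r * history E -> R) (c t : R).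
Hypotheses (mA : measurable A) (PA : P (past xi 0 @^-1` A) = 1%E).
Hypotheses (t01 : `[0, 1]%classic t) (mf : measurable_fun setT f) (f0c : forall p, 0 <= f p <= c).
Hypothesis fE : forall h v, A h -> f (v, h) = cond_pdf Q v t h.

Let null_compl (Z : Omega -> history E) : measurable_fun setT Z -> P (Z @^-1` A) = 1%E ->
  measurable (~` (Z @^-1` A)) /\ P (~` (Z @^-1` A)) = 0%E.
Proof.
move=> mZ PZ; have mZA := preimage_measurable mZ mA; split; first exact: measurableC.
by apply: etrans (probability_setC P mZA) _; rewrite PZ subee.
Qed.

(** [cond_pdf] along the past need not be measurable; it agrees with the version off a measurable
    null event, which is enough to identify the integrals. *)
Lemma marginal_pdfE v k : marginal_pdf P xi Q v t = expect P (fun w => f (v, past xi k w)).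
Proof.
have mfv : measurable_fun setT (fun h : history E => f (v, h)) by exact: measurable_fun_pair2.
rewrite (past_expect iid_xi k mfv); last by move=> z; case/andP: (f0c (v, z)).
have [mN N0] := null_compl (measurable_past 0 (joint_measurable iid_xi)) PA.
rewrite /marginal_pdf !expectE /Rintegral; congr fine.
apply: (integral_eq_off_null mN N0) => w /contrapT Aw.
by rewrite fE.
Qed.

(** The coupled past has the same law as the past itself, so it also avoids the exceptional
    histories almost surely. Off the union of the two null events the norm inside [psi] is that of
    the version. *)
Lemma dependence_bound v l : (psi P xi xi' Q l 2 < +oo)%E ->
  expect P (fun w => (f (v, past xi l%:Z w) - f (v, past (coupled xi xi') l%:Z w)) ^+ 2) <=
  fine (psi P xi xi' Q l 2) ^+ 2.
Proof.
move=> psi_fin.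
have m1 := measurable_past l%:Z (joint_measurable iid_xi).
have m2 := measurable_past_coupled iid_xi l%:Z.
have [mN1 N10] := null_compl m1 (etrans (past_law iid_xi l%:Z mA) PA).
have [mN2 N20] := null_compl m2 (etrans (past_coupled_law iid_xi l%:Z mA) PA).
pose N := ~` (past xi l%:Z @^-1` A) `|` ~` (past (coupled xi xi') l%:Z @^-1` A).
have mN : measurable N by exact: measurableU.
have N0 : P N = 0%E by rewrite measureU0.
set D := fun w => _; set e := expect P D.
have mfv : measurable_fun setT (fun h : history E => f (v, h)) by exact: measurable_fun_pair2.
have mD : measurable_fun setT D.
  by apply: measurable_funX; apply: measurable_funB; [exact: (measurableT_comp mfv m1)|exact: (measurableT_comp mfv m2)].
have c0 : 0 <= c by case/andP: (f0c (0, point)); exact: le_trans.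
have iD : P.-integrable setT (EFin \o D).
  apply: (@bounded_integrable _ _ _ P _ (c ^+ 2)) => // w; rewrite /D normrX lerXn2r ?nnegrE//.
  have /andP[h1 h2] := f0c (v, past xi l%:Z w); have /andP[h3 h4] := f0c (v, past (coupled xi xi') l%:Z w).
  by rewrite ler_norml; apply/andP; split; lra.
have e0 : 0 <= e by apply: expect_ge0 => w; exact: sqr_ge0.
have LE : Lnorm P 2%:E (fun w => (cond_pdf Q v t (past xi l%:Z w) -
    cond_pdf Q v t (past (coupled xi xi') l%:Z w))%:E) = (Num.sqrt e)%:E.
  rewrite unlock (integral_eq_off_null mN N0 (g := fun w => (D w)%:E)); last first.
    move=> w /not_orP[/contrapT A1 /contrapT A2].
    by rewrite /D !fE// poweR_EFin powR_mulrn// real_normK// num_real.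
  rewrite (_ : (\int[P]_w (D w)%:E)%E = e%:E); last first.
    by rewrite /e expectE /Rintegral fineK//; exact: (integrable_fin_num measurableT iD).
  by rewrite poweR_EFin powR12_sqrt.
have Lpsi : ((Num.sqrt e)%:E <= psi P xi xi' Q l 2)%E.
  rewrite -LE; apply: le_trans (ereal_sup_ubound _); last by exists t.
  by apply: ereal_sup_ubound; exists v.
have psi0 : (0 <= psi P xi xi' Q l 2)%E by apply: le_trans Lpsi; rewrite lee_fin sqrtr_ge0.
have : Num.sqrt e <= fine (psi P xi xi' Q l 2) by rewrite -lee_fin fineK// ge0_fin_numE.
by rewrite -{2}(sqr_sqrtr e0) => h; rewrite lerXn2r ?nnegrE ?sqrtr_ge0 ?fine_ge0.
Qed.

Lemma expect_weighted_integral (w : 'rV[R]_r -> R) (B : R) k : measurable_fun setT w ->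
  (\int[lebesgue_rV r]_v (`|w v|)%:E <= B%:E)%E ->
  expect P (fun x => weighted_integral (lebesgue_rV r) w f (past xi k x)) =
  Rintegral (lebesgue_rV r) setT (fun v => w v * marginal_pdf P xi Q v t).
Proof.
move=> mw wB.
have mH := measurable_past k (joint_measurable iid_xi).
have c0 : 0 <= c by case/andP: (f0c (0, point)); exact: le_trans.
pose g (p : Omega * 'rV[R]_r) : R := w p.2 * f (p.2, past xi k p.1).
have mg : measurable_fun setT g.
  apply: measurable_funM; first exact: (measurableT_comp mw measurable_snd).
  by apply: (measurableT_comp mf); apply: measurable_fun_pair => //; exact: (measurableT_comp mH measurable_fst).
have mgE : measurable_fun setT (EFin \o g) by exact/measurable_EFinP.
have sec x : (\int[lebesgue_rV r]_v (`|g (x, v)|)%:E <= (c * B)%:E)%E.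
  apply: (@le_trans _ _ (\int[lebesgue_rV r]_v (c%:E * (`|w v|)%:E))%E).
    apply: ge0_le_integral => //.
    - by apply/measurable_EFinP; apply: measurableT_comp => //; exact: measurable_fun_pair2.
    - by apply: emeasurable_funM => //; apply/measurable_EFinP; exact: measurableT_comp.
    move=> v _; have /andP[p0 pc] := f0c (v, past xi k x).
    by rewrite -EFinM lee_fin normrM mulrC ler_wpM2r// ger0_norm.
  rewrite ge0_integralZl//; last by apply/measurable_EFinP; exact: measurableT_comp.
  by rewrite EFinM lee_wpmul2l.
have Ig : (P \x lebesgue_rV r)%E.-integrable setT (EFin \o g).
  apply: (@integrable12ltyP _ _ Omega 'rV[R]_r R P (lebesgue_rV r) _ mgE).2.
  apply: (@le_lt_trans _ _ (\int[P]_x (c * B)%:E)%E).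
    apply: ge0_le_integral => //.
    - by move=> x _; apply: integral_ge0.
    - apply: (@measurable_fun_fubini_tonelli_F _ _ _ _ _ (lebesgue_rV r) (abse \o (EFin \o g))).
        exact: measurableT_comp.
      by move=> p; exact: abse_ge0.
    by move=> x _; exact: sec.
  rewrite integral_cst//; apply: (eq_ind_r (fun y => ((c * B)%:E * y < +oo)%E) _ (probability_setT P)).
  by rewrite mule1 ltry.
have := Fubini Ig => /= F.
transitivity (fine (\int[P]_x \int[lebesgue_rV r]_v (g (x, v))%:E)%E).
  rewrite expectE /Rintegral; congr fine; apply: eq_integral => x _ /=.
  rewrite /weighted_integral /Rintegral fineK//.
  exact: (integrable_fin_num measurableT (weighted_integrable mw mf wB f0c (past xi k x))).
rewrite F /Rintegral; congr fine; apply: eq_integral => v _.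
have mfv : measurable_fun setT (fun h : history E => f (v, h)) by exact: measurable_fun_pair2.
have Ifv : P.-integrable setT (EFin \o (fun x => f (v, past xi k x))).
  apply: (@bounded_integrable _ _ _ P _ c); first exact: (measurableT_comp mfv mH).
  by move=> x; have /andP[p0 pc] := f0c (v, past xi k x); rewrite ger0_norm.
rewrite (marginal_pdfE v k) expectE /Rintegral /g /=.
under eq_integral do rewrite EFinM.
rewrite integralZl// EFinM fineK//.
exact: (integrable_fin_num measurableT Ifv).
Qed.

Hypothesis Qf : forall h B, A h -> measurable B -> (Q t h B = \int[lebesgue_rV r]_(v in B) (f (v, h))%:E)%E.
Hypothesis f_out : forall h v, ~ A h -> f (v, h) = 0.

Lemma conditional_density_mass h : (\int[lebesgue_rV r]_v (f (v, h))%:E <= 1)%E.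
Proof.
have [Ah|Ah] := pselect (A h).
  by rewrite -(Qf Ah measurableT) prob_kernel.
by rewrite integral0_eq// => v _; rewrite f_out.
Qed.

(* Jensen's inequality for the sub-probability density [f (., h)]. *)
Lemma weighted_integral_sqr (w : 'rV[R]_r -> R) (B N : R) h : measurable_fun setT w ->
  (\int[lebesgue_rV r]_v (`|w v|)%:E <= B%:E)%E -> (forall v, `|w v| <= N) ->
  weighted_integral (lebesgue_rV r) w f h ^+ 2 <= weighted_integral (lebesgue_rV r) (fun v => w v ^+ 2) f h.
Proof.
move=> mw wB wN.
have N0 : 0 <= N := le_trans (normr_ge0 _) (wN 0).
have f0 p : 0 <= f p by case/andP: (f0c p).
have mfh : measurable_fun setT (fun v => f (v, h)) by exact: measurable_fun_pair1.
have If : (lebesgue_rV r).-integrable setT (EFin \o (fun v => f (v, h))).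
  apply/integrableP; split; first exact/measurable_EFinP.
  apply: (@le_lt_trans _ _ 1%E); last exact: ltry.
  apply: le_trans (conditional_density_mass h); rewrite le_eqVlt; apply/orP; left; apply/eqP.
  by apply: eq_integral => v _; rewrite /= ger0_norm.
have Iw := weighted_integrable mw mf wB f0c h.
have mw2 : measurable_fun setT (fun v => w v ^+ 2) by exact: measurable_funX.
have w2B : (\int[lebesgue_rV r]_v (`|w v ^+ 2|)%:E <= (N * B)%:E)%E.
  apply: (@le_trans _ _ (\int[lebesgue_rV r]_v (N%:E * (`|w v|)%:E))%E).
    apply: ge0_le_integral => //.
    - by apply/measurable_EFinP; apply: measurableT_comp.
    - by apply: emeasurable_funM => //; apply/measurable_EFinP; exact: measurableT_comp.
    by move=> v _; rewrite -EFinM lee_fin normrX expr2 ler_wpM2r.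
  rewrite ge0_integralZl//; last by apply/measurable_EFinP; exact: measurableT_comp.
  by rewrite EFinM lee_wpmul2l.
have Iw2 := weighted_integrable mw2 mf w2B f0c h.
rewrite /weighted_integral; set s := Rintegral _ _ _.
have I1 : (lebesgue_rV r).-integrable setT (EFin \o (fun v => s ^+ 2 * f (v, h))) := integrableZl measurableT (s ^+ 2) If.
have I2 : (lebesgue_rV r).-integrable setT (EFin \o (fun v => 2 * s * (w v * f (v, h)))) := integrableZl measurableT (2 * s) Iw.
have I12 : (lebesgue_rV r).-integrable setT (EFin \o (fun v => w v ^+ 2 * f (v, h) - 2 * s * (w v * f (v, h)))) :=
  integrableB measurableT Iw2 I2.
have mass : Rintegral (lebesgue_rV r) setT (fun v => f (v, h)) <= 1.
  rewrite -lee_fin /Rintegral fineK; first exact: conditional_density_mass.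
  exact: (integrable_fin_num measurableT If).
have : 0 <= Rintegral (lebesgue_rV r) setT (fun v => (w v ^+ 2 * f (v, h) - 2 * s * (w v * f (v, h))) + s ^+ 2 * f (v, h)).
  apply: Rintegral_ge0 => v _; rewrite (_ : _ + _ = (w v - s) ^+ 2 * f (v, h)); last by ring.
  by rewrite mulr_ge0// sqr_ge0.
rewrite RintegralD// RintegralB// !RintegralZl// -/s => H.
have := ler_wpM2l (sqr_ge0 s) mass; rewrite mulr1 => H2.
set W2 := Rintegral _ _ (fun v => w v ^+ 2 * _) in H *.
have : 2 * s * s = 2 * s ^+ 2 by rewrite expr2 mulrA.
by move=> E2; rewrite E2 in H; lra.
Qed.

End conditional_density.

(** * Kernel-weighted sums *)

Section kernel_sums.
Context {R : realType} (disp : measure_display) (Omega : measurableType disp) (P : probability Omega R).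
Context (d : nat) (dE : measure_display) (E : measurableType dE).
Variables (xi xi' : int -> Omega -> E) (eta : int -> Omega -> R).
Hypotheses (d_gt0 : (0 < d)%N) (iid_xi : iid P (joint xi xi')) (iid_eta : iid P eta).
Hypothesis ind : independent_sigma P (sigma_of [set: int] eta) (sigma_of [set: int] xi).
Hypothesis eta2 : forall k, P.-integrable setT (EFin \o (fun w => eta k w ^+ 2)).
Hypothesis mean_eta : forall k, expect P (eta k) = 0.
Hypothesis var_eta : forall k, expect P (fun w => eta k w ^+ 2) = 1.
Variables (G : R -> history E -> 'rV[R]_d) (Q : R -> R.-pker (history E) ~> 'rV[R]_d).
Hypothesis mG : forall t : R, `[0, 1]%classic t -> measurable_fun setT (G t).
Hypothesis law_Q : is_one_step_law P G xi Q.
Variables (A : set (history E)) (fh : R -> 'rV[R]_d * history E -> R) (c : R).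
Hypotheses (mA : measurable A) (PA : P (past xi 0 @^-1` A) = 1%E).
Hypothesis fh_out : forall t h v, ~ A h -> fh t (v, h) = 0.
Hypothesis mfh : forall t : R, `[0, 1]%classic t -> measurable_fun setT (fh t).
Hypothesis fhc : forall t : R, `[0, 1]%classic t -> forall p, 0 <= fh t p <= c.
Hypothesis fhE : forall t : R, `[0, 1]%classic t -> forall h v, A h -> fh t (v, h) = cond_pdf Q v t h.
Hypothesis Qfh : forall t : R, `[0, 1]%classic t -> forall h B, A h -> measurable B ->
  (Q t h B = \int[lebesgue_rV d]_(v in B) (fh t (v, h))%:E)%E.
Variable Psi0 : R.
Hypothesis psi_fin : forall l, (psi P xi xi' Q l 2 < +oo)%E.
Hypothesis psi_sum : forall N, \sum_(l < N) fine (psi P xi xi' Q l 2) <= Psi0.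
Variables (m sigma : 'rV[R]_d -> R -> R).
Hypothesis cm : {within setT `*` `[0, 1], continuous (fun p : 'rV[R]_d * R^o => m p.1 p.2)}.
Hypothesis cs : {within setT `*` `[0, 1], continuous (fun p : 'rV[R]_d * R^o => sigma p.1 p.2)}.
Hypothesis cf : {within setT `*` `[0, 1], continuous (fun p : 'rV[R]_d * R^o => marginal_pdf P xi Q p.1 p.2)}.
Variables (K : 'rV[R]_d -> R) (MK : R).
Hypotheses (mK : measurable_fun setT K) (KM : forall s, `|K s| <= MK).
Hypothesis K_out : forall s, ~ cube s -> K s = 0.
Variables (h : nat -> R) (u : 'rV[R]_d).
Hypotheses (h_gt0 : forall n, 0 < h n) (h_cvg0 : h n @[n --> \oo] --> (0 : R)).
Hypothesis nhd_cvgy : n%:R * h n ^+ d @[n --> \oo] --> +oo.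
Variables (alp : nat -> R) (B : R) (alim : R).
Hypothesis alp_cvg : alp n @[n --> \oo] --> alim.

Local Notation lam := (@lebesgue_rV R d).
Local Notation f := (marginal_pdf P xi Q).
Local Notation WI := (weighted_integral lam).

(* Outside of the rows [k < n] of the array the time is set to 0, so that it is in [0, 1] throughout. *)
Definition array_time (n k : nat) : R := if (k < n)%N then k.+1%:R / n%:R else 0.

Local Notation t := array_time.

Let t01 n k : `[0, 1]%classic (t n k).
Proof.
rewrite /= in_itv/= /t; case: ifP => [kn|_]; last by rewrite lexx ler01.
rewrite divr_ge0//= ler_pdivrMr ?mul1r ?ler_nat// ltr0n.
exact: leq_ltn_trans kn.
Qed.

Let mxi := joint_measurable iid_xi.

Let mpast k : measurable_fun setT (past xi k).
Proof. exact: measurable_past. Qed.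

Let meta j : measurable_fun setT (eta j). Proof. by case: iid_eta. Qed.

Let PAk k : P (past xi k @^-1` A) = 1%E.
Proof. exact: etrans (past_law iid_xi k mA) PA. Qed.

Definition signal n k v := alp n + B * m v (t n k).
Definition noise_scale n k v := B * sigma v (t n k).

Definition signal_weight n k := local_weight u (h n) K (signal n k).
Definition noise_weight n k := local_weight u (h n) K (noise_scale n k).

(** The array index starts at 0: row entry [k] is observation [k + 1], and the past at [k] is what
    precedes it. *)
Definition regr n k w := G (t n k) (past xi (k%:Z + 1) w).

Definition summand n k w :=
  signal_weight n k (regr n k w) + noise_weight n k (regr n k w) * eta (k%:Z + 1) w.

Definition power_weight n k :=
  local_weight u (h n) (fun s => K s ^+ 2) (fun v => signal n k v ^+ 2 + noise_scale n k v ^+ 2).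

Definition cond_mean n k z := WI (signal_weight n k) (fh (t n k)) z.
Definition cond_power n k z := WI (power_weight n k) (fh (t n k)) z.

Definition rate n := (Num.sqrt (n%:R * h n ^+ d))^-1.

Definition mart n k w := rate n * (summand n k w - cond_mean n k (past xi k%:Z w)).
Definition mart_var n k w :=
  rate n ^+ 2 * (cond_power n k (past xi k%:Z w) - cond_mean n k (past xi k%:Z w) ^+ 2).

Let rate0 n : 0 <= rate n. Proof. by rewrite invr_ge0 sqrtr_ge0. Qed.

Let nh0 n : 0 <= n%:R * h n ^+ d.
Proof. by rewrite mulr_ge0// exprn_ge0// ltW. Qed.

Let rate2 n : rate n ^+ 2 = (n%:R * h n ^+ d)^-1.
Proof. by rewrite /rate exprVn sqr_sqrtr. Qed.

Let mreg n k : measurable_fun setT (regr n k).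
Proof. exact: (measurableT_comp (mG (t01 n k)) (mpast _)). Qed.

Let MK0 : 0 <= MK. Proof. exact: le_trans (normr_ge0 _) (KM 0). Qed.

Let mm n k : measurable_fun setT (fun v => m v (t n k)).
Proof. by apply: continuous_measurable_rV; exact: (space_time_continuous_l cm). Qed.

Let ms n k : measurable_fun setT (fun v => sigma v (t n k)).
Proof. by apply: continuous_measurable_rV; exact: (space_time_continuous_l cs). Qed.

Let msignal n k : measurable_fun setT (signal n k).
Proof. by apply: measurable_funD => //; exact: measurable_funM. Qed.

Let mnoise n k : measurable_fun setT (noise_scale n k).
Proof. exact: measurable_funM. Qed.

Let msw n k : measurable_fun setT (signal_weight n k).
Proof. exact: measurable_local_weight. Qed.

Let mnw n k : measurable_fun setT (noise_weight n k).
Proof. exact: measurable_local_weight. Qed.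

Let mpw n k : measurable_fun setT (power_weight n k).
Proof.
apply: measurable_local_weight; first exact: measurable_funX.
by apply: measurable_funD; exact: measurable_funX.
Qed.

Let power_weightE n k v : power_weight n k v = signal_weight n k v ^+ 2 + noise_weight n k v ^+ 2.
Proof. by rewrite /power_weight /signal_weight /noise_weight /local_weight; ring. Qed.

(** The bandwidths and [alp] converge, hence are bounded, so a single compact neighbourhood of [u]
    serves all [n]. *)
Lemma local_bound : exists2 N, 0 < N & forall n k (v : 'rV[R]_d), (forall i, `|u ord0 i - v ord0 i| <= h n) ->
  `|signal n k v| <= N /\ `|noise_scale n k v| <= N.
Proof.
have [H [_ HH]] : exists H, 0 <= H /\ forall n, h n <= H.
  have [H [_ /(_ (H + 1))]] := cvg_seq_bounded (cvgP _ h_cvg0).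
  rewrite ltrDl ltr01 => /(_ isT) hH; exists `|H + 1|; split=> // n.
  by apply: le_trans (ler_norm _) (le_trans (hH n I) (ler_norm _)).
have [Ma [_ HMa]] : exists Ma, 0 <= Ma /\ forall n, `|alp n| <= Ma.
  have [M' [_ /(_ (M' + 1))]] := cvg_seq_bounded (cvgP _ alp_cvg).
  rewrite ltrDl ltr01 => /(_ isT) hM; exists `|M' + 1|; split=> // n.
  exact: le_trans (hM n I) (ler_norm _).
have [Nm HNm] := space_time_bounded cm u H.
have [Ns HNs] := space_time_bounded cs u H.
exists (Ma + `|B| * `|Nm| + `|B| * `|Ns| + 1).
  rewrite ltr_wpDl// !addr_ge0 ?mulr_ge0//.
  exact: le_trans (normr_ge0 _) (HMa 0%N).
move=> n k v uv.
have uvH i : `|u ord0 i - v ord0 i| <= H by exact: le_trans (uv i) (HH n).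
have h1 : `|m v (t n k)| <= `|Nm| by apply: le_trans (HNm v _ (t01 n k) uvH) (ler_norm _).
have h2 : `|sigma v (t n k)| <= `|Ns| by apply: le_trans (HNs v _ (t01 n k) uvH) (ler_norm _).
have h3 := HMa n; have h30 := le_trans (normr_ge0 _) h3.
have p1 : `|B| * `|m v (t n k)| <= `|B| * `|Nm| by rewrite ler_wpM2l.
have p2 : `|B| * `|sigma v (t n k)| <= `|B| * `|Ns| by rewrite ler_wpM2l.
have p3 : 0 <= `|B| * `|Nm| by rewrite mulr_ge0.
have p4 : 0 <= `|B| * `|Ns| by rewrite mulr_ge0.
split; rewrite /signal /noise_scale.
  by apply: le_trans (ler_normD _ _) _; rewrite normrM; move: (`|alp n|) (`|B| * `|m v _|) (`|B| * `|Nm|) (`|B| * `|Ns|) p1 p3 p4 h3 => *; lra.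
by rewrite normrM; move: (`|B| * `|sigma v _|) (`|B| * `|Nm|) (`|B| * `|Ns|) p2 p3 p4 h30 => *; lra.
Qed.

Section bounded.
Variable N : R.
Hypothesis N0 : 0 < N.
Hypothesis HN : forall n k (v : 'rV[R]_d), (forall i, `|u ord0 i - v ord0 i| <= h n) ->
  `|signal n k v| <= N /\ `|noise_scale n k v| <= N.

Let c0 : 0 <= c.
Proof. by have /andP[] := fhc (t01 0 0) (0, point); exact: le_trans. Qed.

Let vol n := h n ^+ d * 2 ^+ d.

Let vol0 n : 0 <= vol n.
Proof. by rewrite mulr_ge0 ?exprn_ge0// ltW. Qed.

Let K2_out (s : 'rV[R]_d) : ~ cube s -> K s ^+ 2 = 0.
Proof. by move=> /K_out ->; rewrite expr0n. Qed.

Let K2M s : `|K s ^+ 2| <= MK ^+ 2.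
Proof. by rewrite normrX lerXn2r ?nnegrE. Qed.

Let mK2 : measurable_fun setT (fun s => K s ^+ 2). Proof. exact: measurable_funX. Qed.

Let sw_le n k v : `|signal_weight n k v| <= N * MK * \1_(window u (h n)) v.
Proof. by apply: local_weight_le => // x /(HN k)[]. Qed.

Let nw_le n k v : `|noise_weight n k v| <= N * MK * \1_(window u (h n)) v.
Proof. by apply: local_weight_le => // x /(HN k)[]. Qed.

Let power_bound n k (v : 'rV[R]_d) : (forall i, `|u ord0 i - v ord0 i| <= h n) ->
  `|signal n k v ^+ 2 + noise_scale n k v ^+ 2| <= 2 * N ^+ 2.
Proof.
have sq (x : R) : `|x| <= N -> x ^+ 2 <= N ^+ 2.
  by move=> xN; rewrite -(real_normK (num_real x)) lerXn2r ?nnegrE// ltW.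
move=> /(HN k)[/sq h1 /sq h2]; rewrite ger0_norm ?addr_ge0 ?sqr_ge0//.
by apply: le_trans (lerD h1 h2) _; rewrite -mulr2n mulr_natl.
Qed.

Let mpower n k : measurable_fun setT (fun v => signal n k v ^+ 2 + noise_scale n k v ^+ 2).
Proof. by apply: measurable_funD; exact: measurable_funX. Qed.

Let swI n k : (\int[lam]_v (`|signal_weight n k v|)%:E <= (N * MK * vol n)%:E)%E.
Proof. by apply: local_weight_integral => // x /(HN k)[]. Qed.

Let pwI n k : (\int[lam]_v (`|power_weight n k v|)%:E <= (2 * N ^+ 2 * MK ^+ 2 * vol n)%:E)%E.
Proof. by apply: local_weight_integral => // x /(power_bound k). Qed.

Let cm_le n k z : `|cond_mean n k z| <= c * (N * MK * vol n).
Proof. by apply: weighted_integral_le => //; [exact: mfh|exact: fhc]. Qed.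

Let cp_le n k z : `|cond_power n k z| <= c * (2 * N ^+ 2 * MK ^+ 2 * vol n).
Proof. by apply: weighted_integral_le => //; [exact: mfh|exact: fhc]. Qed.

Let mcm n k : measurable_fun setT (cond_mean n k).
Proof. by apply: measurable_weighted_integral => //; exact: mfh. Qed.

Let mcp n k : measurable_fun setT (cond_power n k).
Proof. by apply: measurable_weighted_integral => //; exact: mfh. Qed.

Let cm2_le n k z : cond_mean n k z ^+ 2 <= cond_power n k z.
Proof.
have swN v : `|signal_weight n k v| <= N * MK.
  have NM0 : 0 <= N * MK by rewrite mulr_ge0// ltW.
  apply: le_trans (sw_le _ _ _) _; apply: ler_piMr NM0 _.
  by rewrite indicE; case: (_ \in _).
apply: (le_trans (weighted_integral_sqr (mfh (t01 n k)) (fhc (t01 n k)) (Qfh (t01 n k)) (@fh_out (t n k)) z (msw n k) (swI n k) swN)).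
have msw2 : measurable_fun setT (fun v => signal_weight n k v ^+ 2) by exact: measurable_funX.
have I2 := weighted_integrable (mpw n k) (mfh (t01 n k)) (pwI n k) (fhc (t01 n k)) z.
have mfz : measurable_fun setT (fun v => fh (t n k) (v, z)) by apply: measurable_fun_pair1; exact: mfh.
have fz v : 0 <= fh (t n k) (v, z) by case/andP: (fhc (t01 n k) (v, z)).
apply: le_Rintegral => //.
  apply: (@le_integrable _ _ _ _ _ _ _ _ _ _ I2) => //; first by apply/measurable_EFinP; exact: measurable_funM.
  move=> v _ /=; rewrite lee_fin [in leLHS]normrM [in leRHS]normrM ler_wpM2r// power_weightE ger0_norm ?sqr_ge0//.
  by rewrite ger0_norm ?addr_ge0 ?sqr_ge0// lerDl sqr_ge0.
by move=> v _; rewrite ler_wpM2r// power_weightE lerDl sqr_ge0.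
Qed.

(** The bandwidth cancels between normalization and window volume, whence the uniform bound [C / n]
    on conditional variances. At [n = 0] both sides are 0 by the convention for inverses. *)
Let rate_vol n : rate n ^+ 2 * vol n = 2 ^+ d / n%:R.
Proof.
rewrite rate2 /vol invfM; have hd : h n ^+ d != 0 by rewrite gt_eqF// exprn_gt0.
have [->|n0] := eqVneq n 0%N; first by rewrite invr0 mul0r mul0r mulr0.
by rewrite -!mulrA [(h n ^+ d)^-1 * _]mulrA mulVf// mul1r mulrC.
Qed.

Let C := c * (2 * N ^+ 2 * MK ^+ 2) * 2 ^+ d.

Let C0 : 0 <= C.
Proof. by rewrite /C !mulr_ge0 ?exprn_ge0// ltW. Qed.

Let mart_var_bound n k w : 0 <= mart_var n k w <= C / n%:R.
Proof.
rewrite /mart_var mulr_ge0 ?sqr_ge0 ?subr_ge0 ?cm2_le//=.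
apply: (@le_trans _ _ (rate n ^+ 2 * (c * (2 * N ^+ 2 * MK ^+ 2 * vol n)))).
  rewrite ler_wpM2l ?sqr_ge0// lerBlDr; apply: le_trans (ler_norm _) (le_trans (cp_le _ _ _) _).
  by rewrite lerDl sqr_ge0.
rewrite (_ : rate n ^+ 2 * _ = c * (2 * N ^+ 2 * MK ^+ 2) * (rate n ^+ 2 * vol n)); last by rewrite [LHS]mulrCA [RHS]mulrCA; rewrite ![rate n ^+ 2 * _]mulrC !mulrA.
by rewrite rate_vol /C !mulrA.
Qed.

Let shift {dT} {T : measurableType dT} (l : nat) (z : history T) : history T := fun j => z (j + l)%N.

Let mshift {dT} {T : measurableType dT} l : measurable_fun setT (@shift dT T l).
Proof. by apply: (@measurable_prodspaceP _ T _ _ nat) => j; exact: (@measurable_coord _ T nat). Qed.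

Let pastE {dT} {T : measurableType dT} (X : int -> Omega -> T) j k w : (j <= k)%N ->
  past X j%:Z w = shift (k - j) (past X k%:Z w).
Proof.
move=> jk; apply/funext => i; rewrite /shift /past /=; congr (X _ w).
by rewrite PoszD -subzn//; ring.
Qed.

Let Z k w := both_pasts xi k%:Z eta w.

(** Weak conditioning at [k] requires earlier terms to be written as functions of the two pasts at
    [k]. Term [j] looks back [k - j.+1] steps for its regressor and error, and [k - j] steps for its
    conditional mean. *)
Let mart_of n k j (z : history E * history R) := rate n *
  (signal_weight n j (G (t n j) (shift (k - j.+1) z.1)) +
   noise_weight n j (G (t n j) (shift (k - j.+1) z.1)) * z.2 (k - j.+1)%N - cond_mean n j (shift (k - j) z.1)).

Let mart_ofE n k j w : (j < k)%N -> mart n j w = mart_of n k j (Z k w).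
Proof.
move=> jk; rewrite /mart /mart_of /summand /regr /Z /both_pasts /= -(pastE xi w (ltnW jk)) -(pastE xi w jk).
rewrite [past eta k%:Z w]lock -addn1 PoszD; congr (_ * (_ + _ * _ - _)).
rewrite -lock; transitivity (eta (k%:Z - (k - (j + 1))%N%:Z) w) => //.
by congr (eta _ w); rewrite -subzn ?addn1// -addn1 PoszD; ring.
Qed.

Let mmart_of n k j : measurable_fun setT (mart_of n k j).
Proof.
have ms1 l : measurable_fun setT (fun z : history E * history R => shift l z.1).
  exact: (measurableT_comp (mshift l) measurable_fst).
have mG1 := measurableT_comp (mG (t01 n j)) (ms1 (k - j.+1)%N).
apply: measurable_funM => //; apply: measurable_funB; last exact: (measurableT_comp (mcm n j) (ms1 _)).
apply: measurable_funD; first exact: (measurableT_comp (msw n j) mG1).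
apply: measurable_funM; first exact: (measurableT_comp (mnw n j) mG1).
exact: (measurableT_comp (@measurable_coord _ R nat _) measurable_snd).
Qed.

Let var_of n k j (z : history E * history R) := rate n ^+ 2 *
  (cond_power n j (shift (k - j) z.1) - cond_mean n j (shift (k - j) z.1) ^+ 2).

Let var_ofE n k j w : (j <= k)%N -> mart_var n j w = var_of n k j (Z k w).
Proof. by move=> jk; rewrite /mart_var /var_of /Z /both_pasts /= -(pastE xi w jk). Qed.

Let mvar_of n k j : measurable_fun setT (var_of n k j).
Proof.
have ms1 l : measurable_fun setT (fun z : history E * history R => shift l z.1).
  exact: (measurableT_comp (mshift l) measurable_fst).
apply: measurable_funM => //; apply: measurable_funB; first exact: (measurableT_comp (mcp n j) (ms1 _)).
by apply: measurable_funX; exact: (measurableT_comp (mcm n j) (ms1 _)).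
Qed.

(** The clock may run one index ahead of the partial sum: the conditional variance of term [k]
    already is a function of the past at [k]. *)
Let adapted n k : exists2 phi : history E * history R -> R * R, measurable_fun setT phi &
  forall w, (psum mart_var n k.+1 w, psum mart n k w) = phi (Z k w).
Proof.
exists (fun z => (\sum_(j < k.+1) var_of n k j z, \sum_(j < k) mart_of n k j z)).
  by apply: measurable_fun_pair; apply: measurable_sum.
by move=> w; congr pair; apply: eq_bigr => j _; [apply: var_ofE; rewrite -ltnS|exact: mart_ofE].
Qed.

Let mmart n k : measurable_fun setT (mart n k).
Proof.
have := measurableT_comp (mmart_of n k.+1 k) (measurable_both_pasts (joint_measurable iid_xi) k.+1%:Z iid_eta).
by congr measurable_fun; apply/funext => w; rewrite /= (@mart_ofE n k.+1).
Qed.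

Let mmart_var n k : measurable_fun setT (mart_var n k).
Proof.
have := measurableT_comp (mvar_of n k k) (measurable_both_pasts (joint_measurable iid_xi) k%:Z iid_eta).
by congr measurable_fun; apply/funext => w; rewrite /= (@var_ofE n k).
Qed.

Let vol_fin n : (lam (window u (h n)) < +oo)%E.
Proof. by rewrite lebesgue_window// ltry. Qed.

Let NM0 : 0 <= N * MK. Proof. by rewrite mulr_ge0// ltW. Qed.

Let cond1 n k (F : history E * history R -> R) (M : R) : measurable_fun setT F -> (forall z, `|F z| <= M) ->
  expect P (fun w => F (Z k w) * summand n k w) = expect P (fun w => F (Z k w) * cond_mean n k (past xi k%:Z w)).
Proof.
move=> mF FM; have M0 : 0 <= M := le_trans (normr_ge0 _) (FM point).
have f0 p : 0 <= fh (t n k) p by case/andP: (fhc (t01 n k) p).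
have fc p : fh (t n k) p <= c by case/andP: (fhc (t01 n k) p).
have i0 v : 0 <= \1_(window u (h n)) v :> R by rewrite indicE.
apply: (@conditional_mean _ _ _ P _ _ _ G xi Q mxi law_Q (t n k) k%:Z (t01 n k) (mG (t01 n k)) A (fh (t n k)) mA (PAk _)
  (mfh (t01 n k)) f0 (@Qfh _ (t01 n k)) eta c iid_eta ind fc (eta2 _) (mean_eta _) F _ _ (M + N * MK) mF _
  (msw n k) (mnw n k) _ (measurable_window u (h n)) (vol_fin n)).
- by move=> z; apply: le_trans (FM z) _; rewrite lerDl.
- by move=> v; apply: le_trans (sw_le n k v) _; rewrite ler_wpM2r// lerDr.
- by move=> v; apply: le_trans (nw_le n k v) _; rewrite ler_wpM2r// lerDr.
Qed.

Let cond2 n k (F : history E * history R -> R) (M : R) : measurable_fun setT F -> (forall z, `|F z| <= M) ->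
  expect P (fun w => F (Z k w) * summand n k w ^+ 2) = expect P (fun w => F (Z k w) * cond_power n k (past xi k%:Z w)).
Proof.
move=> mF FM; have M0 : 0 <= M := le_trans (normr_ge0 _) (FM point).
have f0 p : 0 <= fh (t n k) p by case/andP: (fhc (t01 n k) p).
have fc p : fh (t n k) p <= c by case/andP: (fhc (t01 n k) p).
have i0 v : 0 <= \1_(window u (h n)) v :> R by rewrite indicE.
rewrite /cond_power (_ : power_weight n k = fun v => signal_weight n k v ^+ 2 + noise_weight n k v ^+ 2); last first.
  by apply/funext => v; exact: power_weightE.
apply: (@conditional_second_moment _ _ _ P _ _ _ G xi Q mxi law_Q (t n k) k%:Z (t01 n k) (mG (t01 n k)) A (fh (t n k)) mA (PAk _)
  (mfh (t01 n k)) f0 (@Qfh _ (t01 n k)) eta c iid_eta ind fc (eta2 _) (mean_eta _) (var_eta _) F _ _ (M + N * MK) mF _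
  (msw n k) (mnw n k) _ (measurable_window u (h n)) (vol_fin n)).
- by move=> z; apply: le_trans (FM z) _; rewrite lerDl.
- by move=> v; apply: le_trans (sw_le n k v) _; rewrite ler_wpM2r// lerDr.
- by move=> v; apply: le_trans (nw_le n k v) _; rewrite ler_wpM2r// lerDr.
Qed.

Let msummand n k : measurable_fun setT (summand n k).
Proof.
apply: measurable_funD; first exact: (measurableT_comp (msw n k) (mreg n k)).
by apply: measurable_funM => //; exact: (measurableT_comp (mnw n k) (mreg n k)).
Qed.

Let summand_sqr_le n k w : `|summand n k w ^+ 2| <=
  2 * (N * MK) ^+ 2 * (\1_(window u (h n)) (regr n k w) * (1 + eta (k%:Z + 1) w ^+ 2)).
Proof.
have := sw_le n k (regr n k w); have := nw_le n k (regr n k w).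
rewrite /summand normrX; move: (signal_weight _ _ _) (noise_weight _ _ _) (eta _ w) => a b e.
have sq (x : R) : `|x| <= N * MK -> x ^+ 2 <= (N * MK) ^+ 2.
  by move=> xN; rewrite -(real_normK (num_real x)) lerXn2r ?nnegrE.
rewrite indicE; case: (_ \in _); rewrite /= ?mulr1 ?mulr0 ?mul1r ?mul0r ?mulr0.
  move=> /sq b2 /sq a2; rewrite real_normK ?num_real//.
  have h1 : (a + b * e) ^+ 2 <= 2 * (a ^+ 2 + (b * e) ^+ 2).
    have := sqr_ge0 (a - b * e); rewrite sqrrB sqrrD; move: (a ^+ 2) ((b * e) ^+ 2) (a * (b * e)) => x y z.
    by move=> ?; lra.
  by apply: (le_trans h1); rewrite -mulrA ler_wpM2l// mulrDr mulr1 lerD// exprMn ler_wpM2r// sqr_ge0.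
by rewrite !normr_le0 => /eqP -> /eqP ->; rewrite mul0r addr0 normr0 expr0n.
Qed.

Let isq n k : P.-integrable setT (EFin \o (fun w => summand n k w ^+ 2)).
Proof.
have Ie : P.-integrable setT (EFin \o (fun w => 1 + eta (k%:Z + 1) w ^+ 2)) by apply: integD; [exact: integ_cst|exact: eta2].
apply: (integ_dom (measurable_funX 2 (msummand n k)) (summand_sqr_le n k)).
apply: integZ; apply: (@integM _ _ _ P 1) => //.
  by apply: (measurableT_comp _ (mreg n k)); apply: measurable_indic; exact: measurable_window.
by move=> w; rewrite indicE; case: (_ \in _); rewrite ?normr1 ?normr0.
Qed.

Let is1 n k : P.-integrable setT (EFin \o summand n k).
Proof.
apply: (@integ_dom _ _ _ P _ (fun w => 1 + summand n k w ^+ 2)) => //.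
  move=> w; have := sqr_ge0 (`|summand n k w| - 1); rewrite sqrrB expr1n mulr1 real_normK ?num_real//.
  by move: (`|_|) (normr_ge0 (summand n k w)) (_ ^+ 2) => x x0 y ?; lra.
by apply: integD; [exact: integ_cst|exact: isq].
Qed.

Let mart_mean_var n k (F : history E * history R -> R) (M : R) : measurable_fun setT F -> (forall z, `|F z| <= M) ->
  expect P (fun w => F (Z k w) * mart n k w) = 0 /\
  expect P (fun w => F (Z k w) * mart n k w ^+ 2) = expect P (fun w => F (Z k w) * mart_var n k w).
Proof.
move=> mF FM; have M0 : 0 <= M := le_trans (normr_ge0 _) (FM point).
have mZ : measurable_fun setT (Z k) := measurable_both_pasts mxi k%:Z iid_eta.
have mFZ : measurable_fun setT (fun w => F (Z k w)) := measurableT_comp mF mZ.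
have mb1 : measurable_fun setT (fun z : history E * history R => cond_mean n k z.1) := measurableT_comp (mcm n k) measurable_fst.
have mbp : measurable_fun setT (fun w => cond_mean n k (past xi k%:Z w)) := measurableT_comp (mcm n k) (mpast _).
have mcpp : measurable_fun setT (fun w => cond_power n k (past xi k%:Z w)) := measurableT_comp (mcp n k) (mpast _).
have IFs : P.-integrable setT (EFin \o (fun w => F (Z k w) * summand n k w)) by apply: (integM mFZ (fun w => FM _)).
have IFs2 : P.-integrable setT (EFin \o (fun w => F (Z k w) * summand n k w ^+ 2)) by apply: (integM mFZ (fun w => FM _)).
set cb := c * (N * MK * vol n).
have bI (Y : Omega -> R) y : measurable_fun setT Y -> (forall w, `|Y w| <= y) ->
    P.-integrable setT (EFin \o (fun w => F (Z k w) * Y w)).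
  by move=> mY Yy; apply: (integM mFZ (fun w => FM _)); exact: bounded_integrable Yy.
have IFb := bI _ _ mbp (fun w => cm_le n k _).
have IFb2 : P.-integrable setT (EFin \o (fun w => F (Z k w) * cond_mean n k (past xi k%:Z w) ^+ 2)).
  apply: (bI _ (cb ^+ 2)); first exact: measurable_funX.
  by move=> w; rewrite normrX lerXn2r ?nnegrE ?(le_trans (normr_ge0 _) (cm_le n k point))// cm_le.
have IFp := bI _ _ mcpp (fun w => cp_le n k _).
split.
  under eq_fun do rewrite /mart mulrCA mulrBr.
  by rewrite expectZ; [rewrite expectB// (cond1 _ _ mF FM) subrr mulr0|exact: integB].
have FbM z : `|F z * cond_mean n k z.1| <= M * cb by rewrite normrM ler_pM// cm_le.
have mFb : measurable_fun setT (fun z => F z * cond_mean n k z.1) by exact: measurable_funM.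
have IFbs : P.-integrable setT (EFin \o (fun w => F (Z k w) * cond_mean n k (Z k w).1 * summand n k w)).
  by apply: (@integM _ _ _ P (M * cb)) => //; exact: (measurableT_comp mFb mZ).
(* The cross term: the conditional mean is itself a bounded function of the past, so it can be
   absorbed into the test function. Hence the square of the difference reduces to a difference of
   squares. *)
have E3 := cond1 n k mFb FbM.
rewrite (_ : (fun w => F (Z k w) * mart n k w ^+ 2) = (fun w => rate n ^+ 2 *
  ((F (Z k w) * summand n k w ^+ 2 - 2 * (F (Z k w) * cond_mean n k (Z k w).1 * summand n k w)) +
   F (Z k w) * cond_mean n k (past xi k%:Z w) ^+ 2))); last first.
  apply/funext => w; rewrite /mart [(Z k w).1]/=.
  by move: (F _) (rate n) (summand _ _ _) (cond_mean _ _ _) => *; ring.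
rewrite expectZ; last by apply: integD => //; apply: integB => //; exact: integZ.
rewrite expectD//; last by apply: integB => //; exact: integZ.
rewrite expectB//; last exact: integZ.
rewrite expectZ// E3 (cond2 _ _ mF FM).
rewrite (_ : (fun w => _ * _ * cond_mean n k (past xi k%:Z w)) = (fun w => F (Z k w) * cond_mean n k (past xi k%:Z w) ^+ 2)); last first.
  by apply/funext => w; rewrite -mulrA.
rewrite (_ : (fun w => F (Z k w) * mart_var n k w) = (fun w => rate n ^+ 2 *
   (F (Z k w) * cond_power n k (past xi k%:Z w) - F (Z k w) * cond_mean n k (past xi k%:Z w) ^+ 2))); last first.
  by apply/funext => w; rewrite /mart_var mulrCA mulrBr.
rewrite expectZ; last exact: integB.
rewrite expectB//; congr (_ * _).
by move: (expect _ _) (expect _ _) => x y; ring.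
Qed.

Let imart2 n k : P.-integrable setT (EFin \o (fun w => mart n k w ^+ 2)).
Proof.
apply: (@integ_dom _ _ _ P _ (fun w => rate n ^+ 2 * (2 * (summand n k w ^+ 2 + (c * (N * MK * vol n)) ^+ 2)))).
- exact: measurable_funX.
- move=> w; rewrite /mart exprMn normrM ger0_norm ?sqr_ge0// ler_wpM2l ?sqr_ge0// ger0_norm ?sqr_ge0//.
  have := cm_le n k (past xi k%:Z w); move: (summand _ _ _) (cond_mean _ _ _) (c * _) => s b y yb.
  have : b ^+ 2 <= y ^+ 2.
    by rewrite -(real_normK (num_real b)) lerXn2r ?nnegrE// (le_trans (normr_ge0 _) yb).
  have := sqr_ge0 (s + b); rewrite sqrrB sqrrD; move: (s ^+ 2) (b ^+ 2) (y ^+ 2) (s * b) => *; lra.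
apply: integZ; apply: integZ; apply: integD; [exact: isq|exact: integ_cst].
Qed.

Let Psi00 : 0 <= Psi0. Proof. by have := psi_sum 0; rewrite big_ord0. Qed.

(** In both applications [Bw] is of order [h^d]. With the factor [rate^2] for the conditional second
    moments this leaves order [n^(-1/2)], and with [rate] for the conditional means order
    [h^(d/2)]. *)
Let fluctuation n (W : nat -> 'rV[R]_d -> R) (Bw : R) : (forall k, measurable_fun setT (W k)) ->
  (forall k, (\int[lam]_v (`|W k v|)%:E <= Bw%:E)%E) ->
  expect P (fun w => `|\sum_(k < n) WI (W k) (fh (t n k)) (past xi k%:Z w) -
    expect P (fun w => \sum_(k < n) WI (W k) (fh (t n k)) (past xi k%:Z w))|) <= Num.sqrt n%:R * (Bw * Psi0).
Proof.
move=> mW WB; pose S w := \sum_(k < n) WI (W k) (fh (t n k)) (past xi k%:Z w).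
have Bw0 : 0 <= Bw by rewrite -lee_fin; apply: le_trans (WB 0); apply: integral_ge0.
apply: (@expect_norm_deviation _ _ _ P S (n%:R * (c * Bw))).
- by apply: measurable_sum => k; exact: (measurableT_comp (measurable_weighted_integral lam (mW k) (mfh (t01 n k))) (mpast _)).
- move=> w; apply: (le_trans (ler_norm_sum _ _ _)).
  rewrite mulr_natl -[X in _ *+ X]card_ord -sumr_const; apply: ler_sum => k _.
  exact: (weighted_integral_le (mW k) (mfh (t01 n k)) (WB k) (fhc (t01 n k))).
- by rewrite mulr_ge0 ?sqrtr_ge0// mulr_ge0.
rewrite exprMn sqr_sqrtr//.
apply: (predictable_variance iid_xi (phi := fun k => fh (t n k)) (ps := fun l => fine (psi P xi xi' Q l 2)) (c := c)) => //.
- by move=> k; exact: mfh.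
- by move=> k p; exact: fhc.
- move=> l; rewrite fine_ge0//; apply: le_trans (ereal_sup_ubound _); last by exists 0 => //; exact: (t01 0 0).
  by apply: le_trans (ereal_sup_ubound _); last (by exists 0); exact: Lnorm_ge0.
by move=> k l v; exact: (dependence_bound iid_xi mA PA (t01 n k) (mfh (t01 n k)) (fhc (t01 n k)) (fhE (t01 n k))).
Qed.

Let mf n k : measurable_fun setT (fun v => f v (t n k)).
Proof. by apply: continuous_measurable_rV; exact: (space_time_continuous_l cf). Qed.

Let f_le n k v : `|f v (t n k)| <= c.
Proof.
rewrite (marginal_pdfE iid_xi mA PA (mfh (t01 n k)) (fhc (t01 n k)) (fhE (t01 n k)) v 0).
have mfv : measurable_fun setT (fun z => fh (t n k) (v, z)) by apply: measurable_fun_pair2; exact: mfh.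
have B1 w : `|fh (t n k) (v, past xi 0 w)| <= c by have /andP[p0 p1] := fhc (t01 n k) (v, past xi 0 w); rewrite ger0_norm.
by apply: expect_norm_le => //; apply: (@bounded_integrable _ _ _ P _ c) => //; exact: (measurableT_comp mfv (mpast _)).
Qed.

Let expect_cond_power n k : expect P (fun w => cond_power n k (past xi k%:Z w)) =
  h n ^+ d * Rintegral lam setT (fun s => K s ^+ 2 *
    ((signal n k (u - h n *: s) ^+ 2 + noise_scale n k (u - h n *: s) ^+ 2) * f (u - h n *: s) (t n k))).
Proof.
rewrite /cond_power (expect_weighted_integral iid_xi mA PA (mfh (t01 n k)) (fhc (t01 n k)) (fhE (t01 n k)) _ (mpw n k) (pwI n k)).
exact: (local_weight_rescale (h_gt0 n) mK2 K2M K2_out (mpower n k) (power_bound (n := n) k) (mf n k) (f_le n k)).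
Qed.

Let average_integrable (H : 'rV[R]_d -> R -> R) n k :
  {within setT `*` `[0, 1], continuous (fun p : 'rV[R]_d * R^o => H p.1 p.2)} ->
  lam.-integrable setT (EFin \o (fun s => K s ^+ 2 * H (u - h n *: s) (t n k))).
Proof.
move=> cH; have [L HL] := space_time_bounded cH u (h n).
have mH : measurable_fun setT (fun v => H v (t n k)).
  by apply: continuous_measurable_rV; exact: (space_time_continuous_l cH).
apply: (cube_supported_integrable mK2 K2M K2_out (measurableT_comp mH (measurable_rescaling (h n) u)) (N := L)) => s cus.
apply: HL => // i; rewrite !mxE opprB addrC subrK normrM gtr0_norm// ler_piMr ?(ltW (h_gt0 n))//.
by rewrite ler_norml; exact: cus.
Qed.

Let rate_vol_le n : rate n ^+ 2 * n%:R * vol n <= 2 ^+ d.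
Proof.
rewrite mulrAC rate_vol; have [->|n0] := eqVneq n 0%N; first by rewrite mulr0 exprn_ge0.
by rewrite mulfVK// pnatr_eq0.
Qed.

Let rate_le n X : 0 <= X -> rate n ^+ 2 * (n%:R * (vol n * X)) <= 2 ^+ d * X.
Proof. by move=> X0; rewrite 2!mulrA; apply: le_trans (ler_wpM2r X0 (rate_vol_le n)); rewrite mulrA. Qed.

Let vol_cvg0 : vol n @[n --> \oo] --> (0 : R).
Proof.
rewrite -[X in _ --> X](mul0r (2 ^+ d)); apply: cvgM; last exact: cvg_cst.
(* Here positivity of the dimension enters: [0 ^+ 0] would be 1. *)
have -> : (0 : R) = 0 ^+ d by rewrite expr0n eqn0Ngt d_gt0.
exact: (cvg_comp h (fun x => x ^+ d) h_cvg0 (@exprn_continuous R d 0)).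
Qed.

Lemma rate_cvg0 : rate n @[n --> \oo] --> (0 : R).
Proof.
have rate2_cvg : rate n ^+ 2 @[n --> \oo] --> (0 : R).
  under eq_fun do rewrite rate2.
  apply/gtr0_cvgV0 => //.
  by have /cvgryPgt/(_ 0) := nhd_cvgy.
have := cvg_comp (fun n => rate n ^+ 2) Num.sqrt rate2_cvg (@sqrt_continuous R 0); rewrite sqrtr0.
by apply: cvg_trans; apply: near_eq_cvg; apply: nearW => n /=; rewrite sqrtr_sqr ger0_norm.
Qed.

Let WK := Rintegral lam setT (fun s => K s ^+ 2).

Definition limit_variance := WK * Rintegral lebesgue_measure `[0, 1]
  (fun x => ((alim + B * m u x) ^+ 2 + (B * sigma u x) ^+ 2) * f u x).

Let V := limit_variance.

Let f_ge0 v x : `[0, 1]%classic x -> 0 <= f v x.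
Proof.
move=> x01; rewrite (marginal_pdfE iid_xi mA PA (mfh x01) (fhc x01) (fhE x01) v 0).
by apply: expect_ge0 => w; case/andP: (fhc x01 (v, past xi 0 w)).
Qed.

Let V_ge0 : 0 <= V.
Proof.
apply: mulr_ge0; first by apply: Rintegral_ge0 => // s _; exact: sqr_ge0.
by apply: Rintegral_ge0 => // x x01; rewrite mulr_ge0 ?f_ge0// addr_ge0// sqr_ge0.
Qed.

(** [alp] varies with [n], whereas [local_average_cvg] takes a fixed integrand. The square of the
    signal is therefore expanded in powers of [alp n], and each coefficient is averaged
    separately. *)
Let power_mean_cvg : rate n ^+ 2 * (\sum_(k < n) expect P (fun w => cond_power n k (past xi k%:Z w)))
  @[n --> \oo] --> V.
Proof.
pose G2 (v : 'rV[R]_d) (x : R) := 2 * B * m v x * f v x.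
pose G3 (v : 'rV[R]_d) (x : R) := (B * m v x * (B * m v x) + B * sigma v x * (B * sigma v x)) * f v x.
have cG2 : {within setT `*` `[0, 1], continuous (fun p : 'rV[R]_d * R^o => G2 p.1 p.2)}.
  by move=> p; apply: cvgM; [apply: cvgM; [exact: cvg_cst|exact: cm]|exact: cf].
have cBm : {within setT `*` `[0, 1], continuous (fun p : 'rV[R]_d * R^o => B * m p.1 p.2)}.
  by move=> p; apply: cvgM; [exact: cvg_cst|exact: cm].
have cBs : {within setT `*` `[0, 1], continuous (fun p : 'rV[R]_d * R^o => B * sigma p.1 p.2)}.
  by move=> p; apply: cvgM; [exact: cvg_cst|exact: cs].
have cG3 : {within setT `*` `[0, 1], continuous (fun p : 'rV[R]_d * R^o => G3 p.1 p.2)}.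
  move=> p; apply: cvgM; last exact: cf.
  by apply: cvgD; (apply: cvgM; [|]); (exact: cBm || exact: cBs).
have L1 := local_average_cvg mK2 K2M K2_out (u := u) cf h_gt0 h_cvg0.
have L2 := local_average_cvg mK2 K2M K2_out (u := u) cG2 h_gt0 h_cvg0.
have L3 := local_average_cvg mK2 K2M K2_out (u := u) cG3 h_gt0 h_cvg0.
pose A1 n := n%:R^-1 * \sum_(k < n) Rintegral lam setT (fun s => K s ^+ 2 * f (u - h n *: s) (k.+1%:R / n%:R)).
pose A2 n := n%:R^-1 * \sum_(k < n) Rintegral lam setT (fun s => K s ^+ 2 * G2 (u - h n *: s) (k.+1%:R / n%:R)).
pose A3 n := n%:R^-1 * \sum_(k < n) Rintegral lam setT (fun s => K s ^+ 2 * G3 (u - h n *: s) (k.+1%:R / n%:R)).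
have EA n : rate n ^+ 2 * (\sum_(k < n) expect P (fun w => cond_power n k (past xi k%:Z w))) =
    alp n ^+ 2 * A1 n + alp n * A2 n + A3 n.
  rewrite /A1 /A2 /A3 (mulrCA (alp n ^+ 2)) (mulrCA (alp n)) -!mulrDr.
  rewrite [alp n ^+ 2 * _]mulr_sumr [alp n * _]mulr_sumr -!big_split/= mulr_sumr [RHS]mulr_sumr.
  apply: eq_bigr => k _; rewrite expect_cond_power mulrA.
  have -> : rate n ^+ 2 * h n ^+ d = n%:R^-1.
    by rewrite rate2 invfM mulfVK// gt_eqF// exprn_gt0.
  have tE : k.+1%:R / n%:R = t n k by rewrite /t ltn_ord.
  rewrite tE; congr (_ * _).
  have I1 := average_integrable n k cf; have I2 := average_integrable n k cG2; have I3 := average_integrable n k cG3.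
  have I1a := integrableZl measurableT (alp n ^+ 2) I1; have I2a := integrableZl measurableT (alp n) I2.
  rewrite -!RintegralZl// -RintegralD// -RintegralD//; last exact: (integrableD measurableT I1a I2a).
  by apply: eq_Rintegral => s _; rewrite /G2 /G3 /signal /noise_scale; ring.
have -> : V = alim ^+ 2 * (WK * Rintegral lebesgue_measure `[0, 1] (f u)) +
    alim * (WK * Rintegral lebesgue_measure `[0, 1] (G2 u)) + WK * Rintegral lebesgue_measure `[0, 1] (G3 u).
  have J (H : 'rV[R]_d -> R -> R) : {within setT `*` `[0, 1], continuous (fun p : 'rV[R]_d * R^o => H p.1 p.2)} ->
      lebesgue_measure.-integrable `[0, 1] (EFin \o H u).
    by move=> cH; apply: continuous_segment_integrable => //; exact: (space_time_continuous_r cH).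
  have J1 := J _ cf; have J2 := J _ cG2; have J3 := J _ cG3.
  have cZ (a : R) (H : 'rV[R]_d -> R -> R) : {within setT `*` `[0, 1], continuous (fun p : 'rV[R]_d * R^o => H p.1 p.2)} ->
      {within setT `*` `[0, 1], continuous (fun p : 'rV[R]_d * R^o => a * H p.1 p.2)}.
    by move=> cH p; apply: cvgM; [exact: cvg_cst|exact: cH].
  have c1 := cZ (alim ^+ 2) f cf; have c2 := cZ alim G2 cG2.
  have J1a := J (fun v x => alim ^+ 2 * f v x) c1; have J2a := J (fun v x => alim * G2 v x) c2.
  have J12 : lebesgue_measure.-integrable `[0, 1] (EFin \o (fun x => alim ^+ 2 * f u x + alim * G2 u x)).
    by apply: (J (fun v x => alim ^+ 2 * f v x + alim * G2 v x)) => p; apply: cvgD; [exact: c1|exact: c2].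
  rewrite (mulrCA (alim ^+ 2)) (mulrCA alim) -!mulrDr; congr (WK * _).
  rewrite -!RintegralZl// -RintegralD// -RintegralD//.
  by apply: eq_Rintegral => x _; rewrite /G2 /G3 -[expect P _]/(f u x); ring.
under eq_fun do rewrite EA.
apply: cvgD; last exact: L3.
by apply: cvgD; (apply: cvgM; [|]); [apply: cvgM| | |]; (exact: alp_cvg || exact: L1 || exact: L2).
Qed.

Let sqrt_cvg0 : (Num.sqrt n%:R)^-1 @[n --> \oo] --> (0 : R).
Proof.
have inv_cvg : n%:R^-1 @[n --> \oo] --> (0 : R).
  apply/gtr0_cvgV0; last exact: cvgr_idn.
  by exists 1%N => // n /=; rewrite ltr0n.
have := cvg_comp (fun n => n%:R^-1) Num.sqrt inv_cvg (@sqrt_continuous R 0); rewrite sqrtr0.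
by apply: cvg_trans; apply: near_eq_cvg; apply: nearW => n /=; rewrite sqrtrV.
Qed.

Let cond_mean_sqr_le n k z : cond_mean n k z ^+ 2 <= vol n * (vol n * (c * (N * MK)) ^+ 2).
Proof.
rewrite -(real_normK (num_real _)); apply: (@le_trans _ _ ((c * (N * MK * vol n)) ^+ 2)).
  have y0 : 0 <= c * (N * MK * vol n) := le_trans (normr_ge0 _) (cm_le n k z).
  by rewrite lerXn2r ?nnegrE// cm_le.
by rewrite !expr2 le_eqVlt; apply/orP; left; apply/eqP; ring.
Qed.

Let q_cvg : expect P (fun w => `|psum mart_var n n w - V|) @[n --> \oo] --> (0 : R).
Proof.
pose S n w := \sum_(k < n) cond_power n k (past xi k%:Z w).
pose k0 := 2 * N ^+ 2 * MK ^+ 2; pose k1 := (c * (N * MK)) ^+ 2.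
have k00 : 0 <= k0 by rewrite !mulr_ge0// ?exprn_ge0// ltW.
have Scond n k : P.-integrable setT (EFin \o (fun w => cond_power n k (past xi k%:Z w))).
  by apply: (@bounded_integrable _ _ _ P _ (c * (k0 * vol n))) => //; exact: (measurableT_comp (mcp n k) (mpast _)).
have IS n : P.-integrable setT (EFin \o S n) by exact: integ_sum.
have ES n : expect P (S n) = \sum_(k < n) expect P (fun w => cond_power n k (past xi k%:Z w)) by exact: expect_sum.
(* Three errors: the fluctuation of the conditional second moments, the deterministic error of their
   mean, and the squared conditional means, which are smaller by one factor of the window volume. *)
pose r n := 2 ^+ d * (k0 * Psi0) * (Num.sqrt n%:R)^-1 + (`|rate n ^+ 2 * expect P (S n) - V| + 2 ^+ d * k1 * vol n).
have r0 : r n @[n --> \oo] --> (0 : R).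
  rewrite -[X in _ --> X]addr0 -[X in _ --> _ + X]addr0; apply: cvgD; last apply: cvgD.
  - by rewrite -[X in _ --> X](mulr0 (2 ^+ d * (k0 * Psi0))); apply: cvgM; [exact: cvg_cst|exact: sqrt_cvg0].
  - rewrite -[X in _ --> X](@normr0 _ R) -(subrr V); apply: cvg_norm; apply: cvgB; last exact: cvg_cst.
    by under eq_fun do rewrite ES; exact: power_mean_cvg.
  - by rewrite -[X in _ --> X](mulr0 (2 ^+ d * k1)); apply: cvgM; [exact: cvg_cst|exact: vol_cvg0].
apply: (squeeze_cvgr _ (cvg_cst 0) r0); apply: nearW => n; apply/andP; split; first exact: expect_ge0.
have Eq n' w : psum mart_var n' n' w = rate n' ^+ 2 * S n' w - rate n' ^+ 2 * \sum_(k < n') cond_mean n' k (past xi k%:Z w) ^+ 2.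
  by rewrite /psum /mart_var -mulr_sumr sumrB mulrBr.
have Imv : P.-integrable setT (EFin \o (fun w => psum mart_var n n w - V)).
  apply: integB; last exact: integ_cst.
  apply: integ_sum => k; apply: (@bounded_integrable _ _ _ P _ (C / n%:R)) => // w.
  by have /andP[p0 p1] := mart_var_bound n k w; rewrite ger0_norm.
have ISS : P.-integrable setT (EFin \o (fun w => S n w - expect P (S n))) by apply: integB => //; exact: integ_cst.
apply: (@le_trans _ _ (expect P (fun w => rate n ^+ 2 * `|S n w - expect P (S n)| +
    (`|rate n ^+ 2 * expect P (S n) - V| + 2 ^+ d * k1 * vol n)))).
  apply: expect_le; first exact: integ_norm.
    by apply: integD; [exact/integZ/integ_norm|exact: integ_cst].
  move=> w; rewrite Eq.
  have -> : rate n ^+ 2 * S n w - rate n ^+ 2 * \sum_(k < n) cond_mean n k (past xi k%:Z w) ^+ 2 - V =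
    rate n ^+ 2 * (S n w - expect P (S n)) + ((rate n ^+ 2 * expect P (S n) - V) -
    rate n ^+ 2 * \sum_(k < n) cond_mean n k (past xi k%:Z w) ^+ 2) by ring.
  apply: le_trans (ler_normD _ _) _; rewrite normrM [`|_ ^+ 2|]ger0_norm ?sqr_ge0// lerD2l.
  apply: le_trans (ler_normB _ _) _; rewrite lerD2l ger0_norm; last first.
    by rewrite mulr_ge0 ?sqr_ge0// sumr_ge0// => k _; exact: sqr_ge0.
  rewrite -[leRHS]mulrA [k1 * _]mulrC; apply: le_trans (rate_le n _); last by rewrite mulr_ge0// sqr_ge0.
  rewrite ler_wpM2l ?sqr_ge0//; apply: (@le_trans _ _ (\sum_(k < n) vol n * (vol n * k1))).
    by apply: ler_sum => k _; exact: cond_mean_sqr_le.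
  by rewrite sumr_const card_ord mulr_natl.
rewrite expectD; [|exact/integZ/integ_norm|exact: integ_cst].
rewrite expect_cst lerD2r expectZ; last exact: integ_norm.
have := @fluctuation n (power_weight n) _ (fun k => mpw n k) (fun k => pwI n k).
rewrite -/k0 -[X in X <= _]/(expect P (fun w => `|S n w - expect P (S n)|)) => /(ler_wpM2l (sqr_ge0 (rate n))) H.
apply: (le_trans H); rewrite (_ : _ * _ = rate n ^+ 2 * vol n * (k0 * Psi0) * Num.sqrt n%:R); last by ring.
rewrite rate_vol le_eqVlt; apply/orP; left; apply/eqP.
have [->|n0] := eqVneq n 0%N; first by rewrite sqrtr0 invr0 !mulr0.
have sn0 : Num.sqrt n%:R != 0 :> R by rewrite gt_eqF// sqrtr_gt0 ltr0n lt0n.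
have -> : n%:R^-1 = (Num.sqrt n%:R)^-1 * (Num.sqrt n%:R)^-1 :> R.
  by rewrite -invfM -expr2 sqr_sqrtr.
by move: (k0 * _) (2 ^+ d) => x y; field.
Qed.

Let eta_expect k (g : R -> R) : measurable_fun setT g -> (forall x, 0 <= g x) ->
  expect P (fun w => g (eta k w)) = expect P (fun w => g (eta 0 w)).
Proof.
move=> mg g0; rewrite !expectE /Rintegral; congr fine.
have mgE : measurable_fun setT (fun z : prodspace R unit => (g (z tt))%:E).
  by apply/measurable_EFinP; exact: (measurableT_comp mg (measurable_coord _)).
have inj j : injective (fun _ : unit => j : int) by move=> [] [].
by apply: (iid_law_reindex iid_eta (inj k) (inj 0) mgE) => z; rewrite lee_fin.
Qed.

(** [min (D^2) (|D|^3)] is at most [D^2] times [min 1 |D|], and [|D|] is at most a vanishing scale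
    times [1 + |e|]. The second factor is thus a function of the error alone that tends to 0
    pointwise. *)
Let tail n (e : R) := (1 + e ^+ 2) * Num.min 1 (rate n * (N * MK * (1 + c * vol n)) * (1 + `|e|)).

Let scale0 n : 0 <= rate n * (N * MK * (1 + c * vol n)).
Proof. by apply: mulr_ge0 => //; apply: mulr_ge0 NM0 _; rewrite addr_ge0// mulr_ge0. Qed.

Let tail01 n (e : R) : 0 <= tail n e <= 1 + e ^+ 2.
Proof.
have e0 : 0 <= 1 + e ^+ 2 by rewrite addr_ge0 ?sqr_ge0.
rewrite /tail mulr_ge0//= ?ler_piMr// ?ge_min ?lexx// le_min ler01/=.
by apply: mulr_ge0; [exact: scale0|rewrite addr_ge0].
Qed.

Let mtail n : measurable_fun setT (tail n).
Proof.
apply: measurable_funM; first by apply: measurable_funD => //; exact: measurable_funX.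
apply: measurable_minr => //; by apply: measurable_funM => //; exact: measurable_funD.
Qed.

Let tail_integrable n k : P.-integrable setT (EFin \o (fun w => tail n (eta k w))).
Proof.
apply: (@integ_dom _ _ _ P _ (fun w => 1 + eta k w ^+ 2)); first exact: (measurableT_comp (mtail n) (meta k)).
  by move=> w; have /andP[p0 p1] := tail01 n (eta k w); rewrite ger0_norm.
by apply: integD; [exact: integ_cst|exact: eta2].
Qed.

Let tail_cvg0 : expect P (fun w => tail n (eta 0 w)) @[n --> \oo] --> (0 : R).
Proof.
apply: (@expect_dominated_cvg0 _ _ _ P _ (fun w => 1 + eta 0 w ^+ 2)).
- by move=> n; exact: (measurableT_comp (mtail n) (meta 0)).
- by apply: integD; [exact: integ_cst|exact: eta2].
- by move=> n w; have /andP[p0 p1] := tail01 n (eta 0 w); rewrite ger0_norm.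
move=> w; set e := eta 0 w.
have e0 : 0 <= 1 + e ^+ 2 by rewrite addr_ge0 ?sqr_ge0.
have r0 : (1 + e ^+ 2) * (rate n * (N * MK * (1 + c * vol n)) * (1 + `|e|)) @[n --> \oo] --> (0 : R).
  rewrite -[X in _ --> X](mulr0 (1 + e ^+ 2)); apply: cvgM; first exact: cvg_cst.
  rewrite -[X in _ --> X](mul0r (1 + `|e|)); apply: cvgM; last exact: cvg_cst.
  rewrite -[X in _ --> X](mul0r (N * MK * (1 + c * 0))); apply: cvgM; first exact: rate_cvg0.
  apply: cvgM; first exact: cvg_cst.
  by apply: cvgD; [exact: cvg_cst|apply: cvgM; [exact: cvg_cst|exact: vol_cvg0]].
apply: (squeeze_cvgr _ (cvg_cst 0) r0); apply: nearW => n.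
have /andP[-> _] := tail01 n e; rewrite /tail ler_wpM2l// ge_min lexx orbT//.
Qed.

(** The conditional mean formula without noise and with constant test function 1: a density bounded
    by [c] gives the window at most [c] times its volume. *)
Let window_expect n k : expect P (fun w => \1_(window u (h n)) (regr n k w)) <= c * vol n.
Proof.
have f0 p : 0 <= fh (t n k) p by case/andP: (fhc (t01 n k) p).
have fc p : fh (t n k) p <= c by case/andP: (fhc (t01 n k) p).
have mW := measurable_window u (h n).
have mI : measurable_fun setT (\1_(window u (h n)) : 'rV[R]_d -> R) by exact: measurable_indic.
have i0 v : 0 <= \1_(window u (h n)) v :> R by rewrite indicE.
have := (@conditional_mean _ _ _ P _ _ _ G xi Q mxi law_Q (t n k) k%:Z (t01 n k) (mG (t01 n k)) A (fh (t n k)) mA (PAk _)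
  (mfh (t01 n k)) f0 (@Qfh _ (t01 n k)) eta c iid_eta ind fc (eta2 _) (mean_eta _) (fun=> 1) (\1_(window u (h n))) (fun=> 0) 1
  (measurable_cst _) _ mI (measurable_cst _) _ mW (vol_fin n)).
have E1 (z : history E * history R) : `|(1 : R)| <= 1 by rewrite normr1.
have E2 v : `|\1_(window u (h n)) v : R| <= 1 * \1_(window u (h n)) v by rewrite mul1r ger0_norm.
have E3 v : `|(0 : R)| <= 1 * \1_(window u (h n)) v by rewrite mul1r normr0.
move=> /(_ E1 E2 E3); under eq_fun do rewrite mul1r mul0r addr0.
rewrite -[k%:Z + 1]/(k%:Z + 1) => ->; under eq_fun do rewrite mul1r.
have IW : (\int[lam]_v (`|\1_(window u (h n)) v|)%:E <= (vol n)%:E)%E.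
  rewrite (_ : (\int[lam]_v _)%E = (\int[lam]_v (\1_(window u (h n)) v)%:E)%E); last first.
    by apply: eq_integral => v _; rewrite ger0_norm.
  rewrite integral_indic// setIT.
  exact: (eq_ind_r (fun x : \bar R => (x <= (vol n)%:E)%E) (lexx _) (lebesgue_window u (h_gt0 n))).
have WB z : `|WI (\1_(window u (h n))) (fh (t n k)) z| <= c * vol n.
  by apply: weighted_integral_le => //; [exact: mfh|exact: fhc].
apply: le_trans (ler_norm _) _; apply: expect_norm_le; last by move=> w; exact: WB.
apply: (@bounded_integrable _ _ _ P _ (c * vol n)) => //.
exact: (measurableT_comp (measurable_weighted_integral lam mI (mfh (t01 n k))) (mpast _)).
Qed.

Let regr_noise_independent n k : independent_rv P (regr n k) (eta (k%:Z + 1)).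
Proof.
move=> B1 B2 mB1 mB2; rewrite setIC muleC.
have := past_independent ind (k%:Z + 1) (k%:Z + 1).
move=> /(_ ((fun z : history R => z 0%N) @^-1` B2) (G (t n k) @^-1` B1)).
have E0 : past eta (k%:Z + 1) @^-1` ((fun z : history R => z 0%N) @^-1` B2) = eta (k%:Z + 1) @^-1` B2.
  by apply/seteqP; split => w; rewrite /past /= subr0.
rewrite E0; apply.
- by rewrite -[X in measurable X]setTI; exact: (@measurable_coord _ R nat 0%N).
- by rewrite -[X in measurable X]setTI; exact: (mG (t01 n k)).
Qed.

(** Independence of regressor and error separates the small probability of the window from the
    vanishing expectation of [tail]; the former compensates the normalization in the sum over
    [k]. *)
Let windowed_tail n k : expect P (fun w => \1_(window u (h n)) (regr n k w) * tail n (eta (k%:Z + 1) w)) <=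
  c * vol n * expect P (fun w => tail n (eta 0 w)).
Proof.
have mI : measurable_fun setT (\1_(window u (h n)) : 'rV[R]_d -> R).
  by apply: measurable_indic; exact: measurable_window.
have I1 v : `|\1_(window u (h n)) v : R| <= 1 by rewrite indicE; case: (_ \in _); rewrite ?normr1 ?normr0.
rewrite (independent_expectM_bounded (mreg n k) (meta _) (regr_noise_independent n k) mI (mtail n) I1 (tail_integrable n _)).
rewrite [X in _ * X](eta_expect (k%:Z + 1) (mtail n)); last by move=> x; case/andP: (tail01 n x).
rewrite ler_wpM2r ?window_expect//; apply: expect_ge0 => w; by case/andP: (tail01 n (eta 0 w)).
Qed.

Let lindeberg_term n k : expect P (fun w => Num.min (mart n k w ^+ 2) (`|mart n k w| ^+ 3)) <=
  rate n ^+ 2 * (vol n * (4 * (N * MK) ^+ 2 * c * expect P (fun w => tail n (eta 0 w)) + 2 * vol n * (c * (N * MK)) ^+ 2)).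
Proof.
pose b w := cond_mean n k (past xi k%:Z w).
have mI : measurable_fun setT (fun w => \1_(window u (h n)) (regr n k w) : R).
  by apply: (measurableT_comp _ (mreg n k)); apply: measurable_indic; exact: measurable_window.
have I1 w : `|\1_(window u (h n)) (regr n k w) : R| <= 1 by rewrite indicE; case: (_ \in _); rewrite ?normr1 ?normr0.
have IT : P.-integrable setT (EFin \o (fun w => \1_(window u (h n)) (regr n k w) * tail n (eta (k%:Z + 1) w))).
  exact: (integM mI I1).
pose b2 := vol n * (vol n * (c * (N * MK)) ^+ 2).
apply: (@le_trans _ _ (expect P (fun w => rate n ^+ 2 * (4 * (N * MK) ^+ 2 *
    (\1_(window u (h n)) (regr n k w) * tail n (eta (k%:Z + 1) w)) + 2 * b2)))); last first.
  rewrite expectZ; last by apply: integD; [exact: integZ|exact: integ_cst].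
  rewrite ler_wpM2l ?sqr_ge0// expectD; [|exact: integZ|exact: integ_cst].
  rewrite expect_cst (expectZ (4 * (N * MK) ^+ 2) IT) mulrDr; apply: lerD; last by rewrite /b2; lra.
  have k0 : 0 <= 4 * (N * MK) ^+ 2 by rewrite mulr_ge0// sqr_ge0.
  apply: le_trans (ler_wpM2l k0 (windowed_tail n k)) _.
  by rewrite le_eqVlt; apply/orP; left; apply/eqP; ring.
apply: expect_le.
- apply: (@integ_dom _ _ _ P _ (fun w => mart n k w ^+ 2)) => //.
    apply: measurable_minr; first exact: measurable_funX.
    by apply: measurable_funX; exact: measurableT_comp.
  by move=> w; rewrite ger0_norm ?ge_min ?lexx// le_min sqr_ge0 exprn_ge0.
- by apply: integZ; apply: integD; [exact: integZ|exact: integ_cst].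
move=> w; set e := eta (k%:Z + 1) w.
have sb : summand n k w ^+ 2 <= 2 * (N * MK) ^+ 2 * (\1_(window u (h n)) (regr n k w) * (1 + e ^+ 2)).
  exact: le_trans (ler_norm _) (summand_sqr_le n k w).
have bb : b w ^+ 2 <= b2 := cond_mean_sqr_le n k _.
have i1 : (\1_(window u (h n)) (regr n k w) : R) <= 1 := le_trans (ler_norm _) (I1 w).
have s1 : `|summand n k w| <= N * MK * (1 + `|e|).
  rewrite /summand mulrDr mulr1; apply: le_trans (ler_normD _ _) _; apply: lerD.
    by apply: le_trans (sw_le _ _ _) _; rewrite -[leRHS]mulr1 ler_wpM2l.
  rewrite normrM ler_wpM2r//; apply: le_trans (nw_le _ _ _) _; by rewrite -[leRHS]mulr1 ler_wpM2l.
have Dle : `|mart n k w| <= rate n * (N * MK * (1 + c * vol n)) * (1 + `|e|).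
  rewrite /mart normrM (ger0_norm (rate0 n)) -mulrA ler_wpM2l//.
  apply: le_trans (ler_normB _ _) _; apply: le_trans (lerD s1 (cm_le n k _)) _.
  have -> : N * MK * (1 + c * vol n) * (1 + `|e|) = N * MK * (1 + `|e|) + c * (N * MK * vol n) + c * vol n * (N * MK) * `|e| by ring.
  by rewrite lerDl; apply: mulr_ge0 => //; apply: mulr_ge0 NM0; exact: mulr_ge0.
have D2 : mart n k w ^+ 2 <= rate n ^+ 2 * (2 * summand n k w ^+ 2 + 2 * b w ^+ 2).
  rewrite /mart exprMn ler_wpM2l ?sqr_ge0//; have := sqr_ge0 (summand n k w + b w).
  by rewrite sqrrB sqrrD -/(b w); move: (summand _ _ _ ^+ 2) (b w ^+ 2) (_ * _) => *; lra.
set mu := Num.min 1 (rate n * (N * MK * (1 + c * vol n)) * (1 + `|e|)).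
have mu01 : 0 <= mu <= 1.
  by rewrite /mu ge_min lexx andbT le_min ler01/= mulr_ge0 ?scale0// addr_ge0.
(* From here the square is split as [2 s^2 + 2 b^2], with [s] the summand and [b] its conditional
   mean; the factor [mu] is kept on the first part, and bounded by 1 on the second, which is already
   of smaller order. *)
have h1 : Num.min (mart n k w ^+ 2) (`|mart n k w| ^+ 3) <= mart n k w ^+ 2 * mu.
  rewrite /mu minr_pMr ?sqr_ge0// mulr1 le_min ge_min lexx/= ge_min; apply/orP; right.
  by rewrite -[mart n k w ^+ 2](real_normK (num_real _)) exprSr ler_wpM2l ?exprn_ge0.
apply: (le_trans h1); case/andP: mu01 => m0 m1.
apply: (le_trans (ler_wpM2r m0 D2)); rewrite -[leLHS]mulrA ler_wpM2l ?sqr_ge0// mulrDl lerD//.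
  rewrite /tail -/mu -/e; have := ler_wpM2r m0 sb; move: (_ ^+ 2) (\1_ _ _) (1 + e ^+ 2) => x y z H.
  rewrite (_ : 4 * (N * MK) ^+ 2 * _ = 2 * (2 * (N * MK) ^+ 2 * (y * z) * mu)); last by ring.
  by rewrite -[leLHS]mulrA ler_wpM2l.
by rewrite -[leLHS]mulrA ler_wpM2l//; apply: le_trans (ler_piMr (sqr_ge0 _) m1) bb.
Qed.

Let lindeberg : \sum_(k < n) expect P (fun w => Num.min (mart n k w ^+ 2) (`|mart n k w| ^+ 3)) @[n --> \oo] --> (0 : R).
Proof.
pose r n := 2 ^+ d * (4 * (N * MK) ^+ 2 * c * expect P (fun w => tail n (eta 0 w)) + 2 * vol n * (c * (N * MK)) ^+ 2).
have r0 : r n @[n --> \oo] --> (0 : R).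
  rewrite -[X in _ --> X](mulr0 (2 ^+ d)); apply: cvgM; first exact: cvg_cst.
  rewrite -[X in _ --> X]addr0; apply: cvgD.
    by rewrite -[X in _ --> X](mulr0 (4 * (N * MK) ^+ 2 * c)); apply: cvgM; [exact: cvg_cst|exact: tail_cvg0].
  rewrite -[X in _ --> X](mul0r ((c * (N * MK)) ^+ 2)); apply: cvgM; last exact: cvg_cst.
  by rewrite -[X in _ --> X](mulr0 2); apply: cvgM; [exact: cvg_cst|exact: vol_cvg0].
apply: (squeeze_cvgr _ (cvg_cst 0) r0); apply: nearW => n; apply/andP; split.
  by apply: sumr_ge0 => k _; apply: expect_ge0 => w; rewrite le_min sqr_ge0 exprn_ge0.
apply: (@le_trans _ _ (\sum_(k < n) rate n ^+ 2 * (vol n * (4 * (N * MK) ^+ 2 * c * expect P (fun w => tail n (eta 0 w)) +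
    2 * vol n * (c * (N * MK)) ^+ 2)))); first by apply: ler_sum => k _; exact: lindeberg_term.
rewrite -mulr_sumr sumr_const card_ord -[_ *+ n]mulr_natl; apply: rate_le.
have t0 : 0 <= expect P (fun w => tail n (eta 0 w)) by apply: expect_ge0 => w; case/andP: (tail01 n (eta 0 w)).
by apply: addr_ge0; rewrite !mulr_ge0 ?exprn_ge0 ?mulr_ge0// ltW.
Qed.

Let martingale_clt : smooth_cvg P (fun n => psum mart n n) V.
Proof.
have Dm n k (g : R * R -> R) (M : R) : (k < n)%N -> measurable_fun setT g -> (forall z, `|g z| <= M) ->
    expect P (fun w => g (psum mart_var n k.+1 w, psum mart n k w) * mart n k w) = 0 /\
    expect P (fun w => g (psum mart_var n k.+1 w, psum mart n k w) * mart n k w ^+ 2) =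
    expect P (fun w => g (psum mart_var n k.+1 w, psum mart n k w) * mart_var n k w).
  move=> _ mg gM; have [phi mphi Ephi] := adapted n k.
  have [H1 H2] := mart_mean_var n k (F := g \o phi) (measurableT_comp mg mphi) (fun z => gM _).
  have Eg w : g (psum mart_var n k.+1 w, psum mart n k w) = (g \o phi) (Z k w) by rewrite Ephi.
  split; first by apply: etrans H1; congr expect; apply/funext => w; rewrite Eg.
  by apply: etrans (etrans _ H2) _; congr expect; apply/funext => w; rewrite Eg.
move=> a s s0.
have := @array_clt_test _ _ _ P mart mart_var V C V_ge0 C0.
move=> /(_ mmart mmart_var mart_var_bound imart2 Dm q_cvg lindeberg a s s0); exact.
Qed.

Let icm n k : P.-integrable setT (EFin \o (fun w => cond_mean n k (past xi k%:Z w))).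
Proof.
apply: (@bounded_integrable _ _ _ P _ (c * (N * MK * vol n))) => //.
exact: (measurableT_comp (mcm n k) (mpast _)).
Qed.

Let expect_summand n k : expect P (summand n k) = expect P (fun w => cond_mean n k (past xi k%:Z w)).
Proof.
have E1 (z : history E * history R) : `|(1 : R)| <= 1 by rewrite normr1.
have := cond1 n k (measurable_cst (1 : R)) E1.
by under eq_fun do rewrite /= mul1r; under [in RHS]eq_fun do rewrite /= mul1r.
Qed.

Let mean_fluctuation n w := rate n * (\sum_(k < n) cond_mean n k (past xi k%:Z w) -
  expect P (fun w => \sum_(k < n) cond_mean n k (past xi k%:Z w))).

Let mmean_fluctuation n : measurable_fun setT (mean_fluctuation n).
Proof.
apply: measurable_funM => //; apply: measurable_funB => //; apply: measurable_sum => k.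
exact: (measurableT_comp (mcm n k) (mpast _)).
Qed.

Let mean_fluctuation_cvg0 : cvg0_in_probability P mean_fluctuation.
Proof.
have Im n : P.-integrable setT (EFin \o (fun w => \sum_(k < n) cond_mean n k (past xi k%:Z w) -
  expect P (fun w => \sum_(k < n) cond_mean n k (past xi k%:Z w)))).
  by apply: integB; [exact: integ_sum|exact: integ_cst].
apply: cvg0_in_probability_L1; first by move=> n; exact: integZ.
(* [rate * sqrt n * vol] is the square root of [(rate^2 * n * vol) * vol], whose first factor is at
   most [2^d]. *)
pose r n := Num.sqrt (2 ^+ d * vol n) * (N * MK * Psi0).
have r0 : r n @[n --> \oo] --> (0 : R).
  rewrite -[X in _ --> X](mul0r (N * MK * Psi0)); apply: cvgM; last exact: cvg_cst.
  have v0 : 2 ^+ d * vol n @[n --> \oo] --> (0 : R).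
    by rewrite -[X in _ --> X](mulr0 (2 ^+ d)); apply: cvgM; [exact: cvg_cst|exact: vol_cvg0].
  by have := cvg_comp (fun n => 2 ^+ d * vol n) Num.sqrt v0 (@sqrt_continuous R 0); rewrite sqrtr0.
apply: (squeeze_cvgr _ (cvg_cst 0) r0); apply: nearW => n; apply/andP; split; first exact: expect_ge0.
have -> : (fun w => `|mean_fluctuation n w|) = (fun w => rate n * `|\sum_(k < n) cond_mean n k (past xi k%:Z w) -
    expect P (fun w => \sum_(k < n) cond_mean n k (past xi k%:Z w))|).
  by apply/funext => w; rewrite /mean_fluctuation normrM ger0_norm.
rewrite expectZ; last exact: integ_norm.
have := @fluctuation n (signal_weight n) _ (fun k => msw n k) (fun k => swI n k).
move=> /(ler_wpM2l (rate0 n)) H; apply: (le_trans H).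
rewrite (_ : _ * _ = rate n * Num.sqrt n%:R * vol n * (N * MK * Psi0)); last by ring.
rewrite /r; apply: ler_wpM2r; first exact: mulr_ge0.
have s0 : 0 <= rate n * Num.sqrt n%:R * vol n by apply: mulr_ge0; [exact: mulr_ge0|exact: vol0].
rewrite -[leLHS](ger0_norm s0) -sqrtr_sqr.
have -> : (rate n * Num.sqrt n%:R * vol n) ^+ 2 = rate n ^+ 2 * n%:R * vol n * vol n.
  by rewrite -[n%:R in RHS]sqr_sqrtr//; move: (rate n) (Num.sqrt _) (vol n) => *; ring.
by rewrite ler_wsqrtr// ler_wpM2r.
Qed.

Let kernel_clt : smooth_cvg P (fun n w => rate n * (\sum_(k < n) summand n k w - expect P (fun w => \sum_(k < n) summand n k w))) V.
Proof.
have Em n : expect P (fun w => \sum_(k < n) summand n k w) = expect P (fun w => \sum_(k < n) cond_mean n k (past xi k%:Z w)).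
  by rewrite !expect_sum//; apply: eq_bigr => k _; exact: expect_summand.
apply: (@smooth_cvg_perturb _ _ _ P (fun n => psum mart n n) _ V _ _ _ martingale_clt).
- by move=> n; exact: measurable_psum.
- by move=> n; apply: measurable_funM => //; apply: measurable_funB => //; exact: measurable_sum.
move: mean_fluctuation_cvg0; congr (cvg0_in_probability P _); apply/funext => n; apply/funext => w.
by rewrite /mean_fluctuation /psum /mart -mulr_sumr sumrB Em; ring.
Qed.

Let expect_cond_mean n k : expect P (fun w => cond_mean n k (past xi k%:Z w)) =
  h n ^+ d * Rintegral lam setT (fun s => K s * (signal n k (u - h n *: s) * f (u - h n *: s) (t n k))).
Proof.
rewrite /cond_mean (expect_weighted_integral iid_xi mA PA (mfh (t01 n k)) (fhc (t01 n k)) (fhE (t01 n k)) _ (msw n k) (swI n k)).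
have sN (v : 'rV[R]_d) : (forall i, `|u ord0 i - v ord0 i| <= h n) -> `|signal n k v| <= N by case/(HN k).
exact: (local_weight_rescale (h_gt0 n) mK KM K_out (msignal n k) sN (mf n k) (f_le n k)).
Qed.

Let kernel_average_integrable (H : 'rV[R]_d -> R -> R) n k :
  {within setT `*` `[0, 1], continuous (fun p : 'rV[R]_d * R^o => H p.1 p.2)} ->
  lam.-integrable setT (EFin \o (fun s => K s * H (u - h n *: s) (t n k))).
Proof.
move=> cH; have [L HL] := space_time_bounded cH u (h n).
have mH : measurable_fun setT (fun v => H v (t n k)).
  by apply: continuous_measurable_rV; exact: (space_time_continuous_l cH).
apply: (cube_supported_integrable mK KM K_out (measurableT_comp mH (measurable_rescaling (h n) u)) (N := L)) => s cus.
apply: HL => // i; rewrite !mxE opprB addrC subrK normrM gtr0_norm// ler_piMr ?(ltW (h_gt0 n))//.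
by rewrite ler_norml; exact: cus.
Qed.

Let mean_cvg : (n%:R * h n ^+ d)^-1 * expect P (fun w => \sum_(k < n) summand n k w) @[n --> \oo] -->
  Rintegral lam setT K * Rintegral lebesgue_measure `[0, 1] (fun x => (alim + B * m u x) * f u x).
Proof.
pose G2 (v : 'rV[R]_d) (x : R) := B * m v x * f v x.
have cG2 : {within setT `*` `[0, 1], continuous (fun p : 'rV[R]_d * R^o => G2 p.1 p.2)}.
  by move=> p; apply: cvgM; [apply: cvgM; [exact: cvg_cst|exact: cm]|exact: cf].
have L1 := local_average_cvg mK KM K_out (u := u) cf h_gt0 h_cvg0.
have L2 := local_average_cvg mK KM K_out (u := u) cG2 h_gt0 h_cvg0.
pose A1 n := n%:R^-1 * \sum_(k < n) Rintegral lam setT (fun s => K s * f (u - h n *: s) (k.+1%:R / n%:R)).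
pose A2 n := n%:R^-1 * \sum_(k < n) Rintegral lam setT (fun s => K s * G2 (u - h n *: s) (k.+1%:R / n%:R)).
have EA n : (n%:R * h n ^+ d)^-1 * expect P (fun w => \sum_(k < n) summand n k w) = alp n * A1 n + A2 n.
  rewrite /A1 /A2 (mulrCA (alp n)) -!mulrDr [alp n * _]mulr_sumr -!big_split/= expect_sum//.
  rewrite mulr_sumr [RHS]mulr_sumr; apply: eq_bigr => k _; rewrite expect_summand expect_cond_mean mulrA.
  have -> : (n%:R * h n ^+ d)^-1 * h n ^+ d = n%:R^-1.
    by rewrite invfM mulfVK// gt_eqF// exprn_gt0.
  have tE : k.+1%:R / n%:R = t n k by rewrite /t ltn_ord.
  rewrite tE; congr (_ * _).
  have I1 := kernel_average_integrable n k cf; have I2 := kernel_average_integrable n k cG2.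
  have I1a := integrableZl measurableT (alp n) I1.
  rewrite -!RintegralZl// -RintegralD//.
  by apply: eq_Rintegral => s _; rewrite /G2 /signal; ring.
have -> : Rintegral lam setT K * Rintegral lebesgue_measure `[0, 1] (fun x => (alim + B * m u x) * f u x) =
    alim * (Rintegral lam setT K * Rintegral lebesgue_measure `[0, 1] (f u)) +
    Rintegral lam setT K * Rintegral lebesgue_measure `[0, 1] (G2 u).
  have J (H : 'rV[R]_d -> R -> R) : {within setT `*` `[0, 1], continuous (fun p : 'rV[R]_d * R^o => H p.1 p.2)} ->
      lebesgue_measure.-integrable `[0, 1] (EFin \o H u).
    by move=> cH; apply: continuous_segment_integrable => //; exact: (space_time_continuous_r cH).
  have J1 := J _ cf; have J2 := J _ cG2.
  have J1a : lebesgue_measure.-integrable `[0, 1] (EFin \o (fun x => alim * f u x)).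
    by apply: (J (fun v x => alim * f v x)) => p; apply: cvgM; [exact: cvg_cst|exact: cf].
  rewrite (mulrCA alim) -!mulrDr; congr (_ * _).
  rewrite -!RintegralZl// -RintegralD//.
  by apply: eq_Rintegral => x _; rewrite /G2 -[expect P _]/(f u x); ring.
under eq_fun do rewrite EA.
by apply: cvgD; [apply: cvgM; [exact: alp_cvg|exact: L1]|exact: L2].
Qed.

Lemma bounded_kernel_sums : [/\ 0 <= limit_variance, forall n k, measurable_fun setT (summand n k),
  forall n k, P.-integrable setT (EFin \o summand n k),
  smooth_cvg P (fun n w => rate n * (\sum_(k < n) summand n k w - expect P (fun w => \sum_(k < n) summand n k w)))
    limit_variance &
  (n%:R * h n ^+ d)^-1 * expect P (fun w => \sum_(k < n) summand n k w) @[n --> \oo] -->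
    Rintegral lam setT K * Rintegral lebesgue_measure `[0, 1] (fun x => (alim + B * m u x) * f u x)].
Proof. by split; [exact: V_ge0| | |exact: kernel_clt|exact: mean_cvg]. Qed.

End bounded.

Lemma kernel_sums : [/\ 0 <= limit_variance, forall n k, measurable_fun setT (summand n k),
  forall n k, P.-integrable setT (EFin \o summand n k),
  smooth_cvg P (fun n w => rate n * (\sum_(k < n) summand n k w - expect P (fun w => \sum_(k < n) summand n k w)))
    limit_variance &
  (n%:R * h n ^+ d)^-1 * expect P (fun w => \sum_(k < n) summand n k w) @[n --> \oo] -->
    Rintegral lam setT K * Rintegral lebesgue_measure `[0, 1] (fun x => (alim + B * m u x) * f u x)].
Proof. by have [N N0 HN] := local_bound; exact: bounded_kernel_sums N0 HN. Qed.

End kernel_sums.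

(** * The estimators *)

Lemma cvg0_in_probabilityD {R : realType} d (T : measurableType d) (P : probability T R) (X Y : nat -> T -> R) :
  (forall n, measurable_fun setT (X n)) -> (forall n, measurable_fun setT (Y n)) ->
  cvg0_in_probability P X -> cvg0_in_probability P Y -> cvg0_in_probability P (fun n w => X n w + Y n w).
Proof.
move=> mX mY X0 Y0 e e0; have e20 : 0 < e / 2 by rewrite divr_gt0.
have XY0 : fine (P [set w | e / 2 <= `|X n w|]) + fine (P [set w | e / 2 <= `|Y n w|]) @[n --> \oo] --> (0 : R).
  by rewrite -[X in _ --> X]addr0; apply: cvgD; [exact: X0|exact: Y0].
apply: (squeeze_cvgr _ (cvg_cst 0) XY0); apply: nearW => n; rewrite fine_prob_ge0/=.
apply: fine_prob_leU; [|exact: measurable_norm_ge..|].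
  by apply: measurable_norm_ge; exact: measurable_funD.
move=> w /= h; have := le_trans h (ler_normD _ _).
case: (lerP (e / 2) `|X n w|) => [|hX] hs; first by left.
by right; move: hX hs; move: (`|_|) (`|Y n w|) => *; lra.
Qed.

Lemma cvg0_in_probability_cst {R : realType} d (T : measurableType d) (P : probability T R) (r : nat -> R) :
  r n @[n --> \oo] --> (0 : R) -> cvg0_in_probability P (fun n _ => r n).
Proof.
move=> r0; apply: cvg0_in_probability_L1; first by move=> n; exact: integ_cst.
by under eq_fun do rewrite expect_cst; rewrite -(@normr0 _ R); exact: cvg_norm.
Qed.

Lemma sqrtrM_inv {R : rcfType} (y : R) : 0 <= y -> Num.sqrt y * y^-1 = (Num.sqrt y)^-1.
Proof.
move=> y0; have [->|yn0] := eqVneq y 0; first by rewrite sqrtr0 mul0r invr0.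
have sy : Num.sqrt y != 0 by rewrite sqrtr_eq0 -ltNge lt_def yn0.
by rewrite -[in y^-1](sqr_sqrtr y0) expr2 invfM mulrA mulfV// mul1r.
Qed.

Lemma sum_summandE {R : realType} disp (Omega : measurableType disp) d dE (E : measurableType dE) (xi : int -> Omega -> E)
    (eta : int -> Omega -> R) (G : R -> history E -> 'rV[R]_d) (m sigma : 'rV[R]_d -> R -> R)
    (K : 'rV[R]_d -> R) (h : nat -> R) (u : 'rV[R]_d) (alp : nat -> R) (B : R) n w :
  \sum_(k < n) summand xi eta G m sigma K h u alp B n k w =
  alp n * \sum_(1 <= i < n.+1) K ((h n)^-1 *: (u - regressor G xi n i w)) +
  B * \sum_(1 <= i < n.+1) response G xi m sigma eta n i w * K ((h n)^-1 *: (u - regressor G xi n i w)).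
Proof.
rewrite !big_add1 /= !big_mkord !mulr_sumr -big_split/=; apply: eq_bigr => k _.
rewrite /summand /signal_weight /noise_weight /local_weight /signal /noise_scale /rescaled /regr /array_time.
rewrite /response /regressor ltn_ord -[k.+1]addn1 PoszD; ring.
Qed.


Theorem theorem3p2 (R : realType) (disp : measure_display)
    (Omega : measurableType disp) (P : probability Omega R)
    (d : nat) (d_gt0 : (0 < d)%N) (q : nat)
    (* innovations, their i.i.d. copy, and the errors *)
    (xi xi' : int -> Omega -> 'rV[R]_q) (eta : int -> Omega -> R)
    (iid_xi : iid P (joint xi xi'))
    (iid_eta : iid P eta)
    (indep_eta_xi :
      independent_sigma P (sigma_of [set: int] eta) (sigma_of [set: int] xi))
    (mean_eta : forall k, ('E_P[eta k] = 0)%E)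
    (var_eta : forall k, ('E_P[fun w => (eta k w ^+ 2)%R] = 1)%E)
    (* regressors and their one-step-ahead conditional law *)
    (G : R -> history 'rV[R]_q -> 'rV[R]_d)
    (meas_G : measurable_fun
      (`[0, 1]%classic `*` setT : set (R * history 'rV[R]_q))
      (fun p : R * history 'rV[R]_q => G p.1 p.2))
    (Q : R -> R.-pker (history 'rV[R]_q) ~> 'rV[R]_d)
    (law_Q : is_one_step_law P G xi Q)
    (pdf_Q : has_cond_pdf P xi Q)
    (m sigma : 'rV[R]_d -> R -> R)
    (* kernel and bandwidths *)
    (K : 'rV[R]_d -> R) (kernel_K : is_kernel K)
    (h : nat -> R) (h_gt0 : forall n, 0 < h n)
    (* assumptions *)
    (C3_f : class_C_space_time 3 (marginal_pdf P xi Q))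
    (C3_m : class_C_space_time 3 m)
    (C3_sigma : class_C_space_time 3 sigma)
    (Psi_fin : (Psi P xi xi' Q 0 2 < +oo)%E)
    (pdf_bound : exists c0 : R, cond_pdf_bound P xi Q c0)
    (Lp_eta : exists2 p : R, 2 < p &
      forall k, (Lnorm P p%:E (EFin \o eta k) < +oo)%E)
    (h_cvg0 : h n @[n --> \oo] --> (0 : R))
    (nhd_cvgy : n%:R * h n ^+ d @[n --> \oo] --> +oo)
    (u : 'rV[R]_d) :
  let fn := f_tilde G xi K h u in
  let Tn := T_tilde G xi m sigma eta K h u in
  let mun := mu_hat G xi m sigma eta K h u in
  cvg_in_distribution P
    (fun n w => Num.sqrt (n%:R * h n ^+ d) * (fn n w - expect P (fn n)))
    (centered_normal (f_bar P xi Q u * lambda_K K))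
  /\
  (0 < f_bar P xi Q u ->
   cvg_in_distribution P
    (fun n w => Num.sqrt (n%:R * h n ^+ d) *
                (mun n w - expect P (Tn n) / expect P (fn n)))
    (centered_normal (V_tilde P xi Q m sigma u * lambda_K K))).

Proof.
move=> fn Tn mun.
have mxi := joint_measurable iid_xi.
have [mQ _ _] := iid_eta.
have eta2 k : P.-integrable setT (EFin \o (fun w => eta k w ^+ 2)).
  apply/integrableP; split; first by apply/measurable_EFinP; exact: measurable_funX.
  have := var_eta k; rewrite unlock => E1.
  apply: (@le_lt_trans _ _ 1%E); last exact: ltry.
  rewrite -E1 le_eqVlt; apply/orP; left; apply/eqP.
  by apply: eq_integral => w _; rewrite /= ger0_norm ?sqr_ge0.
have mean0 k : expect P (eta k) = 0 by rewrite /expect mean_eta.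
have var1 k : expect P (fun w => eta k w ^+ 2) = 1 by rewrite /expect var_eta.
have mGt (t : R) : `[0, 1]%classic t -> measurable_fun setT (G t).
  move=> t01; have m01 : measurable (`[0, 1]%classic `*` setT : set (R * history 'rV[R]_q)).
    by apply: measurableX => //; exact: measurable_itv.
  apply: (measurable_comp m01 _ meas_G (g := pair t)) => //.
  by move=> _ [z _ <-].
have [c0 Hc0] := pdf_bound.
have [A [fh [mA PA fh_out Hfh]]] := cond_pdf_version (measurable_past 0 mxi) pdf_Q Hc0.
have mfh (t : R) : `[0, 1]%classic t -> measurable_fun setT (fh t) by case/Hfh.
have fhc (t : R) : `[0, 1]%classic t -> forall p, 0 <= fh t p <= `|c0| by case/Hfh.
have fhE (t : R) : `[0, 1]%classic t -> forall h v, A h -> fh t (v, h) = cond_pdf Q v t h by case/Hfh.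
have Qfh (t : R) : `[0, 1]%classic t -> forall h B, A h -> measurable B ->
    (Q t h B = \int[lebesgue_rV d]_(v in B) (fh t (v, h))%:E)%E by case/Hfh.
have psi0 l : (0 <= psi P xi xi' Q l 2)%E.
  apply: le_trans (ereal_sup_ubound _); last by exists 0 => //=; rewrite in_itv/= lexx ler01.
  by apply: le_trans (ereal_sup_ubound _); last (by exists 0); exact: Lnorm_ge0.
have psi_le N : (\sum_(0 <= l < N) psi P xi xi' Q l 2 <= Psi P xi xi' Q 0 2)%E by exact: nneseries_lim_ge.
have psi_fin l : (psi P xi xi' Q l 2 < +oo)%E.
  apply: le_lt_trans Psi_fin; apply: le_trans (psi_le l.+1).
  by rewrite big_nat_recr//= leeDr// sume_ge0.
have psi_sum N : \sum_(l < N) fine (psi P xi xi' Q l 2) <= fine (Psi P xi xi' Q 0 2).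
  rewrite -lee_fin fineK; last by rewrite ge0_fin_numE//; apply: le_trans (psi_le 0%N); rewrite big_nil.
  apply: le_trans (psi_le N); rewrite big_mkord -sumEFin le_eqVlt; apply/orP; left; apply/eqP.
  by apply: eq_bigr => l _; rewrite fineK// ge0_fin_numE.
have [cf _] := C3_f; have [cm _] := C3_m; have [cs _] := C3_sigma.
have [MK MK0 KM] := kernel_bounded kernel_K.
have mK := measurable_kernel_fun kernel_K.
have K_out s : ~ cube s -> K s = 0 by move=> /(kernel_out kernel_K).
have intK : Rintegral (lebesgue_rV d) setT K = 1.
  by rewrite -(cube_supported_Rintegral K_out); case: kernel_K.
have lambdaE : Rintegral (lebesgue_rV d) setT (fun s => K s ^+ 2) = lambda_K K.
  by rewrite -(cube_supported_Rintegral (phi := fun s => K s ^+ 2))// => s /K_out ->; rewrite expr0n.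
have KS alp B alim := @kernel_sums R disp Omega P d _ _ xi xi' eta d_gt0 iid_xi iid_eta indep_eta_xi eta2 mean0 var1
  G Q mGt law_Q A fh `|c0| mA PA fh_out mfh fhc fhE Qfh _ psi_fin psi_sum m sigma cm cs cf K MK mK KM K_out h u
  h_gt0 h_cvg0 nhd_cvgy alp B alim.
pose SK n w := \sum_(1 <= i < n.+1) K ((h n)^-1 *: (u - regressor G xi n i w)).
pose SY n w := \sum_(1 <= i < n.+1) response G xi m sigma eta n i w * K ((h n)^-1 *: (u - regressor G xi n i w)).
have sumE (alp : nat -> R) (B : R) n : (fun w => \sum_(k < n) summand xi eta G m sigma K h u alp B n k w) =
    (fun w => alp n * SK n w + B * SY n w) by apply/funext => w; rewrite sum_summandE.
pose y n := n%:R * h n ^+ d.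
have y0 n : 0 <= y n by rewrite mulr_ge0// exprn_ge0// ltW.
have rateE n : rate d h n = Num.sqrt (y n) * (y n)^-1 by rewrite sqrtrM_inv.
have fnE n : fn n = fun w => (y n)^-1 * SK n w by [].
have TnE n : Tn n = fun w => (y n)^-1 * SY n w by [].
have [V1_ge0 mS1 iS1 clt1 mean1] := KS (fun=> 1) 0 1 (cvg_cst _).
(* The choice [(0, 1)] isolates the numerator; what is kept from it is integrability and the limit
   of its mean, which determine the centring of the ratio. *)
have [_ mS0 iS0 _ meanY] := KS (fun=> 0) 1 0 (cvg_cst _).
have sumK n : (fun w => \sum_(k < n) summand xi eta G m sigma K h u (fun=> 1) 0 n k w) = SK n.
  by rewrite sumE; apply/funext => w; rewrite mul1r mul0r addr0.
have sumY n : (fun w => \sum_(k < n) summand xi eta G m sigma K h u (fun=> 0) 1 n k w) = SY n.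
  by rewrite sumE; apply/funext => w; rewrite mul1r mul0r add0r.
have iSK n : P.-integrable setT (EFin \o SK n).
  by rewrite -sumK; exact: (@integ_sum _ _ _ P _ (index_enum 'I_n) (fun k : 'I_n => _) (iS1 n)).
have iSY n : P.-integrable setT (EFin \o SY n).
  by rewrite -sumY; exact: (@integ_sum _ _ _ P _ (index_enum 'I_n) (fun k : 'I_n => _) (iS0 n)).
have mSK n := integrable_fun (iSK n); have mSY n := integrable_fun (iSY n).
have mfn n : measurable_fun setT (fn n) by apply: measurable_funM => //; exact: mSK.
have mTn n : measurable_fun setT (Tn n) by apply: measurable_funM => //; exact: mSY.
have Efn n : expect P (fn n) = (y n)^-1 * expect P (SK n) by rewrite fnE expectZ.
have ETn n : expect P (Tn n) = (y n)^-1 * expect P (SY n) by rewrite TnE expectZ.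
have X1E : (fun n w => rate d h n * (\sum_(k < n) summand xi eta G m sigma K h u (fun=> 1) 0 n k w -
      expect P (fun w => \sum_(k < n) summand xi eta G m sigma K h u (fun=> 1) 0 n k w))) =
    (fun n w => Num.sqrt (y n) * (fn n w - expect P (fn n))).
  apply/funext => n; apply/funext => w; rewrite Efn fnE -mulrBr mulrA -rateE.
  by rewrite sumK (congr1 (fun g => g w) (sumK n)).
rewrite X1E in clt1.
have V1E : limit_variance P xi Q m sigma K u 0 1 = f_bar P xi Q u * lambda_K K.
  rewrite /limit_variance lambdaE mulrC; congr (_ * _); apply: eq_Rintegral => x _.
  by rewrite !mul0r addr0 expr1n expr0n addr0 mul1r.
rewrite V1E in V1_ge0 clt1.
have mX1 n : measurable_fun setT (fun w => Num.sqrt (y n) * (fn n w - expect P (fn n))).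
  by apply: measurable_funM => //; apply: measurable_funB.
split; first exact: cvg_distribution_of_smooth V1_ge0 mX1 clt1.
move=> fbar0.
have fbar_neq0 : f_bar P xi Q u != 0 by rewrite gt_eqF.
pose a n := expect P (fn n); pose b n := expect P (Tn n); pose r n := b n / a n.
have a_cvg : a n @[n --> \oo] --> f_bar P xi Q u.
  have : (fun n => (n%:R * h n ^+ d)^-1 * expect P
    (fun w : Omega => \sum_(k < n) summand xi eta G m sigma K h u (fun=> 1) 0 n k w)) = a.
    by apply/funext => n; rewrite sumK /a Efn.
  move: mean1 => /[swap] ->; rewrite intK mul1r; congr (_ --> _).
  by apply: eq_Rintegral => x _; rewrite mul0r addr0 mul1r.
have b_cvg : b n @[n --> \oo] --> Rintegral lebesgue_measure `[0, 1] (fun x => m u x * marginal_pdf P xi Q u x).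
  have : (fun n => (n%:R * h n ^+ d)^-1 * expect P
    (fun w : Omega => \sum_(k < n) summand xi eta G m sigma K h u (fun=> 0) 1 n k w)) = b.
    by apply/funext => n; rewrite sumY /b ETn.
  move: meanY => /[swap] ->; rewrite intK mul1r; congr (_ --> _).
  by apply: eq_Rintegral => x _; rewrite mul1r add0r.
have r_cvg : r n @[n --> \oo] --> m_bar P xi Q m u by apply: cvgM => //; exact: cvgV.
(* The centring [- r n] converges to [- m_bar], so the limiting signal is [m - m_bar], as in
   [V_tilde]. *)
have [V2_ge0 mS2 iS2 clt2 _] := KS (fun n => - r n) 1 (- m_bar P xi Q m u) (cvgN r_cvg).
set V2 := limit_variance _ _ _ _ _ _ _ _ _ in V2_ge0 clt2.
pose X2 n w := rate d h n * (\sum_(k < n) summand xi eta G m sigma K h u (fun n => - r n) 1 n k w -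
      expect P (fun w => \sum_(k < n) summand xi eta G m sigma K h u (fun n => - r n) 1 n k w)).
have X2E n w : X2 n w = Num.sqrt (y n) * ((Tn n w - r n * fn n w) - (b n - r n * a n)).
  rewrite /X2 sumE (congr1 (fun g => g w) (sumE (fun n => - r n) 1 n)) rateE.
  rewrite (expectD (integZ _ (iSK n)) (integZ _ (iSY n))) !expectZ//.
  rewrite /a /b ETn Efn TnE fnE.
  by move: (SK n w) (SY n w) (expect _ _) (expect _ _) (Num.sqrt _) (r n) (y n)^-1 => *; ring.
have mX2 n : measurable_fun setT (X2 n).
  by apply: measurable_funM => //; apply: measurable_funB => //; exact: measurable_sum.
have fn_cvg : cvg0_in_probability P (fun n w => fn n w - f_bar P xi Q u).
  (* Consistency of the density estimator follows from its own limit theorem: a tight sequence times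
     a vanishing rate, plus the convergence of the mean. *)
  have rX := cvg0_in_probability_tightM V1_ge0 mX1 clt1 (rate_cvg0 h_gt0 nhd_cvgy).
  have aX : a n - f_bar P xi Q u @[n --> \oo] --> (0 : R).
    by rewrite -(subrr (f_bar P xi Q u)); apply: cvgB => //; exact: cvg_cst.
  have mrX n : measurable_fun setT (fun w => rate d h n * (Num.sqrt (y n) * (fn n w - expect P (fn n)))).
    exact: measurable_funM.
  have maX n : measurable_fun setT (fun _ : Omega => a n - f_bar P xi Q u) by exact: measurable_cst.
  have := cvg0_in_probabilityD mrX maX rX (cvg0_in_probability_cst P aX).
  congr (cvg0_in_probability P _); apply/funext => n; apply/funext => w.
  rewrite addrA; congr (_ - _); rewrite rateE /a Efn fnE -mulrBr.
  rewrite (_ : _ * _ * (_ * _) = Num.sqrt (y n) ^+ 2 * (y n)^-1 * ((y n)^-1 * (SK n w - expect P (SK n)))); last by ring.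
  (* [y n] vanishes only at [n = 0], where the convention for inverses makes both sides 0. *)
  rewrite sqr_sqrtr//; have [->|yn0] := eqVneq (y n) 0; first by rewrite invr0 !mul0r addr0.
  by rewrite mulfV// mul1r mulrBr subrK.
have V_ratio := smooth_cvg_ratio V2_ge0 fbar0 mX2 mfn clt2 fn_cvg.
have VE : V_tilde P xi Q m sigma u * lambda_K K = V2 / f_bar P xi Q u ^+ 2.
  rewrite /V2 /limit_variance lambdaE /V_tilde [RHS]mulrC mulrCA [LHS]mulrC; congr (_ * (_ * _)).
  by apply: eq_Rintegral => x _; rewrite !mul1r [- _ + _]addrC.
rewrite VE.
pose Y n w := Num.sqrt (y n) * (mun n w - b n / a n).
have mX2f n : measurable_fun setT (fun w => X2 n w / fn n w).
  by apply: measurable_funM => //; exact: measurable_fun_inv.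
have mY n : measurable_fun setT (Y n).
  apply: measurable_funM => //; apply: measurable_funB => //.
  by apply: measurable_funM => //; exact: measurable_fun_inv.
(* The two expressions coincide as soon as [a n] and [fn n w] are nonzero, because then
   [b n - r n * a n] is 0. The first holds eventually; where [fn n w] vanishes, its distance to
   [f_bar] is [f_bar] itself, an event of vanishing probability by consistency. *)
have XY : cvg0_in_probability P (fun n w => Y n w - X2 n w / fn n w).
  move=> e e0; have near_a : \forall n \near \oo, a n != 0 by exact: (cvgr_neq0 _ a_cvg fbar_neq0).
  apply: (squeeze_cvgr _ (cvg_cst 0) (fn_cvg _ fbar0)).
  apply: filterS near_a => n an0; rewrite fine_prob_ge0/=.
  apply: fine_prob_le; [by apply: measurable_norm_ge; exact: measurable_funB..|].
  move=> w /= he; have [fw0|fwn0] := eqVneq (fn n w) 0; first by rewrite fw0 sub0r normrN ger0_norm// ltW.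
  move: he; rewrite X2E /Y /mun /mu_hat -/(Tn n w) -/(fn n w) /r divfK// subrr subr0.
  rewrite -[X in _ - X]mulrA mulrBl mulfK// subrr normr0 => he.
  by move: (lt_le_trans e0 he); rewrite ltxx.
have V0 : 0 <= V2 / f_bar P xi Q u ^+ 2 by rewrite divr_ge0// sqr_ge0.
exact: cvg_distribution_of_smooth V0 mY (smooth_cvg_perturb mX2f mY XY V_ratio).
Qed.
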